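(* Fix $\tau\in\mathbb{H}=\{\tau\in\mathbb{C}:\operatorname{Im}\tau>0\}$ and $p\in\mathbb{C}$ with $p\notin E_\tau[2]$. Let $A,B\in\mathbb{C}$ be such that $\pm p$ are apparent singularities of the equation $$y''(z)=\Big[2\wp(z)+\tfrac34\big(\wp(z+p)+\wp(z-p)\big)+A\big(\zeta(z+p)-\zeta(z-p)\big)+B\Big]y(z)\quad\text{in }E_\tau,$$ (where $\wp,\zeta$ are the Weierstrass functions of $\Lambda_\tau$), equivalently $B=A^2-\zeta(2p)A-\tfrac34\wp(2p)-2\wp(p)$. Suppose that the monodromy of this equation is not completely reducible, so that, up to a common conjugation, $$\rho(\ell_1)=\varepsilon_1\begin{pmatrix}1&0\\1&1\end{pmatrix},\qquad \rho(\ell_2)=\varepsilon_2\begin{pmatrix}1&0\\C&1\end{pmatrix},$$ with $\varepsilon_1,\varepsilon_2\in\{\pm1\}$ and monodromy data $C\in\mathbb{C}\cup\{\infty\}$ (with the convention for $C=\infty$ given in the context). Then $C$ satisfies either $$\wp(p|\tau)=\frac{2g_3(C-\tau)^3-4(C\eta_1-\eta_2)^3-g_2(C\eta_1-\eta_2)(C-\tau)^2}{(C-\tau)\left[12(C\eta_1-\eta_2)^2-g_2(C-\tau)^2\right]}$$ with $(\varepsilon_1,\varepsilon_2)=(1,1)$, or $$\wp(p|\tau)=\frac{(\frac{g_2}{2}-3e_k^2)(C\eta_1-\eta_2)+\frac{g_2}{4}e_k(C-\tau)}{3e_k(C\eta_1-\eta_2)+(\frac{g_2}{2}-3e_k^2)(C-\tau)}$$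 for some $k\in\{1,2,3\}$ with $$(\varepsilon_1,\varepsilon_2)=\begin{cases}(1,-1)&\text{if }k=1,\\(-1,1)&\text{if }k=2,\\(-1,-1)&\text{if }k=3.\end{cases}$$
   Context: Notation: $\omega_0=0,\ \omega_1=1,\ \omega_2=\tau,\ \omega_3=1+\tau$; $\Lambda_\tau=\mathbb{Z}+\mathbb{Z}\tau$; $E_\tau=\mathbb{C}/\Lambda_\tau$; $E_\tau[2]=\{\omega_k/2: 0\le k\le 3\}+\Lambda_\tau$. $\wp(z)=\wp(z|\tau)$ is the Weierstrass function with period lattice $\Lambda_\tau$, $e_k=\wp(\omega_k/2|\tau)$ for $k=1,2,3$, and $g_2=g_2(\tau)$, $g_3=g_3(\tau)$ are defined by $\wp'^2=4\wp^3-g_2\wp-g_3=4\prod_{k=1}^3(\wp-e_k)$. $\zeta(z)=\zeta(z|\tau)$ is the Weierstrass zeta function (odd, $\zeta'=-\wp$), with quasi-periods $\eta_1=\zeta(z+1)-\zeta(z)$, $\eta_2=\zeta(z+\tau)-\zeta(z)$. Apparent singularities: the local exponents of the equation at $\pm p$ are $-\frac12,\frac32$; $\pm p$ are called apparent if the local solutions there contain no logarithms. Monodromy: Let $q_0\notin E_\tau[2]\cup(\{\pm p\}+\Lambda_\tau)$ be a base point, and $\rho:\pi_1(E_\tau\setminus(E_\tau[2]\cup(\{\pm p\}+\Lambda_\tau)),q_0)\to SL(2,\mathbb{C})$ the monodromy representation: for a basis $(y_1,y_2)$ of local solutions at $q_0$, analytic continuation along $\ell$ gives $\ell^*\binom{y_1}{y_2}=\rho(\ell)\binom{y_1}{y_2}$.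 Let $\gamma_\pm$ be simple loops encircling $\pm p$ counterclockwise, let $L$ be the straight segment connecting $p$ and $-p$, and let $\ell_j$ ($j=1,2$) be fundamental cycles of $E_\tau$ connecting $q_0$ with $q_0+\omega_j$ such that $\ell_j$ does not intersect $L+\Lambda_\tau$ and $\gamma_+\gamma_-=\ell_1\ell_2\ell_1^{-1}\ell_2^{-1}$ in $\pi_1(E_\tau\setminus(\{\pm p\}+\Lambda_\tau),q_0)$. The lift $p\in\mathbb{C}$ is assumed to be chosen so that such $\ell_1,\ell_2$ exist (for instance $p=a+b\tau$ with real $|a|,|b|\le\frac12$). Known facts: $\rho(\gamma_\pm)=-I_2$, the local monodromy at each point of $E_\tau[2]$ is $I_2$, and the monodromy group is abelian, generated by $-I_2,\rho(\ell_1),\rho(\ell_2)$. The monodromy is called completely reducible if all monodromy matrices have two linearly independent common eigenfunctions (solutions), and not completely reducible if the space of common eigenfunctions is one-dimensional. In the latter case, up to a common conjugation, $\rho(\ell_1),\rho(\ell_2)$ have the form displayed in the claim, where $C=\infty$ means $\rho(\ell_1)=\varepsilon_1 I_2$ and $\rho(\ell_2)=\varepsilon_2\begin{pmatrix}1&0\\1&1\end{pmatrix}$; $C$ is called the monodromy data of the equation. The right-hand sides of the formulas for $\wp(p|\tau)$ are regarded as rational functions of $C\in\mathbb{C}\cup\{\infty\}$ (at $C=\infty$ they are taken as the limit $C\to\infty$). *)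

(* Defs.v *)
From Stdlib Require Import Reals ZArith.
From Coquelicot Require Import Coquelicot.

Open Scope C_scope.

(** ** Lattice and Weierstrass functions *)

(* Unique choice in [C]; a junk value when [P] has no or several solutions. *)
Definition the (P : C -> Prop) : C := @iota C_CompleteNormedModule P.

Definition seq_limit (u : nat -> C) : C :=
  the (fun l => filterlim u eventually (locally l)).

Definition latt (tau : C) (m n : Z) : C := IZR m + IZR n * tau.

Definition in_lattice (tau z : C) : Prop := exists m n : Z, z = latt tau m n.

(* Sum over the nonzero lattice points, by squares |m|, |n| <= N, N -> oo.
   The series below converge absolutely, so the order of summation is
   immaterial. *)
Definition lattice_sum (tau : C) (f : C -> C) : C :=
  seq_limit (fun N : nat =>
    sum_n (fun i => sum_n (fun j =>
      let m := (Z.of_nat i - Z.of_nat N)%Z in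
      let n := (Z.of_nat j - Z.of_nat N)%Z in
      if (Z.eqb m 0 && Z.eqb n 0)%bool then RtoC 0 else f (latt tau m n))
    (2 * N)) (2 * N)).

Definition wp (tau z : C) : C :=
  1 / z ^ 2 + lattice_sum tau (fun w => 1 / (z - w) ^ 2 - 1 / w ^ 2).

Definition zeta (tau z : C) : C :=
  1 / z + lattice_sum tau (fun w => 1 / (z - w) + 1 / w + z / w ^ 2).

Definition omega (tau : C) (k : nat) : C :=
  match k with
  | 0%nat => 0
  | 1%nat => 1
  | 2%nat => tau
  | _ => 1 + tau
  end.

Definition e (tau : C) (k : nat) : C := wp tau (omega tau k / 2).

(* eta_j, for j = 1, 2 *)
Definition eta (tau : C) (j : nat) : C :=
  the (fun c => forall z, ~ in_lattice tau z ->
                zeta tau (z + omega tau j) - zeta tau z = c).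

Definition invariants (tau a b : C) : Prop :=
  forall z, ~ in_lattice tau z ->
    C_derive (wp tau) z ^ 2 = 4 * wp tau z ^ 3 - a * wp tau z - b
    /\ C_derive (wp tau) z ^ 2 =
       4 * ((wp tau z - e tau 1) * (wp tau z - e tau 2) * (wp tau z - e tau 3)).

Definition g2 (tau : C) : C := the (fun a => exists b, invariants tau a b).
Definition g3 (tau : C) : C := the (fun b => exists a, invariants tau a b).

(* Subsets of E_tau are represented by their preimages in C. *)

Definition two_torsion (tau z : C) : Prop :=
  exists (k : nat) (w : C),
    (k <= 3)%nat /\ in_lattice tau w /\ z = omega tau k / 2 + w.

Definition pm_p (tau p z : C) : Prop :=
  in_lattice tau (z - p) \/ in_lattice tau (z + p).

Definition sing (tau p z : C) : Prop := two_torsion tau z \/ pm_p tau p z.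

(* L + Lambda_tau *)
Definition cut (tau p z : C) : Prop :=
  exists (s : R) (w : C), (0 <= s <= 1)%R /\ in_lattice tau w /\
    z = (1 - s) * p + s * (- p) + w.

(** ** The equation y'' = Q y and its local solutions *)

Definition potential (tau p A B z : C) : C :=
  2 * wp tau z + 3 / 4 * (wp tau (z + p) + wp tau (z - p))
  + A * (zeta tau (z + p) - zeta tau (z - p)) + B.

Definition holomorphic_near (f : C -> C) (a : C) : Prop :=
  locally a (fun z => ex_derive f z).

Definition germ_eq (a : C) (f g : C -> C) : Prop :=
  locally a (fun z => f z = g z).

Definition local_solution (Q : C -> C) (a : C) (y : C -> C) : Prop :=
  exists dy : C -> C,
    locally a (fun z => is_derive y z (dy z) /\ is_derive dy z (Q z * y z)).

Definition lin_indep (a : C) (y1 y2 : C -> C) : Prop :=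
  forall c1 c2 : C,
    germ_eq a (fun z => c1 * y1 z + c2 * y2 z) (fun _ => RtoC 0) ->
    c1 = 0 /\ c2 = 0.

Definition solution_basis (Q : C -> C) (a : C) (y1 y2 : C -> C) : Prop :=
  local_solution Q a y1 /\ local_solution Q a y2 /\ lin_indep a y1 y2 /\
  forall y, local_solution Q a y ->
    exists c1 c2 : C, germ_eq a y (fun z => c1 * y1 z + c2 * y2 z).

(* The local exponents at [a] are -1/2 and 3/2, so a log-free solution is
   (z - a)^(-1/2) times a power series in z - a: every solution near a point
   [z0] of a punctured disc around [a], multiplied by a branch [s] of
   (z - a)^(1/2), is the restriction of a function holomorphic on the whole
   disc. *)
Definition apparent (Q : C -> C) (a : C) : Prop :=
  exists r : R, (0 < r)%R /\
    forall (z0 : C) (y s : C -> C),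
      (0 < Cmod (z0 - a) < r)%R ->
      local_solution Q z0 y ->
      holomorphic_near s z0 ->
      locally z0 (fun z => s z ^ 2 = z - a) ->
      exists h : C -> C,
        (forall z, (Cmod (z - a) < r)%R -> ex_derive h z) /\
        germ_eq z0 (fun z => s z * y z) h.

(** ** Paths *)

Definition unit_itv (t : R) : Prop := (0 <= t <= 1)%R.

Definition path (X : C -> Prop) (g : R -> C) (a b : C) : Prop :=
  continuous_on unit_itv g /\ g 0%R = a /\ g 1%R = b /\
  forall t, unit_itv t -> X (g t).

(* A loop in E_tau based at q0 is represented by its lift to C starting at q0;
   it ends at a point of q0 + Lambda_tau.  In a product the left factor is
   travelled first. *)

Definition loop_mul (g h : R -> C) : R -> C := fun t =>
  if Rle_dec t (1 / 2) then g (2 * t)%R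
  else g 1%R + (h (2 * t - 1)%R - h 0%R).

Definition loop_inv (g : R -> C) : R -> C := fun t =>
  g 0%R + (g (1 - t)%R - g 1%R).

(* Homotopy in X with fixed end points.  When X is the preimage of a subset of
   E_tau, this is homotopy of the loops in that subset. *)
Definition homotopic (X : C -> Prop) (g h : R -> C) : Prop :=
  exists H : R * R -> C,
    continuous_on (fun st => unit_itv (fst st) /\ unit_itv (snd st)) H /\
    (forall t, unit_itv t -> H (0%R, t) = g t /\ H (1%R, t) = h t) /\
    (forall s, unit_itv s -> H (s, 0%R) = g 0%R /\ H (s, 1%R) = g 1%R) /\
    (forall s t, unit_itv s -> unit_itv t -> X (H (s, t))).

Definition winding_number (g : R -> C) (a : C) (k : Z) : Prop :=
  exists theta : R -> R,
    continuous_on unit_itv theta /\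
    (forall t, unit_itv t ->
       g t = a + Cmod (g t - a) * (cos (theta t), sin (theta t))) /\
    (theta 1 - theta 0 = 2 * PI * IZR k)%R.

(* A simple loop of E_tau minus the singular points, bounding a disc whose only
   singular point is the class of [a], run counterclockwise.  Such a loop is
   contractible in E_tau, so its lift is closed. *)
Definition simple_loop_around (tau p q0 : C) (g : R -> C) (a : C) : Prop :=
  path (fun z => ~ sing tau p z) g q0 q0 /\
  (forall s t, unit_itv s -> unit_itv t -> in_lattice tau (g s - g t) ->
     s = t \/ (s = 0%R /\ t = 1%R) \/ (s = 1%R /\ t = 0%R)) /\
  exists w, in_lattice tau w /\
    winding_number g (a + w) 1 /\
    forall b, sing tau p b -> b <> a + w -> winding_number g b 0.

Definition fundamental_cycles
    (tau p q0 : C) (gp gm l1 l2 : R -> C) : Prop :=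
  simple_loop_around tau p q0 gp p /\
  simple_loop_around tau p q0 gm (- p) /\
  path (fun z => ~ sing tau p z /\ ~ cut tau p z) l1 q0 (q0 + omega tau 1) /\
  path (fun z => ~ sing tau p z /\ ~ cut tau p z) l2 q0 (q0 + omega tau 2) /\
  homotopic (fun z => ~ pm_p tau p z)
    (loop_mul gp gm)
    (loop_mul (loop_mul (loop_mul l1 l2) (loop_inv l1)) (loop_inv l2)).

(** ** Monodromy *)

(* The germ [w] at g 1 is the analytic continuation along [g] of the germ [y]
   at g 0. *)
Definition analytic_continuation (g : R -> C) (y w : C -> C) : Prop :=
  exists F : R -> C -> C,
    (forall t, unit_itv t -> holomorphic_near (F t) (g t)) /\
    (forall t, unit_itv t ->
       locally t (fun s => unit_itv s -> germ_eq (g s) (F s) (F t))) /\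
    germ_eq (g 0%R) (F 0%R) y /\ germ_eq (g 1%R) (F 1%R) w.

(* g^* y = w as germs at g 0, where [g] is the lift of a loop of E_tau and the
   end point g 1 is identified with g 0 by translation. *)
Definition pullback (g : R -> C) (y w : C -> C) : Prop :=
  exists v : C -> C, analytic_continuation g y v /\
    germ_eq (g 0%R) w (fun z => v (z + (g 1%R - g 0%R))).

(* rho(g) = (a b; c d) in the basis (y1, y2) *)
Definition monodromy_matrix
    (g : R -> C) (y1 y2 : C -> C) (a b c d : C) : Prop :=
  pullback g y1 (fun z => a * y1 z + b * y2 z) /\
  pullback g y2 (fun z => c * y1 z + d * y2 z).

Definition common_eigenfunction (tau p A B q0 : C) (y : C -> C) : Prop :=
  local_solution (potential tau p A B) q0 y /\
  forall (g : R -> C) (w : C),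
    in_lattice tau w ->
    path (fun z => ~ sing tau p z) g q0 (q0 + w) ->
    exists c : C, pullback g y (fun z => c * y z).

Definition completely_reducible (tau p A B q0 : C) : Prop :=
  exists y1 y2 : C -> C,
    common_eigenfunction tau p A B q0 y1 /\
    common_eigenfunction tau p A B q0 y2 /\
    lin_indep q0 y1 y2.

(* C together with the point at infinity *)
Inductive Chat : Set :=
  | Fin (c : C)
  | Infty.

(* A common conjugation of rho(l1), rho(l2) is a change of the basis
   (y1, y2). *)
Definition monodromy_data (tau p A B q0 : C) (l1 l2 : R -> C)
    (eps1 eps2 : C) (c : Chat) : Prop :=
  (eps1 = 1 \/ eps1 = RtoC (-1)) /\ (eps2 = 1 \/ eps2 = RtoC (-1)) /\
  exists y1 y2 : C -> C,
    solution_basis (potential tau p A B) q0 y1 y2 /\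
    match c with
    | Fin c =>
        monodromy_matrix l1 y1 y2 (eps1 * 1) (eps1 * 0) (eps1 * 1) (eps1 * 1) /\
        monodromy_matrix l2 y1 y2 (eps2 * 1) (eps2 * 0) (eps2 * c) (eps2 * 1)
    | Infty =>
        monodromy_matrix l1 y1 y2 (eps1 * 1) (eps1 * 0) (eps1 * 0) (eps1 * 1) /\
        monodromy_matrix l2 y1 y2 (eps2 * 1) (eps2 * 0) (eps2 * 1) (eps2 * 1)
    end.

(* [v] (finite) is the value at [c] of the rational function num / den, for
   polynomials num and den without common root: at a root of den the value is
   infinity.  At c = infinity the value is the limit. *)
Definition rational_value (num den : C -> C) (c : Chat) (v : C) : Prop :=
  match c with
  | Fin c => den c <> 0 /\ v = num c / den c
  | Infty =>
      forall eps : R, (0 < eps)%R ->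
        exists M : R, forall c : C, (M < Cmod c)%R ->
          (Cmod (num c / den c - v) < eps)%R
  end.

(* Main.v *)
(* The apparentness condition makes [Phi = w + c + d / w], with [w = wp z - wp p]
   and suitable constants [c], [d], a product of two solutions:
   [kappa = Phi'^2 - 2 Phi Phi'' + 4 Q Phi^2] is constant, where [Q] is the potential.
   The operator [T y = Phi y' - Phi' y / 2] then acts on the solutions, commutes
   with analytic continuation, and satisfies [T^2 = kappa / 4].  If [kappa <> 0],
   eigenvectors of [T] for its two eigenvalues are common eigenfunctions, so here
   [kappa = 0] and [T] is nilpotent; its kernel is spanned by [y1 = sqrt Phi].
   For [kappa = 0], the two zeros of [Phi] in the variable [x = wp z] are either a
   double zero [x0] or two of the values [e_k].  Off the translates of the segment
   from [p] to [-p], [wp z - wp p] has a lattice periodic square root, the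
   exponential of an integral of [zeta (z + s p) - zeta (z - s p)] over [s]; hence
   [y1] is explicit and the signs can be read off.  Moreover [y2 / y1] equals
   [beta z - alpha zeta z] plus an elliptic function, with explicit [alpha] and
   [beta], so that continuation along [l_j] adds a multiple of
   [beta omega_j - alpha eta_j].  Therefore [(C - tau : C eta_1 - eta_2)] is
   [(alpha : beta)], because [eta_2 <> tau eta_1], and this is equivalent to the
   displayed formulas. *)

Require Import Defs.
From Stdlib Require Import Reals ZArith Lra Lia Psatz ssreflect ssrfun ssrbool.
From Stdlib Require Import Classical ClassicalEpsilon FunctionalExtensionality.
From Coquelicot Require Import Coquelicot.
Open Scope C_scope.

(** * Limits along a filter *)

(** If Phi = u v with solutions u and v, then kappa is the square of their Wronskian W, and T
    multiplies u and v by - W / 2 and W / 2. So kappa = 0 means that Phi is a constant times the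
    square of one solution. Phi may vanish at points of the paths, so T is used in place of the
    factors u and v, and identities involving 1 / Phi are multiplied out. Identities between
    elliptic functions come from Liouville's theorem: the poles are removed by explicit expansions,
    and the constant is read off at one point. Nonvanishing of such a constant, as for the
    differences of the e_k, is shown by continuing a hypothetical constant germ of wp towards its
    pole. Both displayed formulas are homogeneous in C - tau and C eta_1 - eta_2. They are therefore
    proved at the point (alpha : beta) of the projective line, which treats finite C and C =
    infinity together. *)

Lemma Cmod_sub_sym (a b : C) : Cmod (a - b) = Cmod (b - a).
Proof. by rewrite -Cmod_opp; congr Cmod; ring. Qed.

Lemma Cmod_sub_le (a b : C) : (Cmod (a - b) <= Cmod a + Cmod b)%R.
Proof. by rewrite -(Cmod_opp b); exact: Cmod_triangle. Qed.

Lemma Cmod_sub_ge (a b : C) : (Cmod a - Cmod b <= Cmod (a - b))%R.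
Proof.
have := Cmod_triangle (a - b) b.
have -> : a - b + b = a by ring.
lra.
Qed.

Lemma Cmod_sub_tri (a b c : C) : (Cmod (a - c) <= Cmod (a - b) + Cmod (b - c))%R.
Proof. have -> : a - c = (a - b) + (b - c) by ring. exact: Cmod_triangle. Qed.

Lemma Cmod_le_Re_Im (z : C) : (Cmod z <= Rabs (Re z) + Rabs (Im z))%R.
Proof.
have -> : z = Re z + Ci * Im z.
  by case: z => x y; rewrite /Re /Im /Ci /Cmult /Cplus /RtoC /=; congr pair; ring.
apply: Rle_trans; first exact: Cmod_triangle.
rewrite Cmod_mult Cmod_Ci !Cmod_R re_plus im_plus re_mult im_mult !re_RtoC !im_RtoC.
have -> : Re Ci = 0%R by []. have -> : Im Ci = 1%R by [].
apply: Req_le; congr (_ + _)%R; last rewrite Rmult_1_l; congr Rabs; ring.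
Qed.

Lemma Im_le_Cmod (z : C) : (Rabs (Im z) <= Cmod z)%R.
Proof. exact: Rle_trans (Rmax_r _ _) (Rmax_Cmod z). Qed.

(** Neighbourhoods in C are generated by boxes, while estimates use the modulus. A box of half side
    d / 2 lies in the disc of radius d because sqrt 2 <= 2. *)
Lemma locallyC (z : C) (P : C -> Prop) :
  locally z P <-> exists d : R, (0 < d)%R /\ forall w, (Cmod (w - z) < d)%R -> P w.
Proof.
split.
- case=> d Hd; exists d; split; first exact: cond_pos.
  move=> w Hw; apply: Hd.
  exact: (C_NormedModule_mixin_compat1 z w d Hw).
- case=> d [d0 Hd].
  have d2 : (0 < d / 2)%R by lra.
  exists (mkposreal _ d2) => w Hw; apply: Hd.
  have := C_NormedModule_mixin_compat2 z w _ Hw.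
  rewrite /minus /plus /opp /=.
  have : (sqrt 2 <= 2)%R.
    rewrite -[X in (_ <= X)%R]sqrt_Rsqr; last lra.
    by apply: sqrt_le_1_alt; rewrite /Rsqr; lra.
  move=> h1 h2; apply: (Rlt_le_trans _ _ _ h2).
  have := Rmult_le_compat_r (d/2) _ _ _ h1. lra.
Qed.

Lemma locallyR (t : R) (P : R -> Prop) :
  locally t P <-> exists d : R, (0 < d)%R /\ forall s, (Rabs (s - t) < d)%R -> P s.
Proof.
split.
- case=> d Hd; exists d; split; first exact: cond_pos. by move=> s Hs; apply: Hd.
- case=> d [d0 Hd]. by exists (mkposreal _ d0) => s Hs; apply: Hd.
Qed.

Lemma locally_disc (c z : C) (r : R) : (Cmod (z - c) < r)%R ->
  locally z (fun w => (Cmod (w - c) < r)%R).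
Proof.
move=> H; apply/locallyC; exists (r - Cmod (z - c))%R; split; first lra.
move=> w Hw; have := Cmod_sub_tri w z c; lra.
Qed.

Lemma locallyC_imp (z : C) (P Q : C -> Prop) :
  (forall w, P w -> Q w) -> locally z P -> locally z Q.
Proof. exact: filter_imp. Qed.

Lemma locally_locallyC (z : C) (P : C -> Prop) :
  locally z P -> locally z (fun w => locally w P).
Proof. exact: locally_locally. Qed.

(** The epsilon form of [filterlim], with the modulus and for any filter, so that one set of rules
    serves sequences, real parameters, complex variables and products of these. *)
Definition flim {T : Type} (F : (T -> Prop) -> Prop) (f : T -> C) (l : C) : Prop :=
  forall eps : R, (0 < eps)%R -> F (fun x => (Cmod (f x - l) < eps)%R).

Lemma flim_filterlim {T : Type} (F : (T -> Prop) -> Prop) {FF : Filter F} f l :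
  flim F f l <-> filterlim f F (locally l).
Proof.
split=> H.
- move=> P /locallyC [d [d0 Hd]]. rewrite /filtermap.
  apply: filter_imp (H d d0) => x Hx; exact: Hd.
- move=> eps e0. apply: (H (fun y => (Cmod (y - l) < eps)%R)).
  by apply/locallyC; exists eps.
Qed.

Section FlimRules.
Context {T : Type} (F : (T -> Prop) -> Prop) {FF : Filter F}.
Implicit Types (f g : T -> C) (a b : C).

Lemma flim_ext f g l : F (fun x => f x = g x) -> flim F f l -> flim F g l.
Proof.
move=> E H eps e0; apply: filter_imp (filter_and _ _ E (H _ e0)) => x [<- //].
Qed.

Lemma flim_const (c : C) : flim F (fun _ => c) c.
Proof.
move=> eps e0; apply: filter_forall => x.
have -> : c - c = 0 by ring. by rewrite Cmod_0.
Qed.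

Lemma flim_plus f g a b : flim F f a -> flim F g b -> flim F (fun x => f x + g x) (a + b).
Proof.
move=> Hf Hg eps e0.
have e2 : (0 < eps / 2)%R by lra.
apply: filter_imp (filter_and _ _ (Hf _ e2) (Hg _ e2)) => x [h1 h2].
have -> : f x + g x - (a + b) = (f x - a) + (g x - b) by ring.
have := Cmod_triangle (f x - a) (g x - b); lra.
Qed.

Lemma flim_mult f g a b : flim F f a -> flim F g b -> flim F (fun x => f x * g x) (a * b).
Proof.
move=> Hf Hg eps e0.
have a0 := Cmod_ge_0 a. have b0 := Cmod_ge_0 b.
set m := (Cmod a + Cmod b + 1)%R.
have m0 : (0 < m)%R by rewrite /m; lra.
have d0 : (0 < Rmin 1 (eps / (2 * m)))%R.
  by apply: Rmin_pos; [lra | apply: Rdiv_lt_0_compat; lra].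
apply: filter_imp (filter_and _ _ (Hf _ d0) (Hg _ d0)) => x [h1 h2].
have -> : f x * g x - a * b = (f x - a) * (g x - b) + a * (g x - b) + b * (f x - a) by ring.
apply: Rle_lt_trans; first exact: Cmod_triangle.
apply: Rle_lt_trans.
  apply: Rplus_le_compat_r; exact: Cmod_triangle.
rewrite !Cmod_mult.
set p := Cmod (f x - a) in h1 *. set q := Cmod (g x - b) in h2 *.
have p0 : (0 <= p)%R by exact: Cmod_ge_0. have q0 : (0 <= q)%R by exact: Cmod_ge_0.
have p1 : (p < 1)%R by apply: Rlt_le_trans h1 (Rmin_l _ _).
have p2 : (p < eps / (2 * m))%R by apply: Rlt_le_trans h1 (Rmin_r _ _).
have q2 : (q < eps / (2 * m))%R by apply: Rlt_le_trans h2 (Rmin_r _ _).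
have E : (m * (eps / (2 * m)) = eps / 2)%R by field; lra.
have h3 : (p * q <= q)%R by nra.
have h4 : (Cmod a * q + q <= (Cmod a + 1) * (eps / (2 * m)))%R by nra.
have h5 : (Cmod b * p <= Cmod b * (eps / (2 * m)))%R by apply: Rmult_le_compat_l; lra.
have h6 : ((Cmod a + 1) * (eps / (2 * m)) + Cmod b * (eps / (2 * m)) = eps / 2)%R
  by rewrite -E /m; ring.
lra.
Qed.

Lemma flim_opp f a : flim F f a -> flim F (fun x => - f x) (- a).
Proof.
move=> H. have -> : - a = (-1) * a by ring.
apply: (flim_ext (fun x => (-1) * f x)).
  by apply: filter_forall => x; ring.
exact: flim_mult (flim_const _) H.
Qed.

Lemma flim_minus f g a b : flim F f a -> flim F g b -> flim F (fun x => f x - g x) (a - b).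
Proof. move=> Hf Hg; exact: (flim_plus _ _ _ _ Hf (flim_opp _ _ Hg)). Qed.

Lemma flim_inv f a : a <> 0 -> flim F f a -> flim F (fun x => / f x) (/ a).
Proof.
move=> a0 H eps e0.
have A0 : (0 < Cmod a)%R by apply/Cmod_gt_0.
set A := Cmod a in A0 *.
(* Within A / 2 of a the modulus of f exceeds A / 2, so the denominator below exceeds A * A / 2. *)
have d0 : (0 < Rmin (A / 2) (eps * (A * A / 2)))%R by apply: Rmin_pos; [lra | apply: Rmult_lt_0_compat => //; nra].
apply: filter_imp (H _ d0) => x h.
have h1 := Rlt_le_trans _ _ _ h (Rmin_l _ _).
have h2 := Rlt_le_trans _ _ _ h (Rmin_r _ _).
have h3 : (A / 2 < Cmod (f x))%R.
  have := Cmod_sub_ge a (f x). rewrite (Cmod_sub_sym a) -/A. lra.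
have fx0 : f x <> 0 by apply/Cmod_gt_0; lra.
have -> : / f x - / a = (a - f x) / (f x * a) by field.
rewrite Cmod_div; last exact: Cmult_neq_0.
rewrite Cmod_mult -/A Cmod_sub_sym.
have P : (A * A / 2 < Cmod (f x) * A)%R by nra.
apply/Rlt_div_l; nra.
Qed.

Lemma flim_div f g a b : b <> 0 -> flim F f a -> flim F g b ->
  flim F (fun x => f x / g x) (a / b).
Proof. move=> b0 Hf Hg; exact: (flim_mult _ _ _ _ Hf (flim_inv _ _ b0 Hg)). Qed.

Lemma flim_pow f a n : flim F f a -> flim F (fun x => f x ^ n) (a ^ n).
Proof.
move=> H; elim: n => [|n IH] /=; first exact: flim_const. exact: flim_mult.
Qed.

Lemma flim_comp (h : C -> C) f a : flim F f a -> flim (locally a) h (h a) ->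
  flim F (fun x => h (f x)) (h a).
Proof.
move=> Hf Hh eps e0.
have /locallyC [d [d0 Hd]] := Hh _ e0.
apply: filter_imp (Hf _ d0) => x Hx; exact: Hd.
Qed.

Lemma flim_neq0 f a : a <> 0 -> flim F f a -> F (fun x => f x <> 0).
Proof.
move=> /Cmod_gt_0 a0 H; apply: filter_imp (H _ a0) => x Hx E.
move: Hx; rewrite E. have -> : 0 - a = - a by ring. rewrite Cmod_opp; lra.
Qed.

Lemma flim_unique {PF : ProperFilter F} f a b : flim F f a -> flim F f b -> a = b.
Proof.
move=> Ha Hb; apply: NNPP => ne.
have d0 : (0 < Cmod (a - b))%R by apply/Cmod_gt_0; exact: Cminus_eq_contra.
have d2 : (0 < Cmod (a - b) / 2)%R by lra.
have [x [h1 h2]] := filter_ex _ (filter_and _ _ (Ha _ d2) (Hb _ d2)).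
have := Cmod_sub_tri a (f x) b. rewrite (Cmod_sub_sym a (f x)). lra.
Qed.

Lemma flim_Cmod_le {PF : ProperFilter F} f a M :
  flim F f a -> F (fun x => (Cmod (f x) <= M)%R) -> (Cmod a <= M)%R.
Proof.
move=> Ha Hb. apply: Rnot_lt_le => h.
have d0 : (0 < Cmod a - M)%R by lra.
have [x [h1 h2]] := filter_ex _ (filter_and _ _ (Ha _ d0) Hb).
have := Cmod_sub_ge a (f x). rewrite (Cmod_sub_sym a). lra.
Qed.

End FlimRules.

Lemma flim_id (z : C) : flim (locally z) (fun w => w) z.
Proof. by move=> eps e0; apply/locallyC; exists eps. Qed.

Lemma flim_RtoC (t : R) : flim (locally t) (fun s : R => RtoC s) t.
Proof.
move=> eps e0; apply/locallyR; exists eps; split=> // s.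
by rewrite -RtoC_minus Cmod_R.
Qed.

Lemma flim_close {T : Type} (F : (T -> Prop) -> Prop) {FF : Filter F} f l (g : T -> R) :
  flim F (fun x => RtoC (g x)) 0 -> F (fun x => (Cmod (f x - l) <= g x)%R) -> flim F f l.
Proof.
move=> Hg Hb eps e0.
apply: filter_imp (filter_and _ _ (Hg _ e0) Hb) => x [h1 h2].
have E : RtoC (g x) - 0 = g x by ring.
rewrite E Cmod_R in h1. have := Rle_abs (g x). lra.
Qed.

(** * Complex derivatives *)

(** Caratheodory's form: the difference quotient, completed by l at z, has limit l. The rules of
    differentiation become algebra of slopes followed by rules for limits. *)
Lemma is_derive_carath (f : C -> C) (z l : C) :
  is_derive f z l <->
  exists phi : C -> C, (forall w, f w = f z + (w - z) * phi w) /\ phi z = l /\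
    flim (locally z) phi l.
Proof.
split.
- case=> _ H.
  have {}H : forall eps : R, (0 < eps)%R ->
      locally z (fun w => (Cmod (f w - f z - (w - z) * l) <= eps * Cmod (w - z))%R).
    move=> eps e0. apply: locallyC_imp (proj2 (locally_C z _) (H z (fun P HP => HP) (mkposreal _ e0))) => w Hw.
    exact: Hw.
  exists (fun w => if Ceq_dec w z then l else (f w - f z) / (w - z)). split; [|split].
  + move=> w; case: Ceq_dec => [h|ne] /=; first by rewrite h; ring.
    have h : w - z <> 0 by exact: Cminus_eq_contra. by field.
  + by case: Ceq_dec.
  + move=> eps e0. have e2 : (0 < eps / 2)%R by lra.
    apply: filter_imp (H _ e2) => w Hw. case: Ceq_dec => [E|ne].
      have -> : l - l = 0 by ring. by rewrite Cmod_0.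
    have h : w - z <> 0 by exact: Cminus_eq_contra.
    have -> : (f w - f z) / (w - z) - l = (f w - f z - (w - z) * l) / (w - z) by field.
    rewrite Cmod_div //. have h0 : (0 < Cmod (w - z))%R by apply/Cmod_gt_0.
    apply/Rlt_div_l; first by []. nra.
- case=> phi [E [pz H]]. split.
    exact: (@is_linear_scal_l C_AbsRing C_NormedModule l).
  move=> x Hx. have <- : z = x by exact: (@is_filter_lim_locally_unique C_AbsRing (AbsRing_NormedModule C_AbsRing) z x).
  move=> eps. apply/locally_C. apply: locallyC_imp (H eps (cond_pos eps)) => w Hw.
  change (Cmod (f w - f z - (w - z) * l) <= eps * Cmod (w - z))%R.
  rewrite {1}E.
  have -> : f z + (w - z) * phi w - f z - (w - z) * l = (phi w - l) * (w - z) by ring.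
  rewrite Cmod_mult. apply: Rmult_le_compat_r; [exact: Cmod_ge_0 | lra].
Qed.

Lemma is_derive_cont (f : C -> C) (z l : C) : is_derive f z l -> flim (locally z) f (f z).
Proof.
move=> /is_derive_carath [phi [E [pz H]]].
apply: (flim_ext _ (fun w => f z + (w - z) * phi w)); first by apply: filter_forall => w; rewrite -E.
have {2}-> : f z = f z + (z - z) * l by ring.
apply: flim_plus; first exact: flim_const.
apply: flim_mult => //. exact: (flim_minus _ _ _ _ _ (flim_id z) (flim_const _ z)).
Qed.

Lemma ex_derive_cont (f : C -> C) (z : C) : ex_derive f z -> flim (locally z) f (f z).
Proof. by case=> l /is_derive_cont. Qed.

Lemma is_derive_eq (f : C -> C) (z l l' : C) : is_derive f z l -> l = l' -> is_derive f z l'.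
Proof. by move=> H <-. Qed.

Lemma derive_ext_near (f g : C -> C) (z l : C) : locally z (fun w => f w = g w) ->
  is_derive f z l -> is_derive g z l.
Proof. move=> /locally_C; exact: (@is_derive_ext_loc C_AbsRing C_NormedModule). Qed.

Lemma derive_const (c z : C) : is_derive (fun _ : C => c) z (RtoC 0).
Proof. exact: (@is_derive_const C_AbsRing C_NormedModule). Qed.

Lemma derive_id (z : C) : is_derive (fun w : C => w) z (RtoC 1).
Proof.
apply/is_derive_carath; exists (fun _ => RtoC 1). split; [move=> w; ring|split=> //].
exact: flim_const.
Qed.

Lemma derive_plus (f g : C -> C) (z a b : C) : is_derive f z a -> is_derive g z b ->
  is_derive (fun w => f w + g w) z (a + b).
Proof. move=> Hf Hg; exact: (@is_derive_plus C_AbsRing C_NormedModule f g z a b Hf Hg). Qed.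

Lemma derive_opp (f : C -> C) (z a : C) : is_derive f z a -> is_derive (fun w => - f w) z (- a).
Proof. move=> Hf; exact: (@is_derive_opp C_AbsRing C_NormedModule f z a Hf). Qed.

Lemma derive_minus (f g : C -> C) (z a b : C) : is_derive f z a -> is_derive g z b ->
  is_derive (fun w => f w - g w) z (a - b).
Proof. move=> Hf Hg; exact: (derive_plus _ _ _ _ _ Hf (derive_opp _ _ _ Hg)). Qed.

Lemma derive_mult (f g : C -> C) (z a b : C) : is_derive f z a -> is_derive g z b ->
  is_derive (fun w => f w * g w) z (a * g z + f z * b).
Proof.
move=> Hf Hg. have cg := is_derive_cont _ _ _ Hg.
move: Hf Hg => /is_derive_carath [p [E [pz H]]] /is_derive_carath [q [E' [qz H']]].
apply/is_derive_carath; exists (fun w => p w * g w + f z * q w). split; [|split].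
- move=> w. have h := E w. have h' := E' w.
  transitivity ((f z + (w - z) * p w) * g w); first by rewrite -h.
  transitivity ((w - z) * p w * g w + f z * (g z + (w - z) * q w)); last by ring.
  by rewrite -h'; ring.
- by rewrite pz qz.
- apply: flim_plus; apply: flim_mult => //; exact: flim_const.
Qed.

Lemma derive_scal (c : C) (f : C -> C) (z a : C) : is_derive f z a ->
  is_derive (fun w => c * f w) z (c * a).
Proof.
move=> H; apply: is_derive_eq (derive_mult _ _ _ _ _ (derive_const c z) H) _; ring.
Qed.

Lemma derive_inv (f : C -> C) (z a : C) : f z <> 0 -> is_derive f z a ->
  is_derive (fun w => / f w) z (- a / f z ^ 2).
Proof.
move=> f0 Hf. have cf := is_derive_cont _ _ _ Hf.
move: (Hf) => /is_derive_carath [p [E [pz H]]].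
have nz : locally z (fun w => f w <> 0) by exact: flim_neq0 cf.
(* The identity for the slope is required at every w, so where f vanishes 1 / f is first replaced by
   the affine function with the expected slope. *)
apply: (derive_ext_near
  (fun w => if excluded_middle_informative (f w = 0) then / f z - (w - z) * a / f z ^ 2 else / f w)).
  by apply: filter_imp nz => w Hw; case: excluded_middle_informative => [h|] //=; case: (Hw h).
apply/is_derive_carath.
exists (fun w => if excluded_middle_informative (f w = 0) then - a / f z ^ 2 else - p w / (f z * f w)).
split; [|split].
- move=> w. case: (excluded_middle_informative (f z = 0)) => [//|_] /=.
  case: excluded_middle_informative => h /=; first by field.
  have e : p w * (w - z) = f w - f z by rewrite (E w); ring.
  transitivity (/ f z - (p w * (w - z)) / (f z * f w)); last by field; split.
  by rewrite e; field; split.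
- by case: excluded_middle_informative => [//|_] /=; rewrite pz; field.
- apply: (flim_ext _ (fun w => - p w / (f z * f w))).
    by apply: filter_imp nz => w Hw; case: excluded_middle_informative => [h|] //=; case: (Hw h).
  have -> : - a / f z ^ 2 = - a / (f z * f z) by field.
  apply: flim_div; [exact: Cmult_neq_0 | exact: flim_opp |].
  by apply: flim_mult => //; exact: flim_const.
Qed.

Lemma derive_div (f g : C -> C) (z a b : C) : g z <> 0 -> is_derive f z a -> is_derive g z b ->
  is_derive (fun w => f w / g w) z ((a * g z - f z * b) / g z ^ 2).
Proof.
move=> g0 Hf Hg; apply: is_derive_eq (derive_mult _ _ _ _ _ Hf (derive_inv _ _ _ g0 Hg)) _.
by field.
Qed.

Lemma derive_pow (f : C -> C) (z a : C) n : is_derive f z a ->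
  is_derive (fun w => f w ^ S n) z (INR (S n) * a * f z ^ n).
Proof.
move=> H; elim: n => [|n IH].
  apply: (@is_derive_ext C_AbsRing C_NormedModule f); first by move=> t /=; ring.
  by apply: is_derive_eq H _; rewrite /=; ring.
have := derive_mult _ _ _ _ _ H IH => /(is_derive_eq _ _ _ _); apply.
rewrite (S_INR (S n)) RtoC_plus !Cpow_S. ring.
Qed.

Lemma derive_comp (f g : C -> C) (z a b : C) : is_derive f (g z) a -> is_derive g z b ->
  is_derive (fun w => f (g w)) z (a * b).
Proof.
move=> /is_derive_carath [p [E [pz H]]] Hg. have cg := is_derive_cont _ _ _ Hg.
move: Hg => /is_derive_carath [q [E' [qz H']]].
apply/is_derive_carath; exists (fun s => p (g s) * q s). split; [|split].
- move=> s. rewrite {1}E. have -> : g s - g z = (s - z) * q s by rewrite {1}E'; ring. ring.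
- by rewrite pz qz.
- apply: flim_mult => //. rewrite -pz. apply: flim_comp => //. by rewrite pz.
Qed.

Lemma derive_shift (f : C -> C) (z c a : C) : is_derive f (z + c) a ->
  is_derive (fun w => f (w + c)) z a.
Proof.
move=> H.
apply: is_derive_eq (derive_comp f (fun w => w + c) z a 1 H _) _; last by ring.
apply: is_derive_eq (derive_plus _ _ _ _ _ (derive_id z) (derive_const c z)) _; ring.
Qed.

Lemma derive_unique (f : C -> C) (z a b : C) : is_derive f z a -> is_derive f z b -> a = b.
Proof. by move=> /is_C_derive_unique <- /is_C_derive_unique <-. Qed.

Lemma C_derive_is (f : C -> C) (z : C) : ex_derive f z -> is_derive f z (C_derive f z).
Proof. by case=> l H; rewrite (is_C_derive_unique _ _ _ H). Qed.

Lemma C_derive_ext_near (f g : C -> C) (z : C) : ex_derive f z ->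
  locally z (fun w => f w = g w) -> C_derive f z = C_derive g z.
Proof.
move=> /C_derive_is H E. by rewrite -(is_C_derive_unique _ _ _ (derive_ext_near _ _ _ _ E H)).
Qed.

(** * Functions of a real variable with complex values *)

(** Caratheodory's form again, so that composition with a complex derivative multiplies slopes. *)
Definition rder (f : R -> C) (t : R) (l : C) : Prop :=
  exists phi : R -> C, (forall s, f s = f t + (s - t) * phi s) /\ phi t = l /\
    flim (locally t) phi l.

Definition rcont (f : R -> C) (t : R) : Prop := flim (locally t) f (f t).

Lemma rder_cont f t l : rder f t l -> rcont f t.
Proof.
move=> [phi [E [pz H]]]. rewrite /rcont.
apply: (flim_ext _ (fun w : R => f t + (w - t) * phi w)); first by apply: filter_forall => w; rewrite -E.
have {2}-> : f t = f t + (t - t) * l by ring.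
apply: flim_plus; first exact: flim_const.
apply: flim_mult => //. exact: (flim_minus _ _ _ _ _ (flim_RtoC t) (flim_const _ (RtoC t))).
Qed.

Lemma rder_comp (f : C -> C) (g : R -> C) (t : R) (a b : C) :
  is_derive f (g t) a -> rder g t b -> rder (fun s => f (g s)) t (a * b).
Proof.
move=> /is_derive_carath [p [E [pz H]]] Hg. have cg := rder_cont _ _ _ Hg.
case: Hg => q [E' [qz H']].
exists (fun s => p (g s) * q s). split; [|split].
- move=> s. rewrite {1}E. have -> : g s - g t = (s - t) * q s by rewrite {1}E'; ring. ring.
- by rewrite pz qz.
- apply: flim_mult => //. rewrite -pz. apply: flim_comp => //. by rewrite pz.
Qed.

Lemma rder_affine (a b : C) t : rder (fun s => a + s * b) t b.
Proof.
exists (fun _ => b). split; [|split] => //; last exact: flim_const. move=> s; ring.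
Qed.

Lemma rder_minus f g t a b : rder f t a -> rder g t b -> rder (fun s => f s - g s) t (a - b).
Proof.
move=> [p [E [pz H]]] [q [E' [qz H']]]. exists (fun s => p s - q s). split; [|split].
- move=> s. rewrite E E'. ring.
- by rewrite pz qz.
- exact: flim_minus.
Qed.

Lemma rder_components f t l : rder f t l ->
  is_derive (fun s => Re (f s)) t (Re l) /\ is_derive (fun s => Im (f s)) t (Im l).
Proof.
move=> [phi [E [pz H]]].
have key : forall (g : C -> R), (forall u v : C, g (u - v) = (g u - g v)%R) ->
   (forall (r : R) (u : C), g (r * u) = (r * g u)%R) -> (forall u : C, (Rabs (g u) <= Cmod u)%R) ->
   is_derive (fun s => g (f s)) t (g l).
  move=> g gB gZ gM. apply/is_derive_Reals => eps e0.
  have /locallyR [d [d0 Hd]] := H _ e0.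
  exists (mkposreal _ d0) => h h0 hd.
  have e1 : f (t + h)%R - f t = h * phi (t + h)%R by rewrite {1}E RtoC_plus; ring.
  have -> : ((g (f (t + h)) - g (f t)) / h = g (phi (t + h)))%R.
    by rewrite -gB e1 gZ; field.
  rewrite -gB. apply: Rle_lt_trans (gM _) _. apply: Hd.
  by have -> : (t + h - t = h)%R by ring.
split; apply: key.
- by move=> u v; rewrite /Cminus re_plus re_opp.
- exact: re_scal_l.
- exact: re_le_Cmod.
- by move=> u v; rewrite /Cminus im_plus im_opp.
- exact: im_scal_l.
- exact: Im_le_Cmod.
Qed.

(** * Propagation and uniformity on the unit interval *)

(** Take the supremum of the m such that P holds on [0, m]; the local hypothesis carries P past it.
    This stands for connectedness of the interval, and P need only be carried forward. *)
Lemma propagation01 (P : R -> Prop) :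
  P 0%R ->
  (forall t, (0 <= t <= 1)%R -> exists d, (0 < d)%R /\
     forall s s', (0 <= s <= 1)%R -> (0 <= s' <= 1)%R -> (Rabs (s - t) < d)%R ->
       (Rabs (s' - t) < d)%R -> (s <= s')%R -> P s -> P s') ->
  forall t, (0 <= t <= 1)%R -> P t.
Proof.
move=> P0 Hloc.
pose E m := (0 <= m <= 1)%R /\ forall s, (0 <= s <= m)%R -> P s.
have E0 : E 0%R.
  split; first by lra. move=> s Hs. by have -> : s = 0%R by lra.
have bE : bound E by exists 1%R => x [Hx _]; lra.
have [m [ub lub]] := completeness E bE (ex_intro _ _ E0).
have m0 : (0 <= m)%R by exact: ub.
have m1 : (m <= 1)%R by apply: lub => x [Hx _]; lra.
have [d [d0 Hd]] := Hloc m (conj m0 m1).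
have [a [Ea Ha]] : exists a, E a /\ (m - d < a)%R.
  apply: NNPP => N. have : (m <= m - d)%R; last by lra.
  apply: lub => x Ex. apply: Rnot_lt_le => h. apply: N. by exists x.
have am := ub _ Ea.
have ext : forall b, (a <= b <= 1)%R -> (b < m + d)%R -> E b.
  move=> b Hb Hbd. case: (Ea) => [a01 Pa]. split; first by lra.
  move=> s Hs. case: (Rle_dec s a) => h; first by apply: Pa; lra.
  apply: (Hd a s); try lra; try (apply: Rabs_def1; lra). apply: Pa; lra.
have E1 : E 1%R.
  case: (Rle_dec 1 (m + d / 2)) => h; first by apply: ext; lra.
  have : (m + d / 2 <= m)%R; last by lra. apply: ub. apply: ext; lra.
move=> t Ht. apply: (proj2 E1); lra.
Qed.

(** Compactness of the interval: [propagation01] is applied to the existence of a common radius on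
    [0, t], two radii being merged by their minimum. *)
Lemma uniform01 (Q : R -> R -> Prop) :
  (forall d d' s, (0 < d' <= d)%R -> Q d s -> Q d' s) ->
  (forall t, (0 <= t <= 1)%R -> exists d, (0 < d)%R /\
     forall s, (0 <= s <= 1)%R -> (Rabs (s - t) < d)%R -> Q d s) ->
  exists d, (0 < d)%R /\ forall s, (0 <= s <= 1)%R -> Q d s.
Proof.
move=> mono Hloc.
suff H : forall t, (0 <= t <= 1)%R ->
    exists d, (0 < d)%R /\ forall s, (0 <= s <= t)%R -> Q d s by apply: H; lra.
apply: propagation01.
  have [|d [d0 Hd]] := Hloc 0%R; first by lra.
  exists d; split=> // s Hs. apply: Hd; first by lra. apply: Rabs_def1; lra.
move=> t Ht. have [d [d0 Hd]] := Hloc t Ht. exists d; split=> //.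
move=> s s' Hs Hs' As As' ss' [c [c0 Hc]].
exists (Rmin c d). split; first exact: Rmin_pos.
move=> x Hx. case: (Rle_dec x s) => h.
  apply: (mono c); last by apply: Hc; lra.
  split; [exact: Rmin_pos | exact: Rmin_l].
apply: (mono d); first by split; [exact: Rmin_pos | exact: Rmin_r].
apply: Hd; first by lra. move: As As' => /Rabs_def2 As /Rabs_def2 As'. apply: Rabs_def1; lra.
Qed.

(** * Integrals over the unit interval *)

Definition I01 (f : R -> C) : C :=
  (RInt (fun t => Re (f t)) 0 1, RInt (fun t => Im (f t)) 0 1).

Definition cont01 (f : R -> C) : Prop := forall t, (0 <= t <= 1)%R -> rcont f t.

Lemma rcont_Re f t : rcont f t -> continuous (fun s => Re (f s)) t.
Proof.
move=> H. apply/filterlim_locally => eps.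
apply: filter_imp (H eps (cond_pos eps)) => s Hs.
apply: Rle_lt_trans Hs. apply: Rle_trans (re_le_Cmod _). rewrite /Cminus re_plus re_opp.
exact: Rle_refl.
Qed.

Lemma rcont_Im f t : rcont f t -> continuous (fun s => Im (f s)) t.
Proof.
move=> H. apply/filterlim_locally => eps.
apply: filter_imp (H eps (cond_pos eps)) => s Hs.
apply: Rle_lt_trans Hs. apply: Rle_trans (Im_le_Cmod _). rewrite /Cminus im_plus im_opp.
exact: Rle_refl.
Qed.

Lemma cont_ex_RInt (f : R -> R) : (forall t, (0 <= t <= 1)%R -> continuous f t) ->
  ex_RInt f 0 1.
Proof.
move=> H. apply: (@ex_RInt_continuous R_CompleteNormedModule) => t.
rewrite Rmin_left ?Rmax_right; try lra. exact: H.
Qed.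

Lemma cont01_Re f : cont01 f -> ex_RInt (fun t => Re (f t)) 0 1.
Proof. move=> H; apply: cont_ex_RInt => t Ht. exact: rcont_Re (H t Ht). Qed.

Lemma cont01_Im f : cont01 f -> ex_RInt (fun t => Im (f t)) 0 1.
Proof. move=> H; apply: cont_ex_RInt => t Ht. exact: rcont_Im (H t Ht). Qed.

Lemma I01_ext f g : (forall t, (0 <= t <= 1)%R -> f t = g t) -> I01 f = I01 g.
Proof.
move=> H. congr pair; apply: RInt_ext => t; rewrite Rmin_left ?Rmax_right; try lra;
  move=> Ht; rewrite H //; lra.
Qed.

Lemma I01_plus f g : cont01 f -> cont01 g -> I01 (fun t => f t + g t) = I01 f + I01 g.
Proof.
move=> Hf Hg. rewrite /I01 /Cplus /=. congr pair.
- exact: (@RInt_plus R_CompleteNormedModule (fun t => Re (f t)) (fun t => Re (g t)) 0 1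
    (cont01_Re _ Hf) (cont01_Re _ Hg)).
- exact: (@RInt_plus R_CompleteNormedModule (fun t => Im (f t)) (fun t => Im (g t)) 0 1
    (cont01_Im _ Hf) (cont01_Im _ Hg)).
Qed.

Lemma I01_scal (c : C) f : cont01 f -> I01 (fun t => c * f t) = c * I01 f.
Proof.
move=> Hf.
have er := cont01_Re _ Hf. have ei := cont01_Im _ Hf.
have sc : forall (k : R) (h : R -> R), ex_RInt h 0 1 ->
    ex_RInt (fun t => k * h t)%R 0 1 /\ RInt (fun t => k * h t)%R 0 1 = (k * RInt h 0 1)%R.
  move=> k h Hh. split.
  - exact: (@ex_RInt_scal R_NormedModule h 0 1 k Hh).
  - exact: (@RInt_scal R_CompleteNormedModule h 0 1 k Hh).
case: c => x y. rewrite /I01 /Cmult /=. congr pair.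
- have [e1 <-] := sc x _ er. have [e2 <-] := sc y _ ei.
  exact: (@RInt_minus R_CompleteNormedModule _ _ 0 1 e1 e2).
- have [e1 <-] := sc x _ ei. have [e2 <-] := sc y _ er.
  exact: (@RInt_plus R_CompleteNormedModule _ _ 0 1 e1 e2).
Qed.

Lemma cont01_scal (c : C) f : cont01 f -> cont01 (fun t => c * f t).
Proof. move=> H t Ht; apply: flim_mult; [exact: flim_const | exact: H]. Qed.

Lemma cont01_minus f g : cont01 f -> cont01 g -> cont01 (fun t => f t - g t).
Proof. move=> H H' t Ht; apply: flim_minus; [exact: H | exact: H']. Qed.

Lemma I01_minus f g : cont01 f -> cont01 g -> I01 (fun t => f t - g t) = I01 f - I01 g.
Proof.
move=> Hf Hg. rewrite (I01_ext _ (fun t => f t + (-1) * g t)).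
  rewrite I01_plus // ?I01_scal //; first by ring. exact: cont01_scal.
move=> t _; ring.
Qed.

Lemma I01_const (c : C) : I01 (fun _ => c) = c.
Proof.
rewrite /I01 !RInt_const. case: c => x y. rewrite /scal /= /mult /=. congr pair; ring.
Qed.

(** The factor 2 comes from adding the bounds of the real and of the imaginary part. *)
Lemma I01_bound f M : cont01 f -> (forall t, (0 <= t <= 1)%R -> (Cmod (f t) <= M)%R) ->
  (Cmod (I01 f) <= 2 * M)%R.
Proof.
move=> Hf HM. apply: Rle_trans (Cmod_le_Re_Im _) _.
have h : forall g : R -> R, ex_RInt g 0 1 ->
    (forall t, (0 <= t <= 1)%R -> (Rabs (g t) <= M)%R) -> (Rabs (RInt g 0 1) <= M)%R.
  move=> g eg Hg. have := abs_RInt_le_const g 0 1 M Rle_0_1 eg Hg. lra.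
have h1 := h _ (cont01_Re _ Hf) (fun t Ht => Rle_trans _ _ _ (re_le_Cmod _) (HM t Ht)).
have h2 := h _ (cont01_Im _ Hf) (fun t Ht => Rle_trans _ _ _ (Im_le_Cmod _) (HM t Ht)).
rewrite /I01 /Re /Im /= in h1 h2 *. lra.
Qed.

Lemma I01_derive (F f : R -> C) : (forall t, (0 <= t <= 1)%R -> rder F t (f t)) -> cont01 f ->
  I01 f = F 1%R - F 0%R.
Proof.
move=> HF Hf. rewrite /I01.
have -> : F 1%R - F 0%R = ((Re (F 1%R) - Re (F 0%R))%R, (Im (F 1%R) - Im (F 0%R))%R) by [].
congr pair; apply: (@is_RInt_unique R_CompleteNormedModule).
- apply: (@is_RInt_derive R_CompleteNormedModule (fun t => Re (F t)));
    rewrite Rmin_left ?Rmax_right; try lra.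
  + move=> t Ht; exact: (proj1 (rder_components _ _ _ (HF t Ht))).
  + move=> t Ht; exact: rcont_Re (Hf t Ht).
- apply: (@is_RInt_derive R_CompleteNormedModule (fun t => Im (F t)));
    rewrite Rmin_left ?Rmax_right; try lra.
  + move=> t Ht; exact: (proj2 (rder_components _ _ _ (HF t Ht))).
  + move=> t Ht; exact: rcont_Im (Hf t Ht).
Qed.

Lemma RInt01_halves (f : R -> R) : (forall t, (0 <= t <= 1)%R -> continuous f t) ->
  RInt f 0 1 = (/ 2 * (RInt (fun t => f (t / 2)%R) 0 1 + RInt (fun t => f ((1 + t) / 2)%R) 0 1))%R.
Proof.
move=> H.
have ex : forall a b, (0 <= a <= b)%R -> (b <= 1)%R -> ex_RInt f a b.
  move=> a b Hab Hb. apply: (@ex_RInt_continuous R_CompleteNormedModule) => t.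
  rewrite Rmin_left ?Rmax_right; try lra. move=> Ht; apply: H; lra.
have half : forall v, (0 <= v)%R -> (v + 1/2 <= 1)%R ->
    RInt f v (v + 1/2) = (/ 2 * RInt (fun t => f (/ 2 * t + v)%R) 0 1)%R.
  move=> v v0 v1.
  have e : ex_RInt f (/ 2 * 0 + v) (/ 2 * 1 + v) by apply: ex; lra.
  have := @RInt_comp_lin R_CompleteNormedModule f (/ 2) v 0 1 e.
  have -> : (/ 2 * 0 + v)%R = v by lra. have -> : (/ 2 * 1 + v)%R = (v + 1/2)%R by lra.
  move=> <-.
  have e' := @ex_RInt_comp_lin R_NormedModule f (/2) v 0 1 e.
  (* The substitution rule keeps the factor 1 / 2 inside the integral, so the integrand is first
     written as twice its half. *)
  rewrite (RInt_ext (fun t => f (/ 2 * t + v)%R) (fun t => scal 2%R (scal (/2)%R (f (/ 2 * t + v)%R)))).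
    rewrite (@RInt_scal R_CompleteNormedModule _ 0 1 2%R e').
    have q : forall x : R, (x = / 2 * (2 * x))%R by move=> x; field. exact: q.
  move=> t _. have q : forall x : R, (x = 2 * (/ 2 * x))%R by move=> x; field. exact: q.
rewrite -(@RInt_Chasles R_CompleteNormedModule f 0 (1/2) 1); try (apply: ex; lra).
have h1 := half 0%R. have h2 := half (1/2)%R.
rewrite Rplus_0_l in h1. have q : (1/2 + 1/2 = 1)%R by lra. rewrite q in h2.
rewrite h1 ?h2; try lra. rewrite /plus /= -Rmult_plus_distr_l. congr (_ * (_ + _))%R;
 apply: RInt_ext => t _; congr f; field.
Qed.

Lemma I01_halves f : cont01 f ->
  I01 f = / 2 * (I01 (fun t => f (t / 2)%R) + I01 (fun t => f ((1 + t) / 2)%R)).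
Proof.
move=> Hf.
have h1 := RInt01_halves (fun t => Re (f t)) (fun t Ht => rcont_Re _ _ (Hf t Ht)).
have h2 := RInt01_halves (fun t => Im (f t)) (fun t Ht => rcont_Im _ _ (Hf t Ht)).
rewrite -RtoC_inv; last lra. rewrite /I01 h1 h2 /Cmult /Cplus /=. congr pair; ring.
Qed.

Lemma RInt01_rev (f : R -> R) : (forall t, (0 <= t <= 1)%R -> continuous f t) ->
  RInt (fun t => f (1 - t)%R) 0 1 = RInt f 0 1.
Proof.
move=> H. have e01 := cont_ex_RInt f H.
have e : ex_RInt f (-1 * 0 + 1) (-1 * 1 + 1).
  have -> : (-1 * 0 + 1 = 1)%R by ring. have -> : (-1 * 1 + 1 = 0)%R by ring.
  exact: ex_RInt_swap.
have := @RInt_comp_lin R_CompleteNormedModule f (-1) 1 0 1 e.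
have -> : (-1 * 0 + 1 = 1)%R by ring. have -> : (-1 * 1 + 1 = 0)%R by ring.
rewrite -(@opp_RInt_swap R_CompleteNormedModule f 0 1 e01) => E.
have e' := @ex_RInt_comp_lin R_NormedModule f (-1) 1 0 1 e.
rewrite (RInt_ext (fun t => f (1 - t)%R) (fun t => scal (-1)%R (scal (-1)%R (f (-1 * t + 1)%R)))).
  rewrite (@RInt_scal R_CompleteNormedModule _ 0 1 (-1)%R e') E.
    have q : forall x : R, (-1 * - x = x)%R by move=> x; ring. exact: q.
move=> t _. have -> : (-1 * t + 1 = 1 - t)%R by ring.
have q : forall x : R, (x = -1 * (-1 * x))%R by move=> x; ring. exact: q.
Qed.

Lemma I01_rev f : cont01 f -> I01 (fun t => f (1 - t)%R) = I01 f.
Proof.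
move=> Hf. congr pair; [apply: (RInt01_rev (fun t => Re (f t))) | apply: (RInt01_rev (fun t => Im (f t)))] => t Ht.
exact: rcont_Re (Hf t Ht). exact: rcont_Im (Hf t Ht).
Qed.

(** * Segments *)

Definition seg (a b : C) (t : R) : C := a + t * (b - a).

Lemma seg0 a b : seg a b 0 = a. Proof. rewrite /seg; ring. Qed.
Lemma seg1 a b : seg a b 1 = b. Proof. rewrite /seg; ring. Qed.

Lemma rder_seg a b t : rder (seg a b) t (b - a).
Proof. exact: rder_affine. Qed.

Lemma rcont_comp (f : C -> C) (g : R -> C) t :
  flim (locally (g t)) f (f (g t)) -> rcont g t -> rcont (fun s => f (g s)) t.
Proof. move=> Hf Hg; exact: flim_comp. Qed.

Lemma Cmod_01 (t : R) : (0 <= t)%R -> Cmod t = t.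
Proof. by move=> t0; rewrite Cmod_R Rabs_pos_eq. Qed.

Lemma seg_disc (c a b : C) (r : R) t : (0 <= t <= 1)%R ->
  (Cmod (a - c) < r)%R -> (Cmod (b - c) < r)%R -> (Cmod (seg a b t - c) < r)%R.
Proof.
move=> Ht Ha Hb.
have -> : seg a b t - c = (1 - t)%R * (a - c) + t * (b - c).
  rewrite /seg RtoC_minus; ring.
apply: Rle_lt_trans (Cmod_triangle _ _) _. rewrite !Cmod_mult !Cmod_01; try lra.
case: (Rle_dec t (1/2)) => h.
  have : ((1 - t) * Cmod (a - c) < (1 - t) * r)%R by apply: Rmult_lt_compat_l; lra.
  have : (t * Cmod (b - c) <= t * r)%R by apply: Rmult_le_compat_l; lra. lra.
have : ((1 - t) * Cmod (a - c) <= (1 - t) * r)%R by apply: Rmult_le_compat_l; lra.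
have : (t * Cmod (b - c) < t * r)%R by apply: Rmult_lt_compat_l; lra. lra.
Qed.

Lemma seg_disc_le (c a b : C) (r : R) t : (0 <= t <= 1)%R ->
  (Cmod (a - c) <= r)%R -> (Cmod (b - c) <= r)%R -> (Cmod (seg a b t - c) <= r)%R.
Proof.
move=> Ht Ha Hb.
have -> : seg a b t - c = (1 - t)%R * (a - c) + t * (b - c).
  rewrite /seg RtoC_minus; ring.
apply: Rle_trans (Cmod_triangle _ _) _. rewrite !Cmod_mult !Cmod_01; try lra.
have : ((1 - t) * Cmod (a - c) <= (1 - t) * r)%R by apply: Rmult_le_compat_l; lra.
have : (t * Cmod (b - c) <= t * r)%R by apply: Rmult_le_compat_l; lra. lra.
Qed.

(* The constant 2 comes from estimating real and imaginary parts separately. *)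
Lemma mean_value_bound (f df : C -> C) (a b l : C) (M : R) :
  (forall t, (0 <= t <= 1)%R -> is_derive f (seg a b t) (df (seg a b t)) /\
     (Cmod (df (seg a b t) - l) <= M)%R) ->
  (Cmod (f b - f a - l * (b - a)) <= 2 * M * Cmod (b - a))%R.
Proof.
move=> H.
pose h t := f (seg a b t) - t * (l * (b - a)).
have Hh : forall t, (0 <= t <= 1)%R -> rder h t ((df (seg a b t) - l) * (b - a)).
  move=> t Ht. have [H1 _] := H t Ht.
  have -> : (df (seg a b t) - l) * (b - a) = df (seg a b t) * (b - a) - l * (b - a) by ring.
  apply: rder_minus; first by apply: rder_comp => //; exact: rder_seg.
  have := rder_affine 0 (l * (b - a)) t. congr rder. apply: functional_extensionality => s; ring.
have -> : f b - f a - l * (b - a) = h 1%R - h 0%R by rewrite /h seg0 seg1; ring.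
have B : forall t, (0 <= t <= 1)%R -> (Cmod ((df (seg a b t) - l) * (b - a)) <= M * Cmod (b - a))%R.
  move=> t Ht. rewrite Cmod_mult. apply: Rmult_le_compat_r; [exact: Cmod_ge_0 | exact: (proj2 (H t Ht))].
have key : forall g dg : R -> R, (forall t, (0 <= t <= 1)%R -> is_derive g t (dg t)) ->
    (forall t, (0 <= t <= 1)%R -> (Rabs (dg t) <= M * Cmod (b - a))%R) ->
    (Rabs (g 1 - g 0) <= M * Cmod (b - a))%R.
  move=> g dg Hg Hd.
  have [c [Hc ->]] : exists c, (Rmin 0 1 <= c <= Rmax 0 1)%R /\ (g 1 - g 0 = dg c * (1 - 0))%R.
    apply: MVT_gen => t; rewrite Rmin_left ?Rmax_right; try lra; move=> Ht.
      by apply: Hg; lra.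
    apply: derivable_continuous_pt. exists (dg t). apply/is_derive_Reals. exact: Hg.
  rewrite Rminus_0_r Rmult_1_r. apply: Hd. move: Hc; rewrite Rmin_left ?Rmax_right; lra.
apply: Rle_trans (Cmod_le_Re_Im _) _.
have k1 := key (fun t => Re (h t)) (fun t => Re ((df (seg a b t) - l) * (b - a)))
  (fun t Ht => proj1 (rder_components _ _ _ (Hh t Ht)))
  (fun t Ht => Rle_trans _ _ _ (re_le_Cmod _) (B t Ht)).
have k2 := key (fun t => Im (h t)) (fun t => Im ((df (seg a b t) - l) * (b - a)))
  (fun t Ht => proj2 (rder_components _ _ _ (Hh t Ht)))
  (fun t Ht => Rle_trans _ _ _ (Im_le_Cmod _) (B t Ht)).
have -> : Re (h 1%R - h 0%R) = (Re (h 1%R) - Re (h 0%R))%R by [].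
have -> : Im (h 1%R - h 0%R) = (Im (h 1%R) - Im (h 0%R))%R by [].
lra.
Qed.

Lemma derive_zero_seg (f : C -> C) (a b : C) :
  (forall t, (0 <= t <= 1)%R -> is_derive f (seg a b t) (RtoC 0)) -> f a = f b.
Proof.
move=> H. apply/esym/Ceq_minus/Cmod_eq_0. apply: Rle_antisym; last exact: Cmod_ge_0.
have := mean_value_bound f (fun _ => RtoC 0) a b 0 0.
have -> : f b - f a - 0 * (b - a) = f b - f a by ring.
move=> h; apply: Rle_trans (h _) _; last by lra.
move=> t Ht; split; first exact: H. have -> : RtoC 0 - 0 = 0 by ring. rewrite Cmod_0; lra.
Qed.

Lemma derive_zero_disc (f : C -> C) (c : C) (r : R) :
  (forall w, (Cmod (w - c) < r)%R -> is_derive f w (RtoC 0)) ->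
  forall w, (Cmod (w - c) < r)%R -> f w = f c.
Proof.
move=> H w Hw. apply/esym. apply: derive_zero_seg => t Ht. apply: H. apply: seg_disc => //.
have -> : c - c = 0 by ring. rewrite Cmod_0. have := Cmod_ge_0 (w - c); lra.
Qed.

(** * Differentiation under the integral sign *)

(** The hypotheses hold near each parameter t. [uniform01] turns them into one disc around z0 on
    which the mean value bound holds for all parameters at once. *)
Lemma derive_I01_param (f fz : C -> R -> C) (z0 : C) :
  (forall t, (0 <= t <= 1)%R -> exists d, (0 < d)%R /\ forall z s,
     (Cmod (z - z0) < d)%R -> (Rabs (s - t) < d)%R ->
     is_derive (fun w => f w s) z (fz z s)) ->
  (forall t, (0 <= t <= 1)%R -> forall eps, (0 < eps)%R -> exists d, (0 < d)%R /\ forall z s,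
     (Cmod (z - z0) < d)%R -> (Rabs (s - t) < d)%R ->
     (Cmod (fz z s - fz z0 t) < eps)%R) ->
  (exists d, (0 < d)%R /\ forall z, (Cmod (z - z0) < d)%R -> cont01 (f z)) ->
  is_derive (fun z => I01 (f z)) z0 (I01 (fz z0)).
Proof.
move=> Hder Hcont [d1 [d10 Hc]].
have zz : (Cmod (z0 - z0) = 0)%R by (have -> : z0 - z0 = 0 by ring); exact: Cmod_0.
have Hfz : cont01 (fz z0).
  move=> t Ht eps e0. have [d [d0 Hd]] := Hcont t Ht eps e0.
  apply/locallyR. exists d; split=> // s Hs. apply: Hd => //. lra.
have Hf0 : cont01 (f z0) by apply: Hc; lra.
apply/is_derive_carath.
exists (fun w => if Ceq_dec w z0 then I01 (fz z0) else (I01 (f w) - I01 (f z0)) / (w - z0)).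
split; [|split].
- move=> w; case: Ceq_dec => [h|ne] /=; first by rewrite h; ring.
  have h : w - z0 <> 0 by exact: Cminus_eq_contra. by field.
- by case: Ceq_dec.
move=> eps e0.
(* Two errors of eps / 10 give eps / 5 between parameters; [mean_value_bound] and [I01_bound] each
   double this, which ends at 4 eps / 5. *)
have e5 : (0 < eps / 10)%R by lra.
have [d [d0 Hd]] : exists d, (0 < d)%R /\ forall s, (0 <= s <= 1)%R ->
   forall z, (Cmod (z - z0) < d)%R ->
     is_derive (fun w => f w s) z (fz z s) /\ (Cmod (fz z s - fz z0 s) <= eps / 5)%R.
  apply: (uniform01 (fun d s => forall z, (Cmod (z - z0) < d)%R ->
     is_derive (fun w => f w s) z (fz z s) /\ (Cmod (fz z s - fz z0 s) <= eps / 5)%R)).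
    move=> d d' s Hd H z Hz. apply: H; lra.
  move=> t Ht. have [a [a0 Ha]] := Hder t Ht. have [b [b0 Hb]] := Hcont t Ht _ e5.
  exists (Rmin a b). split; first exact: Rmin_pos.
  move=> s Hs As z Hz. have := Rmin_l a b. have := Rmin_r a b. move=> h1 h2. split.
    apply: Ha; lra.
  apply: Rle_trans (Cmod_sub_tri _ (fz z0 t) _) _.
  have := Hb z s. rewrite (Cmod_sub_sym (fz z0 t)). have := Hb z0 s. rewrite zz => q1 q2.
  have : (Cmod (fz z s - fz z0 t) < eps / 10)%R by apply: q2; lra.
  have : (Cmod (fz z0 s - fz z0 t) < eps / 10)%R by apply: q1; lra. lra.
apply/locallyC. exists (Rmin d d1). split; first exact: Rmin_pos.
move=> w Hw. have := Rmin_l d d1. have := Rmin_r d d1. move=> h1 h2.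
case: Ceq_dec => [h|ne] /=.
  have -> : I01 (fz z0) - I01 (fz z0) = 0 by ring. by rewrite Cmod_0.
have wz : w - z0 <> 0 by exact: Cminus_eq_contra.
have W0 : (0 < Cmod (w - z0))%R by apply/Cmod_gt_0.
have -> : (I01 (f w) - I01 (f z0)) / (w - z0) - I01 (fz z0)
   = (I01 (f w) - I01 (f z0) - (w - z0) * I01 (fz z0)) / (w - z0) by field.
have cw : cont01 (f w) by apply: Hc; lra.
rewrite -I01_scal // -I01_minus // -I01_minus //; last 2 first.
- exact: cont01_minus.
- exact: cont01_scal.
rewrite Cmod_div //. apply/Rlt_div_l => //.
have B : forall t, (0 <= t <= 1)%R ->
   (Cmod (f w t - f z0 t - (w - z0) * fz z0 t) <= 2 * (eps / 5) * Cmod (w - z0))%R.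
  move=> t Ht. rewrite (Cmult_comm (w - z0)).
  apply: (mean_value_bound (fun w => f w t) (fun w => fz w t)).
  move=> s Hs. apply: Hd => //. apply: seg_disc => //; lra.
apply: Rle_lt_trans (I01_bound _ _ _ B) _; last by nra.
apply: cont01_minus; [exact: cont01_minus | exact: cont01_scal].
Qed.

(** * Goursat's theorem *)

Lemma C_complete_seq (u : nat -> C) (e : nat -> R) :
  (forall n k, (Cmod (u (n + k)%nat - u n) <= e n)%R) -> is_lim_seq e 0 ->
  exists l, (forall n, (Cmod (u n - l) <= e n)%R) /\ flim eventually u l.
Proof.
move=> H He.
have small : forall eps, (0 < eps)%R -> exists N, forall n, (N <= n)%nat -> (Rabs (e n) < eps)%R.
  move=> eps e0. have /is_lim_seq_spec/(_ (mkposreal _ e0)) [N HN] := He.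
  exists N => n Hn. have := HN n Hn. by rewrite /= Rminus_0_r.
have key : forall g : C -> R, (forall a b : C, (Rabs (g a - g b) <= Cmod (a - b))%R) ->
    {l | Un_cv (fun n => g (u n)) l}.
  move=> g Hg. refine (Rcomplete.R_complete (fun n => g (u n)) _) => eps e0. have [N HN] := small (eps / 2)%R ltac:(lra).
  exists N. have tail : forall n, (n >= N)%nat -> (Cmod (u n - u N) < eps / 2)%R.
    move=> n Hn. have -> : n = (N + (n - N))%nat by lia.
    apply: Rle_lt_trans (H _ _) _. apply: Rle_lt_trans (Rle_abs _) (HN N (le_n _)).
  move=> n m Hn Hm. rewrite /Rdist. apply: Rle_lt_trans (Hg _ _) _.
  apply: Rle_lt_trans (Cmod_sub_tri _ (u N) _) _. rewrite (Cmod_sub_sym (u N)).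
  have := tail n Hn. have := tail m Hm. lra.
have [x Hx] := key Re (fun a b => eq_ind (Re (a - b)) (fun y => (Rabs y <= _)%R) (re_le_Cmod (a - b)) (Re a - Re b)%R erefl).
have [y Hy] := key Im (fun a b => eq_ind (Im (a - b)) (fun y => (Rabs y <= _)%R) (Im_le_Cmod (a - b)) (Im a - Im b)%R erefl).
have lim : flim eventually u (x, y).
  move=> eps e0. have [N HN] := Hx (eps / 2)%R ltac:(lra). have [M HM] := Hy (eps / 2)%R ltac:(lra).
  exists (N + M)%nat => n Hn. apply: Rle_lt_trans (Cmod_le_Re_Im _) _.
  have := HN n ltac:(lia). have := HM n ltac:(lia). rewrite /Rdist.
  have -> : Re (u n - (x, y)) = (Re (u n) - x)%R by []. have -> : Im (u n - (x, y)) = (Im (u n) - y)%R by [].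
  lra.
exists (x, y). split=> // n. rewrite Cmod_sub_sym.
apply: (flim_Cmod_le eventually (fun k => u k - u n)).
  apply: (flim_minus _ _ _ _ _ lim (flim_const _ _)).
exists n => k Hk. have -> : k = (n + (k - n))%nat by lia. exact: H.
Qed.

Definition SI (f : C -> C) (a b : C) : C := (b - a) * I01 (fun t => f (seg a b t)).

Definition cont_seg (f : C -> C) (a b : C) : Prop :=
  forall t, (0 <= t <= 1)%R -> flim (locally (seg a b t)) f (f (seg a b t)).

Lemma cont_seg01 f a b : cont_seg f a b -> cont01 (fun t => f (seg a b t)).
Proof.
move=> H t Ht. apply: rcont_comp; first exact: H. exact: rder_cont (rder_seg a b t).
Qed.

Lemma seg_rev a b (t : R) : seg b a t = seg a b (1 - t)%R.
Proof. rewrite /seg RtoC_minus; ring. Qed.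

Lemma SI_rev f a b : cont_seg f a b -> SI f b a = - SI f a b.
Proof.
move=> H. rewrite /SI (I01_ext _ (fun t => f (seg a b (1 - t)%R))).
  rewrite (I01_rev (fun t => f (seg a b t))); last exact: cont_seg01. ring.
move=> t _; by rewrite seg_rev.
Qed.

Lemma SI_mid f a b : cont_seg f a b -> SI f a b = SI f a ((a + b) / 2) + SI f ((a + b) / 2) b.
Proof.
move=> H. rewrite /SI (I01_halves _ (cont_seg01 _ _ _ H)).
rewrite (I01_ext (fun t => f (seg a b (t / 2)%R)) (fun t => f (seg a ((a + b) / 2) t))).
  rewrite (I01_ext (fun t => f (seg a b ((1 + t) / 2)%R)) (fun t => f (seg ((a + b) / 2) b t))).
    by field.
  move=> t _. congr f. rewrite /seg RtoC_div ?RtoC_plus; last lra. by field.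
move=> t _. congr f. rewrite /seg RtoC_div; last lra. by field.
Qed.

Lemma SI_bound f a b M : cont_seg f a b ->
  (forall t, (0 <= t <= 1)%R -> (Cmod (f (seg a b t)) <= M)%R) ->
  (Cmod (SI f a b) <= 2 * M * Cmod (b - a))%R.
Proof.
move=> H HM. rewrite /SI Cmod_mult.
have := I01_bound _ _ (cont_seg01 _ _ _ H) HM. have := Cmod_ge_0 (b - a). nra.
Qed.

Lemma SI_derive (F f : C -> C) a b : cont_seg f a b ->
  (forall t, (0 <= t <= 1)%R -> is_derive F (seg a b t) (f (seg a b t))) ->
  SI f a b = F b - F a.
Proof.
move=> Hc HF. rewrite /SI -I01_scal; last exact: cont_seg01.
rewrite (I01_derive (fun t => F (seg a b t))); first by rewrite seg0 seg1.
- move=> t Ht. rewrite Cmult_comm. apply: rder_comp; [exact: HF | exact: rder_seg].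
- apply: cont01_scal; exact: cont_seg01.
Qed.

Lemma SI_minus f g a b : cont_seg f a b -> cont_seg g a b ->
  SI (fun z => f z - g z) a b = SI f a b - SI g a b.
Proof.
move=> Hf Hg. rewrite /SI (I01_minus (fun t => f (seg a b t))).
- ring.
- exact: cont_seg01.
- exact: cont_seg01.
Qed.

Definition tri (f : C -> C) (a b c : C) : C := SI f a b + SI f b c + SI f c a.
Definition per (a b c : C) : R := (Cmod (b - a) + Cmod (c - b) + Cmod (a - c))%R.

(** Either orientation of each side is allowed because the middle triangle of a subdivision has its
    sides reversed. *)
Lemma per_half (a b c a' b' c' : C) :
  b' - a' = (b - a) / 2 \/ b' - a' = (a - b) / 2 -> c' - b' = (c - b) / 2 \/ c' - b' = (b - c) / 2 ->
  a' - c' = (a - c) / 2 \/ a' - c' = (c - a) / 2 -> per a' b' c' = (per a b c / 2)%R.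
Proof.
have q : forall x y : C, Cmod ((x - y) / 2) = (Cmod (x - y) / 2)%R.
  move=> x y. rewrite Cmod_div; last by move=> /(f_equal Re) /=; lra.
  by rewrite Cmod_R Rabs_pos_eq; last lra.
move=> h1 h2 h3.
have e1 : Cmod (b' - a') = (Cmod (b - a) / 2)%R by case: h1 => ->; rewrite q // Cmod_sub_sym.
have e2 : Cmod (c' - b') = (Cmod (c - b) / 2)%R by case: h2 => ->; rewrite q // Cmod_sub_sym.
have e3 : Cmod (a' - c') = (Cmod (a - c) / 2)%R by case: h3 => ->; rewrite q // Cmod_sub_sym.
rewrite /per e1 e2 e3. field.
Qed.

Lemma seg_half a b : seg a b (1/2) = (a + b) / 2.
Proof. rewrite /seg RtoC_div; last lra. by field. Qed.

Section Goursat.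
Context (K : C -> Prop) (f : C -> C).
Hypothesis Kconv : forall a b t, K a -> K b -> (0 <= t <= 1)%R -> K (seg a b t).
Hypothesis Kclosed : forall (u : nat -> C) l, (forall n, K (u n)) -> flim eventually u l -> K l.
Hypothesis Kder : forall z, K z -> ex_derive f z.

Lemma goursat_cont a b : K a -> K b -> cont_seg f a b.
Proof. move=> Ka Kb t Ht. apply: ex_derive_cont. apply: Kder. exact: Kconv. Qed.

(** One bisection step: half the perimeter and at least a quarter of the integral. The last clause
    makes the first vertices a Cauchy sequence. *)
Definition subtri (T T' : C * C * C) : Prop :=
  let '(a, b, c) := T in let '(a', b', c') := T' in
  K a' /\ K b' /\ K c' /\ per a' b' c' = (per a b c / 2)%R /\
  (Cmod (tri f a b c) <= 4 * Cmod (tri f a' b' c'))%R /\ (Cmod (a' - a) <= per a b c)%R.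

Lemma subtri_exists a b c : K a -> K b -> K c -> exists T', subtri (a, b, c) T'.
Proof.
move=> Ka Kb Kc.
have Kmid : forall x y, K x -> K y -> K ((x + y) / 2).
  move=> x y Kx Ky. rewrite -seg_half. apply: Kconv => //. lra.
have K1 := Kmid _ _ Ka Kb. have K2 := Kmid _ _ Kb Kc. have K3 := Kmid _ _ Kc Ka.
set m1 := (a + b) / 2 in K1. set m2 := (b + c) / 2 in K2. set m3 := (c + a) / 2 in K3.
have split4 : tri f a b c = tri f a m1 m3 + tri f m1 b m2 + tri f m2 c m3 + tri f m1 m2 m3.
  rewrite /tri (SI_mid f a b) ?(SI_mid f b c) ?(SI_mid f c a); try exact: goursat_cont.
  rewrite -/m1 -/m2 -/m3.
  rewrite (SI_rev f m1 m3) ?(SI_rev f m1 m2) ?(SI_rev f m2 m3); try exact: goursat_cont.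
  ring.
have A0 := Cmod_ge_0 (b - a). have B0 := Cmod_ge_0 (c - b). have C0 := Cmod_ge_0 (a - c).
have d1 : (Cmod (m1 - a) <= per a b c)%R.
  have -> : m1 - a = RtoC (/2) * (b - a) by rewrite /m1 RtoC_inv; [field | lra].
  rewrite Cmod_mult Cmod_R Rabs_pos_eq /per; lra.
have d2 : (Cmod (m2 - a) <= per a b c)%R.
  have -> : m2 - a = RtoC (/2) * (c - b) + (b - a) by rewrite /m2 RtoC_inv; [field | lra].
  apply: Rle_trans (Cmod_triangle _ _) _.
  rewrite Cmod_mult Cmod_R Rabs_pos_eq /per; lra.
case: (Rle_dec (Cmod (tri f a b c)) (4 * Cmod (tri f a m1 m3))) => h1.
  exists (a, m1, m3). do 3 split => //; [..|split; [|split]] => //.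
  - apply: per_half; [left | left | left]; rewrite /m1 /m3; field.
  - have -> : a - a = 0 by ring. rewrite Cmod_0 /per; lra.
case: (Rle_dec (Cmod (tri f a b c)) (4 * Cmod (tri f m1 b m2))) => h2.
  exists (m1, b, m2). do 3 split => //; [..|split; [|split]] => //.
  apply: per_half; [left | left | left]; rewrite /m1 /m2; field.
case: (Rle_dec (Cmod (tri f a b c)) (4 * Cmod (tri f m2 c m3))) => h3.
  exists (m2, c, m3). do 3 split => //; [..|split; [|split]] => //.
  have -> : (per a b c = per b c a)%R by rewrite /per; ring.
  apply: per_half; [left | left | left]; rewrite /m2 /m3; field.
exists (m1, m2, m3). do 3 split => //; [..|split; [|split]] => //.
- have -> : (per a b c = per c a b)%R by rewrite /per; ring.
  apply: per_half; [right | right | right]; rewrite /m1 /m2 /m3; field.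
(* Three corner integrals below a quarter of the total leave more than a quarter for the middle
   triangle. *)
- have := Cmod_triangle (tri f a m1 m3 + tri f m1 b m2 + tri f m2 c m3) (tri f m1 m2 m3).
  have := Cmod_triangle (tri f a m1 m3 + tri f m1 b m2) (tri f m2 c m3).
  have := Cmod_triangle (tri f a m1 m3) (tri f m1 b m2).
  rewrite -split4. lra.
Qed.

(** The nested triangles shrink to a point z of K. Near z the function is affine up to ep times the
    distance; the affine part has a primitive, and the remainder is too small for integrals that
    decrease only by a factor 4 per step. *)
Theorem goursat a b c : K a -> K b -> K c -> tri f a b c = 0.
Proof.
move=> Ka Kb Kc.
pose step T := epsilon (inhabits T) (subtri T).
pose T n := Nat.iter n step (a, b, c).
pose u n := (T n).1.1. pose v n := (T n).1.2. pose w n := (T n).2.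
have TE : forall n, T n = (u n, v n, w n).
  by move=> n; rewrite /u /v /w; case: (T n) => [[? ?] ?].
have KT : forall n, K (u n) /\ K (v n) /\ K (w n) /\ subtri (T n) (T (S n)).
  have ok : forall n, K (u n) -> K (v n) -> K (w n) -> subtri (T n) (T (S n)).
    move=> n k1 k2 k3. change (subtri (T n) (step (T n))). apply: epsilon_spec. rewrite TE. exact: subtri_exists.
  elim=> [|n [k1 [k2 [k3 s]]]].
    by split=> //; split=> //; split=> //; apply: ok.
  have : K (u (S n)) /\ K (v (S n)) /\ K (w (S n)).
    move: s. rewrite (TE n) (TE (S n)) => -[? [? [? _]]]. by [].
  move=> [k1' [k2' k3']]. by split=> //; split=> //; split=> //; apply: ok.
set S0 := per a b c.
have S0p : (0 <= S0)%R.
  rewrite /S0 /per. have := Cmod_ge_0 (b - a). have := Cmod_ge_0 (c - b). have := Cmod_ge_0 (a - c). lra.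
have pw : forall n, (0 < 2 ^ n)%R by move=> n; apply: pow_lt; lra.
have perT : forall n, per (u n) (v n) (w n) = (S0 / 2 ^ n)%R.
  elim=> [|n IH]; first by (have -> : per (u 0%nat) (v 0%nat) (w 0%nat) = S0 by []); rewrite /=; field.
  have [_ [_ [_]]] := KT n. rewrite (TE n) (TE (S n)) => -[_ [_ [_ [-> _]]]].
  rewrite IH /=. field. have := pw n; lra.
have triT : forall n, (Cmod (tri f a b c) <= 4 ^ n * Cmod (tri f (u n) (v n) (w n)))%R.
  elim=> [|n IH]; first by rewrite /= Rmult_1_l; apply: Rle_refl.
  have [_ [_ [_]]] := KT n. rewrite (TE n) (TE (S n)) => -[_ [_ [_ [_ [h _]]]]].
  apply: Rle_trans IH _. rewrite /=. have : (0 < 4 ^ n)%R by apply: pow_lt; lra. nra.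
have du : forall n, (Cmod (u (S n) - u n) <= S0 / 2 ^ n)%R.
  move=> n. have [_ [_ [_]]] := KT n. rewrite -perT (TE n) (TE (S n)) => -[_ [_ [_ [_ [_ h]]]]]. exact: h.
have [z [uz Hz]] : exists z, (forall n, (Cmod (u n - z) <= 2 * S0 / 2 ^ n)%R) /\ flim eventually u z.
  apply: C_complete_seq.
    move=> n k. have : (Cmod (u (n + k)%nat - u n) <= 2 * S0 / 2 ^ n - 2 * S0 / 2 ^ (n + k))%R.
      elim: k => [|k IH].
        rewrite Nat.add_0_r. have -> : u n - u n = 0 by ring. rewrite Cmod_0; lra.
      have := du (n + k)%nat. have -> : (n + S k = S (n + k))%nat by lia.
      have := Cmod_sub_tri (u (S (n + k))) (u (n + k)%nat) (u n).
      have -> : (2 * S0 / 2 ^ S (n + k) = S0 / 2 ^ (n + k))%R by rewrite /=; field; have := pw (n + k)%nat; lra.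
      have h2 : (2 * S0 / 2 ^ (n + k) = S0 / 2 ^ (n + k) + S0 / 2 ^ (n + k))%R by field; have := pw (n + k)%nat; lra.
      lra.
    have : (0 <= 2 * S0 / 2 ^ (n + k))%R.
      apply: Rmult_le_pos; first lra. left; apply: Rinv_0_lt_compat; exact: pw.
    lra.
  apply: (is_lim_seq_ext (fun n => 2 * S0 * (/2) ^ n)%R).
    by move=> n; rewrite pow_inv.
  have -> : Finite 0 = Rbar_mult (2 * S0)%R 0 by rewrite /= Rmult_0_r.
  apply: is_lim_seq_scal_l. apply: is_lim_seq_geom. rewrite Rabs_pos_eq; lra.
have Kz : K z by apply: (Kclosed u) => // n; exact: (proj1 (KT n)).
apply: Cmod_eq_0. apply: Rle_antisym; last exact: Cmod_ge_0.
apply: Rnot_lt_le => pos. set eta0 := Cmod (tri f a b c) in pos.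
have [l /is_derive_carath [phi [E [phz Hphi]]]] := Kder z Kz.
(* The remainder will be bounded by 6 ep S0^2, hence by eta0 / 2; the summand 1 covers S0 = 0. *)
set ep := (eta0 / (12 * (S0 * S0 + 1)))%R.
have ep0 : (0 < ep)%R by apply: Rdiv_lt_0_compat => //; nra.
have /locallyC [d [d0 Hd]] := Hphi ep ep0.
have [n Hn] : exists n, (3 * S0 / 2 ^ n < d)%R.
  have dS : (0 < d / (3 * S0 + 1))%R by apply: Rdiv_lt_0_compat; lra.
  have [N HN] := pow_lt_1_zero (/2) ltac:(rewrite Rabs_pos_eq; lra) _ dS.
  exists N. have := HN N (le_n _). rewrite pow_inv Rabs_pos_eq; last by left; apply: Rinv_0_lt_compat; exact: pw.
  move=> /(Rmult_lt_compat_l (3 * S0 + 1) _ _ ltac:(lra)).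
  have -> : ((3 * S0 + 1) * (d / (3 * S0 + 1)) = d)%R by field; lra.
  have : (0 < / 2 ^ N)%R by apply: Rinv_0_lt_compat; exact: pw. rewrite /Rdiv. nra.
have [Ku [Kv [Kw _]]] := KT n.
(* The first vertex is within 2 S0 / 2^n of z, and the others are within one perimeter of it. *)
set r := (3 * S0 / 2 ^ n)%R in Hn.
have in_disc : forall x, x = u n \/ x = v n \/ x = w n -> (Cmod (x - z) <= r)%R.
  move=> x Hx. have p := perT n. rewrite /per in p. have h := uz n.
  have q : (r = 2 * S0 / 2 ^ n + S0 / 2 ^ n)%R by rewrite /r; field; have := pw n; lra.
  have tr := Cmod_sub_tri x (u n) z.
  have A1 := Cmod_ge_0 (v n - u n). have B1 := Cmod_ge_0 (w n - v n). have C1 := Cmod_ge_0 (u n - w n).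
  have : (Cmod (x - u n) <= S0 / 2 ^ n)%R; last by lra.
  rewrite -p. case: Hx => [->|[->|->]].
  + have -> : u n - u n = 0 by ring. rewrite Cmod_0; lra.
  + lra.
  + rewrite (Cmod_sub_sym (w n)); lra.
(* The tangent of f at z, followed by a primitive of it. *)
pose g x := (f z - l * z) + l * x.
pose G x := (f z - l * z) * x + l * x ^ 2 / 2.
have Gd : forall x, is_derive G x (g x).
  move=> x. have d1 := derive_scal (f z - l * z) _ _ _ (derive_id x).
  have d2 := derive_scal (l / 2) _ _ _ (derive_pow _ _ _ 1 (derive_id x)).
  apply: derive_ext_near; last first.
    apply: is_derive_eq (derive_plus _ _ _ _ _ d1 d2) _. rewrite /g.
    have -> : RtoC (INR 2) = 2 by congr RtoC; rewrite /=; ring. by field.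
  apply: filter_forall => y. rewrite /G. by field.
have gc : forall x y, cont_seg g x y.
  move=> x y t _. apply: flim_plus; first exact: flim_const.
  apply: flim_mult; [exact: flim_const | exact: flim_id].
have rem : forall x y, K x -> K y -> (Cmod (x - z) <= r)%R -> (Cmod (y - z) <= r)%R ->
   exists R0, SI f x y = G y - G x + R0 /\ (Cmod R0 <= 2 * (ep * r) * Cmod (y - x))%R.
  move=> x y Kx Ky Hx Hy. have fc := goursat_cont x y Kx Ky.
  exists (SI (fun q => f q - g q) x y). split.
    rewrite SI_minus // (SI_derive G g x y) //. ring.
  apply: SI_bound; first by move=> t Ht; apply: flim_minus; [apply: fc | apply: gc].
  move=> t Ht. set q := seg x y t.
  have Hq : (Cmod (q - z) <= r)%R by apply: seg_disc_le.
  have -> : f q - g q = (q - z) * (phi q - l) by rewrite E /g; ring.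
  rewrite Cmod_mult Rmult_comm. apply: Rmult_le_compat; try exact: Cmod_ge_0; last by [].
  left. apply: Hd. lra.
have [R1 [e1 b1]] := rem _ _ Ku Kv (in_disc _ (or_introl erefl)) (in_disc _ (or_intror (or_introl erefl))).
have [R2 [e2 b2]] := rem _ _ Kv Kw (in_disc _ (or_intror (or_introl erefl))) (in_disc _ (or_intror (or_intror erefl))).
have [R3 [e3 b3]] := rem _ _ Kw Ku (in_disc _ (or_intror (or_intror erefl))) (in_disc _ (or_introl erefl)).
have bt : (Cmod (tri f (u n) (v n) (w n)) <= 2 * (ep * r) * (S0 / 2 ^ n))%R.
  rewrite -perT /per /tri e1 e2 e3.
  have -> : G (v n) - G (u n) + R1 + (G (w n) - G (v n) + R2) + (G (u n) - G (w n) + R3) = R1 + R2 + R3 by ring.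
  have := Cmod_triangle (R1 + R2) R3. have := Cmod_triangle R1 R2. lra.
have := triT n. rewrite -/eta0.
have : (4 ^ n * Cmod (tri f (u n) (v n) (w n)) <= 4 ^ n * (2 * (ep * r) * (S0 / 2 ^ n)))%R.
  apply: Rmult_le_compat_l => //. apply: pow_le; lra.
have -> : (4 ^ n * (2 * (ep * r) * (S0 / 2 ^ n)) = 6 * ep * (S0 * S0))%R.
  have -> : (4 = 2 * 2)%R by lra. rewrite Rpow_mult_distr /r. field. have := pw n; lra.
have : (ep * (12 * (S0 * S0 + 1)) = eta0)%R by rewrite /ep; field; nra.
nra.
Qed.

End Goursat.

(** * Cauchy's integral formula *)

Lemma derive_carath_near (f phi : C -> C) (z l : C) :
  locally z (fun w => f w = f z + (w - z) * phi w) -> flim (locally z) phi l ->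
  is_derive f z l.
Proof.
move=> E H.
pose psi w := if Ceq_dec w z then l else phi w.
apply: (derive_ext_near (fun w => f z + (w - z) * psi w)).
  apply: filter_imp E => w Hw. rewrite Hw /psi. by case: Ceq_dec => [h|_] /=; [rewrite h; ring | ].
apply/is_derive_carath. exists psi. split; [|split].
- move=> w. ring.
- by rewrite /psi; case: Ceq_dec.
- move=> eps e0. apply: filter_imp (H eps e0) => w Hw. rewrite /psi. case: Ceq_dec => [_|_] //=.
  have -> : l - l = 0 by ring. by rewrite Cmod_0.
Qed.

Lemma Cmod_sub_self (z : C) : Cmod (z - z) = 0%R.
Proof. have -> : z - z = 0 by ring. exact: Cmod_0. Qed.

Lemma closed_disc_closed (c : C) (r : R) (u : nat -> C) l :
  (forall n, (Cmod (u n - c) <= r)%R) -> flim eventually u l -> (Cmod (l - c) <= r)%R.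
Proof.
move=> H Hl. apply: (flim_Cmod_le eventually (fun n => u n - c)).
  exact: (flim_minus _ _ _ _ _ Hl (flim_const _ c)).
exact: filter_forall.
Qed.

Definition hol_disc (f : C -> C) (c : C) (R0 : R) : Prop :=
  forall w, (Cmod (w - c) < R0)%R -> ex_derive f w.

(** Goursat's theorem on the triangle c, z, w turns the difference of the two integrals from c into
    the integral over the segment from z to w, whose mean value tends to f z. *)
Lemma primitive_disc f c R0 z : hol_disc f c R0 -> (Cmod (z - c) < R0)%R ->
  is_derive (SI f c) z (f z).
Proof.
move=> H Hz.
have cs : forall a b, (Cmod (a - c) < R0)%R -> (Cmod (b - c) < R0)%R -> cont_seg f a b.
  move=> a b Ha Hb t Ht. apply: ex_derive_cont. apply: H. exact: seg_disc.
have R0p : (0 < R0)%R by have := Cmod_ge_0 (z - c); lra.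
have cc : (Cmod (c - c) < R0)%R by rewrite Cmod_sub_self.
apply: (derive_carath_near _ (fun w => I01 (fun t => f (seg z w t)))).
- apply: filter_imp (locally_disc _ _ _ Hz) => w Hw.
  (* The set K is the closed disc through the farther of z and w, which is convex, closed and inside
     the open disc. *)
  have := goursat (fun x => Cmod (x - c) <= Rmax (Cmod (z - c)) (Cmod (w - c)))%R f.
  move=> /(_ _ _ _ c z w) G.
  have : tri f c z w = 0.
    apply: G.
    + move=> a b t Ha Hb Ht. exact: seg_disc_le.
    + move=> u l. exact: closed_disc_closed.
    + move=> x Hx. apply: H. apply: Rle_lt_trans Hx _. exact: Rmax_lub_lt.
    + rewrite Cmod_sub_self. apply: Rle_trans (Rmax_l _ _). exact: Cmod_ge_0.
    + exact: Rmax_l.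
    + exact: Rmax_r.
  rewrite /tri (SI_rev f c w); last exact: cs. rewrite {2}/SI => E.
  have : SI f c z + (w - z) * I01 (fun t : R => f (seg z w t)) - SI f c w = 0 by rewrite -E; ring.
  move=> e. have -> : SI f c w = SI f c w + 0 by ring. rewrite -e. ring.
- move=> eps e0.
  have fc : flim (locally z) f (f z) by apply: ex_derive_cont; apply: H.
  have e4 : (0 < eps / 4)%R by lra.
  have [d [d0 Hd]] := proj1 (locallyC _ _) (filter_and _ _ (locally_disc _ _ _ Hz) (fc _ e4)).
  apply/locallyC. exists d; split=> // w Hw.
  have Hw' := proj1 (Hd w Hw).
  rewrite -(I01_const (f z)) -I01_minus.
  + apply: Rle_lt_trans (I01_bound _ (eps / 4)%R _ _) _; last by lra.
      apply: cont01_minus; last by move=> t _; exact: flim_const.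
      apply: cont_seg01. exact: cs.
    move=> t Ht. left. apply: (proj2 (Hd _ _)). apply: seg_disc => //. by rewrite Cmod_sub_self.
  + apply: cont_seg01. exact: cs.
  + move=> t _; exact: flim_const.
Qed.

(** The same rule with product filters, so that the rules for [flim] verify its hypotheses. *)
Lemma derive_I01_filter (f fz : C -> R -> C) (z0 : C) :
  (forall t, (0 <= t <= 1)%R -> filter_prod (locally z0) (locally t)
     (fun q => is_derive (fun w => f w (snd q)) (fst q) (fz (fst q) (snd q)))) ->
  (forall t, (0 <= t <= 1)%R -> flim (filter_prod (locally z0) (locally t))
     (fun q => fz (fst q) (snd q)) (fz z0 t)) ->
  locally z0 (fun z => cont01 (f z)) ->
  is_derive (fun z => I01 (f z)) z0 (I01 (fz z0)).
Proof.
have key : forall t (P : C * R -> Prop), filter_prod (locally z0) (locally t) P ->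
    exists d, (0 < d)%R /\ forall z s, (Cmod (z - z0) < d)%R -> (Rabs (s - t) < d)%R -> P (z, s).
  move=> t P [A B /locallyC [a [a0 Ha]] /locallyR [b [b0 Hb]] HP].
  exists (Rmin a b). split; first exact: Rmin_pos.
  move=> z s Hz Hs. apply: HP; [apply: Ha | apply: Hb].
  - exact: Rlt_le_trans Hz (Rmin_l _ _).
  - exact: Rlt_le_trans Hs (Rmin_r _ _).
move=> H1 H2 /locallyC H3. apply: derive_I01_param => //.
- move=> t Ht. exact: (key t _ (H1 t Ht)).
- move=> t Ht eps e0. exact: (key t _ (H2 t Ht eps e0)).
Qed.

Lemma flim_fst {T} {F : (T -> Prop) -> Prop} {FF : Filter F} (z : C) :
  flim (filter_prod (locally z) F) (fun q => fst q) z.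
Proof.
move=> eps e0. apply: (Filter_prod _ _ _ (fun w => (Cmod (w - z) < eps)%R) (fun _ => True)) => //.
  exact: (flim_id z eps e0).
exact: filter_true.
Qed.

Lemma flim_snd {F : (C -> Prop) -> Prop} {FF : Filter F} (g : R -> C) (t : R) :
  rcont g t -> flim (filter_prod F (locally t)) (fun q => g (snd q)) (g t).
Proof.
move=> H eps e0. apply: (Filter_prod _ _ _ (fun _ => True) (fun s => (Cmod (g s - g t) < eps)%R)) => //.
  exact: filter_true.
exact: H.
Qed.

Definition e2pi (t : R) : C := (cos (2 * PI * t), sin (2 * PI * t)).

Lemma rder_pair (u v : R -> R) t u' v' : is_derive u t u' -> is_derive v t v' ->
  rder (fun s => (u s, v s) : C) t (u', v').
Proof.
move=> /is_derive_Reals Hu /is_derive_Reals Hv.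
exists (fun s => if Req_EM_T s t then (u', v') : C
   else ((u s - u t) / (s - t), (v s - v t) / (s - t))%R : C).
split; [|split].
- move=> s. case: Req_EM_T => [e | ne] /=.
    rewrite e /Cplus /Cmult /Cminus /Copp /=. congr pair; ring.
  rewrite /Cplus /Cmult /Cminus /Copp /=. congr pair; field; lra.
- by case: Req_EM_T.
- move=> eps e0. have [d1 H1] := Hu (eps / 2)%R ltac:(lra). have [d2 H2] := Hv (eps / 2)%R ltac:(lra).
  apply/locallyR. exists (Rmin d1 d2). split; first by apply: Rmin_pos; exact: cond_pos.
  move=> s Hs. case: Req_EM_T => [e | ne] /=; first by rewrite Cmod_sub_self.
  have s0 : (s - t <> 0)%R by lra.
  have q1 := H1 (s - t)%R s0 (Rlt_le_trans _ _ _ Hs (Rmin_l _ _)).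
  have q2 := H2 (s - t)%R s0 (Rlt_le_trans _ _ _ Hs (Rmin_r _ _)).
  have st : (t + (s - t) = s)%R by ring. rewrite st in q1, q2.
  apply: Rle_lt_trans (Cmod_le_Re_Im _) _. rewrite /Re /Im /=. rewrite /Rminus in q1 q2 *. lra.
Qed.

Lemma rder_e2pi t : rder e2pi t (2 * PI * Ci * e2pi t).
Proof.
have -> : 2 * PI * Ci * e2pi t = ((- (2 * PI) * sin (2 * PI * t))%R, (2 * PI * cos (2 * PI * t))%R).
  rewrite /e2pi /Ci /Cmult /=. congr pair; ring.
apply: rder_pair; auto_derive => //; ring.
Qed.

Lemma Cmod_e2pi t : Cmod (e2pi t) = 1%R.
Proof.
rewrite /Cmod /e2pi /=. transitivity (sqrt 1); last exact: sqrt_1. congr sqrt.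
have := sin2_cos2 (2 * PI * t). rewrite /Rsqr. lra.
Qed.

Lemma e2pi_neq0 t : e2pi t <> 0.
Proof. apply/Cmod_gt_0. rewrite Cmod_e2pi. lra. Qed.

Lemma e2pi_01 : e2pi 1 = e2pi 0.
Proof. rewrite /e2pi Rmult_1_r Rmult_0_r cos_2PI sin_2PI cos_0 sin_0 //. Qed.

(** Its derivative is 2 PI i r [e2pi] t, so the factor r * [e2pi] t in the integrals below stands
    for dz / (2 PI i). *)
Definition circ (c : C) (r : R) (t : R) : C := c + r * e2pi t.

Lemma circ_sub c r t : circ c r t - c = r * e2pi t.
Proof. rewrite /circ; ring. Qed.

Lemma Cmod_circ c r t : (0 <= r)%R -> Cmod (circ c r t - c) = r.
Proof. move=> r0. by rewrite circ_sub Cmod_mult Cmod_e2pi Cmod_R Rabs_pos_eq // Rmult_1_r. Qed.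

Lemma circ_01 c r : circ c r 1 = circ c r 0.
Proof. by rewrite /circ e2pi_01. Qed.

Lemma rder_circ c r t : rder (circ c r) t (2 * PI * Ci * (r * e2pi t)).
Proof.
have h := rder_comp (fun w => c + r * w) e2pi t r (2 * PI * Ci * e2pi t).
have -> : 2 * PI * Ci * (r * e2pi t) = r * (2 * PI * Ci * e2pi t) by ring.
apply: h; last exact: rder_e2pi.
apply: is_derive_eq (derive_plus _ _ _ _ _ (derive_const c _) (derive_scal r _ _ _ (derive_id _))) _.
ring.
Qed.

Lemma rcont_circ c r t : rcont (circ c r) t.
Proof. exact: rder_cont (rder_circ c r t). Qed.

Lemma rcont_re2pi (r t : R) : rcont (fun s => r * e2pi s) t.
Proof. apply: flim_mult; [exact: flim_const | exact: rder_cont (rder_e2pi t)]. Qed.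

Lemma circ_neq c r z t : (Cmod (z - c) < r)%R -> circ c r t - z <> 0.
Proof.
move=> Hz E. have r0 : (0 <= r)%R by have := Cmod_ge_0 (z - c); lra.
have := Cmod_circ c r t r0. have -> : circ c r t = z by rewrite -[LHS](Cplus_0_r _) -(Cplus_opp_r z);
  transitivity (circ c r t - z + z); [ring | rewrite E; ring].
lra.
Qed.

Lemma closed_loop_integral (h : R -> C) (g : R -> C) :
  (forall t, (0 <= t <= 1)%R -> rder h t (2 * PI * Ci * g t)) -> cont01 g -> h 1%R = h 0%R ->
  I01 g = 0.
Proof.
move=> Hh Hg E.
have : 2 * PI * Ci * I01 g = 0.
  rewrite -I01_scal // (I01_derive h) //; last exact: cont01_scal. rewrite E; ring.
move=> e. have -> : I01 g = / (2 * PI * Ci) * (2 * PI * Ci * I01 g).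
  field; repeat split; try exact: Ci_nz; move=> /(f_equal Re) /=; have := PI_RGT_0; lra.
rewrite e; ring.
Qed.

(** The density phi is an arbitrary continuous function. Hence Cauchy integrals can be
    differentiated before anything is known about the function that they represent. *)
Lemma derive_cauchy_kernel (phi : R -> C) c r z n : cont01 phi -> (Cmod (z - c) < r)%R ->
  is_derive (fun w => I01 (fun t => phi t / (circ c r t - w) ^ S n)) z
    (INR (S n) * I01 (fun t => phi t / (circ c r t - z) ^ S (S n))).
Proof.
move=> Hphi Hz.
have cont : forall w m, (Cmod (w - c) < r)%R -> cont01 (fun t => phi t / (circ c r t - w) ^ m).
  move=> w m Hw t Ht. apply: flim_div; [|exact: Hphi|].
    by apply: Cpow_nz; exact: circ_neq.
  apply: flim_pow. apply: flim_minus; [exact: rcont_circ | exact: flim_const].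
rewrite -I01_scal; last exact: cont.
apply: (derive_I01_filter _ (fun w t => INR (S n) * (phi t / (circ c r t - w) ^ S (S n)))).
- move=> t Ht.
  apply: (Filter_prod _ _ _ (fun w => (Cmod (w - c) < r)%R) (fun _ => True)).
  + exact: locally_disc.
  + exact: filter_true.
  + move=> w s Hw _. cbn [fst snd]. have ne := circ_neq c r w s Hw.
    have d := derive_pow _ _ _ n (derive_minus _ _ _ _ _ (derive_const (circ c r s) w) (derive_id w)).
    apply: is_derive_eq (derive_scal (phi s) _ _ _ (derive_inv _ _ _ _ d)) _.
      exact: Cpow_nz.
    have pn := Cpow_nz _ n ne. rewrite !(Cpow_S (circ c r s - w)). move: ne pn.
    set X := circ c r s - w. set Y := X ^ n. move=> ne pn. field. by split.
- move=> t Ht. apply: flim_mult; first exact: flim_const.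
  apply: flim_div.
  + apply: Cpow_nz. exact: circ_neq.
  + exact: (flim_snd phi t (Hphi t Ht)).
  + apply: flim_pow. apply: flim_minus; first exact: (flim_snd (circ c r) t (rcont_circ c r t)).
    exact: flim_fst.
- apply: filter_imp (locally_disc _ _ _ Hz) => w Hw. exact: cont.
Qed.

Lemma INR2 : RtoC (INR 2) = 2. Proof. congr RtoC; rewrite /=; ring. Qed.

Lemma radius_pos (z c : C) (r : R) : (Cmod (z - c) < r)%R -> (0 < r)%R.
Proof. have := Cmod_ge_0 (z - c). lra. Qed.

(** The derivative in w is the integral of the derivative of - 1 / (gamma - w) along a closed curve,
    hence 0, and at the centre the integrand is 1. *)
Lemma cauchy_kernel_one c r w : (Cmod (w - c) < r)%R ->
  I01 (fun t => (r * e2pi t) / (circ c r t - w) ^ 1) = 1.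
Proof.
move=> Hw. have r0 := radius_pos _ _ _ Hw.
have cphi : cont01 (fun t => r * e2pi t) by move=> t _; exact: rcont_re2pi.
have -> : RtoC 1 = I01 (fun t => (r * e2pi t) / (circ c r t - c) ^ 1).
  rewrite (I01_ext _ (fun _ => RtoC 1)) ?I01_const // => t _.
  rewrite Cpow_1_r circ_sub. field. split; first exact: e2pi_neq0.
  move=> /(f_equal Re) /=; lra.
apply/esym. apply: (derive_zero_seg (fun w => I01 (fun t => (r * e2pi t) / (circ c r t - w) ^ 1))).
move=> s Hs. have Hv : (Cmod (seg c w s - c) < r)%R by apply: seg_disc => //; rewrite Cmod_sub_self.
apply: is_derive_eq (derive_cauchy_kernel _ c r _ 0 cphi Hv) _.
rewrite (closed_loop_integral (fun t => - / (circ c r t - seg c w s))) ?circ_01 //; first by ring.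
- move=> t Ht. have ne := circ_neq c r _ t Hv.
  have d := derive_opp _ _ _ (derive_inv (fun u => u - seg c w s) (circ c r t) _ ne (derive_minus _ _ _ _ _ (derive_id (circ c r t)) (derive_const (seg c w s) _))).
  have := rder_comp _ _ _ _ _ d (rder_circ c r t).
  set l := (X in rder _ _ X -> _). set l' := (X in _ -> rder _ _ X). have -> : l = l' => //.
  rewrite /l /l'. field. exact: ne.
- move=> t Ht. apply: flim_div; [by apply: Cpow_nz; exact: circ_neq | exact: cphi|].
  apply: flim_pow. apply: flim_minus; [exact: rcont_circ | exact: flim_const].
Qed.

(* The integral [g x] of [F (z + x (gamma - z)) gamma' / (gamma - z)] has
   derivative zero in [x]; at [x = 1] it is the Cauchy integral of [F] and at
   [x = 0] it is [F z]. *)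
Lemma cauchy_C1 (F dF : C -> C) c R0 r z :
  (forall w, (Cmod (w - c) < R0)%R -> is_derive F w (dF w) /\ flim (locally w) dF (dF w)) ->
  (Cmod (z - c) < r)%R -> (r < R0)%R ->
  F z = I01 (fun t => F (circ c r t) * (r * e2pi t) / (circ c r t - z) ^ 1).
Proof.
move=> HF Hz rR. have r0 := radius_pos _ _ _ Hz.
have Fc : forall w, (Cmod (w - c) < R0)%R -> flim (locally w) F (F w).
  move=> w Hw. exact: is_derive_cont (proj1 (HF w Hw)).
pose k t := (r * e2pi t) / (circ c r t - z) ^ 1.
have kc : cont01 k.
  move=> t _. apply: flim_div; [by apply: Cpow_nz; exact: circ_neq | exact: rcont_re2pi|].
  apply: flim_pow. apply: flim_minus; [exact: rcont_circ | exact: flim_const].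
pose m (x : C) t := z + x * (circ c r t - z).
have mc : forall x, cont01 (m x).
  move=> x t _. apply: flim_plus; first exact: flim_const.
  apply: flim_mult; first exact: flim_const. apply: flim_minus; [exact: rcont_circ | exact: flim_const].
pose g x := I01 (fun t => F (m x t) * k t).
have inR : forall x t, (0 <= x <= 1)%R -> (Cmod (m x t - c) < R0)%R.
  move=> x t Hx. apply: (seg_disc c z (circ c r t) R0 x Hx); first lra.
  rewrite Cmod_circ; lra.
have jm : forall (x : C) (t : R), flim (filter_prod (locally x) (locally t)) (fun q => m (fst q) (snd q)) (m x t).
  move=> x t. apply: flim_plus; first exact: flim_const.
  apply: flim_mult; first exact: flim_fst.
  apply: flim_minus; last exact: flim_const. exact: (flim_snd (circ c r) t (rcont_circ c r t)).
have gder : forall x : R, (0 <= x <= 1)%R -> is_derive g (RtoC x) (I01 (fun t => dF (m x t) * (r * e2pi t))).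
  move=> x Hx. apply: (derive_I01_filter _ (fun x t => dF (m x t) * (r * e2pi t))).
  - move=> t Ht.
    have h' := inR x t Hx. have h0 : (0 < R0 - Cmod (m x t - c))%R by lra.
    apply: filter_imp (jm x t _ h0) => -[y s]. cbn [fst snd] => Hy.
    have ys : (Cmod (m y s - c) < R0)%R by have := Cmod_sub_tri (m y s) (m x t) c; lra.
    have d0 := derive_plus _ _ _ _ _ (derive_const z y)
       (derive_mult _ _ _ _ _ (derive_id y) (derive_const (circ c r s - z) y)).
    have d1 := derive_comp F (fun y => z + y * (circ c r s - z)) y _ _ (proj1 (HF _ ys)) d0.
    apply: is_derive_eq (derive_mult _ _ _ _ _ d1 (derive_const (k s) y)) _.
    rewrite /k. field. exact: circ_neq.
  - move=> t Ht. apply: flim_mult; last exact: (flim_snd (fun t => r * e2pi t) t (rcont_re2pi r t)).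
    apply: (flim_comp _ dF); first exact: jm. exact: (proj2 (HF _ (inR x t Hx))).
  - have h : exists d, (0 < d)%R /\ forall s, (0 <= s <= 1)%R -> forall y, (Cmod (y - x) < d)%R -> (Cmod (m y s - c) < R0)%R.
      apply: (uniform01 (fun d s => forall y, (Cmod (y - x) < d)%R -> (Cmod (m y s - c) < R0)%R)).
        move=> d d' s Hd H y Hy. apply: H; lra.
      move=> t Ht. have h' := inR x t Hx.
      have [A B /locallyC [a [a0 Ha]] /locallyR [b [b0 Hb]] HP] := jm x t (R0 - Cmod (m x t - c))%R ltac:(lra).
      exists (Rmin a b). split; first exact: Rmin_pos. move=> s Hs As y Hy.
      have := HP y s (Ha _ (Rlt_le_trans _ _ _ Hy (Rmin_l _ _))) (Hb _ (Rlt_le_trans _ _ _ As (Rmin_r _ _))).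
      cbn [fst snd]. have := Cmod_sub_tri (m y s) (m x t) c. lra.
    have [d [d0 Hd]] := h. apply/locallyC. exists d; split=> // y Hy t Ht.
    apply: flim_mult; last exact: kc. apply: (flim_comp _ F); first exact: mc. apply: Fc. exact: Hd.
(* At x = 0 the integrand is, up to 2 PI i, the derivative of dF z times the circle; for other x it
   is that of F (m x t) / x. Both functions take equal values at the ends of the loop. *)
have gder0 : forall x : R, (0 <= x <= 1)%R -> is_derive g (RtoC x) (RtoC 0).
  move=> x Hx. apply: is_derive_eq (gder x Hx) _.
  case: (Req_EM_T x 0) => [x0|x0].
  - apply: (closed_loop_integral (fun t => dF z * circ c r t)).
    + move=> t Ht. rewrite x0. have -> : m 0 t = z by rewrite /m; ring.
      have := rder_comp _ _ _ _ _ (derive_scal (dF z) _ _ _ (derive_id (circ c r t))) (rder_circ c r t).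
      set l := (X in rder _ _ X -> _). set l' := (X in _ -> rder _ _ X). have -> : l = l' => //.
      rewrite /l /l'. ring.
    + move=> t Ht. apply: flim_mult; last exact: rcont_re2pi.
      apply: (flim_comp _ dF); first exact: mc. exact: (proj2 (HF _ (inR x t Hx))).
    + by rewrite circ_01.
  - have xC : RtoC x <> 0 by move=> /(f_equal Re) /=.
    apply: (closed_loop_integral (fun t => / x * F (m x t))).
    + move=> t Ht.
      have d1 := derive_plus _ _ _ _ _ (derive_const z (circ c r t))
        (derive_scal x _ _ _ (derive_minus _ _ _ _ _ (derive_id (circ c r t)) (derive_const z _))).
      have d2 := derive_scal (/ x) _ _ _ (derive_comp F (fun u => z + x * (u - z)) _ _ _ (proj1 (HF _ (inR x t Hx))) d1).
      have := rder_comp _ _ _ _ _ d2 (rder_circ c r t).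
      set l := (X in rder _ _ X -> _). set l' := (X in _ -> rder _ _ X). have -> : l = l' => //.
      rewrite /l /l' /m. by field.
    + move=> t Ht. apply: flim_mult; last exact: rcont_re2pi.
      apply: (flim_comp _ dF); first exact: mc. exact: (proj2 (HF _ (inR x t Hx))).
    + by rewrite /m circ_01.
have : g 0 = g 1.
  apply: derive_zero_seg => t Ht. have -> : seg 0 1 t = t by rewrite /seg; ring. exact: gder0.
have -> : g 0 = F z.
  rewrite /g (I01_ext _ (fun t => F z * k t)).
    rewrite I01_scal // /k cauchy_kernel_one //. ring.
  move=> t _. by (have -> : m 0 t = z by rewrite /m; ring).
move=> ->. apply: I01_ext => t _. have -> : m 1 t = circ c r t by rewrite /m; ring.
rewrite /k. field. exact: circ_neq.
Qed.

(** The entry of index 0 is f itself, which agrees with its Cauchy integral only inside the disc;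
    the later ones are the differentiated kernels with the factor k!. *)
Lemma cauchy_integral_smooth (f : C -> C) phi c r : cont01 phi ->
  (forall z, (Cmod (z - c) < r)%R -> f z = I01 (fun t => phi t / (circ c r t - z) ^ 1)) ->
  forall n, exists g : nat -> C -> C, g 0%nat = f /\
    forall k, (k < n)%nat -> forall z, (Cmod (z - c) < r)%R -> is_derive (g k) z (g (S k) z).
Proof.
move=> Hphi Hf n.
exists (fun k => match k with O => f | S k' => fun z => INR (fact k) * I01 (fun t => phi t / (circ c r t - z) ^ S k) end).
split=> // k _ z Hz.
have d := derive_cauchy_kernel phi c r z k Hphi Hz.
case: k d => [|k] d.
- apply: (derive_ext_near (fun z => I01 (fun t => phi t / (circ c r t - z) ^ 1))).
    apply: filter_imp (locally_disc _ _ _ Hz) => w Hw. by rewrite Hf.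
  exact: d.
- apply: is_derive_eq (derive_scal (INR (fact (S k))) _ _ _ d) _.
  rewrite (fact_simpl (S k)) mult_INR RtoC_mult. ring.
Qed.

(** [cauchy_C1] asks for a continuous derivative, which is not yet known for f. It does apply to the
    primitive of f, whose derivative f is continuous; so the primitive is smooth, and with it f. *)
Lemma hol_disc_derive2 f c R0 z : hol_disc f c R0 -> (Cmod (z - c) < R0)%R ->
  exists r df ddf, (0 < r)%R /\ forall w, (Cmod (w - z) < r)%R ->
    is_derive f w (df w) /\ is_derive df w (ddf w).
Proof.
move=> H Hz. set r := ((R0 - Cmod (z - c)) / 2)%R.
have r0 : (0 < r)%R by rewrite /r; lra.
have sub : forall w, (Cmod (w - z) < 2 * r)%R -> (Cmod (w - c) < R0)%R.
  move=> w Hw. have := Cmod_sub_tri w z c. rewrite /r in Hw. lra.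
pose F := SI f c.
have HF : forall w, (Cmod (w - z) < 2 * r)%R -> is_derive F w (f w) /\ flim (locally w) f (f w).
  move=> w Hw. split; first exact: (primitive_disc f c R0 w H (sub w Hw)).
  apply: ex_derive_cont. apply: H. exact: sub.
have FC : forall w, (Cmod (w - z) < r)%R ->
    F w = I01 (fun t => F (circ z r t) * (r * e2pi t) / (circ z r t - w) ^ 1).
  move=> w Hw. apply: (cauchy_C1 F f z (2 * r)) => //. lra.
have phic : cont01 (fun t => F (circ z r t) * (r * e2pi t)).
  move=> t _. apply: flim_mult; last exact: rcont_re2pi.
  apply: (flim_comp _ F); first exact: rcont_circ. apply: is_derive_cont (proj1 (HF _ _)).
  rewrite Cmod_circ; lra.
have [g [g0 Hg]] := cauchy_integral_smooth F _ z r phic FC 4.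
exists r, (g 2%nat), (g 3%nat). split=> // w Hw.
have g1f : forall u, (Cmod (u - z) < r)%R -> g 1%nat u = f u.
  move=> u Hu. have := Hg 0%nat ltac:(lia) u Hu. rewrite g0.
  move=> /derive_unique; apply. apply: (proj1 (HF u _)). lra.
split; last by apply: Hg => //; lia.
apply: (derive_ext_near (g 1%nat)); last by apply: Hg => //; lia.
apply: filter_imp (locally_disc _ _ _ Hw) => u. exact: g1f.
Qed.

Lemma hol_disc_derive f c R0 : hol_disc f c R0 -> hol_disc (C_derive f) c R0.
Proof.
move=> H z Hz. have [r [df [ddf [r0 Hr]]]] := hol_disc_derive2 f c R0 z H Hz.
exists (ddf z). apply: (derive_ext_near df); last by apply: (proj2 (Hr z _)); rewrite Cmod_sub_self.
apply/locallyC. exists r; split=> // w Hw. apply/esym. apply: is_C_derive_unique. exact: (proj1 (Hr w Hw)).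
Qed.

Theorem cauchy_disc f c R0 r z : hol_disc f c R0 -> (Cmod (z - c) < r)%R -> (r < R0)%R ->
  f z = I01 (fun t => f (circ c r t) * (r * e2pi t) / (circ c r t - z) ^ 1).
Proof.
move=> H. apply: (cauchy_C1 f (C_derive f) c R0) => w Hw.
split; first exact: (C_derive_is _ _ (H w Hw)).
apply: ex_derive_cont. exact: (hol_disc_derive _ _ _ H).
Qed.

(** * Consequences of Cauchy's formula *)

Lemma cont01_bounded f : cont01 f ->
  exists M, (0 < M)%R /\ forall t, (0 <= t <= 1)%R -> (Cmod (f t) <= M)%R.
Proof.
move=> H.
have [d [d0 Hd]] : exists d, (0 < d)%R /\ forall s, (0 <= s <= 1)%R -> (d * Cmod (f s) <= 1)%R.
  apply: (uniform01 (fun d s => (d * Cmod (f s) <= 1)%R)).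
    move=> d d' s Hd h. have := Cmod_ge_0 (f s). nra.
  move=> t Ht. have /locallyR [a [a0 Ha]] := H t Ht 1%R Rlt_0_1.
  have p := Cmod_ge_0 (f t). have q0 : (0 < / (Cmod (f t) + 1))%R by apply: Rinv_0_lt_compat; lra.
  exists (Rmin a (/ (Cmod (f t) + 1))). split; first exact: Rmin_pos.
  move=> s Hs As. have := Ha s (Rlt_le_trans _ _ _ As (Rmin_l _ _)).
  have := Cmod_sub_ge (f s) (f t). have := Rmin_r a (/ (Cmod (f t) + 1)). have := Rmin_pos _ _ a0 q0.
  set mn := Rmin _ _. have ps := Cmod_ge_0 (f s). move=> m0 m1 h1 h2.
  have : (/ (Cmod (f t) + 1) * (Cmod (f t) + 1) = 1)%R by field; lra. nra.
exists (/ d)%R. split; first exact: Rinv_0_lt_compat.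
move=> t Ht. have := Hd t Ht. move=> h. apply: (Rmult_le_reg_l d) => //. rewrite Rinv_r; lra.
Qed.

Lemma hol_disc_circ_cont f c R0 r : hol_disc f c R0 -> (0 <= r < R0)%R -> cont01 (fun t => f (circ c r t)).
Proof.
move=> H Hr t _. apply: (flim_comp _ f); first exact: rcont_circ. apply: ex_derive_cont.
apply: H. rewrite Cmod_circ; lra.
Qed.

Lemma Cmod_circ_sub_ge c r z t : (Cmod (z - c) < r)%R ->
  (r - Cmod (z - c) <= Cmod (circ c r t - z))%R.
Proof.
move=> Hz. have r0 := radius_pos _ _ _ Hz.
have := Cmod_sub_tri (circ c r t) z c. rewrite Cmod_circ; lra.
Qed.

(** As f vanishes near c, f / (w - c)^n is holomorphic on the whole disc for every n. Cauchy's
    formula on the circle of radius r bounds f z by K (rho / r)^n, which tends to 0. *)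
Lemma vanish_from_center f c R0 : hol_disc f c R0 -> locally c (fun w => f w = 0) ->
  forall z, (Cmod (z - c) < R0)%R -> f z = 0.
Proof.
move=> H H0 z Hz.
set r := ((R0 + Cmod (z - c)) / 2)%R. have rR : (r < R0)%R by rewrite /r; lra.
have zr : (Cmod (z - c) < r)%R by rewrite /r; lra. have r0 := radius_pos _ _ _ zr.
have [M [M0 HM]] := cont01_bounded _ (hol_disc_circ_cont f c R0 r H ltac:(lra)).
set rho := Cmod (z - c) in zr *.
have rho0 : (0 <= rho)%R by exact: Cmod_ge_0.
set K := (2 * (M * r / (r - rho)))%R.
have bound : forall n, (Cmod (f z) <= K * (rho / r) ^ n)%R.
  move=> n. pose h w := f w / (w - c) ^ n.
  have Hh : hol_disc h c R0.
    move=> w Hw. case: (Ceq_dec w c) => [-> | ne].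
    - exists (RtoC 0). apply: (derive_ext_near (fun _ => RtoC 0)); last exact: derive_const.
      apply: filter_imp H0 => u Hu. rewrite /h Hu /Cdiv. ring.
    - have wc : w - c <> 0 by exact: Cminus_eq_contra.
      case: n @h => [|n] h.
        have [l Hl] := H w Hw. exists l. apply: (derive_ext_near f) => //.
        apply: filter_forall => u. rewrite /h /=. by field.
      eexists. apply: derive_div; [exact: Cpow_nz | exact: (C_derive_is _ _ (H w Hw)) |].
      exact: (derive_pow _ _ _ n (derive_minus _ _ _ _ _ (derive_id w) (derive_const c w))).
  case: (Ceq_dec z c) => [e | ne].
    have -> : f z = 0 by rewrite e; exact: locally_singleton H0.
    rewrite Cmod_0. apply: Rmult_le_pos.
      rewrite /K. apply: Rmult_le_pos; first lra. apply: Rlt_le. apply: Rdiv_lt_0_compat; nra.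
    apply: pow_le. apply: Rdiv_le_0_compat; lra.
  have zc : z - c <> 0 by exact: Cminus_eq_contra.
  have -> : f z = (z - c) ^ n * h z by rewrite /h; field; exact: Cpow_nz.
  rewrite (cauchy_disc h c R0 r z Hh zr rR).
  have rC : RtoC r <> 0 by move=> /(f_equal Re) /=; lra.
  have cn : forall t, circ c r t - c <> 0.
    move=> t. rewrite circ_sub. apply: Cmult_neq_0 => //. exact: e2pi_neq0.
  rewrite Cmod_mult Cmod_pow -/rho.
  have rn : (0 < r ^ n)%R by exact: pow_lt.
  set Ih := I01 _. have b : (Cmod Ih <= K / r ^ n)%R.
    have -> : (K / r ^ n = 2 * (M / r ^ n * r / (r - rho)))%R by rewrite /K; field; lra.
    rewrite /Ih. apply: I01_bound.
    - move=> t Ht. apply: flim_div; first by apply: Cpow_nz; exact: circ_neq.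
        apply: flim_mult; last exact: rcont_re2pi.
        exact: (hol_disc_circ_cont h c R0 r Hh ltac:(lra) t Ht).
      apply: flim_pow. apply: flim_minus; [exact: rcont_circ | exact: flim_const].
    - move=> t Ht. rewrite Cpow_1_r /h. rewrite Cmod_div; last exact: circ_neq.
      rewrite Cmod_mult Cmod_div; last exact: Cpow_nz.
      rewrite Cmod_pow Cmod_circ; last lra. rewrite Cmod_mult Cmod_e2pi Cmod_R Rabs_pos_eq ?Rmult_1_r; last lra.
      have g := Cmod_circ_sub_ge c r z t zr. rewrite -/rho in g.
      apply: Rmult_le_compat.
      + apply: Rmult_le_pos; last lra. apply: Rdiv_le_0_compat => //. exact: Cmod_ge_0.
      + left. apply: Rinv_0_lt_compat. lra.
      + apply: Rmult_le_compat_r; first lra. apply: Rmult_le_compat_r; last exact: HM.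
        left. exact: Rinv_0_lt_compat.
      + apply: Rinv_le_contravar; lra.
  rewrite Rpow_mult_distr pow_inv.
  have p0 : (0 <= rho ^ n)%R by exact: pow_le.
  have := Rmult_le_compat_l _ _ _ p0 b. rewrite /Rdiv. lra.
apply: Cmod_eq_0. apply: Rle_antisym; last exact: Cmod_ge_0.
apply: (@is_lim_seq_le (fun _ => Cmod (f z)) (fun n => K * (rho / r) ^ n)%R (Cmod (f z)) 0 bound).
  exact: is_lim_seq_const.
have -> : Finite 0 = Rbar_mult K 0 by rewrite /= Rmult_0_r.
apply: is_lim_seq_scal_l. apply: is_lim_seq_geom.
rewrite Rabs_pos_eq; last by apply: Rdiv_le_0_compat.
apply/Rlt_div_l; lra.
Qed.

(** Vanishing near a point is propagated along the segment from z1 to z by [vanish_from_center]. *)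
Theorem identity_disc f c R0 z1 : hol_disc f c R0 -> (Cmod (z1 - c) < R0)%R ->
  locally z1 (fun w => f w = 0) -> forall z, (Cmod (z - c) < R0)%R -> f z = 0.
Proof.
move=> H Hz1 H0 z Hz.
suff : locally (seg z1 z 1) (fun w => f w = 0) by rewrite seg1; exact: locally_singleton.
have := propagation01 (fun s => locally (seg z1 z s) (fun w => f w = 0)).
apply; [by rewrite seg0 | | lra].
move=> t Ht. have wt : (Cmod (seg z1 z t - c) < R0)%R by exact: seg_disc.
set dl := (R0 - Cmod (seg z1 z t - c))%R.
have dl0 : (0 < dl)%R by rewrite /dl; lra.
have L0 := Cmod_ge_0 (z - z1).
have dist : forall s s', Cmod (seg z1 z s - seg z1 z s') = (Rabs (s - s') * Cmod (z - z1))%R.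
  move=> s s'. rewrite -Cmod_R -Cmod_mult. congr Cmod. rewrite /seg RtoC_minus. ring.
(* Points with such parameters are within dl / 4 of the point at t. The disc of radius 3 dl / 4
   about one of them stays in the domain and contains the disc of radius dl / 4 about another. *)
exists (dl / (4 * (Cmod (z - z1) + 1)))%R. split; first by apply: Rdiv_lt_0_compat; lra.
move=> s s' Hs Hs' As As' _ Ps.
have E : (dl / (4 * (Cmod (z - z1) + 1)) * (Cmod (z - z1) + 1) = dl / 4)%R by field; lra.
have near : forall u, (Rabs (u - t) < dl / (4 * (Cmod (z - z1) + 1)))%R -> (Cmod (seg z1 z u - seg z1 z t) <= dl / 4)%R.
  move=> u Hu. rewrite dist. have := Rabs_pos (u - t). nra.
have Hd : hol_disc f (seg z1 z s) (3 * dl / 4).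
  move=> w Hw. apply: H. have := Cmod_sub_tri w (seg z1 z s) c.
  have := Cmod_sub_tri (seg z1 z s) (seg z1 z t) c. have := near s As. rewrite /dl in Hw *. lra.
have V := vanish_from_center f _ _ Hd Ps.
apply/locallyC. exists (dl / 4)%R. split; first lra. move=> w Hw. apply: V.
have := Cmod_sub_tri w (seg z1 z s') (seg z1 z s).
have := Cmod_sub_tri (seg z1 z s') (seg z1 z t) (seg z1 z s).
have := near s As. have := near s' As'. rewrite (Cmod_sub_sym (seg z1 z t)). lra.
Qed.

Notation hol := holomorphic_near.

Lemma hol_ex_derive f a : hol f a -> ex_derive f a.
Proof. exact: locally_singleton. Qed.

Lemma hol_disc_of f a : hol f a -> exists r, (0 < r)%R /\ hol_disc f a r.
Proof. by move=> /locallyC [r [r0 Hr]]; exists r. Qed.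

Lemma hol_of_disc f c r z : hol_disc f c r -> (Cmod (z - c) < r)%R -> hol f z.
Proof. move=> H Hz. apply: filter_imp (locally_disc _ _ _ Hz) => w Hw. exact: H. Qed.

Lemma hol_hol f a : hol f a -> locally a (fun z => hol f z).
Proof. exact: locally_locallyC. Qed.

Lemma hol_derive f a : hol f a -> hol (C_derive f) a.
Proof.
move=> /hol_disc_of [r [r0 Hr]]. apply: (hol_of_disc _ a r); first exact: hol_disc_derive.
by rewrite Cmod_sub_self.
Qed.

Lemma hol_ext f g a : locally a (fun z => f z = g z) -> hol f a -> hol g a.
Proof.
move=> /locally_locallyC E H. apply: filter_imp (filter_and _ _ E H) => z [Ez [l Hl]].
exists l. exact: derive_ext_near Hl.
Qed.

(* Cauchy's formula gives [(f z - f a) / (z - a)] as a Cauchy integral which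
   makes sense at [z = a]. *)
Lemma hol_divide f a : hol f a -> f a = 0 ->
  exists k, hol k a /\ k a = C_derive f a /\ locally a (fun z => f z = (z - a) * k z).
Proof.
move=> /hol_disc_of [R0 [R00 H]] f0. set r := (R0 / 2)%R.
have r0 : (0 < r)%R by rewrite /r; lra. have rR : (r < R0)%R by rewrite /r; lra.
have rC : RtoC r <> 0 by move=> /(f_equal Re) /=; lra.
have phic := hol_disc_circ_cont f a R0 r H ltac:(lra).
pose k z := I01 (fun t => f (circ a r t) / (circ a r t - z) ^ 1).
have aa : (Cmod (a - a) < r)%R by rewrite Cmod_sub_self.
have E : forall z, (Cmod (z - a) < r)%R -> f z = (z - a) * k z.
  move=> z Hz. have -> : f z = f z - f a by rewrite f0; ring.
  rewrite {1}(cauchy_disc f a R0 r z H Hz rR) (cauchy_disc f a R0 r a H aa rR).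
  have c1 : forall w, (Cmod (w - a) < r)%R -> cont01 (fun t => f (circ a r t) * (r * e2pi t) / (circ a r t - w) ^ 1).
    move=> w Hw t Ht. apply: flim_div; first by apply: Cpow_nz; exact: circ_neq.
      apply: flim_mult; last exact: rcont_re2pi. exact: phic.
    apply: flim_pow. apply: flim_minus; [exact: rcont_circ | exact: flim_const].
  rewrite -I01_minus; [|exact: c1|exact: c1]. rewrite /k -I01_scal.
    apply: I01_ext => t _. have n1 := circ_neq a r z t Hz. have e0 := e2pi_neq0 t.
    rewrite (Cpow_1_r (circ a r t - a)) circ_sub. set ff := f _. rewrite /circ in n1 *.
    by field.
  move=> t Ht. apply: flim_div; first by apply: Cpow_nz; exact: circ_neq.
    exact: phic.
  apply: flim_pow. apply: flim_minus; [exact: rcont_circ | exact: flim_const].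
have hk : hol k a.
  apply: (hol_of_disc _ a r) => // w Hw. eexists. exact: (derive_cauchy_kernel _ a r w 0 phic Hw).
exists k. split=> //. split.
- apply/esym. apply: is_C_derive_unique.
  apply: (derive_ext_near (fun z => (z - a) * k z)).
    apply: filter_imp (locally_disc _ _ _ aa) => w Hw. by rewrite E.
  apply: is_derive_eq (derive_mult _ _ _ _ _ (derive_minus _ _ _ _ _ (derive_id a) (derive_const a a)) (C_derive_is _ _ (hol_ex_derive _ _ hk))) _.
  ring.
- apply: filter_imp (locally_disc _ _ _ aa) => w Hw. exact: E.
Qed.

(** Compare the Cauchy integrals for z and 0 over the circle of radius |z| + n + 1. The integrand of
    the difference is f times z / (gamma - z), which gives the bound 2 M |z| / (n + 1). *)
Lemma liouville (f : C -> C) M : (forall z : C, ex_derive f z) -> (forall z, (Cmod (f z) <= M)%R) ->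
  forall z, f z = f (RtoC 0).
Proof.
move=> H HM z.
have M0 : (0 <= M)%R by apply: Rle_trans (HM 0); exact: Cmod_ge_0.
have Hd : forall R0, hol_disc f 0 R0 by move=> R0 w _; exact: H.
have z0 := Cmod_ge_0 z.
have zz : z - 0 = z by ring.
have B : forall n, (Cmod (f z - f 0) <= 2 * M * Cmod z * / INR (S n))%R.
  move=> n. have n0 : (0 < INR (S n))%R by apply: lt_0_INR; lia.
  set r := (Cmod z + INR (S n))%R.
  have zr : (Cmod (z - 0) < r)%R by rewrite zz /r; lra.
  have r0 := radius_pos _ _ _ zr.
  have aa : (Cmod (0 - 0) < r)%R by rewrite Cmod_sub_self.
  have rC : RtoC r <> 0 by move=> /(f_equal Re) /=; lra.
  have rR : (r < r + 1)%R by lra.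
  rewrite (cauchy_disc f 0 (r + 1) r z (Hd _) zr rR) (cauchy_disc f 0 (r + 1) r 0 (Hd _) aa rR).
  have phic := hol_disc_circ_cont f 0 (r + 1) r (Hd _) ltac:(lra).
  have c1 : forall w, (Cmod (w - 0) < r)%R -> cont01 (fun t => f (circ 0 r t) * (r * e2pi t) / (circ 0 r t - w) ^ 1).
    move=> w Hw t Ht. apply: flim_div; first by apply: Cpow_nz; exact: circ_neq.
      apply: flim_mult; last exact: rcont_re2pi. exact: phic.
    apply: flim_pow. apply: flim_minus; [exact: rcont_circ | exact: flim_const].
  have c2 := cont01_minus _ _ (c1 z zr) (c1 0 aa).
  rewrite -I01_minus; [|exact: c1|exact: c1].
  have -> : (2 * M * Cmod z * / INR (S n) = 2 * (M * Cmod z * / INR (S n)))%R by ring.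
  apply: I01_bound => // t _.
  have n1 := circ_neq 0 r z t zr. have e0 := e2pi_neq0 t.
  rewrite (Cpow_1_r (circ 0 r t - 0)) (Cpow_1_r (circ 0 r t - z)) circ_sub.
  have -> : f (circ 0 r t) * (r * e2pi t) / (circ 0 r t - z) - f (circ 0 r t) * (r * e2pi t) / (r * e2pi t)
    = f (circ 0 r t) * z / (circ 0 r t - z).
    set ff := f _. have E : circ 0 r t = r * e2pi t by rewrite -(circ_sub 0 r t); ring.
    rewrite E in n1 *. by field.
  rewrite Cmod_div // Cmod_mult.
  have g := Cmod_circ_sub_ge 0 r z t zr. rewrite zz in g.
  apply: Rmult_le_compat.
  - apply: Rmult_le_pos; exact: Cmod_ge_0.
  - left. apply: Rinv_0_lt_compat. by apply/Cmod_gt_0.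
  - exact: Rmult_le_compat_r.
  - apply: Rinv_le_contravar => //. have q : (r - Cmod z = INR (S n))%R by rewrite /r; ring. lra.
apply/Ceq_minus. apply: Cmod_eq_0. apply: Rle_antisym; last exact: Cmod_ge_0.
apply: (@is_lim_seq_le (fun _ => Cmod (f z - f 0)) _ (Cmod (f z - f 0)) 0 B).
  exact: is_lim_seq_const.
have -> : Finite 0 = Rbar_mult (2 * M * Cmod z)%R 0 by rewrite /= Rmult_0_r.
apply: is_lim_seq_scal_l.
apply (proj1 (is_lim_seq_incr_1 (fun n => / INR n)%R 0)).
by have := is_lim_seq_inv INR p_infty is_lim_seq_INR; apply.
Qed.

(* The binder type is normalized because unification leaves [AbsRing.sort C_AbsRing]. *)
Ltac cderive := lazymatch goal with |- @is_derive _ _ ?F0 ?z _ =>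
  let F := eval cbv beta in (fun w : C => F0 w) in lazymatch F with
  | (fun w => w) => exact (derive_id z)
  | (fun w => Cminus (@?f w) (@?g w)) => eapply (derive_minus f g); cderive
  | (fun w => Cplus (@?f w) (@?g w)) => eapply (derive_plus f g); cderive
  | (fun w => Copp (@?f w)) => eapply (derive_opp f); cderive
  | (fun w => Cdiv (@?f w) (@?g w)) => eapply (derive_div f g); [ | cderive | cderive]
  | (fun w => Cinv (@?f w)) => eapply (derive_inv f); [ | cderive]
  | (fun w => Cpow (@?f w) (S ?n)) => eapply (derive_pow f); cderive
  | (fun w => Cmult (@?f w) (@?g w)) => eapply (derive_mult f g); cderive
  | (fun _ => ?c) => exact (derive_const c z)
  | _ => try eassumption
  end end.

(** * Closure rules for holomorphic germs *)

Section HolomorphicRules.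
Implicit Types (f g : C -> C) (a z w c : C).

Lemma hol_cont f a : hol f a -> flim (locally a) f (f a).
Proof. by move=> H; apply: ex_derive_cont; apply: hol_ex_derive. Qed.

Lemma hol_is_derive (f : C -> C) (a : C) : hol f a -> locally a (fun z : C => is_derive f z (C_derive f z)).
Proof. move=> H. apply: locallyC_imp H => z Hz. exact: C_derive_is. Qed.

Lemma hol_of_derive (f df : C -> C) (a : C) : locally a (fun z : C => is_derive f z (df z)) -> hol f a.
Proof. move=> H. apply: locallyC_imp H => z Hz. by exists (df z). Qed.

Lemma hol_const (c a : C) : hol (fun _ => c) a.
Proof. apply: filter_forall => z. exists (RtoC 0). exact: derive_const. Qed.

Lemma hol_id (a : C) : hol (fun z => z) a.
Proof. apply: filter_forall => z. exists (RtoC 1). exact: derive_id. Qed.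

Lemma hol_plus f g a : hol f a -> hol g a -> hol (fun z => f z + g z) a.
Proof.
move=> Hf Hg. apply: filter_imp (filter_and _ _ Hf Hg) => z [[l Hl] [m Hm]].
exists (l + m). exact: derive_plus.
Qed.

Lemma hol_opp f a : hol f a -> hol (fun z => - f z) a.
Proof. move=> Hf. apply: filter_imp Hf => z [l Hl]. exists (- l). exact: derive_opp. Qed.

Lemma hol_minus f g a : hol f a -> hol g a -> hol (fun z => f z - g z) a.
Proof. move=> Hf Hg. exact: (hol_plus _ _ _ Hf (hol_opp _ _ Hg)). Qed.

Lemma hol_mult f g a : hol f a -> hol g a -> hol (fun z => f z * g z) a.
Proof.
move=> Hf Hg. apply: filter_imp (filter_and _ _ Hf Hg) => z [[l Hl] [m Hm]].
eexists. exact: (derive_mult _ _ _ _ _ Hl Hm).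
Qed.

Lemma hol_inv f a : f a <> 0 -> hol f a -> hol (fun z => / f z) a.
Proof.
move=> f0 Hf. apply: filter_imp (filter_and _ _ (flim_neq0 _ _ _ f0 (hol_cont _ _ Hf)) Hf) => z [h [l Hl]].
eexists. exact: (derive_inv _ _ _ h Hl).
Qed.

Lemma hol_div f g a : g a <> 0 -> hol f a -> hol g a -> hol (fun z => f z / g z) a.
Proof. move=> g0 Hf Hg. exact: (hol_mult _ _ _ Hf (hol_inv _ _ g0 Hg)). Qed.

Lemma hol_pow f a n : hol f a -> hol (fun z => f z ^ n) a.
Proof. move=> H. elim: n => [|n IH] /=; first exact: hol_const. exact: hol_mult. Qed.

End HolomorphicRules.

Ltac hol_tac := lazymatch goal with
  | |- hol (fun w => w) _ => apply hol_id
  | |- hol (fun w => Cminus (@?f w) (@?g w)) _ => apply (hol_minus f g); hol_tac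
  | |- hol (fun w => Cplus (@?f w) (@?g w)) _ => apply (hol_plus f g); hol_tac
  | |- hol (fun w => Copp (@?f w)) _ => apply (hol_opp f); hol_tac
  | |- hol (fun w => Cdiv (@?f w) (@?g w)) _ => apply (hol_div f g); [ | hol_tac | hol_tac]
  | |- hol (fun w => Cinv (@?f w)) _ => apply (hol_inv f); [ | hol_tac]
  | |- hol (fun w => Cpow (@?f w) _) _ => apply (hol_pow f); hol_tac
  | |- hol (fun w => Cmult (@?f w) (@?g w)) _ => apply (hol_mult f g); hol_tac
  | |- hol (fun _ => ?c) _ => apply (hol_const c)
  | |- _ => try eassumption
  end.

(** * Affine substitutions and cancellation of germs *)

Section HolomorphicLimits.
Implicit Types (f g : C -> C) (a z w c : C).

Lemma locally_affine (u v a : C) (P : C -> Prop) : locally (u * a + v) P ->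
  locally a (fun z => P (u * z + v)).
Proof.
move=> /locallyC [d [d0 Hd]].
have u0 := Cmod_ge_0 u.
apply/locallyC. exists (d / (Cmod u + 1))%R. split; first by apply: Rdiv_lt_0_compat; lra.
move=> w Hw. apply: Hd. have -> : u * w + v - (u * a + v) = u * (w - a) by ring.
rewrite Cmod_mult.
have : (d / (Cmod u + 1) * (Cmod u + 1) = d)%R by field; lra.
have := Cmod_ge_0 (w - a). nra.
Qed.

Lemma hol_affine f (u v a : C) : hol f (u * a + v) -> hol (fun z => f (u * z + v)) a.
Proof.
move=> H. apply: filter_imp (locally_affine _ _ _ _ H) => z [l Hl].
eexists. apply: (derive_comp f (fun z => u * z + v)); first exact: Hl.
exact: (derive_plus _ _ _ _ _ (derive_scal u _ _ _ (derive_id z)) (derive_const v z)).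
Qed.

Lemma locally_shift (v a : C) (P : C -> Prop) : locally (a + v) P -> locally a (fun z => P (z + v)).
Proof.
move=> H. have := locally_affine 1 v a P. have -> : 1 * a + v = a + v by ring.
move=> /(_ H). apply: filter_imp => z. by have -> : 1 * z + v = z + v by ring.
Qed.

Lemma hol_shift f (v a : C) : hol f (a + v) -> hol (fun z => f (z + v)) a.
Proof.
move=> H. apply: filter_imp (locally_shift _ _ _ H) => z [l Hl]. exists l. exact: derive_shift.
Qed.

Lemma derive_affine f (u v a l : C) : is_derive f (u * a + v) l ->
  is_derive (fun z => f (u * z + v)) a (l * u).
Proof.
move=> H. have d := derive_plus _ _ _ _ _ (derive_scal u _ _ _ (derive_id a)) (derive_const v a).
apply: is_derive_eq (derive_comp f (fun z => u * z + v) _ _ _ H d) _. ring.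
Qed.

Lemma locally_punctured_cont f (a b : C) : flim (locally a) f (f a) ->
  locally a (fun z => z <> a -> f z = b) -> f a = b.
Proof.
move=> Hf H. apply: NNPP => ne.
have d0 : (0 < Cmod (f a - b))%R by apply/Cmod_gt_0; exact: Cminus_eq_contra.
have [d [dp Hd]] := proj1 (locallyC _ _) (filter_and _ _ H (Hf _ d0)).
have ad : (Cmod (a + (d / 2)%R - a) < d)%R.
  have -> : a + (d / 2)%R - a = (d / 2)%R by ring. rewrite Cmod_R Rabs_pos_eq; lra.
have [h1 h2] := Hd _ ad. rewrite h1 in h2; first by rewrite Cmod_sub_sym in h2; lra.
move=> /(f_equal Re). rewrite re_plus re_RtoC. lra.
Qed.

(** Germs of holomorphic functions form a domain: where f is nonzero g vanishes, and the identity
    theorem brings this back to a. It serves to cancel factors that may vanish at a. *)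
Lemma hol_mult_zero f g a : hol f a -> hol g a -> locally a (fun z => f z * g z = 0) ->
  locally a (fun z => f z = 0) \/ locally a (fun z => g z = 0).
Proof.
move=> /hol_disc_of [r [r0 Hf]] /hol_disc_of [s [s0 Hg]] /locallyC [d [d0 H]].
set m := Rmin r (Rmin s d). have m0 : (0 < m)%R by do 2 apply: Rmin_pos => //.
have mr : (m <= r)%R by exact: Rmin_l.
have ms : (m <= s)%R by apply: Rle_trans (Rmin_r _ _) (Rmin_l _ _).
have md : (m <= d)%R by apply: Rle_trans (Rmin_r _ _) (Rmin_r _ _).
case: (classic (forall z, (Cmod (z - a) < m)%R -> f z = 0)) => h.
  left. apply/locallyC. by exists m.
right. have [z1 Hz1] := not_all_ex_not _ _ h. have [Hz Hz0] := imply_to_and _ _ Hz1.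
have fc : flim (locally z1) f (f z1) by apply: ex_derive_cont; apply: Hf; lra.
have L : locally z1 (fun w => g w = 0).
  apply: filter_imp (filter_and _ _ (flim_neq0 _ _ _ Hz0 fc) (locally_disc _ _ _ Hz)) => w [h1 h2].
  apply: NNPP => g0. apply: (Cmult_neq_0 _ _ h1 g0). apply: H. lra.
apply/locallyC. exists m. split=> // w Hw.
apply: (identity_disc g a m z1) => // u Hu. apply: Hg. lra.
Qed.

(** * Limits of holomorphic functions *)

(** Each u n equals its Cauchy integral on an inner circle. Uniform convergence passes this on to f,
    and a Cauchy integral with continuous density is holomorphic. *)
Lemma hol_uniform_limit (u : nat -> C -> C) (f : C -> C) (e : nat -> R) c R0 :
  (forall n, hol_disc (u n) c R0) ->
  (forall n z, (Cmod (z - c) < R0)%R -> (Cmod (u n z - f z) <= e n)%R) ->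
  is_lim_seq e 0 -> hol_disc f c R0.
Proof.
move=> Hu Hf He z Hz.
have small : forall eps, (0 < eps)%R -> exists n, (e n < eps)%R.
  move=> eps e0. have /is_lim_seq_spec/(_ (mkposreal _ e0)) [N HN] := He.
  exists N. have := HN N (le_n _). rewrite /= Rminus_0_r. have := Rle_abs (e N). lra.
have fc : forall w, (Cmod (w - c) < R0)%R -> flim (locally w) f (f w).
  move=> w Hw eps e0. have [n Hn] := small (eps / 3)%R ltac:(lra).
  have uc := ex_derive_cont _ _ (Hu n w Hw). have e3 : (0 < eps / 3)%R by lra.
  apply: filter_imp (filter_and _ _ (locally_disc _ _ _ Hw) (uc _ e3)) => v [h1 h2].
  have := Cmod_sub_tri (f v) (u n v) (f w). have := Cmod_sub_tri (u n v) (u n w) (f w).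
  have := Hf n v h1. have := Hf n w Hw. rewrite (Cmod_sub_sym (u n v) (f v)). lra.
set r := ((R0 + Cmod (z - c)) / 2)%R. have rR : (r < R0)%R by rewrite /r; lra.
have zr : (Cmod (z - c) < r)%R by rewrite /r; lra. have r0 := radius_pos _ _ _ zr.
have ic : forall t, (Cmod (circ c r t - c) < R0)%R by move=> t; rewrite Cmod_circ; lra.
have phic : cont01 (fun t => f (circ c r t) * (r * e2pi t)).
  move=> t _. apply: flim_mult; last exact: rcont_re2pi.
  apply: (flim_comp _ f); first exact: rcont_circ. exact: fc.
eexists. apply: (derive_ext_near (fun w => I01 (fun t => f (circ c r t) * (r * e2pi t) / (circ c r t - w) ^ 1)));
  last exact: (derive_cauchy_kernel _ c r z 0 phic zr).
apply: filter_imp (locally_disc _ _ _ zr) => w Hw.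
apply/Ceq_minus. apply: Cmod_eq_0. apply: Rle_antisym; last exact: Cmod_ge_0.
set If := I01 _.
have g0 : (0 < r - Cmod (w - c))%R by lra.
set K := (1 + 2 * (r / (r - Cmod (w - c))))%R.
have K0 : (0 < K)%R.
  have : (0 < r / (r - Cmod (w - c)))%R by exact: Rdiv_lt_0_compat. rewrite /K; lra.
have B : forall n, (Cmod (If - f w) <= K * e n)%R.
  move=> n. have en : (0 <= e n)%R by apply: Rle_trans (Hf n z Hz); exact: Cmod_ge_0.
  have := cauchy_disc (u n) c R0 r w (Hu n) Hw rR. set Iu := I01 _ => E.
  have b : (Cmod (If - Iu) <= 2 * (e n * r / (r - Cmod (w - c))))%R.
    have phiu : cont01 (fun t => u n (circ c r t) * (r * e2pi t)).
      move=> t _. apply: flim_mult; last exact: rcont_re2pi.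
      apply: (flim_comp _ (u n)); first exact: rcont_circ. apply: ex_derive_cont. exact: Hu.
    have dc : forall phi, cont01 phi -> cont01 (fun t => phi t / (circ c r t - w) ^ 1).
      move=> phi Hphi t Ht. apply: flim_div; [by apply: Cpow_nz; exact: circ_neq | exact: Hphi |].
      apply: flim_pow. apply: flim_minus; [exact: rcont_circ | exact: flim_const].
    have q1 := dc _ phic. have q2 := dc _ phiu.
    rewrite /If /Iu -I01_minus //. apply: I01_bound; first exact: cont01_minus.
    move=> t Ht. have n1 := circ_neq c r w t Hw.
    rewrite (Cpow_1_r (circ c r t - w)).
    have -> : f (circ c r t) * (r * e2pi t) / (circ c r t - w) - u n (circ c r t) * (r * e2pi t) / (circ c r t - w)
      = (f (circ c r t) - u n (circ c r t)) * (r * e2pi t) / (circ c r t - w) by field.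
    rewrite Cmod_div // !Cmod_mult Cmod_e2pi Cmod_R Rabs_pos_eq ?Rmult_1_r; last lra.
    rewrite Cmod_sub_sym. apply: Rmult_le_compat.
    - apply: Rmult_le_pos; [exact: Cmod_ge_0 | lra].
    - left. apply: Rinv_0_lt_compat. by apply/Cmod_gt_0.
    - apply: Rmult_le_compat_r; first lra. exact: Hf.
    - apply: Rinv_le_contravar => //. exact: Cmod_circ_sub_ge.
  have := Cmod_sub_tri If Iu (f w).
  have := Hf n w ltac:(lra). rewrite E.
  have -> : (K * e n = e n + 2 * (e n * r / (r - Cmod (w - c))))%R by rewrite /K; field; lra.
  lra.
apply: (@is_lim_seq_le (fun _ => Cmod (If - f w)) (fun n => K * e n)%R (Cmod (If - f w)) 0 B).
  exact: is_lim_seq_const.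
have -> : Finite 0 = Rbar_mult K 0 by rewrite /= Rmult_0_r.
exact: is_lim_seq_scal_l.
Qed.

(** A second order remainder bound, uniform in n, survives the limit; the derivatives need to
    converge only at the point z0. *)
Lemma derive_limit (U : nat -> C -> C) (dU : nat -> C) (f : C -> C) (z0 l : C) (M : R) :
  locally z0 (fun w => forall n, (Cmod (U n w - U n z0 - (w - z0) * dU n) <= M * Cmod (w - z0) ^ 2)%R) ->
  locally z0 (fun w => flim eventually (fun n => U n w) (f w)) ->
  flim eventually dU l -> is_derive f z0 l.
Proof.
move=> HM HU Hd.
have Hz := locally_singleton _ _ HU.
have B : locally z0 (fun w => (Cmod (f w - f z0 - (w - z0) * l) <= M * Cmod (w - z0) ^ 2)%R).
  apply: filter_imp (filter_and _ _ HM HU) => w [h1 h2].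
  apply: (flim_Cmod_le eventually (fun n => U n w - U n z0 - (w - z0) * dU n)); last exact: filter_forall.
  apply: flim_minus; first exact: flim_minus.
  apply: flim_mult => //. exact: flim_const.
pose phi w := if Ceq_dec w z0 then l else (f w - f z0) / (w - z0).
apply: (derive_carath_near _ phi).
- apply: filter_forall => w. rewrite /phi. case: Ceq_dec => [h|ne] /=; first by rewrite h; ring.
  have h : w - z0 <> 0 by exact: Cminus_eq_contra. by field.
- apply: (flim_close _ _ _ (fun w => (Rabs M * Cmod (w - z0))%R)).
    have : flim (locally z0) (fun w => RtoC (Cmod (w - z0))) 0.
      move=> eps e0. apply/locallyC. exists eps. split=> // w Hw.
      have -> : RtoC (Cmod (w - z0)) - 0 = Cmod (w - z0) by ring.
      rewrite Cmod_R Rabs_pos_eq //. exact: Cmod_ge_0.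
    move=> h. have -> : RtoC 0 = Rabs M * 0 by ring.
    apply: (flim_ext _ (fun w => Rabs M * Cmod (w - z0))).
      by apply: filter_forall => w; rewrite RtoC_mult.
    apply: flim_mult => //. exact: flim_const.
  apply: filter_imp B => w Hw. rewrite /phi. case: Ceq_dec => [h|ne] /=.
    rewrite h !Cmod_sub_self Rmult_0_r. exact: Rle_refl.
  have h : w - z0 <> 0 by exact: Cminus_eq_contra.
  have -> : (f w - f z0) / (w - z0) - l = (f w - f z0 - (w - z0) * l) / (w - z0) by field.
  have h0 : (0 < Cmod (w - z0))%R by apply/Cmod_gt_0.
  rewrite Cmod_div //. apply/Rle_div_l => //. apply: Rle_trans Hw _.
  have := Rle_abs M. rewrite /=. nra.
Qed.

(** * Existence for second order linear equations *)

Lemma SI_self f c : SI f c c = 0.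
Proof. rewrite /SI; ring. Qed.

Lemma SI_disc_bound f c R0 r M z : hol_disc f c R0 -> (Cmod (z - c) < R0)%R ->
  (Cmod (z - c) <= r)%R -> (0 <= M)%R ->
  (forall w, (Cmod (w - c) < R0)%R -> (Cmod (f w) <= M)%R) -> (Cmod (SI f c z) <= 2 * M * r)%R.
Proof.
move=> H Hz Hr M0 HM.
have R00 := radius_pos _ _ _ Hz.
have cc : (Cmod (c - c) < R0)%R by rewrite Cmod_sub_self.
have sg : forall t, (0 <= t <= 1)%R -> (Cmod (seg c z t - c) < R0)%R.
  move=> t Ht. exact: seg_disc.
apply: Rle_trans (SI_bound f c z M _ _) _.
- move=> t Ht. apply: ex_derive_cont. apply: H. exact: sg.
- move=> t Ht. apply: HM. exact: sg.
- apply: Rmult_le_compat_l => //. lra.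
Qed.

Lemma hol_disc_primitive f c R0 : hol_disc f c R0 -> hol_disc (SI f c) c R0.
Proof. move=> H z Hz. eexists. exact: (primitive_disc f c R0 z H Hz). Qed.

(** Picard iteration for y = y0 + T y, where T u is the double primitive of Q u. The radius makes T
    halve the supremum norm and is the same for all initial values. *)
Lemma linear_ode_disc (Q : C -> C) c : hol Q c -> exists rho, (0 < rho)%R /\
  forall a b : C, exists y dy : C -> C, y c = a /\ dy c = b /\
    forall z, (Cmod (z - c) < rho)%R -> is_derive y z (dy z) /\ is_derive dy z (Q z * y z).
Proof.
move=> hQ. have [R0 [R00 HQ]] := hol_disc_of _ _ hQ.
have [R1 [R10 HB]] := proj1 (locallyC _ _) (hol_cont _ _ hQ 1%R Rlt_0_1).
set M := (Cmod (Q c) + 1)%R. have M0 : (1 <= M)%R by rewrite /M; have := Cmod_ge_0 (Q c); lra.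
(* Two applications of [SI_disc_bound] give a norm of at most 4 M rho^2 for T, which is at most 1 /
   2 when rho <= 1 and 8 M rho <= 1. *)
set rho := Rmin (Rmin R0 R1) (Rmin 1 (/ (8 * M))).
have i0 : (0 < / (8 * M))%R by apply: Rinv_0_lt_compat; lra.
have rho0 : (0 < rho)%R by apply: Rmin_pos; apply: Rmin_pos; lra.
have rhoR : (rho <= R0)%R by apply: Rle_trans (Rmin_l _ _) (Rmin_l _ _).
have rhoR1 : (rho <= R1)%R by apply: Rle_trans (Rmin_l _ _) (Rmin_r _ _).
have rho1 : (rho <= 1)%R by apply: Rle_trans (Rmin_r _ _) (Rmin_l _ _).
have rhoM : (rho * (8 * M) <= 1)%R.
  have : (rho <= / (8 * M))%R by apply: Rle_trans (Rmin_r _ _) (Rmin_r _ _).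
  have : (/ (8 * M) * (8 * M) = 1)%R by field; lra. nra.
have QM : forall w, (Cmod (w - c) < rho)%R -> (Cmod (Q w) <= M)%R.
  move=> w Hw. have := HB w ltac:(lra). have := Cmod_sub_ge (Q w) (Q c). rewrite /M. lra.
exists rho. split=> // a b.
have Qd : hol_disc Q c rho by move=> w Hw; apply: HQ; lra.
pose T u := SI (SI (fun z => Q z * u z) c) c.
have Qu : forall u, hol_disc u c rho -> hol_disc (fun z => Q z * u z) c rho.
  move=> u Hu w Hw. eexists. exact: (derive_mult _ _ _ _ _ (C_derive_is _ _ (Qd w Hw)) (C_derive_is _ _ (Hu w Hw))).
have Td : forall u, hol_disc u c rho -> hol_disc (T u) c rho.
  move=> u Hu. apply: hol_disc_primitive. apply: hol_disc_primitive. exact: Qu.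
have Tb : forall u A, hol_disc u c rho -> (0 <= A)%R -> (forall w, (Cmod (w - c) < rho)%R -> (Cmod (u w) <= A)%R) ->
    forall w, (Cmod (w - c) < rho)%R -> (Cmod (T u w) <= A / 2)%R.
  move=> u A Hu A0 HA w Hw.
  have b1 : forall v, (Cmod (v - c) < rho)%R -> (Cmod (SI (fun z => (Q z * u z)%C) c v) <= 2 * (M * A) * rho)%R.
    move=> v Hv. apply: (SI_disc_bound _ c rho) => //; [exact: Qu | lra | nra |].
    move=> x Hx. rewrite Cmod_mult. apply: Rmult_le_compat; try exact: Cmod_ge_0; [exact: QM | exact: HA].
  have p0 : (0 <= 2 * (M * A) * rho)%R by apply: Rmult_le_pos; nra.
  have := SI_disc_bound _ c rho rho _ w (hol_disc_primitive _ _ _ (Qu u Hu)) Hw ltac:(lra) p0 b1.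
  move=> h. apply: Rle_trans h _.
  have : (rho * M * rho <= / 8)%R by nra. nra.
have Tsub : forall u v, hol_disc u c rho -> hol_disc v c rho -> forall w, (Cmod (w - c) < rho)%R ->
    T u w - T v w = T (fun z => u z - v z) w.
  have sd : forall f, hol_disc f c rho -> forall w, (Cmod (w - c) < rho)%R -> cont_seg f c w.
    move=> f Hf w Hw t Ht. apply: ex_derive_cont. apply: Hf. apply: seg_disc => //. by rewrite Cmod_sub_self.
  have sgin : forall w t, (Cmod (w - c) < rho)%R -> (0 <= t <= 1)%R -> (Cmod (seg c w t - c) < rho)%R.
    move=> w t Hw Ht. apply: seg_disc => //. by rewrite Cmod_sub_self.
  move=> u v Hu Hv w Hw. rewrite /T.
  rewrite -(SI_minus (SI (fun z => Q z * u z) c)); last 2 first.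
  - apply: sd => //. apply: hol_disc_primitive. exact: Qu.
  - apply: sd => //. apply: hol_disc_primitive. exact: Qu.
  rewrite /SI. congr (_ * _). apply: I01_ext => t Ht. have Hs := sgin w t Hw Ht.
  rewrite -[LHS](SI_minus (fun z => Q z * u z) (fun z => Q z * v z) c (seg c w t)); last 2 first.
  - apply: sd => //. exact: Qu.
  - apply: sd => //. exact: Qu.
  rewrite /SI. congr (_ * _). apply: I01_ext => s _. ring.
pose y0 z := a + b * (z - c).
have y0d : forall z, is_derive y0 z b.
  move=> z. apply: is_derive_eq (derive_plus _ _ _ _ _ (derive_const a z)
    (derive_scal b _ _ _ (derive_minus _ _ _ _ _ (derive_id z) (derive_const c z)))) _. ring.
pose step u := fun z => y0 z + T u z.
pose Y n := Nat.iter n step y0.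
have Yd : forall n, hol_disc (Y n) c rho.
  elim=> [|n IH] w Hw; first by exists b.
  eexists. exact: (derive_plus _ _ _ _ _ (y0d w) (C_derive_is _ _ (Td _ IH w Hw))).
set A := (Cmod a + Cmod b)%R.
have A0 : (0 <= A)%R by rewrite /A; have := Cmod_ge_0 a; have := Cmod_ge_0 b; lra.
have y0b : forall w, (Cmod (w - c) < rho)%R -> (Cmod (y0 w) <= A)%R.
  move=> w Hw. apply: Rle_trans (Cmod_triangle _ _) _. rewrite Cmod_mult /A.
  have := Cmod_ge_0 b. have := Cmod_ge_0 (w - c). nra.
have pw : forall n, (0 < 2 ^ n)%R by move=> n; apply: pow_lt; lra.
have dY : forall n w, (Cmod (w - c) < rho)%R -> (Cmod (Y (S n) w - Y n w) <= A / 2 ^ n / 2)%R.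
  elim=> [|n IH] w Hw.
    have -> : Y 1%nat w - Y 0%nat w = T y0 w by rewrite /Y /= /step; ring.
    have := Tb y0 A (Yd 0%nat) A0 y0b w Hw. rewrite /=. lra.
  have -> : Y (S (S n)) w - Y (S n) w = T (Y (S n)) w - T (Y n) w.
    rewrite /Y /= /step /=. ring.
  rewrite Tsub //. have -> : (A / 2 ^ S n / 2 = (A / 2 ^ n / 2) / 2)%R by rewrite /=; field; have := pw n; lra.
  apply: Tb => //.
  - move=> v Hv. eexists. exact: (derive_minus _ _ _ _ _ (C_derive_is _ _ (Yd (S n) v Hv)) (C_derive_is _ _ (Yd n v Hv))).
  - have : (0 <= / 2 ^ n)%R by left; apply: Rinv_0_lt_compat; exact: pw. rewrite /Rdiv. nra.
have lim : forall w, exists l, (Cmod (w - c) < rho)%R -> forall n, (Cmod (Y n w - l) <= A / 2 ^ n)%R.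
  move=> w. case: (Rlt_dec (Cmod (w - c)) rho) => Hw; last by exists (RtoC 0).
  have [l [Hl _]] : exists l, (forall n, (Cmod (Y n w - l) <= A / 2 ^ n)%R) /\ flim eventually (fun n => Y n w) l.
    apply: (C_complete_seq (fun n => Y n w)).
      move=> n k. have : (Cmod (Y (n + k)%nat w - Y n w) <= A / 2 ^ n - A / 2 ^ (n + k))%R.
        elim: k => [|k IH].
          rewrite Nat.add_0_r Cmod_sub_self; lra.
        have := dY (n + k)%nat w Hw. have -> : (n + S k = S (n + k))%nat by lia.
        have := Cmod_sub_tri (Y (S (n + k)) w) (Y (n + k)%nat w) (Y n w).
        have -> : (A / 2 ^ S (n + k) = A / 2 ^ (n + k) / 2)%R by rewrite /=; field; have := pw (n + k)%nat; lra.
        lra.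
      have : (0 <= A / 2 ^ (n + k))%R by apply: Rmult_le_pos => //; left; apply: Rinv_0_lt_compat; exact: pw.
      lra.
    apply: (is_lim_seq_ext (fun n => A * (/2) ^ n)%R); first by move=> n; rewrite pow_inv.
    have -> : Finite 0 = Rbar_mult A 0 by rewrite /= Rmult_0_r.
    apply: is_lim_seq_scal_l. apply: is_lim_seq_geom. rewrite Rabs_pos_eq; lra.
  by exists l.
(* The limit is chosen pointwise; outside the disc its value is arbitrary. *)
pose y w := epsilon (inhabits (RtoC 0)) (fun l => (Cmod (w - c) < rho)%R -> forall n, (Cmod (Y n w - l) <= A / 2 ^ n)%R).
have Hy : forall n w, (Cmod (w - c) < rho)%R -> (Cmod (Y n w - y w) <= A / 2 ^ n)%R.
  move=> n w Hw. exact: (epsilon_spec (inhabits (RtoC 0)) _ (lim w) Hw n).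
have elim0 : is_lim_seq (fun n => A / 2 ^ n)%R 0.
  apply: (is_lim_seq_ext (fun n => A * (/2) ^ n)%R); first by move=> n; rewrite pow_inv.
  have -> : Finite 0 = Rbar_mult A 0 by rewrite /= Rmult_0_r.
  apply: is_lim_seq_scal_l. apply: is_lim_seq_geom. rewrite Rabs_pos_eq; lra.
have yd : hol_disc y c rho by exact: (hol_uniform_limit Y y _ c rho Yd Hy elim0).
have fix_y : forall w, (Cmod (w - c) < rho)%R -> y w = y0 w + T y w.
  move=> w Hw. apply/Ceq_minus. apply: Cmod_eq_0. apply: Rle_antisym; last exact: Cmod_ge_0.
  have B : forall n, (Cmod (y w - (y0 w + T y w)) <= A / 2 ^ n)%R.
    move=> n.
    have := Cmod_sub_tri (y w) (Y (S n) w) (y0 w + T y w).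
    have -> : Y (S n) w - (y0 w + T y w) = T (Y n) w - T y w by rewrite /Y /= /step; ring.
    rewrite (Tsub (Y n) y (Yd n) yd w Hw) (Cmod_sub_sym (y w) (Y (S n) w)). have := Hy (S n) w Hw.
    have An : (0 <= A / 2 ^ n)%R by apply: Rmult_le_pos => //; left; apply: Rinv_0_lt_compat; exact: pw.
    have := Tb (fun z => Y n z - y z) (A / 2 ^ n)%R _ An (Hy n) w Hw.
    have -> : (A / 2 ^ S n = A / 2 ^ n / 2)%R by rewrite /=; field; have := pw n; lra.
    move=> h. have := h _. move=> /(_ (fun v Hv => ex_intro _ _ (derive_minus _ _ _ _ _ (C_derive_is _ _ (Yd n v Hv)) (C_derive_is _ _ (yd v Hv))))).
    lra.
  apply: (@is_lim_seq_le (fun _ => Cmod (y w - (y0 w + T y w))) _ (Cmod (y w - (y0 w + T y w))) 0 B) => //.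
  exact: is_lim_seq_const.
pose dy z := b + SI (fun z => Q z * y z) c z.
have cc : (Cmod (c - c) < rho)%R by rewrite Cmod_sub_self.
exists y, dy. split; [|split].
- rewrite fix_y // /y0 /T SI_self. ring.
- rewrite /dy SI_self. ring.
- move=> z Hz. split.
  + apply: (derive_ext_near (fun w => y0 w + T y w)).
      apply: filter_imp (locally_disc _ _ _ Hz) => w Hw. by rewrite fix_y.
    apply: (derive_plus _ _ _ _ _ (y0d z)).
    exact: (primitive_disc _ c rho z (hol_disc_primitive _ _ _ (Qu y yd)) Hz).
  + apply: is_derive_eq (derive_plus _ _ _ _ _ (derive_const b z) (primitive_disc _ c rho z (Qu y yd) Hz)) _. ring.
Qed.

(** * Exponential and square root *)

Definition cexp (z : C) : C := exp (Re z) * (cos (Im z), sin (Im z)).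

Lemma cexp_plus z w : cexp (z + w) = cexp z * cexp w.
Proof.
rewrite /cexp re_plus im_plus exp_plus cos_plus sin_plus RtoC_mult.
rewrite /Cmult /=. congr pair; ring.
Qed.

Lemma cexp_0 : cexp 0 = 1.
Proof. rewrite /cexp re_RtoC im_RtoC exp_0 cos_0 sin_0 /Cmult /=. congr pair; ring. Qed.

Lemma cexp_neq0 z : cexp z <> 0.
Proof.
move=> E. have := cexp_plus z (- z). rewrite E. have -> : z + - z = 0 by ring. rewrite cexp_0.
have -> : 0 * cexp (- z) = 0 by ring. exact: C1_nz.
Qed.

Lemma rder_cexp_ray (h : C) t : rder (fun s => cexp (s * h)) t (h * cexp (t * h)).
Proof.
have -> : (fun s : R => cexp (s * h)) = (fun s : R => ((exp (s * Re h) * cos (s * Im h))%R, (exp (s * Re h) * sin (s * Im h))%R) : C).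
  apply: functional_extensionality => s. rewrite /cexp re_scal_l im_scal_l /Cmult /=. congr pair; ring.
have -> : h * cexp (t * h) = ((Re h * (exp (t * Re h) * cos (t * Im h)) - Im h * (exp (t * Re h) * sin (t * Im h)))%R,
   (Re h * (exp (t * Re h) * sin (t * Im h)) + Im h * (exp (t * Re h) * cos (t * Im h)))%R).
  rewrite /cexp re_scal_l im_scal_l. case: h => x y. rewrite /Cmult /=. congr pair; ring.
apply: rder_pair; auto_derive => //; ring.
Qed.

Lemma cexp_cont0 : flim (locally (RtoC 0)) cexp 1.
Proof.
have rc : forall (g : R -> R) (p : C -> R), continuity_pt g 0 -> (forall z, (Rabs (p z) <= Cmod z)%R) ->
    flim (locally (RtoC 0)) (fun z => RtoC (g (p z))) (g 0%R).
  move=> g p gc Hp eps e0. have [d [d0 Hd]] := gc eps e0.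
  apply/locallyC. exists d. split=> // w Hw. have ww : w - 0 = w by ring. rewrite ww in Hw.
  rewrite -RtoC_minus Cmod_R.
  case: (Req_EM_T (p w) 0) => [-> | ne]; first by rewrite Rminus_diag Rabs_R0.
  apply: Hd. split; first by split => //; apply/not_eq_sym.
  rewrite /= /Rdist Rminus_0_r. have := Hp w. lra.
have -> : RtoC 1 = exp 0 * (cos 0 + Ci * sin 0) by rewrite exp_0 cos_0 sin_0; ring.
apply: (flim_ext _ (fun z => exp (Re z) * (cos (Im z) + Ci * sin (Im z)))).
  apply: filter_forall => z. rewrite /cexp /Ci /Cmult /Cplus /=. congr pair; ring.
apply: flim_mult.
  apply: (rc exp Re); last exact: re_le_Cmod. apply: derivable_continuous_pt. exact: derivable_pt_exp.
apply: flim_plus.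
  apply: (rc cos Im); last exact: Im_le_Cmod. exact: continuity_cos.
apply: flim_mult; first exact: flim_const.
apply: (rc sin Im); last exact: Im_le_Cmod. exact: continuity_sin.
Qed.

(** At 0 the slope is the integral of [cexp] (t h) over the unit interval, which tends to 1; the
    addition formula moves this to z. *)
Lemma derive_cexp z : is_derive cexp z (cexp z).
Proof.
have d0 : is_derive cexp (RtoC 0) (RtoC 1).
  apply: (derive_carath_near _ (fun h => I01 (fun t => cexp (t * h)))).
  - apply: filter_forall => h. rewrite cexp_0.
    have -> : h - 0 = h by ring.
    have cc : cont01 (fun t => cexp (t * h)) by move=> t _; exact: rder_cont (rder_cexp_ray h t).
    rewrite -I01_scal // (I01_derive (fun t => cexp (t * h))).
    + have -> : RtoC 1 * h = h by ring. have -> : RtoC 0 * h = 0 by ring. rewrite cexp_0. ring.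
    + move=> t _. exact: rder_cexp_ray.
    + exact: cont01_scal.
  - move=> eps e0. have e4 : (0 < eps / 4)%R by lra.
    have [d [dp Hd]] := proj1 (locallyC _ _) (cexp_cont0 _ e4).
    apply/locallyC. exists d. split=> // h Hh. have hh : h - 0 = h by ring. rewrite hh in Hh.
    have cc : cont01 (fun t => cexp (t * h)) by move=> t _; exact: rder_cont (rder_cexp_ray h t).
    have c1 : cont01 (fun _ => RtoC 1) by move=> t _; exact: flim_const.
    rewrite -(I01_const 1) -I01_minus //.
    apply: Rle_lt_trans (I01_bound _ (eps / 4)%R (cont01_minus _ _ cc c1) _) _; last lra.
    move=> t Ht. left. apply: Hd. have -> : t * h - 0 = t * h by ring.
    rewrite Cmod_mult Cmod_01; last lra. have := Cmod_ge_0 h. nra.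
apply: (derive_ext_near (fun w => cexp z * cexp (w + - z))).
  apply: filter_forall => w. rewrite -cexp_plus. congr cexp. ring.
apply: is_derive_eq (derive_scal (cexp z) _ _ _ (derive_shift cexp z (- z) 1 _)) _; last ring.
by have -> : z + - z = 0 by ring.
Qed.

Lemma C_sqrt_exists (z : C) : exists w, w ^ 2 = z.
Proof.
case: z => x y. set r := Cmod (x, y).
have r2 : (r * r = x * x + y * y)%R.
  have := sqrt_sqrt (x ^ 2 + y ^ 2) ltac:(nra). rewrite /r /Cmod /=. nra.
have r0 : (0 <= r)%R by exact: Cmod_ge_0.
have xr : (- r <= x <= r)%R.
  split.
  - apply: Rnot_lt_le => h. nra.
  - apply: Rnot_lt_le => h. nra.
set a := sqrt ((r + x) / 2). set b := sqrt ((r - x) / 2).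
have a2 : (a * a = (r + x) / 2)%R by apply: sqrt_sqrt; lra.
have b2 : (b * b = (r - x) / 2)%R by apply: sqrt_sqrt; lra.
have a0 : (0 <= a)%R by exact: sqrt_pos. have b0 : (0 <= b)%R by exact: sqrt_pos.
have ab : (2 * (a * b) = Rabs y)%R.
  apply: Rsqr_inj; [nra | exact: Rabs_pos |]. rewrite -Rsqr_abs /Rsqr.
  have -> : (2 * (a * b) * (2 * (a * b)) = 4 * (a * a) * (b * b))%R by ring. rewrite a2 b2. nra.
case: (Rle_dec 0 y) => h.
- exists (a, b). rewrite Rabs_pos_eq // in ab. rewrite /= /Cmult /=. congr pair; nra.
- exists (a, (- b)%R). rewrite Rabs_left in ab; last lra. rewrite /= /Cmult /=. congr pair; nra.
Qed.

End HolomorphicLimits.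

(** * Analytic continuation *)

Section LocalSolutions.
Implicit Types (y v : C -> C) (g : R -> C).

Lemma path_near g t (P : C -> Prop) : continuous_on unit_itv g -> (0 <= t <= 1)%R ->
  locally (g t) P -> exists d, (0 < d)%R /\
  forall s, (0 <= s <= 1)%R -> (Rabs (s - t) < d)%R -> P (g s).
Proof.
move=> Hg Ht HP. have /locallyR [d [d0 Hd]] := Hg t Ht P HP.
exists d. split=> // s Hs As. exact: Hd.
Qed.

Lemma germ_refl a f : germ_eq a f f.
Proof. exact: filter_forall. Qed.

Lemma germ_sym a f1 f2 : germ_eq a f1 f2 -> germ_eq a f2 f1.
Proof. move=> H. by apply: locallyC_imp H => z ->. Qed.

Lemma germ_trans a f1 f2 f3 : germ_eq a f1 f2 -> germ_eq a f2 f3 -> germ_eq a f1 f3.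
Proof. move=> H1 H2. by apply: locallyC_imp (filter_and _ _ H1 H2) => z [-> ->]. Qed.

Lemma germ_near a f1 f2 : germ_eq a f1 f2 -> locally a (fun z : C => germ_eq z f1 f2).
Proof. exact: locally_locallyC. Qed.

Lemma germ_derive a f1 f2 : hol f1 a -> germ_eq a f1 f2 -> germ_eq a (C_derive f1) (C_derive f2).
Proof.
move=> H /germ_near E. apply: locallyC_imp (filter_and _ _ H E) => z [h1 h2].
exact: C_derive_ext_near.
Qed.

Lemma continuation_local_t (A B : R -> Prop) t :
  locally t (fun s => unit_itv s -> A s) -> locally t (fun s => unit_itv s -> B s) ->
  exists d, (0 < d)%R /\ forall s, (0 <= s <= 1)%R -> (Rabs (s - t) < d)%R -> A s /\ B s.
Proof.
move=> /locallyR [d [d0 Hd]] /locallyR [e [e0 He]].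
exists (Rmin d e). split; first exact: Rmin_pos. move=> s Hs As. split.
- apply: Hd => //. exact: Rlt_le_trans As (Rmin_l _ _).
- apply: He => //. exact: Rlt_le_trans As (Rmin_r _ _).
Qed.

(** On a disc about g t in which both germs at t are holomorphic, the identity theorem carries
    equality from one nearby point of the path to another. *)
Lemma ac_unique g y1 y2 v1 v2 : continuous_on unit_itv g ->
  analytic_continuation g y1 v1 -> analytic_continuation g y2 v2 ->
  germ_eq (g 0%R) y1 y2 -> germ_eq (g 1%R) v1 v2.
Proof.
move=> Hg [F [F1 [F2 [F3 F4]]]] [G [G1 [G2 [G3 G4]]]] E.
suff : germ_eq (g 1%R) (F 1%R) (G 1%R).
  move=> h. apply: germ_trans (germ_sym _ _ _ F4) _. exact: germ_trans h G4.
apply: (propagation01 (fun t => germ_eq (g t) (F t) (G t))); last lra.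
  apply: germ_trans F3 _. apply: germ_trans E _. exact: germ_sym.
move=> t Ht.
have [r [r0 Hr]] := hol_disc_of _ _ (hol_minus _ _ _ (F1 t Ht) (G1 t Ht)).
have near : locally (g t) (fun z : C => (Cmod (z - g t) < r)%R).
  apply: locally_disc. by rewrite Cmod_sub_self.
have [d1 [d10 H1]] := path_near g t _ Hg Ht near.
have [d2 [d20 H2]] := continuation_local_t _ _ _ (F2 t Ht) (G2 t Ht).
exists (Rmin d1 d2). split; first exact: Rmin_pos.
move=> s s' Hs Hs' As As' _ Ps.
have [Fs Gs] := H2 s Hs (Rlt_le_trans _ _ _ As (Rmin_r _ _)).
have [Fs' Gs'] := H2 s' Hs' (Rlt_le_trans _ _ _ As' (Rmin_r _ _)).
have ns := H1 s Hs (Rlt_le_trans _ _ _ As (Rmin_l _ _)).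
have ns' := H1 s' Hs' (Rlt_le_trans _ _ _ As' (Rmin_l _ _)).
have Z : locally (g s) (fun z => F t z - G t z = 0).
  have := germ_trans _ _ _ _ (germ_sym _ _ _ Fs) (germ_trans _ _ _ _ Ps Gs).
  apply: locallyC_imp => z ->. ring.
have V := identity_disc _ (g t) r (g s) Hr ns Z.
apply: germ_trans Fs' _. apply: germ_trans (germ_sym _ _ _ Gs').
apply: locallyC_imp (locally_disc _ _ _ ns') => z Hz. apply/Ceq_minus. exact: V.
Qed.

Lemma ac_global g y : (forall t, (0 <= t <= 1)%R -> hol y (g t)) -> analytic_continuation g y y.
Proof.
move=> H. exists (fun _ => y). split; [|split; [|split]] => //; try exact: germ_refl.
move=> t Ht. apply: filter_forall => s _. exact: germ_refl.
Qed.

Lemma ac_ext g y y' v v' : germ_eq (g 0%R) y y' -> germ_eq (g 1%R) v v' ->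
  analytic_continuation g y v -> analytic_continuation g y' v'.
Proof.
move=> E0 E1 [F [F1 [F2 [F3 F4]]]]. exists F. split; [|split; [|split]] => //.
- exact: germ_trans F3 E0.
- exact: germ_trans F4 E1.
Qed.

Lemma ac_lift2 (op : C -> C -> C) g y1 y2 v1 v2 :
  (forall f1 f2 a, hol f1 a -> hol f2 a -> hol (fun z => op (f1 z) (f2 z)) a) ->
  analytic_continuation g y1 v1 -> analytic_continuation g y2 v2 ->
  analytic_continuation g (fun z => op (y1 z) (y2 z)) (fun z => op (v1 z) (v2 z)).
Proof.
move=> Hop [F [F1 [F2 [F3 F4]]]] [G [G1 [G2 [G3 G4]]]].
have lift : forall a f1 f2 h1 h2, germ_eq a f1 h1 -> germ_eq a f2 h2 ->
    germ_eq a (fun z => op (f1 z) (f2 z)) (fun z => op (h1 z) (h2 z)).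
  move=> a f1 f2 h1 h2 E1 E2. by apply: locallyC_imp (filter_and _ _ E1 E2) => z [-> ->].
exists (fun t z => op (F t z) (G t z)). split; [|split; [|split]].
- move=> t Ht. apply: Hop; [exact: F1 | exact: G1].
- move=> t Ht. apply: filter_imp (filter_and _ _ (F2 t Ht) (G2 t Ht)) => s [h1 h2] Hs.
  apply: lift; [exact: h1 | exact: h2].
- exact: lift.
- exact: lift.
Qed.

Lemma ac_plus g y1 y2 v1 v2 : analytic_continuation g y1 v1 -> analytic_continuation g y2 v2 ->
  analytic_continuation g (fun z => y1 z + y2 z) (fun z => v1 z + v2 z).
Proof. apply: ac_lift2 => f1 f2 a. exact: hol_plus. Qed.

Lemma ac_minus g y1 y2 v1 v2 : analytic_continuation g y1 v1 -> analytic_continuation g y2 v2 ->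
  analytic_continuation g (fun z => y1 z - y2 z) (fun z => v1 z - v2 z).
Proof. apply: ac_lift2 => f1 f2 a. exact: hol_minus. Qed.

Lemma ac_mult g y1 y2 v1 v2 : analytic_continuation g y1 v1 -> analytic_continuation g y2 v2 ->
  analytic_continuation g (fun z => y1 z * y2 z) (fun z => v1 z * v2 z).
Proof. apply: ac_lift2 => f1 f2 a. exact: hol_mult. Qed.

Lemma ac_derive g y v : continuous_on unit_itv g ->
  analytic_continuation g y v -> analytic_continuation g (C_derive y) (C_derive v).
Proof.
move=> Hg [F [F1 [F2 [F3 F4]]]]. exists (fun t => C_derive (F t)). split; [|split; [|split]].
- move=> t Ht. apply: hol_derive. exact: F1.
- move=> t Ht. apply: filter_imp (F2 t Ht) => s h Hs. apply: germ_derive; [exact: F1 | exact: h].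
- apply: germ_derive => //. apply: F1. rewrite /unit_itv; lra.
- apply: germ_derive => //. apply: F1. rewrite /unit_itv; lra.
Qed.

Lemma ac_hol_end g y v : analytic_continuation g y v -> hol v (g 1%R).
Proof.
move=> [F [F1 [F2 [F3 F4]]]]. apply: hol_ext F4 _. apply: F1. rewrite /unit_itv; lra.
Qed.

(** * Local solutions *)

Lemma local_solution_derive (Q : C -> C) a y : local_solution Q a y <->
  locally a (fun z : C => is_derive y z (C_derive y z) /\ is_derive (C_derive y) z (Q z * y z)).
Proof.
split; last by move=> H; exists (C_derive y).
move=> [dy H].
have E : locally a (fun z : C => dy z = C_derive y z).
  apply: locallyC_imp H => z [h _]. by rewrite (is_C_derive_unique _ _ _ h).
apply: locallyC_imp (filter_and _ _ H (germ_near _ _ _ E)) => z [[h1 h2] h3]. split.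
- by have := locally_singleton _ _ h3; rewrite /= => <-.
- exact: derive_ext_near h3 h2.
Qed.

Lemma local_solution_hol (Q : C -> C) a y : local_solution Q a y -> hol y a.
Proof. move=> [dy H]. apply: locallyC_imp H => z [h _]. by exists (dy z). Qed.

Lemma local_solution_ext (Q : C -> C) a y y' : germ_eq a y y' -> local_solution Q a y -> local_solution Q a y'.
Proof.
move=> E [dy H]. exists dy. apply: locallyC_imp (filter_and _ _ H (germ_near _ _ _ E)) => z [[h1 h2] h3].
split; first exact: derive_ext_near h3 h1.
by have <- := locally_singleton _ _ h3.
Qed.

Lemma local_solution_lin (Q : C -> C) a y1 y2 (c1 c2 : C) : local_solution Q a y1 -> local_solution Q a y2 ->
  local_solution Q a (fun z => c1 * y1 z + c2 * y2 z).
Proof.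
move=> [d1 H1] [d2 H2]. exists (fun z => c1 * d1 z + c2 * d2 z).
apply: locallyC_imp (filter_and _ _ H1 H2) => z [[h1 h1'] [h2 h2']]. split.
- apply: derive_plus; exact: derive_scal.
- have -> : Q z * (c1 * y1 z + c2 * y2 z) = c1 * (Q z * y1 z) + c2 * (Q z * y2 z) by ring.
  apply: derive_plus; exact: derive_scal.
Qed.

Definition wronskian y1 y2 (z : C) : C := y1 z * C_derive y2 z - C_derive y1 z * y2 z.

Lemma wronskian_derive (Q : C -> C) y1 y2 z :
  is_derive y1 z (C_derive y1 z) -> is_derive (C_derive y1) z (Q z * y1 z) ->
  is_derive y2 z (C_derive y2 z) -> is_derive (C_derive y2) z (Q z * y2 z) ->
  is_derive (wronskian y1 y2) z (RtoC 0).
Proof.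
move=> h1 h1' h2 h2'.
apply: is_derive_eq (derive_minus _ _ _ _ _ (derive_mult _ _ _ _ _ h1 h2') (derive_mult _ _ _ _ _ h1' h2)) _.
ring.
Qed.

Lemma derive_zero_near (f : C -> C) a : locally a (fun z : C => is_derive f z (RtoC 0)) ->
  locally a (fun z : C => f z = f a).
Proof.
move=> /locallyC [d [d0 Hd]]. apply/locallyC. exists d. split=> // w Hw.
exact: (derive_zero_disc f a d Hd).
Qed.

Lemma wronskian_const (Q : C -> C) a y1 y2 : local_solution Q a y1 -> local_solution Q a y2 ->
  locally a (fun z : C => wronskian y1 y2 z = wronskian y1 y2 a).
Proof.
move=> /local_solution_derive H1 /local_solution_derive H2. apply: derive_zero_near.
apply: locallyC_imp (filter_and _ _ H1 H2) => z [[h1 h1'] [h2 h2']].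
exact: (wronskian_derive Q).
Qed.

Lemma solution_span (Q : C -> C) a y1 y2 y : local_solution Q a y1 -> local_solution Q a y2 ->
  wronskian y1 y2 a <> 0 -> local_solution Q a y ->
  germ_eq a y (fun z => wronskian y y2 a / wronskian y1 y2 a * y1 z + wronskian y1 y a / wronskian y1 y2 a * y2 z).
Proof.
move=> H1 H2 W0 H.
apply: locallyC_imp (filter_and _ _ (wronskian_const Q a y1 y2 H1 H2)
  (filter_and _ _ (wronskian_const Q a y y2 H H2) (wronskian_const Q a y1 y H1 H))) => z [e1 [e2 e3]].
rewrite -e1 in W0 *. rewrite -e2 -e3. rewrite /wronskian in W0 *. by field.
Qed.

(** Uniqueness follows from existence: y is a combination of solutions with initial data (1, 0) and
    (0, 1), and its coefficients are Wronskians that vanish with the data of y. *)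
Lemma solution_zero (Q : C -> C) a y : hol Q a -> local_solution Q a y ->
  y a = 0 -> C_derive y a = 0 -> germ_eq a y (fun _ => RtoC 0).
Proof.
move=> hQ Hy y0 y1. have [rho [rho0 ex]] := linear_ode_disc Q a hQ.
have [u1 [d1 [i1 [j1 S1]]]] := ex 1 0. have [u2 [d2 [i2 [j2 S2]]]] := ex 0 1.
have aa : (Cmod (a - a) < rho)%R by rewrite Cmod_sub_self.
have L1 : local_solution Q a u1.
  exists d1. apply: locallyC_imp (locally_disc _ _ _ aa). exact: S1.
have L2 : local_solution Q a u2.
  exists d2. apply: locallyC_imp (locally_disc _ _ _ aa). exact: S2.
have D1 : C_derive u1 a = 0 by rewrite -j1; exact: is_C_derive_unique (proj1 (S1 a aa)).
have D2 : C_derive u2 a = 1 by rewrite -j2; exact: is_C_derive_unique (proj1 (S2 a aa)).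
have W : wronskian u1 u2 a = 1 by rewrite /wronskian i1 i2 D1 D2; ring.
have W0 : wronskian u1 u2 a <> 0 by rewrite W; exact: C1_nz.
apply: germ_trans (solution_span Q a u1 u2 y L1 L2 W0 Hy) _.
apply: filter_forall => z. rewrite W /wronskian y0 y1. by field.
Qed.

Lemma solution_pair (Q : C -> C) a : hol Q a ->
  exists u1 u2, local_solution Q a u1 /\ local_solution Q a u2 /\ wronskian u1 u2 a = 1.
Proof.
move=> hQ. have [rho [rho0 ex]] := linear_ode_disc Q a hQ.
have [u1 [d1 [i1 [j1 S1]]]] := ex 1 0. have [u2 [d2 [i2 [j2 S2]]]] := ex 0 1.
have aa : (Cmod (a - a) < rho)%R by rewrite Cmod_sub_self.
exists u1, u2. split; [|split].
- exists d1. apply: locallyC_imp (locally_disc _ _ _ aa). exact: S1.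
- exists d2. apply: locallyC_imp (locally_disc _ _ _ aa). exact: S2.
- have D1 : C_derive u1 a = 0 by rewrite -j1; exact: is_C_derive_unique (proj1 (S1 a aa)).
  have D2 : C_derive u2 a = 1 by rewrite -j2; exact: is_C_derive_unique (proj1 (S2 a aa)).
  rewrite /wronskian i1 i2 D1 D2. ring.
Qed.

Lemma wronskian_neq0 (Q : C -> C) a y1 y2 : hol Q a -> local_solution Q a y1 -> local_solution Q a y2 ->
  lin_indep a y1 y2 -> wronskian y1 y2 a <> 0.
Proof.
move=> hQ H1 H2 LI W. rewrite /wronskian in W.
have ed : forall c1 c2 : C, C_derive (fun z => c1 * y1 z + c2 * y2 z) a = c1 * C_derive y1 a + c2 * C_derive y2 a.
  move=> c1 c2. apply: is_C_derive_unique. apply: derive_plus; apply: derive_scal; apply: C_derive_is;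
   apply: hol_ex_derive; [exact: local_solution_hol H1 | exact: local_solution_hol H2].
have dep : forall c1 c2 : C, c1 * y1 a + c2 * y2 a = 0 -> c1 * C_derive y1 a + c2 * C_derive y2 a = 0 ->
    c1 = 0 /\ c2 = 0.
  move=> c1 c2 e1 e2. apply: LI.
  apply: (solution_zero Q) => //; first exact: local_solution_lin. by rewrite ed.
(* With zero Wronskian the rows of its matrix are linear relations between y1 and y2; independence
   makes all four entries vanish, and then y1 itself is zero. *)
have [h1 h2] := dep (y2 a) (- y1 a) ltac:(ring)
  ltac:(transitivity (- (y1 a * C_derive y2 a - C_derive y1 a * y2 a)); [ring | rewrite W; ring]).
have [h3 h4] := dep (C_derive y2 a) (- C_derive y1 a) ltac:(rewrite -W; ring) ltac:(ring).
have y1a : y1 a = 0 by (have -> : y1 a = - - y1 a by ring); rewrite h2; ring.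
have [h5 _] := dep 1 0 ltac:(rewrite y1a; ring)
  ltac:((have -> : C_derive y1 a = - - C_derive y1 a by ring); rewrite h4; ring).
exact: C1_nz h5.
Qed.

(** Permanence of the equation: y'' - Q y continues along g to v'' - Q v, and also to 0. *)
Lemma ac_solution g y v (Q : C -> C) : continuous_on unit_itv g ->
  (forall t, (0 <= t <= 1)%R -> hol Q (g t)) -> analytic_continuation g y v ->
  local_solution Q (g 0%R) y -> local_solution Q (g 1%R) v.
Proof.
move=> Hg HQ H Hy.
have A2 := ac_derive _ _ _ Hg (ac_derive _ _ _ Hg H).
have AQ := ac_minus _ _ _ _ _ A2 (ac_mult _ _ _ _ _ (ac_global g Q HQ) H).
have A0 : analytic_continuation g (fun _ => RtoC 0) (fun _ => RtoC 0) by apply: ac_global => t Ht; exact: hol_const.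
have E := ac_unique _ _ _ _ _ Hg AQ A0.
have {}E : germ_eq (g 1%R) (fun z => C_derive (C_derive v) z - Q z * v z) (fun _ => RtoC 0).
  apply: E. move: Hy => /local_solution_derive Hy. apply: locallyC_imp Hy => z [_ h].
  rewrite (is_C_derive_unique _ _ _ h). ring.
have hv := ac_hol_end _ _ _ H. have hdv := hol_derive _ _ hv.
apply/local_solution_derive.
apply: locallyC_imp (filter_and _ _ E (filter_and _ _ (hol_is_derive _ _ hv) (hol_is_derive _ _ hdv))) => z [e [h1 h2]].
split=> //. apply: is_derive_eq h2 _. apply/Ceq_minus. exact: e.
Qed.

Lemma solution_disc_extend (Q : C -> C) c rho :
  (forall a b : C, exists y dy : C -> C, y c = a /\ dy c = b /\
    forall z : C, (Cmod (z - c) < rho)%R -> is_derive y z (dy z) /\ is_derive dy z (Q z * y z)) ->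
  forall z1 y, (Cmod (z1 - c) < rho)%R -> local_solution Q z1 y ->
  exists Y, germ_eq z1 y Y /\ forall z, (Cmod (z - c) < rho)%R -> local_solution Q z Y.
Proof.
move=> ex z1 y Hz1 Hy.
have [u1 [d1 [i1 [j1 S1]]]] := ex 1 0. have [u2 [d2 [i2 [j2 S2]]]] := ex 0 1.
have cc : (Cmod (c - c) < rho)%R by rewrite Cmod_sub_self; exact: radius_pos Hz1.
have L1 : forall z, (Cmod (z - c) < rho)%R -> local_solution Q z u1.
  move=> z Hz. exists d1. apply: locallyC_imp (locally_disc _ _ _ Hz). exact: S1.
have L2 : forall z, (Cmod (z - c) < rho)%R -> local_solution Q z u2.
  move=> z Hz. exists d2. apply: locallyC_imp (locally_disc _ _ _ Hz). exact: S2.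
have D1 : C_derive u1 c = 0 by rewrite -j1; exact: is_C_derive_unique (proj1 (S1 c cc)).
have D2 : C_derive u2 c = 1 by rewrite -j2; exact: is_C_derive_unique (proj1 (S2 c cc)).
have W : wronskian u1 u2 z1 = 1.
  rewrite (derive_zero_disc (wronskian u1 u2) c rho _ z1 Hz1); first by rewrite /wronskian i1 i2 D1 D2; ring.
  move=> w Hw.
  have [h1 h1'] := locally_singleton _ _ (proj1 (local_solution_derive _ _ _) (L1 w Hw)).
  have [h2 h2'] := locally_singleton _ _ (proj1 (local_solution_derive _ _ _) (L2 w Hw)).
  exact: (wronskian_derive Q).
have W0 : wronskian u1 u2 z1 <> 0 by rewrite W; exact: C1_nz.
eexists. split; first exact: (solution_span Q z1 u1 u2 y (L1 z1 Hz1) (L2 z1 Hz1) W0 Hy).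
move=> z Hz. apply: local_solution_lin; [exact: L1 | exact: L2].
Qed.

(** Around each g t all initial value problems are solved on one common disc, so a germ met in that
    disc extends to all of it and continuation never stops. *)
Lemma ac_exists g y (Q : C -> C) : continuous_on unit_itv g ->
  (forall t, (0 <= t <= 1)%R -> hol Q (g t)) -> local_solution Q (g 0%R) y ->
  exists v, analytic_continuation g y v.
Proof.
move=> Hg HQ Hy.
pose P t := exists F : R -> C -> C,
  (forall s, (0 <= s <= t)%R -> local_solution Q (g s) (F s)) /\
  (forall s, (0 <= s <= t)%R -> exists d, (0 < d)%R /\
     forall s', (0 <= s' <= t)%R -> (Rabs (s' - s) < d)%R -> germ_eq (g s') (F s') (F s)) /\
  germ_eq (g 0%R) (F 0%R) y.
suff : P 1%R.
  move=> [F [F1 [F2 F3]]]. exists (F 1%R). exists F. split; [|split; [|split]] => //.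
  - move=> t Ht. exact: local_solution_hol (F1 t Ht).
  - move=> t Ht. have [d [d0 Hd]] := F2 t Ht. apply/locallyR. exists d. split=> // s As Hs. exact: Hd.
  - exact: germ_refl.
apply: propagation01; last lra.
  exists (fun _ => y). split; [|split].
  - move=> s Hs. by have -> : s = 0%R by lra.
  - move=> s Hs. exists 1%R. split; first lra. move=> s' _ _. exact: germ_refl.
  - exact: germ_refl.
move=> t Ht. have [rho [rho0 ex]] := linear_ode_disc Q (g t) (HQ t Ht).
have near : locally (g t) (fun z : C => (Cmod (z - g t) < rho)%R).
  apply: locally_disc. by rewrite Cmod_sub_self.
have [d [d0 Hd]] := path_near g t _ Hg Ht near.
exists d. split=> // s s' Hs Hs' As As' ss' [F [F1 [F2 F3]]].
have [Y [EY HY]] := solution_disc_extend Q (g t) rho ex (g s) (F s) (Hd s Hs As) (F1 s ltac:(lra)).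
have inr : forall r, (s <= r <= s')%R -> (Cmod (g r - g t) < rho)%R.
  move=> r Hr. apply: Hd; first lra. move: As As' => /Rabs_def2 As /Rabs_def2 As'. apply: Rabs_def1; lra.
have FE : forall r, (r <= s)%R -> (if Rle_dec r s then F r else Y) = F r.
  move=> r Hr. by case: (Rle_dec r s).
have YE : forall r, (s < r)%R -> (if Rle_dec r s then F r else Y) = Y.
  move=> r Hr. case: (Rle_dec r s) => h //=. lra.
(* Beyond s the single function Y continues the chain; at s it has the same germ as F s, which gives
   compatibility on both sides. *)
exists (fun r => if Rle_dec r s then F r else Y). split; [|split].
- move=> r Hr. case: (Rle_dec r s) => h /=; first by apply: F1; lra. apply: HY. apply: inr. lra.
- move=> r Hr. case: (Rlt_le_dec s r) => h; first last; last first.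
    exists (r - s)%R. split; first lra. move=> r' Hr' /Rabs_def2 Ar. rewrite !YE; try lra. exact: germ_refl.
  case: (Rlt_le_dec r s) => h'.
    have [e [e0 He]] := F2 r ltac:(lra). exists (Rmin e (s - r)). split; first by apply: Rmin_pos => //; lra.
    move=> r' Hr' Ar. have a1 := Rlt_le_trans _ _ _ Ar (Rmin_l _ _).
    have /Rabs_def2 a2 := Rlt_le_trans _ _ _ Ar (Rmin_r _ _). rewrite !FE; try lra. apply: He => //; lra.
  have rs : r = s by lra. rewrite {}rs in Hr h h' *.
  have [e [e0 He]] := F2 s ltac:(lra).
  have [e' [e'0 He']] := path_near g s _ Hg Hs (germ_near _ _ _ EY).
  exists (Rmin e e'). split; first exact: Rmin_pos. move=> r' Hr' Ar.
  have a1 := Rlt_le_trans _ _ _ Ar (Rmin_l _ _). have a2 := Rlt_le_trans _ _ _ Ar (Rmin_r _ _).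
  rewrite (FE s); last lra. case: (Rlt_le_dec s r') => h2.
    rewrite YE //. apply: germ_sym. apply: He' => //. lra.
  rewrite FE //. apply: He => //. lra.
- rewrite FE //. lra.
Qed.

(** * Pullback along lifts of loops *)

Lemma germ_shift a f1 f2 (b : C) : germ_eq b f1 f2 -> germ_eq a (fun z => f1 (z + (b - a))) (fun z => f2 (z + (b - a))).
Proof.
move=> H. apply: (locally_shift (b - a) a (fun z => f1 z = f2 z)).
by have -> : a + (b - a) = b by ring.
Qed.

Lemma pullback_unique g y y' v v' : continuous_on unit_itv g ->
  pullback g y v -> pullback g y' v' -> germ_eq (g 0%R) y y' -> germ_eq (g 0%R) v v'.
Proof.
move=> Hg [u [A E]] [u' [A' E']] H.
apply: germ_trans E _. apply: germ_trans (germ_sym _ _ _ E'). apply: germ_shift.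
exact: (ac_unique _ _ _ _ _ Hg A A' H).
Qed.

Lemma pullback_ext g y y' v v' : germ_eq (g 0%R) y y' -> germ_eq (g 0%R) v v' ->
  pullback g y v -> pullback g y' v'.
Proof.
move=> E1 E2 [u [A E]]. exists u. split.
- apply: ac_ext E1 _ A. exact: germ_refl.
- exact: germ_trans (germ_sym _ _ _ E2) E.
Qed.

Lemma pullback_plus g y1 y2 v1 v2 : pullback g y1 v1 -> pullback g y2 v2 ->
  pullback g (fun z => y1 z + y2 z) (fun z => v1 z + v2 z).
Proof.
move=> [u1 [A1 E1]] [u2 [A2 E2]]. exists (fun z => u1 z + u2 z). split; first exact: ac_plus.
by apply: locallyC_imp (filter_and _ _ E1 E2) => z [-> ->].
Qed.

Lemma pullback_minus g y1 y2 v1 v2 : pullback g y1 v1 -> pullback g y2 v2 ->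
  pullback g (fun z => y1 z - y2 z) (fun z => v1 z - v2 z).
Proof.
move=> [u1 [A1 E1]] [u2 [A2 E2]]. exists (fun z => u1 z - u2 z). split; first exact: ac_minus.
by apply: locallyC_imp (filter_and _ _ E1 E2) => z [-> ->].
Qed.

Lemma pullback_mult g y1 y2 v1 v2 : pullback g y1 v1 -> pullback g y2 v2 ->
  pullback g (fun z => y1 z * y2 z) (fun z => v1 z * v2 z).
Proof.
move=> [u1 [A1 E1]] [u2 [A2 E2]]. exists (fun z => u1 z * u2 z). split; first exact: ac_mult.
by apply: locallyC_imp (filter_and _ _ E1 E2) => z [-> ->].
Qed.

Lemma pullback_global g y : (forall t, (0 <= t <= 1)%R -> hol y (g t)) ->
  pullback g y (fun z => y (z + (g 1%R - g 0%R))).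
Proof. move=> H. exists y. split; [exact: ac_global | exact: germ_refl]. Qed.

Lemma pullback_const g (c : C) : pullback g (fun _ => c) (fun _ => c).
Proof. apply: (pullback_global g (fun _ => c)) => t _. exact: hol_const. Qed.

Lemma pullback_scal g y v (c : C) : pullback g y v -> pullback g (fun z => c * y z) (fun z => c * v z).
Proof. move=> H. apply: pullback_mult => //. exact: pullback_const. Qed.

Lemma pullback_derive g y v : continuous_on unit_itv g -> pullback g y v ->
  pullback g (C_derive y) (C_derive v).
Proof.
move=> Hg [u [A E]]. exists (C_derive u). split; first exact: ac_derive.
have hu := ac_hol_end _ _ _ A.
have hs : hol (fun z => u (z + (g 1%R - g 0%R))) (g 0%R).
  apply: hol_shift. by have -> : g 0%R + (g 1%R - g 0%R) = g 1%R by ring.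
have e : g 0%R + (g 1%R - g 0%R) = g 1%R by ring.
have hd := locally_shift (g 1%R - g 0%R) (g 0%R) _ (eq_ind_r (fun x => locally x _) hu e).
apply: germ_trans (germ_derive _ _ _ (hol_ext _ _ _ (germ_sym _ _ _ E) hs) E) _.
apply: locallyC_imp hd => z Hz. apply: is_C_derive_unique. apply: derive_shift. exact: C_derive_is.
Qed.

(** Periodicity of Q makes the translate of the continued solution a solution at the starting
    point. *)
Lemma pullback_exists g y (Q : C -> C) : continuous_on unit_itv g ->
  (forall t, (0 <= t <= 1)%R -> hol Q (g t)) ->
  locally (g 0%R) (fun z => Q (z + (g 1%R - g 0%R)) = Q z) ->
  local_solution Q (g 0%R) y -> exists v, pullback g y v /\ local_solution Q (g 0%R) v.
Proof.
move=> Hg HQ per Hy. have [u A] := ac_exists g y Q Hg HQ Hy.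
have [du Hu] := ac_solution g y u Q Hg HQ A Hy.
exists (fun z => u (z + (g 1%R - g 0%R))). split; first by exists u; split=> //; exact: germ_refl.
have e : g 0%R + (g 1%R - g 0%R) = g 1%R by ring.
have H := locally_shift (g 1%R - g 0%R) (g 0%R) _ (eq_ind_r (fun x => locally x _) Hu e).
exists (fun z => du (z + (g 1%R - g 0%R))).
apply: locallyC_imp (filter_and _ _ H per) => z [[h1 h2] p]. split; first exact: derive_shift.
rewrite -p. exact: derive_shift.
Qed.

End LocalSolutions.

(** * Sums over boxes of integers *)

(** Indexed as in [lattice_sum], so that the partial sums there are [box] sums by computation. *)
Definition sumZ (N : nat) (h : Z -> C) : C :=
  sum_n (fun i => h (Z.of_nat i - Z.of_nat N)%Z) (2 * N).

Definition box (N : nat) (g : Z -> Z -> C) : C := sumZ N (fun m => sumZ N (g m)).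

Lemma sum_n_split_first (a : nat -> C) k : sum_n a (S k) = a 0%nat + sum_n (fun i => a (S i)) k.
Proof.
elim: k => [|k IH]; first by rewrite sum_Sn !sum_O.
by rewrite sum_Sn IH sum_Sn /plus /= Cplus_assoc.
Qed.

Lemma sumZ_0 h : sumZ 0 h = h 0%Z.
Proof. by rewrite /sumZ sum_O. Qed.

Lemma sumZ_S N h : sumZ (S N) h = h (- Z.of_nat (S N))%Z + sumZ N h + h (Z.of_nat (S N)).
Proof.
rewrite /sumZ. have -> : (2 * S N = S (S (2 * N)))%nat by lia.
have P : forall x y : C, plus x y = x + y by []. rewrite sum_Sn sum_n_split_first P.
congr (_ + _ + _).
- apply: sum_n_ext => i. congr h. lia.
- congr h. lia.
Qed.

Lemma sumZ_ext N h h' : (forall m, (Z.abs m <= Z.of_nat N)%Z -> h m = h' m) -> sumZ N h = sumZ N h'.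
Proof. move=> H. apply: sum_n_ext_loc => i Hi. apply: H. lia. Qed.

Lemma sumZ_lin N h h' (c : C) : sumZ N (fun m => h m + c * h' m) = sumZ N h + c * sumZ N h'.
Proof. elim: N => [|N IH]; first by rewrite !sumZ_0. rewrite !sumZ_S IH. ring. Qed.

Lemma sumZ_plus N h h' : sumZ N (fun m => h m + h' m) = sumZ N h + sumZ N h'.
Proof. elim: N => [|N IH]; first by rewrite !sumZ_0. rewrite !sumZ_S IH. ring. Qed.

Lemma sumZ_minus N h h' : sumZ N (fun m => h m - h' m) = sumZ N h - sumZ N h'.
Proof. elim: N => [|N IH]; first by rewrite !sumZ_0. rewrite !sumZ_S IH. ring. Qed.

Lemma sumZ_opp N h : sumZ N (fun m => h (- m)%Z) = sumZ N h.
Proof.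
elim: N => [|N IH]; first by rewrite !sumZ_0.
rewrite !sumZ_S IH Z.opp_involutive. ring.
Qed.

Lemma sumZ_telescope N h : sumZ N (fun m => h (m - 1)%Z - h m) = h (- Z.of_nat N - 1)%Z - h (Z.of_nat N).
Proof.
elim: N => [|N IH]; first by rewrite !sumZ_0.
rewrite sumZ_S IH.
have -> : (- Z.of_nat N - 1 = - Z.of_nat (S N))%Z by lia.
have -> : (Z.of_nat (S N) - 1 = Z.of_nat N)%Z by lia. ring.
Qed.

Lemma sumZ_bound N h M : (forall m, (Z.abs m <= Z.of_nat N)%Z -> (Cmod (h m) <= M)%R) ->
  (Cmod (sumZ N h) <= (2 * INR N + 1) * M)%R.
Proof.
elim: N => [|N IH] H; first by rewrite sumZ_0 /= Rmult_0_r Rplus_0_l Rmult_1_l; apply: H; lia.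
rewrite sumZ_S S_INR.
have h1 := H (- Z.of_nat (S N))%Z ltac:(lia). have h2 := H (Z.of_nat (S N)) ltac:(lia).
have h3 := IH (fun m Hm => H m ltac:(lia)).
have := Cmod_triangle (h (- Z.of_nat (S N))%Z + sumZ N h) (h (Z.of_nat (S N))).
have := Cmod_triangle (h (- Z.of_nat (S N))%Z) (sumZ N h). lra.
Qed.

Lemma box_ext N g g' : (forall m n, g m n = g' m n) -> box N g = box N g'.
Proof. move=> H. apply: sumZ_ext => m _. apply: sumZ_ext => n _. exact: H. Qed.

Lemma box_lin N g g' (c : C) : box N (fun m n => g m n + c * g' m n) = box N g + c * box N g'.
Proof. rewrite /box -sumZ_lin. apply: sumZ_ext => m _. exact: sumZ_lin. Qed.

Lemma box_plus N g g' : box N (fun m n => g m n + g' m n) = box N g + box N g'.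
Proof. rewrite /box -sumZ_plus. apply: sumZ_ext => m _. exact: sumZ_plus. Qed.

Lemma box_minus N g g' : box N (fun m n => g m n - g' m n) = box N g - box N g'.
Proof. rewrite /box -sumZ_minus. apply: sumZ_ext => m _. exact: sumZ_minus. Qed.

Lemma box_opp N g : box N (fun m n => g (- m)%Z (- n)%Z) = box N g.
Proof.
rewrite /box -(sumZ_opp N (fun m => sumZ N (g m))). apply: sumZ_ext => m _.
exact: (sumZ_opp N (g (- m)%Z)).
Qed.

Lemma box_telescope_l N g : box N (fun m n => g (m - 1)%Z n - g m n) =
  sumZ N (fun n => g (- Z.of_nat N - 1)%Z n - g (Z.of_nat N) n).
Proof.
rewrite sumZ_minus -(sumZ_telescope N (fun m => sumZ N (g m))).
apply: sumZ_ext => m _. exact: sumZ_minus.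
Qed.

Lemma box_telescope_r N g : box N (fun m n => g m (n - 1)%Z - g m n) =
  sumZ N (fun m => g m (- Z.of_nat N - 1)%Z - g m (Z.of_nat N)).
Proof. apply: sumZ_ext => m _. exact: (sumZ_telescope N (g m)). Qed.

Lemma box_delta N (c : C) : box N (fun m n => if (Z.eqb m 0 && Z.eqb n 0)%bool then c else 0) = c.
Proof.
have row0 : forall M, sumZ M (fun _ => RtoC 0) = 0.
  elim=> [|M IH]; first by rewrite sumZ_0. rewrite sumZ_S IH; ring.
have del : forall M (h : Z -> C), (forall m, m <> 0%Z -> h m = 0) -> sumZ M h = h 0%Z.
  move=> M h H. elim: M => [|M IH]; first by rewrite sumZ_0.
  rewrite sumZ_S IH (H (- Z.of_nat (S M))%Z) ?(H (Z.of_nat (S M))); try lia. ring.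
rewrite /box del.
- rewrite del //. move=> n Hn. have /Z.eqb_neq -> := Hn. by rewrite Bool.andb_false_r.
- move=> m /Z.eqb_neq Hm. rewrite (sumZ_ext _ _ (fun _ => RtoC 0)) //. move=> n _. by rewrite Hm.
Qed.

Definition mx (m n : Z) : R := IZR (Z.max (Z.abs m) (Z.abs n)).

Definition nz (m n : Z) : Prop := (m <> 0 \/ n <> 0)%Z.

Lemma mx_ge1 m n : nz m n -> (1 <= mx m n)%R.
Proof. move=> H. apply: IZR_le. rewrite /nz in H. lia. Qed.

(** The boundary of the box N + 1 has 8 (N + 1) points, with terms at most K / (N + 1)^3; the
    resulting bound 8 K / (N + 1)^2 is summed by telescoping. *)
Lemma box_bound g K : (0 <= K)%R -> (forall m n, nz m n -> (Cmod (g m n) <= K / mx m n ^ 3)%R) ->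
  forall n k, (Cmod (box (n + k) g - box n g) <= 16 * K / INR (S n))%R.
Proof.
move=> K0 H.
have shell : forall N, (Cmod (box (S N) g - box N g) <= 8 * K / INR (S N) ^ 2)%R.
  move=> N.
  have E : box (S N) g - box N g = sumZ N (fun m => g m (- Z.of_nat (S N))%Z + g m (Z.of_nat (S N)))
      + (sumZ (S N) (g (- Z.of_nat (S N))%Z) + sumZ (S N) (g (Z.of_nat (S N)))).
    rewrite /box (sumZ_S N (fun m => sumZ (S N) (g m))).
    rewrite (sumZ_ext N (fun m => sumZ (S N) (g m)) (fun m => sumZ N (g m) + (g m (- Z.of_nat (S N))%Z + g m (Z.of_nat (S N))))).
      rewrite sumZ_plus. ring.
    move=> m _. rewrite sumZ_S. ring.
  have SN0 : (0 < INR (S N))%R by apply: lt_0_INR; lia.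
  set b := (K / INR (S N) ^ 3)%R.
  have hb : forall m n, (Z.max (Z.abs m) (Z.abs n) = Z.of_nat (S N))%Z -> (Cmod (g m n) <= b)%R.
    move=> m n e. have := H m n. rewrite /mx e -INR_IZR_INZ. apply. rewrite /nz. lia.
  have b0 : (0 <= b)%R by apply: Rdiv_le_0_compat => //; exact: pow_lt.
  have h1 := sumZ_bound N (fun m => g m (- Z.of_nat (S N))%Z + g m (Z.of_nat (S N))) (2 * b).
  have h2 := sumZ_bound (S N) (g (- Z.of_nat (S N))%Z) b.
  have h3 := sumZ_bound (S N) (g (Z.of_nat (S N))) b.
  rewrite E. apply: Rle_trans (Cmod_triangle _ _) _.
  have := Cmod_triangle (sumZ (S N) (g (- Z.of_nat (S N))%Z)) (sumZ (S N) (g (Z.of_nat (S N)))).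
  have {}h1 : (Cmod (sumZ N (fun m : Z => (g m (- Z.of_nat (S N))%Z + g m (Z.of_nat (S N)))%C)) <= (2 * INR N + 1) * (2 * b))%R.
    apply: h1 => m Hm. apply: Rle_trans (Cmod_triangle _ _) _.
    have := hb m (- Z.of_nat (S N))%Z ltac:(lia). have := hb m (Z.of_nat (S N)) ltac:(lia). lra.
  have {}h2 := h2 (fun n Hn => hb (- Z.of_nat (S N))%Z n ltac:(lia)).
  have {}h3 := h3 (fun n Hn => hb (Z.of_nat (S N)) n ltac:(lia)).
  have -> : (8 * K / INR (S N) ^ 2 = 8 * INR (S N) * b)%R by rewrite /b; field; lra.
  rewrite S_INR in h2 h3 *. lra.
move=> n k.
suff : (Cmod (box (n + k) g - box n g) <= 16 * K / INR (S n) - 16 * K / INR (S (n + k)))%R.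
  have : (0 <= 16 * K / INR (S (n + k)))%R by apply: Rdiv_le_0_compat; [lra | apply: lt_0_INR; lia]. lra.
elim: k => [|k IH]; first by rewrite Nat.add_0_r Cmod_sub_self; lra.
have -> : (n + S k = S (n + k))%nat by lia.
have := shell (n + k)%nat. have := Cmod_sub_tri (box (S (n + k)) g) (box (n + k) g) (box n g).
set q := INR (S (n + k)). have q0 : (1 <= q)%R by rewrite /q S_INR; have := pos_INR (n + k); lra.
have -> : INR (S (S (n + k))) = (q + 1)%R by rewrite /q (S_INR (S (n + k))).
(* The constant 16 comes from here: 1 / q^2 is at most 2 / q - 2 / (q + 1) because q >= 1. *)
have : (8 * K / q ^ 2 <= 16 * K / q - 16 * K / (q + 1))%R.
  have -> : (16 * K / q - 16 * K / (q + 1) = 8 * K / q ^ 2 * (2 * q / (q + 1)))%R by field; lra.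
  have p : (0 <= 8 * K / q ^ 2)%R by apply: Rdiv_le_0_compat; [lra | apply: pow_lt; lra].
  have : (1 <= 2 * q / (q + 1))%R by apply/Rle_div_r; lra. nra.
rewrite -/q in IH. lra.
Qed.

Lemma lim_inv_S (K : R) : is_lim_seq (fun n => K / INR (S n))%R 0.
Proof.
have -> : Finite 0 = Rbar_mult K 0 by rewrite /= Rmult_0_r.
apply: is_lim_seq_scal_l.
apply (proj1 (is_lim_seq_incr_1 (fun n => / INR n)%R 0)).
by have := is_lim_seq_inv INR p_infty is_lim_seq_INR; apply.
Qed.

Lemma box_converges g K : (0 <= K)%R -> (forall m n, nz m n -> (Cmod (g m n) <= K / mx m n ^ 3)%R) ->
  exists l, flim eventually (fun N => box N g) l.
Proof.
move=> K0 H.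
have [l [_ Hl]] := C_complete_seq (fun N => box N g) _ (box_bound g K K0 H) (lim_inv_S _). by exists l.
Qed.

Lemma seq_limit_eq u l : flim eventually u l -> seq_limit u = l.
Proof.
move=> /(proj1 (flim_filterlim _ _ _)) H.
exact: (@iota_filterlim_locally C_AbsRing C_CompleteNormedModule nat eventually _ u l H).
Qed.

(** * Geometry of the lattice *)

Section Lattice.
Context (tau : C).
Hypothesis Htau : (0 < Im tau)%R.

Lemma latt_plus m n m' n' : latt tau m n + latt tau m' n' = latt tau (m + m') (n + n').
Proof. rewrite /latt !plus_IZR !RtoC_plus. ring. Qed.

Lemma latt_opp m n : - latt tau m n = latt tau (- m) (- n).
Proof. rewrite /latt !opp_IZR !RtoC_opp. ring. Qed.

Lemma Re_latt m n : Re (latt tau m n) = (IZR m + IZR n * Re tau)%R.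
Proof. by rewrite /latt re_plus re_scal_l re_RtoC. Qed.

Lemma Im_latt m n : Im (latt tau m n) = (IZR n * Im tau)%R.
Proof. by rewrite /latt im_plus im_scal_l im_RtoC Rplus_0_l. Qed.

Lemma in_lattice_plus z w : in_lattice tau z -> in_lattice tau w -> in_lattice tau (z + w).
Proof. move=> [m [n ->]] [m' [n' ->]]. exists (m + m')%Z, (n + n')%Z. exact: latt_plus. Qed.

Lemma in_lattice_opp z : in_lattice tau z -> in_lattice tau (- z).
Proof. move=> [m [n ->]]. exists (- m)%Z, (- n)%Z. exact: latt_opp. Qed.

Lemma in_lattice_minus z w : in_lattice tau z -> in_lattice tau w -> in_lattice tau (z - w).
Proof. move=> Hz Hw. exact: (in_lattice_plus _ _ Hz (in_lattice_opp _ Hw)). Qed.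

Lemma in_lattice_0 : in_lattice tau 0.
Proof. exists 0%Z, 0%Z. rewrite /latt; ring. Qed.

Lemma in_lattice_1 : in_lattice tau 1.
Proof. exists 1%Z, 0%Z. rewrite /latt; ring. Qed.

Lemma in_lattice_tau : in_lattice tau tau.
Proof. exists 0%Z, 1%Z. rewrite /latt; ring. Qed.

(** The imaginary part controls n, and then the real coordinate m is controlled by the modulus and
    n. *)
Lemma latt_norm : exists c, (0 < c)%R /\ forall m n, (c * mx m n <= Cmod (latt tau m n))%R.
Proof.
set K := (/ Im tau + 1 + Cmod tau / Im tau)%R.
have i0 : (0 < / Im tau)%R by apply: Rinv_0_lt_compat.
have t0 := Cmod_ge_0 tau.
have K0 : (0 < K)%R by rewrite /K /Rdiv; nra.
exists (/ K)%R. split; first exact: Rinv_0_lt_compat.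
move=> m n. set w := latt tau m n.
have hn : (Rabs (IZR n) <= Cmod w * / Im tau)%R.
  have := Im_le_Cmod w. rewrite Im_latt Rabs_mult (Rabs_pos_eq (Im tau)); last lra.
  move=> h. apply: (Rmult_le_reg_r (Im tau)) => //. rewrite Rmult_assoc Rinv_l; lra.
have hm : (Rabs (IZR m) <= Cmod w + Rabs (IZR n) * Cmod tau)%R.
  rewrite -!Cmod_R -Cmod_mult. have -> : RtoC (IZR m) = w - IZR n * tau by rewrite /w /latt; ring.
  exact: Cmod_sub_le.
have w0 := Cmod_ge_0 w.
have b : (mx m n <= Cmod w * K)%R.
  rewrite /mx. have [-> | ->] : Z.max (Z.abs m) (Z.abs n) = Z.abs m \/ Z.max (Z.abs m) (Z.abs n) = Z.abs n by lia.
  - rewrite abs_IZR. apply: Rle_trans hm _. rewrite /K /Rdiv.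
    have : (Rabs (IZR n) * Cmod tau <= Cmod w * / Im tau * Cmod tau)%R by apply: Rmult_le_compat_r. nra.
  - rewrite abs_IZR. apply: Rle_trans hn _. rewrite /K /Rdiv.
    have : (0 <= Cmod w * (Cmod tau * / Im tau))%R by apply: Rmult_le_pos => //; nra. nra.
apply: (Rmult_le_reg_l K) => //. rewrite -Rmult_assoc Rinv_r; lra.
Qed.

Lemma finite_positive (Q : Z -> R -> Prop) : (forall m c c', (0 < c' <= c)%R -> Q m c -> Q m c') ->
  (forall m, exists c, (0 < c)%R /\ Q m c) ->
  forall N : nat, exists c, (0 < c)%R /\ forall m, (Z.abs m <= Z.of_nat N)%Z -> Q m c.
Proof.
move=> mono H. elim=> [|N [c [c0 Hc]]].
  have [c [c0 Hc]] := H 0%Z. exists c. split=> // m Hm. by have -> : m = 0%Z by lia.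
have [a [a0 Ha]] := H (Z.of_nat (S N)). have [b [b0 Hb]] := H (- Z.of_nat (S N))%Z.
have p1 := Rmin_pos _ _ a0 b0. have p2 := Rmin_pos _ _ c0 p1.
have l1 := Rmin_l a b. have l2 := Rmin_r a b. have l3 := Rmin_l c (Rmin a b). have l4 := Rmin_r c (Rmin a b).
exists (Rmin c (Rmin a b)). split=> // m Hm.
have [h|[->| ->]] : (Z.abs m <= Z.of_nat N \/ m = Z.of_nat (S N) \/ m = - Z.of_nat (S N))%Z by lia.
- apply: (mono _ c); [lra | exact: Hc].
- apply: (mono _ a) => //; lra.
- apply: (mono _ b) => //; lra.
Qed.

(* Points at which all terms of the lattice sums are regular; 0 is one of them. *)
Definition regular (z : C) : Prop := forall m n, nz m n -> z <> latt tau m n.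

Lemma latt_distance z0 : regular z0 -> exists c d, (0 < c)%R /\ (0 < d)%R /\
  forall z m n, (Cmod (z - z0) < d)%R -> nz m n ->
    (c * mx m n <= Cmod (z - latt tau m n))%R /\ (c * mx m n <= Cmod (latt tau m n))%R.
Proof.
move=> Hz. have [c0 [c00 Hc0]] := latt_norm.
have [N HN] : exists N : nat, (2 * (Cmod z0 + 1) <= c0 * INR N)%R.
  have [N HN] := INR_unbounded (2 * (Cmod z0 + 1) / c0). exists N.
  have : (2 * (Cmod z0 + 1) / c0 * c0 = 2 * (Cmod z0 + 1))%R by field; lra. nra.
have [c1 [c10 Hc1]] : exists c, (0 < c)%R /\ forall m, (Z.abs m <= Z.of_nat N)%Z ->
    forall n, (Z.abs n <= Z.of_nat N)%Z -> nz m n -> (c <= Cmod (z0 - latt tau m n))%R.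
  apply: (finite_positive (fun m c => forall n, (Z.abs n <= Z.of_nat N)%Z -> nz m n -> (c <= Cmod (z0 - latt tau m n))%R)).
    move=> m c c' Hc H n Hn Hnz. have := H n Hn Hnz. lra.
  move=> m. apply: (finite_positive (fun n c => nz m n -> (c <= Cmod (z0 - latt tau m n))%R)).
    move=> n c c' Hc H Hnz. have := H Hnz. lra.
  move=> n. case: (classic (nz m n)) => h; last by exists 1%R; split; [lra |].
  exists (Cmod (z0 - latt tau m n)). split; last by move=> _; apply: Rle_refl.
  apply/Cmod_gt_0. apply: Cminus_eq_contra. exact: Hz.
have N0 := pos_INR N.
set c := Rmin (c0 / 2) (c1 / (2 * (INR N + 1))).
have c_pos : (0 < c)%R by apply: Rmin_pos; apply: Rdiv_lt_0_compat; lra.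
exists c, (Rmin 1 (c1 / 2)). split=> //. split; first by apply: Rmin_pos; lra.
move=> z m n Hzz Hnz. have m1 := mx_ge1 m n Hnz.
have h1 := Rlt_le_trans _ _ _ Hzz (Rmin_l _ _). have h2 := Rlt_le_trans _ _ _ Hzz (Rmin_r _ _).
have cc0 : (c <= c0 / 2)%R by exact: Rmin_l.
have cc1 : (c <= c1 / (2 * (INR N + 1)))%R by exact: Rmin_r.
have H0 := Hc0 m n.
split; last by nra.
case: (Z_le_gt_dec (Z.max (Z.abs m) (Z.abs n)) (Z.of_nat N)) => h.
- have b := Hc1 m ltac:(lia) n ltac:(lia) Hnz.
  have mN : (mx m n <= INR N)%R by rewrite INR_IZR_INZ; apply: IZR_le.
  have := Cmod_sub_tri z0 z (latt tau m n). rewrite (Cmod_sub_sym z0 z).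
  have : (c * mx m n <= c1 / 2)%R.
    have : (c1 / (2 * (INR N + 1)) * (INR N + 1) = c1 / 2)%R by field; lra.
    nra.
  lra.
- have mN : (INR N <= mx m n)%R by rewrite INR_IZR_INZ; apply: IZR_le; lia.
  have := Cmod_sub_ge (latt tau m n) z. rewrite (Cmod_sub_sym (latt tau m n) z).
  have := Cmod_sub_ge z z0. nra.
Qed.

Lemma regular_near z0 : regular z0 -> locally z0 regular.
Proof.
move=> /latt_distance [c [d [c0 [d0 H]]]]. apply/locallyC. exists d. split=> // z Hz m n Hnz E.
have [h _] := H z m n Hz Hnz. rewrite E Cmod_sub_self in h. have := mx_ge1 m n Hnz. nra.
Qed.

Lemma regular_0 : regular 0.
Proof.
move=> m n Hnz E. have [c [c0 H]] := latt_norm. have := H m n. rewrite -E Cmod_0.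
have := mx_ge1 m n Hnz. nra.
Qed.

Lemma regular_opp z : regular z -> regular (- z).
Proof.
move=> H m n Hnz E. apply: (H (- m)%Z (- n)%Z); first by rewrite /nz in Hnz *; lia.
rewrite -latt_opp -E. ring.
Qed.

Lemma regular_notin z : ~ in_lattice tau z -> regular z.
Proof. move=> H m n _ E. apply: H. by exists m, n. Qed.

Lemma notin_lattice_neq0 z : ~ in_lattice tau z -> z <> 0.
Proof. move=> H E. apply: H. rewrite E. exact: in_lattice_0. Qed.

Lemma notin_lattice_near z : ~ in_lattice tau z -> locally z (fun w => ~ in_lattice tau w).
Proof.
move=> H. have n0 := notin_lattice_neq0 z H.
apply: filter_imp (filter_and _ _ (regular_near z (regular_notin z H)) (flim_neq0 _ _ _ n0 (flim_id z))) => w [h1 h2].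
move=> [m [n E]]. case: (classic (nz m n)) => h; first exact: (h1 m n h E).
apply: h2. rewrite E /latt. have -> : m = 0%Z by rewrite /nz in h; lia. have -> : n = 0%Z by rewrite /nz in h; lia. ring.
Qed.

Lemma punctured_notin_lattice z : locally z (fun w => w <> z -> ~ in_lattice tau w).
Proof.
case: (classic (in_lattice tau z)) => h; last first.
  apply: filter_imp (notin_lattice_near z h) => w Hw _. exact: Hw.
have e : z + - z = 0 by ring.
have L : locally (z + - z) regular by rewrite e; apply: regular_near; exact: regular_0.
apply: filter_imp (locally_shift (- z) z regular L) => w Hw ne Hin.
have [m [n E]] := in_lattice_minus _ _ Hin h.
apply: (Hw m n); last by rewrite -E; ring.
apply: NNPP => hn. apply: ne. have : w - z = 0.
  rewrite E /latt. have -> : m = 0%Z by rewrite /nz in hn; lia. have -> : n = 0%Z by rewrite /nz in hn; lia. ring.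
move=> h'. by apply/Ceq_minus.
Qed.

End Lattice.

(** * The Weierstrass functions *)

Lemma box_zero N : box N (fun _ _ => RtoC 0) = 0.
Proof.
transitivity (box N (fun m n => if (Z.eqb m 0 && Z.eqb n 0)%bool then RtoC 0 else 0)); last exact: box_delta.
apply: box_ext => m n. by case: (Z.eqb m 0 && Z.eqb n 0)%bool.
Qed.

Section Weierstrass.
Context (tau : C).
Hypothesis Htau : (0 < Im tau)%R.
Let Lam := in_lattice tau.

(** The zeta function without its pole at 0. It is holomorphic at 0 and gives access to expansions
    there; the next definition does the same for wp. *)
Definition zeta_reg (z : C) : C := lattice_sum tau (fun w => 1 / (z - w) + 1 / w + z / w ^ 2).
Definition wp_reg (z : C) : C := lattice_sum tau (fun w => 1 / (z - w) ^ 2 - 1 / w ^ 2).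

Definition dom (f : C -> C) (m n : Z) : C :=
  if (Z.eqb m 0 && Z.eqb n 0)%bool then RtoC 0 else f (latt tau m n).

Lemma dom_nz f m n : nz m n -> dom f m n = f (latt tau m n).
Proof.
rewrite /dom /nz. move=> [/Z.eqb_neq -> | /Z.eqb_neq ->] //. by rewrite Bool.andb_false_r.
Qed.

Lemma dom_ext (f g : C -> C) m n : (nz m n -> f (latt tau m n) = g (latt tau m n)) -> dom f m n = dom g m n.
Proof.
move=> H. case: (classic (nz m n)) => h; first by rewrite !dom_nz // H.
have [-> ->] : m = 0%Z /\ n = 0%Z by rewrite /nz in h; lia. by [].
Qed.

Lemma lattice_sum_box f l : flim eventually (fun N => box N (dom f)) l -> lattice_sum tau f = l.
Proof. exact: seq_limit_eq. Qed.

Lemma latt_nz_neq0 z m n : regular tau z -> nz m n -> z - latt tau m n <> 0 /\ latt tau m n <> 0.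
Proof.
move=> Hz Hn. split; first by apply: Cminus_eq_contra; exact: Hz.
move=> E. have := regular_0 tau Htau m n Hn. by rewrite E.
Qed.

Lemma mx_frac (x c m : R) : (0 < c)%R -> (0 < m)%R -> (x / (c * m) ^ 3 = (x / c ^ 3) / m ^ 3)%R.
Proof. move=> c0 m0. field. split; lra. Qed.

Lemma Cmod_inv_bound (x : C) (b : R) : (0 < b)%R -> (b <= Cmod x)%R -> (Cmod (/ x) <= / b)%R.
Proof.
move=> b0 H. have x0 : x <> 0 by apply/Cmod_gt_0; lra.
rewrite Cmod_inv //. exact: Rinv_le_contravar.
Qed.

Lemma Cmod_prod3_bound (x y w : C) (A : R) : (Cmod x <= A)%R -> (Cmod y <= A)%R -> (Cmod w <= A)%R ->
  (Cmod (x * y * w) <= A ^ 3)%R.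
Proof.
move=> hx hy hw. rewrite !Cmod_mult. have := Cmod_ge_0 x. have := Cmod_ge_0 y. have := Cmod_ge_0 w.
move=> w0 y0 x0. rewrite /= Rmult_1_r Rmult_assoc.
apply: Rmult_le_compat => //; first by apply: Rmult_le_pos. by apply: Rmult_le_compat.
Qed.

(** Each term is rewritten as a constant times products of three reciprocals of w and z - w, which
    gives the cubic decay required by [box_converges]. *)
Lemma zeta_wp_converge z : regular tau z ->
  flim eventually (fun N => box N (dom (fun w => 1 / (z - w) + 1 / w + z / w ^ 2))) (zeta_reg z) /\
  flim eventually (fun N => box N (dom (fun w => 1 / (z - w) ^ 2 - 1 / w ^ 2))) (wp_reg z).
Proof.
move=> Hz. have [c [d [c0 [d0 H]]]] := latt_distance tau Htau z Hz.
have zz : (Cmod (z - z) < d)%R by rewrite Cmod_sub_self.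
have z0 := Cmod_ge_0 z.
have key : forall f K, (0 <= K)%R -> (forall m n, nz m n -> (Cmod (f (latt tau m n)) <= K / mx m n ^ 3)%R) ->
    flim eventually (fun N => box N (dom f)) (lattice_sum tau f).
  move=> f K K0 Hf. have [l Hl] := box_converges (dom f) K K0 (fun m n Hn => eq_ind_r (fun x => (Cmod x <= _)%R) (Hf m n Hn) (dom_nz f m n Hn)).
  by rewrite (lattice_sum_box f l Hl).
have inv : forall m n, nz m n -> (0 < c * mx m n)%R /\ z - latt tau m n <> 0 /\ latt tau m n <> 0 /\
    (Cmod (/ (z - latt tau m n)) <= / (c * mx m n))%R /\ (Cmod (/ latt tau m n) <= / (c * mx m n))%R.
  move=> m n Hn. have [h1 h2] := H z m n zz Hn. have [n1 n2] := latt_nz_neq0 z m n Hz Hn.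
  have p : (0 < c * mx m n)%R by apply: Rmult_lt_0_compat => //; have := mx_ge1 m n Hn; lra.
  split=> //. split=> //. split=> //. split; exact: Cmod_inv_bound.
have c3 : (0 < c ^ 3)%R by exact: pow_lt.
split.
- apply: (key _ (Cmod z ^ 2 / c ^ 3)%R); first by apply: Rdiv_le_0_compat => //; exact: pow_le.
  move=> m n Hn. have [p [n1 [n2 [h1 h2]]]] := inv m n Hn. set w := latt tau m n in n1 n2 h1 h2 *.
  have m1 := mx_ge1 m n Hn.
  have -> : 1 / (z - w) + 1 / w + z / w ^ 2 = z ^ 2 * (/ (z - w) * / w * / w) by field.
  rewrite -mx_frac //; last lra. rewrite Cmod_mult Cmod_pow /Rdiv -pow_inv.
  apply: Rmult_le_compat_l; first exact: pow_le. exact: Cmod_prod3_bound.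
- apply: (key _ (2 * Cmod z / c ^ 3)%R); first by apply: Rdiv_le_0_compat => //; lra.
  move=> m n Hn. have [p [n1 [n2 [h1 h2]]]] := inv m n Hn. set w := latt tau m n in n1 n2 h1 h2 *.
  have m1 := mx_ge1 m n Hn.
  have -> : 1 / (z - w) ^ 2 - 1 / w ^ 2 = z * (/ w * / (z - w) * / (z - w)) + - z * (/ w * / w * / (z - w)) by field.
  rewrite -mx_frac //; last lra. rewrite /Rdiv -pow_inv.
  apply: Rle_trans (Cmod_triangle _ _) _. rewrite !Cmod_mult Cmod_opp.
  have b1 := Cmod_prod3_bound _ _ _ _ h2 h1 h1. have b2 := Cmod_prod3_bound _ _ _ _ h2 h2 h1.
  rewrite !Cmod_mult in b1 b2. nra.
Qed.

Lemma zeta_reg_derive z : regular tau z -> is_derive zeta_reg z (- wp_reg z).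
Proof.
move=> Hz. have [c [d [c0 [d0 H]]]] := latt_distance tau Htau z Hz.
have c3 : (0 < c ^ 3)%R by exact: pow_lt.
apply: (derive_limit (fun N w => box N (dom (fun l => 1 / (w - l) + 1 / l + w / l ^ 2)))
  (fun N => - box N (dom (fun l => 1 / (z - l) ^ 2 - 1 / l ^ 2))) _ _ _ (16 * / c ^ 3)%R).
- have L : locally z (fun w => (Cmod (w - z) < d)%R) by apply: locally_disc; rewrite Cmod_sub_self.
  apply: filter_imp L => w Hw N. set h := w - z.
  (* The second order remainder of the term at l. It decays cubically, so [box_bound], started from
     the box 0 whose sum is zero, bounds all partial sums by a multiple of |h|^2. *)
  set g := dom (fun l => h ^ 2 * (/ (z - l) * / (z - l) * / (w - l))).
  have h0 := Cmod_ge_0 h.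
  have zz : (Cmod (z - z) < d)%R by rewrite Cmod_sub_self.
  have -> : box N (dom (fun l => 1 / (w - l) + 1 / l + w / l ^ 2)) - box N (dom (fun l => 1 / (z - l) + 1 / l + z / l ^ 2))
     - h * - box N (dom (fun l => 1 / (z - l) ^ 2 - 1 / l ^ 2)) = box N g.
    have -> : forall x y v : C, x - y - h * - v = (x - y) + h * v by move=> x y v; ring.
    rewrite -box_minus -box_lin. apply: box_ext => m n. rewrite /g.
    case: (classic (nz m n)) => hn; last first.
      have [-> ->] : m = 0%Z /\ n = 0%Z by rewrite /nz in hn; lia. rewrite /dom /=. ring.
    rewrite !dom_nz //. have [a1 a2] := H w m n Hw hn. have [a3 _] := H z m n zz hn.
    have m1 := mx_ge1 m n hn. have p : (0 < c * mx m n)%R by apply: Rmult_lt_0_compat; lra.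
    set l := latt tau m n in a1 a2 a3 *.
    have n1 : w - l <> 0 by apply/Cmod_gt_0; lra. have n2 : z - l <> 0 by apply/Cmod_gt_0; lra.
    have n3 : l <> 0 by apply/Cmod_gt_0; lra. rewrite /h. by field.
  have B := box_bound g (Cmod h ^ 2 * / c ^ 3)%R.
  have {}B : (Cmod (box (0 + N) g - box 0 g) <= 16 * (Cmod h ^ 2 * / c ^ 3) / INR 1)%R.
    apply: B.
      apply: Rmult_le_pos; first exact: pow_le. left. exact: Rinv_0_lt_compat.
    move=> m n hn. rewrite /g dom_nz //. have [a1 a2] := H w m n Hw hn. have [a3 _] := H z m n zz hn.
    have m1 := mx_ge1 m n hn. have p : (0 < c * mx m n)%R by apply: Rmult_lt_0_compat; lra.
    set l := latt tau m n in a1 a2 a3 *.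
    have i1 := Cmod_inv_bound _ _ p a1. have i2 := Cmod_inv_bound _ _ p a3.
    rewrite Cmod_mult Cmod_pow. have b := Cmod_prod3_bound _ _ _ _ i2 i2 i1.
    have -> : (Cmod h ^ 2 * / c ^ 3 / mx m n ^ 3 = Cmod h ^ 2 * (/ (c * mx m n)) ^ 3)%R by field; lra.
    apply: Rmult_le_compat_l => //. exact: pow_le.
  have e0 : box 0 g = 0 by rewrite /box !sumZ_0 /g /dom.
  rewrite e0 in B. have e1 : box (0 + N) g - 0 = box N g by rewrite Nat.add_0_l; ring. rewrite e1 in B.
  have -> : (16 * / c ^ 3 * Cmod h ^ 2 = 16 * (Cmod h ^ 2 * / c ^ 3) / INR 1)%R by rewrite /=; field; lra.
  exact: B.
- apply: filter_imp (regular_near tau Htau z Hz) => w Hw. exact: (proj1 (zeta_wp_converge w Hw)).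
- apply: flim_opp. exact: (proj2 (zeta_wp_converge z Hz)).
Qed.

Lemma zeta_reg_hol z : regular tau z -> hol zeta_reg z.
Proof.
move=> Hz. apply: (hol_of_derive _ (fun w => - wp_reg w)).
apply: filter_imp (regular_near tau Htau z Hz) => w Hw. exact: zeta_reg_derive.
Qed.

Lemma wp_reg_hol z : regular tau z -> hol wp_reg z.
Proof.
move=> Hz. apply: (hol_ext (fun w => - C_derive zeta_reg w)).
  apply: filter_imp (regular_near tau Htau z Hz) => w Hw.
  rewrite (is_C_derive_unique _ _ _ (zeta_reg_derive w Hw)). ring.
apply: hol_opp. apply: hol_derive. exact: zeta_reg_hol.
Qed.

Lemma dom_opp f m n : dom f (- m) (- n) = dom (fun w => f (- w)) m n.
Proof.
case: (classic (nz m n)) => h.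
- rewrite !dom_nz //; last by rewrite /nz in h *; lia. by rewrite -latt_opp.
- have [-> ->] : m = 0%Z /\ n = 0%Z by rewrite /nz in h; lia. by [].
Qed.

Lemma zeta_reg_odd z : regular tau z -> zeta_reg (- z) = - zeta_reg z.
Proof.
move=> Hz. apply: lattice_sum_box.
apply: (flim_ext _ (fun N => - box N (dom (fun w => 1 / (z - w) + 1 / w + z / w ^ 2)))).
  apply: filter_forall => N. rewrite -(box_opp N (dom _)).
  have -> : forall x : C, - x = 0 + (-1) * x by move=> x; ring.
  rewrite -{1}(box_zero N) -box_lin. apply: box_ext => m n. rewrite dom_opp.
  case: (classic (nz m n)) => h.
  - rewrite !dom_nz //. have [n1 n2] := latt_nz_neq0 z m n Hz h.
    have [n3 _] := latt_nz_neq0 _ m n (regular_opp _ _ Hz) h.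
    set w := latt tau m n in n1 n2 n3 *.
    have n4 : z - - w <> 0 by move=> E; apply: n3; (have -> : - z - w = - (z - - w) by ring); rewrite E; ring.
    field. repeat split => //.
  - have [-> ->] : m = 0%Z /\ n = 0%Z by rewrite /nz in h; lia. rewrite /dom /=. ring.
apply: flim_opp. exact: (proj1 (zeta_wp_converge z Hz)).
Qed.

Lemma wp_reg_even z : regular tau z -> wp_reg (- z) = wp_reg z.
Proof.
move=> Hz. apply: lattice_sum_box.
apply: (flim_ext _ (fun N => box N (dom (fun w => 1 / (z - w) ^ 2 - 1 / w ^ 2)))); last exact: (proj2 (zeta_wp_converge z Hz)).
apply: filter_forall => N. rewrite -(box_opp N (dom _)). apply: box_ext => m n. rewrite dom_opp.
apply: dom_ext => h. have [n1 n2] := latt_nz_neq0 z m n Hz h.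
have [n3 _] := latt_nz_neq0 _ m n (regular_opp _ _ Hz) h.
set w := latt tau m n in n1 n2 n3 *.
have n4 : z - - w <> 0 by move=> E; apply: n3; (have -> : - z - w = - (z - - w) by ring); rewrite E; ring.
field. repeat split => //.
Qed.

Lemma wp_reg_0 : wp_reg 0 = 0.
Proof.
apply: lattice_sum_box. apply: (flim_ext _ (fun _ => RtoC 0)); last exact: flim_const.
apply: filter_forall => N. apply: etrans (esym (box_delta N 0)) _. apply: box_ext => m n.
apply: (dom_ext (fun _ => RtoC 0)) => h. have [n1 n2] := latt_nz_neq0 0 m n (regular_0 tau Htau) h.
set w := latt tau m n in n1 n2 *. by field.
Qed.

Lemma zeta_reg_0 : zeta_reg 0 = 0.
Proof.
apply: lattice_sum_box. apply: (flim_ext _ (fun _ => RtoC 0)); last exact: flim_const.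
apply: filter_forall => N. apply: etrans (esym (box_delta N 0)) _. apply: box_ext => m n.
apply: (dom_ext (fun _ => RtoC 0)) => h. have [n1 n2] := latt_nz_neq0 0 m n (regular_0 tau Htau) h.
set w := latt tau m n in n1 n2 *. by field.
Qed.

Lemma wp_split z : wp tau z = 1 / z ^ 2 + wp_reg z. Proof. by []. Qed.
Lemma zeta_split z : zeta tau z = 1 / z + zeta_reg z. Proof. by []. Qed.

Lemma zeta_derive z : ~ Lam z -> is_derive (zeta tau) z (- wp tau z).
Proof.
move=> Hz. have n0 := notin_lattice_neq0 tau z Hz.
apply: is_derive_eq (derive_plus _ _ _ _ _ (derive_div _ _ _ _ _ n0 (derive_const 1 z) (derive_id z))
  (zeta_reg_derive z (regular_notin tau z Hz))) _.
rewrite wp_split. by field.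
Qed.

Lemma zeta_hol z : ~ Lam z -> hol (zeta tau) z.
Proof.
move=> Hz. apply: hol_plus; last by apply: zeta_reg_hol; exact: regular_notin.
apply: hol_div; [exact: (notin_lattice_neq0 tau z Hz) | exact: hol_const | exact: hol_id].
Qed.

Lemma wp_hol z : ~ Lam z -> hol (wp tau) z.
Proof.
move=> Hz. have n0 := notin_lattice_neq0 tau z Hz.
apply: hol_plus; last by apply: wp_reg_hol; exact: regular_notin.
apply: hol_div; [exact: Cpow_nz | exact: hol_const | apply: hol_pow; exact: hol_id].
Qed.

Lemma notin_opp z : ~ Lam z -> ~ Lam (- z).
Proof. move=> H Hz. apply: H. have -> : z = - - z by ring. exact: in_lattice_opp. Qed.

Lemma notin_plus z w : ~ Lam z -> Lam w -> ~ Lam (z + w).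
Proof. move=> H Hw Hz. apply: H. have -> : z = z + w - w by ring. exact: in_lattice_minus. Qed.

Lemma zeta_odd z : ~ Lam z -> zeta tau (- z) = - zeta tau z.
Proof.
move=> Hz. have n0 := notin_lattice_neq0 tau z Hz.
rewrite !zeta_split zeta_reg_odd; last exact: regular_notin. field. by [].
Qed.

Lemma wp_even z : ~ Lam z -> wp tau (- z) = wp tau z.
Proof.
move=> Hz. have n0 := notin_lattice_neq0 tau z Hz.
rewrite !wp_split wp_reg_even; last exact: regular_notin. field. by [].
Qed.

(** * Periodicity *)

Definition full (f : C -> C) (m n : Z) : C := f (latt tau m n).

Lemma full_dom f : forall N, box N (full f) = f 0 + box N (dom f).
Proof.
move=> N. rewrite -(box_delta N (f 0)) -box_plus. apply: box_ext => m n.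
rewrite /full /dom. case E : (Z.eqb m 0 && Z.eqb n 0)%bool; last by ring.
move: E => /andb_prop [/Z.eqb_eq -> /Z.eqb_eq ->].
have -> : latt tau 0 0 = 0 by rewrite /latt; ring. ring.
Qed.

(* Shifting the argument by a generator of the lattice changes a sum over the
   box only along two opposite sides. *)
Lemma box_shift (f : C -> C) (om : C) N (b : R) : om = 1 \/ om = tau ->
  (forall m n, Z.max (Z.abs m) (Z.abs n) = Z.of_nat N \/ Z.max (Z.abs m) (Z.abs n) = Z.of_nat (S N) ->
     (Cmod (f (latt tau m n)) <= b)%R) ->
  (Cmod (box N (full (fun w => f (w - om)%C)) - box N (full f)) <= (2 * INR N + 1) * (2 * b))%R.
Proof.
move=> Hom Hb. rewrite -box_minus. case: Hom => ->.
- rewrite (box_ext N _ (fun m n => full f (m - 1)%Z n - full f m n)).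
    rewrite box_telescope_l. apply: sumZ_bound => n Hn. apply: Rle_trans (Cmod_sub_le _ _) _.
    have := Hb (- Z.of_nat N - 1)%Z n ltac:(lia). have := Hb (Z.of_nat N) n ltac:(lia). rewrite /full. lra.
  move=> m n. rewrite /full. congr (f _ - _). rewrite /latt minus_IZR RtoC_minus. ring.
- rewrite (box_ext N _ (fun m n => full f m (n - 1)%Z - full f m n)).
    rewrite box_telescope_r. apply: sumZ_bound => n Hn. apply: Rle_trans (Cmod_sub_le _ _) _.
    have := Hb n (- Z.of_nat N - 1)%Z ltac:(lia). have := Hb n (Z.of_nat N) ltac:(lia). rewrite /full. lra.
  move=> m n. rewrite /full. congr (f _ - _). rewrite /latt minus_IZR RtoC_minus. ring.
Qed.

(** The two sides have O(N) points, and the terms there are O(1 / N^2). *)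
Lemma box_shift_limit (f : C -> C) (om : C) K : om = 1 \/ om = tau ->
  (forall m n, nz m n -> (Cmod (f (latt tau m n)) <= K / mx m n ^ 2)%R) ->
  flim eventually (fun N => box N (full (fun w => f (w - om))) - box N (full f)) 0.
Proof.
move=> Hom Hf.
have K0 : (0 <= K)%R.
  have h := Hf 1%Z 0%Z ltac:(rewrite /nz; lia). have := Cmod_ge_0 (f (latt tau 1 0)).
  have e : mx 1 0 = 1%R by [].
  have e' : (K / mx 1 0 ^ 2 = K)%R by rewrite e; field. lra.
have B : forall N, (Cmod (box (S N) (full (fun w => f (w - om)%C)) - box (S N) (full f)) <= (6 * K) / INR (S N))%R.
  move=> N. have N0 : (1 <= INR (S N))%R by rewrite S_INR; have := pos_INR N; lra.
  apply: Rle_trans (box_shift f om (S N) (K / INR (S N) ^ 2) Hom _) _.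
    move=> m n Hmn. have hn : nz m n by rewrite /nz; lia.
    apply: Rle_trans (Hf m n hn) _. apply: Rmult_le_compat_l => //.
    have : (INR (S N) <= mx m n)%R by rewrite INR_IZR_INZ; apply: IZR_le; lia.
    move=> h. apply: Rinv_le_contravar; first by apply: pow_lt; lra. apply: pow_incr. lra.
  have -> : (6 * K / INR (S N) = 3 * INR (S N) * (2 * (K / INR (S N) ^ 2)))%R by field; lra.
  apply: Rmult_le_compat_r; last lra. apply: Rmult_le_pos; first lra.
  apply: Rdiv_le_0_compat => //. apply: pow_lt; lra.
move=> eps e0. have /is_lim_seq_spec/(_ (mkposreal _ e0)) [N HN] := lim_inv_S (6 * K).
exists (S N) => n Hn. have -> : n = S (n - 1) by lia.
have x0 : forall x : C, x - 0 = x by move=> x; ring. rewrite x0.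
apply: Rle_lt_trans (B _) _. have := HN (n - 1)%nat ltac:(lia). rewrite /= Rminus_0_r.
move=> h. apply: Rle_lt_trans (Rle_abs _) h.
Qed.

Lemma om_in (om : C) : om = 1 \/ om = tau -> Lam om.
Proof. by case=> ->; [exact: in_lattice_1 | exact: in_lattice_tau]. Qed.

(** The subtracted terms 1 / w^2 do not depend on z and cancel, leaving a shifted sum of 1 / (z -
    w)^2. *)
Lemma wp_period1 (om z : C) : om = 1 \/ om = tau -> ~ Lam z -> wp tau (z + om) = wp tau z.
Proof.
move=> Hom Hz. have Hz' := notin_plus _ _ Hz (om_in _ Hom).
pose f w := 1 / (z - w) ^ 2. pose f' w := 1 / (z + om - w) ^ 2. pose s w := 1 / w ^ 2.
have lim : forall u, ~ Lam u -> flim eventually (fun N => box N (full (fun w => 1 / (u - w) ^ 2)) - box N (dom s)) (wp tau u).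
  move=> u Hu. have [_ L] := zeta_wp_converge u (regular_notin tau u Hu).
  apply: (flim_ext _ (fun N => 1 / u ^ 2 + box N (dom (fun w => 1 / (u - w) ^ 2 - 1 / w ^ 2)))).
    apply: filter_forall => N. rewrite full_dom.
    have -> : u - 0 = u by ring.
    rewrite (box_ext N (dom (fun w => 1 / (u - w) ^ 2 - 1 / w ^ 2)) (fun m n => dom (fun w => 1 / (u - w) ^ 2) m n - dom s m n)).
      rewrite box_minus. ring.
    move=> m n. rewrite /dom /s. case: (Z.eqb m 0 && Z.eqb n 0)%bool => //. ring.
  apply: flim_plus => //. exact: flim_const.
have D := flim_minus _ _ _ _ _ (lim _ Hz') (lim _ Hz).
have [c [d [c0 [d0 H]]]] := latt_distance tau Htau z (regular_notin tau z Hz).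
have Z0 : flim eventually (fun N => box N (full (fun w => f (w - om))) - box N (full f)) 0.
  apply: (box_shift_limit f om (/ c ^ 2)%R Hom). move=> m n hn.
  have [h _] := H z m n ltac:(rewrite Cmod_sub_self; lra) hn. have m1 := mx_ge1 m n hn.
  have p : (0 < c * mx m n)%R by apply: Rmult_lt_0_compat; lra.
  have n1 : z - latt tau m n <> 0 by apply/Cmod_gt_0; lra.
  have -> : (/ c ^ 2 / mx m n ^ 2 = (/ (c * mx m n)) ^ 2)%R by field; lra.
  have -> : f (latt tau m n) = (/ (z - latt tau m n)) ^ 2 by rewrite /f; field.
  rewrite Cmod_pow. apply: pow_incr. split; first exact: Cmod_ge_0. exact: Cmod_inv_bound.
apply/Ceq_minus. refine (flim_unique eventually _ _ _ (D _) _).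
apply: flim_ext Z0. apply: filter_forall => N.
rewrite (box_ext N (full (fun w => f (w - om))) (full (fun w => 1 / (z + om - w) ^ 2))).
  rewrite /f. ring.
move=> m n. rewrite /full /f. congr (1 / _ ^ 2). ring.
Qed.

(** For one point the terms are of order 1 / |w|, too large for [box_shift_limit]; in the difference
    between z and u they are of order 1 / |w|^2. *)
Lemma zeta_increment_const (om z u : C) : om = 1 \/ om = tau -> ~ Lam z -> ~ Lam u ->
  zeta tau (z + om) - zeta tau z = zeta tau (u + om) - zeta tau u.
Proof.
move=> Hom Hz Hu. have Hz' := notin_plus _ _ Hz (om_in _ Hom). have Hu' := notin_plus _ _ Hu (om_in _ Hom).
pose s w := 1 / w. pose q w := 1 / w ^ 2.
have lim : forall v, ~ Lam v -> flim eventually (fun N => box N (full (fun w => 1 / (v - w))) + box N (dom s) + v * box N (dom q)) (zeta tau v).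
  move=> v Hv. have [L _] := zeta_wp_converge v (regular_notin tau v Hv).
  apply: (flim_ext _ (fun N => 1 / v + box N (dom (fun w => 1 / (v - w) + 1 / w + v / w ^ 2)))).
    apply: filter_forall => N. rewrite full_dom.
    have -> : v - 0 = v by ring.
    rewrite (box_ext N (dom (fun w => 1 / (v - w) + 1 / w + v / w ^ 2)) (fun m n => (dom (fun w => 1 / (v - w)) m n + dom s m n) + v * dom q m n)).
      rewrite box_lin box_plus. ring.
    move=> m n. rewrite /dom /s /q. case: (Z.eqb m 0 && Z.eqb n 0)%bool; [ring | rewrite /Cdiv; ring].
  apply: flim_plus => //. exact: flim_const.
have D1 : flim eventually _ _ := flim_minus _ _ _ _ _ (lim _ Hz') (lim _ Hz).
have D2 : flim eventually _ _ := flim_minus _ _ _ _ _ (lim _ Hu') (lim _ Hu).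
have D := flim_minus _ _ _ _ _ (D1 _) (D2 _).
have [c [d [c0 [d0 H]]]] := latt_distance tau Htau z (regular_notin tau z Hz).
have [c' [d' [c'0 [d'0 H']]]] := latt_distance tau Htau u (regular_notin tau u Hu).
pose f w := 1 / (z - w) - 1 / (u - w).
have Z0 : flim eventually (fun N => box N (full (fun w => f (w - om))) - box N (full f)) 0.
  apply: (box_shift_limit f om (Cmod (u - z) * (/ c * / c'))%R Hom). move=> m n hn.
  have [h _] := H z m n ltac:(rewrite Cmod_sub_self; lra) hn.
  have [h' _] := H' u m n ltac:(rewrite Cmod_sub_self; lra) hn. have m1 := mx_ge1 m n hn.
  have p : (0 < c * mx m n)%R by apply: Rmult_lt_0_compat; lra.
  have p' : (0 < c' * mx m n)%R by apply: Rmult_lt_0_compat; lra.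
  have n1 : z - latt tau m n <> 0 by apply/Cmod_gt_0; lra. have n2 : u - latt tau m n <> 0 by apply/Cmod_gt_0; lra.
  have -> : (Cmod (u - z) * (/ c * / c') / mx m n ^ 2 = Cmod (u - z) * (/ (c * mx m n) * / (c' * mx m n)))%R by field; lra.
  have -> : f (latt tau m n) = (u - z) * (/ (z - latt tau m n) * / (u - latt tau m n)) by rewrite /f; field.
  rewrite !Cmod_mult. apply: Rmult_le_compat_l; first exact: Cmod_ge_0.
  apply: Rmult_le_compat; try exact: Cmod_ge_0; exact: Cmod_inv_bound.
apply/Ceq_minus. refine (flim_unique eventually _ _ _ (D _ _ _) _).
apply: flim_ext Z0. apply: filter_forall => N.
have e1 : forall v, box N (full (fun w => 1 / (v - (w - om)))) = box N (full (fun w => 1 / (v + om - w))).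
  move=> v. apply: box_ext => m n. rewrite /full. congr (1 / _). ring.
have e2 : box N (full f) = box N (full (fun w => 1 / (z - w))) - box N (full (fun w => 1 / (u - w))).
  by rewrite -box_minus.
have e3 : box N (full (fun w => f (w - om))) = box N (full (fun w => 1 / (z + om - w))) - box N (full (fun w => 1 / (u + om - w))).
  by rewrite -!e1 -box_minus.
rewrite e2 e3. ring.
Qed.

(** The point 1 / 2 serves as the sample at which the increments defining [eta] are evaluated. *)
Lemma notin_half : ~ Lam (1 / 2).
Proof.
move=> [m [n E]]. have hi := f_equal Im E. have hr := f_equal Re E. rewrite Im_latt in hi. rewrite Re_latt in hr.
have e2 : RtoC 1 / 2 = RtoC (1 / 2) by rewrite RtoC_div //; lra.
rewrite e2 im_RtoC in hi. rewrite e2 re_RtoC in hr.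
have n0 : IZR n = 0%R by nra.
rewrite n0 in hr. have h : (2 * IZR m = 1)%R by lra.
rewrite -mult_IZR in h. have := eq_IZR _ _ h. lia.
Qed.

Lemma eta_eq j z : (j = 1 \/ j = 2)%nat -> ~ Lam z ->
  zeta tau (z + omega tau j) - zeta tau z = eta tau j.
Proof.
move=> Hj.
have Hom : omega tau j = 1 \/ omega tau j = tau by case: Hj => ->; [left | right].
pose c0 := zeta tau (1 / 2 + omega tau j) - zeta tau (1 / 2).
have P : forall z, ~ Lam z -> zeta tau (z + omega tau j) - zeta tau z = c0.
  move=> u Hu. apply: zeta_increment_const => //. exact: notin_half.
have -> : eta tau j = c0.
  apply: (@iota_unique C_AbsRing C_CompleteNormedModule) => // y Hy.
  rewrite -(Hy (1/2)) //. exact: notin_half.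
exact: P.
Qed.

End Weierstrass.

(** * Elliptic functions *)

Lemma locally_and (a : C) (P Q : C -> Prop) : locally a P -> locally a Q -> locally a (fun z => P z /\ Q z).
Proof. exact: filter_and. Qed.

Lemma Cplus_cancel_r (x y b : C) : x + b = y + b -> x = y.
Proof. move=> E. transitivity (x + b - b); [ring | rewrite E; ring]. Qed.

Definition removable (f : C -> C) (a : C) : Prop :=
  exists phi, hol phi a /\ locally a (fun z => z <> a -> f z = phi z).

Lemma removable_hol f a : hol f a -> removable f a.
Proof. move=> H. exists f. split=> //. exact: filter_forall. Qed.

Lemma removable_ext f1 f2 a : locally a (fun z => z <> a -> f1 z = f2 z) -> removable f1 a -> removable f2 a.
Proof.
move=> E [phi [H1 H2]]. exists phi. split=> //.
apply: locallyC_imp (locally_and _ _ _ E H2) => z [h1 h2] ne. by rewrite -h1 // h2.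
Qed.

Lemma removable_shift f a b : removable f (a + b) -> removable (fun z => f (z + b)) a.
Proof.
move=> [phi [H1 H2]]. exists (fun z => phi (z + b)). split; first exact: hol_shift.
apply: locallyC_imp (locally_shift b a _ H2) => z h ne. apply: h => E. apply: ne. exact: Cplus_cancel_r E.
Qed.

Section Elliptic.
Context (tau : C).
Hypothesis Htau : (0 < Im tau)%R.
Let Lam := in_lattice tau.

Lemma period_all (S : C -> Prop) (f : C -> C) :
  (forall z w, S z -> Lam w -> S (z + w)) ->
  (forall z, ~ S z -> f (z + 1) = f z) -> (forall z, ~ S z -> f (z + tau) = f z) ->
  forall z w, ~ S z -> Lam w -> f (z + w) = f z.
Proof.
move=> Sinv f1 f2 z w Hz [m [n ->]].
have nS : forall u v, ~ S u -> Lam v -> ~ S (u + v).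
  move=> u v Hu Hv Hs. apply: Hu. have -> : u = u + v + - v by ring. apply: Sinv => //. exact: in_lattice_opp.
have gen : forall om, Lam om -> (forall u, ~ S u -> f (u + om) = f u) ->
    forall k : Z, forall u, ~ S u -> f (u + IZR k * om) = f u.
  move=> om Hom Hf k.
  have mul : forall k : Z, Lam (IZR k * om).
    move=> k'. have [a [b ->]] := Hom. exists (k' * a)%Z, (k' * b)%Z. rewrite /latt !mult_IZR !RtoC_mult. ring.
  elim/Z.peano_ind: k => [|k IH|k IH] u Hu.
  - congr f. ring.
  - have -> : u + IZR (Z.succ k) * om = (u + IZR k * om) + om by rewrite succ_IZR RtoC_plus; ring.
    rewrite Hf; first exact: IH. exact: nS.
  - rewrite -(IH u Hu). have -> : u + IZR k * om = (u + IZR (Z.pred k) * om) + om.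
      rewrite -Z.sub_1_r minus_IZR RtoC_minus; ring.
    rewrite Hf //. exact: nS.
have -> : z + latt tau m n = (z + IZR m * 1) + IZR n * tau by rewrite /latt; ring.
rewrite (gen tau (in_lattice_tau tau) f2) ?(gen 1 (in_lattice_1 tau) f1) //.
apply: nS => //. exists m, 0%Z. rewrite /latt; ring.
Qed.

Lemma wp_period z w : ~ Lam z -> Lam w -> wp tau (z + w) = wp tau z.
Proof.
apply: (period_all Lam (wp tau)).
- move=> u v. exact: in_lattice_plus.
- move=> u Hu. apply: wp_period1 => //. by left.
- move=> u Hu. apply: wp_period1 => //. by right.
Qed.

Lemma coords z : exists m n : Z, exists s t : R, (0 <= s <= 1)%R /\ (0 <= t <= 1)%R /\
  z = s + t * tau + latt tau m n.
Proof.
set y := (Im z / Im tau)%R. set x := (Re z - y * Re tau)%R.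
have fl : forall r : R, exists k : Z, (0 <= r - IZR k <= 1)%R.
  move=> r. have [h1 h2] := archimed r. exists (up r - 1)%Z. rewrite minus_IZR. lra.
have [m Hm] := fl x. have [n Hn] := fl y.
exists m, n, (x - IZR m)%R, (y - IZR n)%R. split=> //. split=> //.
have -> : (x - IZR m)%R + (y - IZR n)%R * tau + latt tau m n = x + y * tau.
  rewrite /latt !RtoC_minus. ring.
have hi : Im (x + y * tau) = Im z by rewrite im_plus im_scal_l im_RtoC /y; field; lra.
have hr : Re (x + y * tau) = Re z by rewrite re_plus re_scal_l re_RtoC /x; ring.
move: hi hr. case: (_ + _) => a b. case: (z) => a' b'. rewrite /Re /Im /= => -> ->. by [].
Qed.

(** [uniform01] is applied first in t, uniformly for s near s0, then in s; the bound is the inverse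
    of the radius. *)
Lemma continuous_bounded_parallelogram (F : C -> C) : (forall z : C, ex_derive F z) ->
  exists M, forall s t : R, (0 <= s <= 1)%R -> (0 <= t <= 1)%R -> (Cmod (F (s + t * tau)%C) <= M)%R.
Proof.
move=> HF.
have [d [d0 Hd]] : exists d, (0 < d)%R /\ forall s, (0 <= s <= 1)%R -> forall t, (0 <= t <= 1)%R -> (d * Cmod (F (s + t * tau)%C) <= 1)%R.
  apply: (uniform01 (fun d s => forall t, (0 <= t <= 1)%R -> (d * Cmod (F (s + t * tau)%C) <= 1)%R)).
    move=> d d' s Hd h t Ht. have := h t Ht. have := Cmod_ge_0 (F (s + t * tau)%C). nra.
  move=> s0 Hs0.
  have [d [d0 Hd]] : exists d, (0 < d)%R /\ forall t, (0 <= t <= 1)%R -> forall s, (Rabs (s - s0) < d)%R -> (d * Cmod (F (s + t * tau)%C) <= 1)%R.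
    apply: (uniform01 (fun d t => forall s, (Rabs (s - s0) < d)%R -> (d * Cmod (F (s + t * tau)%C) <= 1)%R)).
      move=> d d' t Hd h s Hs. have := h s ltac:(lra). have := Cmod_ge_0 (F (s + t * tau)%C). nra.
    move=> t0 Ht0. set q := s0 + t0 * tau.
    have [a [a0 Ha]] := proj1 (locallyC _ _) (ex_derive_cont _ _ (HF q) 1%R Rlt_0_1).
    have T0 := Cmod_ge_0 tau. have p := Cmod_ge_0 (F q).
    set e := (a / (2 * (1 + Cmod tau)))%R. have e0 : (0 < e)%R by apply: Rdiv_lt_0_compat; lra.
    have eE : (e * (1 + Cmod tau) = a / 2)%R by rewrite /e; field; lra.
    have i0 : (0 < / (Cmod (F q) + 1))%R by apply: Rinv_0_lt_compat; lra.
    have iE : (/ (Cmod (F q) + 1) * (Cmod (F q) + 1) = 1)%R by field; lra.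
    have m1 := Rmin_l e (/ (Cmod (F q) + 1)). have m2 := Rmin_r e (/ (Cmod (F q) + 1)).
    have m0 := Rmin_pos _ _ e0 i0.
    exists (Rmin e (/ (Cmod (F q) + 1))). split=> // t Ht At s As.
    have near : (Cmod (s + t * tau - q)%C < a)%R.
      have -> : s + t * tau - q = (s - s0)%R + (t - t0)%R * tau by rewrite /q !RtoC_minus; ring.
      apply: Rle_lt_trans (Cmod_triangle _ _) _. rewrite Cmod_mult !Cmod_R.
      have := Rabs_pos (t - t0). nra.
    have := Ha _ near. have := Cmod_sub_ge (F (s + t * tau)) (F q). have := Cmod_ge_0 (F (s + t * tau)). nra.
  exists d. split=> // s Hs As t Ht. exact: Hd.
exists (/ d)%R => s t Hs Ht. apply: (Rmult_le_reg_l d) => //. rewrite Rinv_r; last lra. exact: Hd.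
Qed.

(** S is a discrete periodic set outside which f behaves well, and removability is asked once modulo
    the lattice. The values of f on S are arbitrary, hence the conclusion on punctured
    neighbourhoods. *)
Theorem elliptic_liouville (S : C -> Prop) (f : C -> C) :
  (forall z w, S z -> Lam w -> S (z + w)) ->
  (forall a, locally a (fun z => z <> a -> ~ S z)) ->
  (forall z, ~ S z -> f (z + 1) = f z) -> (forall z, ~ S z -> f (z + tau) = f z) ->
  (forall a, exists w, Lam w /\ removable f (a + w)) ->
  exists c : C, forall a, locally a (fun z => z <> a -> f z = c).
Proof.
move=> Sinv Sdis f1 f2 Hrem.
have per := period_all S f Sinv f1 f2.
have {}Hrem : forall a, removable f a.
  move=> a. have [w [Hw H]] := Hrem a. apply: (removable_ext (fun z => f (z + w))); last exact: removable_shift.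
  apply: locallyC_imp (Sdis a) => z h ne. apply: per => //. exact: h.
(* The local extensions agree near each other by continuity, so their values at the centres glue to
   one entire periodic function F. *)
pose phi a := epsilon (inhabits (fun _ : C => RtoC 0)) (fun phi => hol phi a /\ locally a (fun z => z <> a -> f z = phi z)).
have Hphi : forall a, hol (phi a) a /\ locally a (fun z => z <> a -> f z = phi a z).
  move=> a. exact: (epsilon_spec (inhabits (fun _ : C => RtoC 0)) _ (Hrem a)).
pose F a := phi a a.
have punct : forall a b (P : C -> Prop), a <> b -> locally a (fun z => z <> b -> P z) -> locally a P.
  move=> a b P ne H.
  have nb : locally a (fun z => z - b <> 0).
    apply: (flim_neq0 _ (fun z => z - b) (a - b)); first exact: Cminus_eq_contra.
    exact: (flim_minus _ _ _ _ _ (flim_id a) (flim_const _ b)).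
  apply: locallyC_imp (locally_and _ _ _ H nb) => z [h1 h2]. apply: h1 => E. apply: h2. rewrite E. ring.
have agree : forall a u v, hol u a -> hol v a -> locally a (fun z => z <> a -> u z = v z) -> u a = v a.
  move=> a u v Hu Hv H. apply/Ceq_minus.
  apply: (locally_punctured_cont (fun z => u z - v z)); first exact: hol_cont (hol_minus _ _ _ Hu Hv).
  apply: locallyC_imp H => z h ne. rewrite h //. ring.
have FE : forall a, locally a (fun z => F z = phi a z).
  move=> a. have [h1 h2] := Hphi a.
  apply: locallyC_imp (locally_and _ _ _ (hol_hol _ _ h1) (locally_locallyC _ _ h2)) => z [q1 q2].
  case: (classic (z = a)) => [-> // | ne].
  have [p1 p2] := Hphi z. apply: (agree z (phi z) (phi a)) => //.
  apply: locallyC_imp (locally_and _ _ _ p2 (punct z a _ ne q2)) => u [r1 r2] ne'. by rewrite -r1 // r2.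
have Fhol : forall z : C, ex_derive F z.
  move=> z. apply: hol_ex_derive. apply: (hol_ext (phi z)); last exact: (proj1 (Hphi z)).
  apply: locallyC_imp (FE z) => w ->. by [].
have Ff : forall a, locally a (fun z => z <> a -> f z = F z).
  move=> a. apply: locallyC_imp (locally_and _ _ _ (FE a) (proj2 (Hphi a))) => z [-> h]. exact: h.
have FhN : forall a, hol F a by move=> a; exact: filter_forall.
have Fper : forall om, Lam om -> forall z, F (z + om) = F z.
  move=> om Hom z. apply: (agree z (fun z => F (z + om)) F) => //; first exact: hol_shift.
  have L := locally_shift om z _ (Ff (z + om)).
  apply: locallyC_imp (locally_and _ _ _ L (locally_and _ _ _ (Ff z) (Sdis z))) => u [h1 [h2 h3]] ne.
  rewrite -h2 // -h1; first by apply: per => //; exact: h3.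
  move=> E. apply: ne. exact: Cplus_cancel_r E.
have [M HM] := continuous_bounded_parallelogram F Fhol.
have Fb : forall z, (Cmod (F z) <= M)%R.
  move=> z. have [m [n [s [t [Hs [Ht ->]]]]]] := coords z.
  rewrite Fper; first exact: HM. by exists m, n.
exists (F 0) => a. apply: locallyC_imp (Ff a) => z h ne. rewrite h //. exact: liouville Fhol Fb z.
Qed.

(** An even function has zero derivative at 0, so a factor z can be split off twice; the quotient is
    again even, which allows iteration. *)
Lemma even_expand g : hol g 0 -> locally (RtoC 0) (fun z => g (- z) = g z) ->
  exists k, hol k 0 /\ locally (RtoC 0) (fun z => k (- z) = k z) /\ locally (RtoC 0) (fun z => g z = g 0 + z ^ 2 * k z).
Proof.
move=> Hg Eg.
have [k1 [K1 [k10 E1]]] := hol_divide (fun z => g z - g 0) 0 (hol_minus _ _ _ Hg (hol_const _ _)) ltac:(cbv beta; ring).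
have zz : forall z : C, z - 0 = z by move=> z; ring.
have d0 : C_derive g 0 = 0.
  have D := C_derive_is _ _ (hol_ex_derive _ _ Hg).
  have D' : is_derive (fun z => g ((-1) * z + 0)) (RtoC 0) (C_derive g 0 * (-1)).
    apply: derive_affine. by have -> : (-1) * 0 + 0 = RtoC 0 by ring.
  have E : C_derive g 0 = C_derive g 0 * (-1).
    apply: (derive_unique g 0 _ _ D). apply: derive_ext_near D'.
    apply: locallyC_imp Eg => z <-. congr g. ring.
  have : 2 * C_derive g 0 = 0 by rewrite {1}E; transitivity (C_derive g 0 * -1 + C_derive g 0 * -1); [ring | rewrite -E {1}E; ring].
  move=> h. have -> : C_derive g 0 = / 2 * (2 * C_derive g 0) by field. rewrite h. ring.
have k1z : k1 0 = 0.
  rewrite k10. apply: is_C_derive_unique.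
  apply: is_derive_eq (derive_minus _ _ _ _ _ (C_derive_is _ _ (hol_ex_derive _ _ Hg)) (derive_const (g 0) _)) _.
  rewrite d0. ring.
have [k [Kk [_ E2]]] := hol_divide k1 0 K1 k1z.
have EE : locally (RtoC 0) (fun z => g z = g 0 + z ^ 2 * k z).
  apply: locallyC_imp (locally_and _ _ _ E1 E2) => z [h1 h2]. rewrite !zz in h1 h2.
  have -> : g z = g 0 + (g z - g 0) by ring. rewrite h1 h2. ring.
have neg : forall P : C -> Prop, locally (RtoC 0) P -> locally (RtoC 0) (fun z => P (- z)).
  move=> P HP. have e0 : (-1) * 0 + 0 = RtoC 0 by ring.
  have HP' : locally ((-1) * 0 + 0) P by rewrite e0.
  apply: locallyC_imp (locally_affine _ _ _ _ HP') => z. by have -> : (-1) * z + 0 = - z by ring.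
exists k. split=> //. split=> //.
apply: locallyC_imp (locally_and _ _ _ EE (locally_and _ _ _ (neg _ EE) Eg)) => z [h1 [h2 h3]].
case: (classic (z = 0)) => [-> | z0]; first by congr k; ring.
have q : z ^ 2 * k (- z) = z ^ 2 * k z.
  have -> : z ^ 2 * k z = g z - g 0 by rewrite h1; ring. rewrite -h3 h2. ring.
have -> : k (- z) = / z ^ 2 * (z ^ 2 * k (- z)) by field. rewrite q. by field.
Qed.

(** * The differential equation of wp *)

Let wp' := C_derive (wp tau).

Lemma dwp_is z : ~ Lam z -> is_derive (wp tau) z (wp' z).
Proof. move=> Hz. apply: C_derive_is. apply: hol_ex_derive. exact: wp_hol. Qed.

Lemma dwp_hol z : ~ Lam z -> hol wp' z.
Proof. move=> Hz. apply: hol_derive. exact: wp_hol. Qed.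

Lemma ddwp_is z : ~ Lam z -> is_derive wp' z (C_derive wp' z).
Proof. move=> Hz. apply: C_derive_is. apply: hol_ex_derive. exact: dwp_hol. Qed.

Lemma dwp_period z w : ~ Lam z -> Lam w -> wp' (z + w) = wp' z.
Proof.
move=> Hz Hw. have D := derive_shift _ _ _ _ (dwp_is _ (notin_plus tau _ _ Hz Hw)).
apply: (derive_unique (wp tau) z); last exact: dwp_is.
apply: derive_ext_near D. apply: locallyC_imp (notin_lattice_near tau Htau z Hz) => u Hu. exact: wp_period.
Qed.

Lemma dwp_odd z : ~ Lam z -> wp' (- z) = - wp' z.
Proof.
move=> Hz. have e0 : (-1) * z + 0 = - z by ring.
have D := derive_affine (wp tau) (-1) 0 z (wp' (- z)).
rewrite e0 in D. have {}D := D (dwp_is _ (notin_opp tau _ Hz)).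
have E : wp' z = wp' (- z) * (-1).
  apply: (derive_unique (wp tau) z _ _ (dwp_is z Hz)). apply: derive_ext_near D.
  apply: locallyC_imp (notin_lattice_near tau Htau z Hz) => u Hu. rewrite -(wp_even tau Htau u Hu). congr (wp tau). ring.
rewrite E. ring.
Qed.

Lemma ddwp_period z w : ~ Lam z -> Lam w -> C_derive wp' (z + w) = C_derive wp' z.
Proof.
move=> Hz Hw. have D := derive_shift _ _ _ _ (ddwp_is _ (notin_plus tau _ _ Hz Hw)).
apply: (derive_unique wp' z); last exact: ddwp_is.
apply: derive_ext_near D. apply: locallyC_imp (notin_lattice_near tau Htau z Hz) => u Hu. exact: dwp_period.
Qed.

Lemma removable_off_lattice f : (forall z, ~ Lam z -> hol f z) -> removable f 0 ->
  forall a, exists w, Lam w /\ removable f (a + w).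
Proof.
move=> H1 H2 a. case: (classic (Lam a)) => h.
- exists (- a). split; first exact: in_lattice_opp. by have -> : a + - a = 0 by ring.
- exists 0. split; first exact: in_lattice_0. have -> : a + 0 = a by ring. apply: removable_hol. exact: H1.
Qed.

Lemma near0_notin : locally (RtoC 0) (fun z : C => z <> 0 -> ~ Lam z).
Proof. exact: punctured_notin_lattice. Qed.

(** [wp_reg] is even and vanishes at 0, so its expansion starts with z^2. The remainder k stays
    symbolic together with its derivatives; k0 is g2 / 20. *)
Lemma wp_laurent : exists k0 : C, exists k, hol k 0 /\ locally (RtoC 0) (fun z : C => z <> 0 ->
  wp tau z = 1 / z ^ 2 + k0 * z ^ 2 + z ^ 4 * k z /\
  wp' z = - 2 / z ^ 3 + 2 * k0 * z + 4 * z ^ 3 * k z + z ^ 4 * C_derive k z /\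
  C_derive wp' z = 6 / z ^ 4 + 2 * k0 + 12 * z ^ 2 * k z + 8 * z ^ 3 * C_derive k z + z ^ 4 * C_derive (C_derive k) z).
Proof.
have reg0 := regular_near tau Htau 0 (regular_0 tau Htau).
have ev : locally (RtoC 0) (fun z => wp_reg tau (- z) = wp_reg tau z).
  apply: locallyC_imp reg0 => z. exact: wp_reg_even.
have [k1 [K1 [ev1 E1]]] := even_expand _ (wp_reg_hol tau Htau 0 (regular_0 tau Htau)) ev.
have [k [K [_ E2]]] := even_expand _ K1 ev1.
exists (k1 0), k. split=> //.
have E : locally (RtoC 0) (fun z : C => z <> 0 -> wp tau z = 1 / z ^ 2 + k1 0 * z ^ 2 + z ^ 4 * k z).
  apply: locallyC_imp (locally_and _ _ _ E1 E2) => z [h1 h2] _.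
  rewrite wp_split h1 h2 wp_reg_0 //. ring.
have HK := hol_is_derive _ _ K. have HK' := hol_is_derive _ _ (hol_derive _ _ K).
have open0 : forall (P : C -> Prop), locally (RtoC 0) (fun z : C => z <> 0 -> P z) ->
    locally (RtoC 0) (fun z : C => z <> 0 -> locally z P).
  move=> P HP. apply: locallyC_imp (locally_locallyC _ _ HP) => z h z0.
  apply: locallyC_imp (locally_and _ _ _ h (flim_neq0 _ _ _ z0 (flim_id z))) => u [q1 q2]. exact: q1.
have E' : locally (RtoC 0) (fun z : C => z <> 0 -> wp' z = - 2 / z ^ 3 + 2 * k1 0 * z + 4 * z ^ 3 * k z + z ^ 4 * C_derive k z).
  apply: locallyC_imp (locally_and _ _ _ (open0 _ E) HK) => z [h1 h2] z0.
  apply: is_C_derive_unique. apply: (derive_ext_near (fun z => 1 / z ^ 2 + k1 0 * z ^ 2 + z ^ 4 * k z)).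
    apply: locallyC_imp (h1 z0) => u -> //.
  apply: is_derive_eq; first (cderive; exact: Cpow_nz).
  rewrite !INR_IZR_INZ. cbn [Z.of_nat Pos.of_succ_nat Pos.succ]. by field.
have E'' : locally (RtoC 0) (fun z : C => z <> 0 -> C_derive wp' z = 6 / z ^ 4 + 2 * k1 0 + 12 * z ^ 2 * k z + 8 * z ^ 3 * C_derive k z + z ^ 4 * C_derive (C_derive k) z).
  apply: locallyC_imp (locally_and _ _ _ (open0 _ E') (locally_and _ _ _ HK HK')) => z [h1 [h2 h3]] z0.
  apply: is_C_derive_unique. apply: (derive_ext_near (fun z => - 2 / z ^ 3 + 2 * k1 0 * z + 4 * z ^ 3 * k z + z ^ 4 * C_derive k z)).
    apply: locallyC_imp (h1 z0) => u -> //.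
  apply: is_derive_eq; first (cderive; exact: Cpow_nz).
  rewrite !INR_IZR_INZ. cbn [Z.of_nat Pos.of_succ_nat Pos.succ]. by field.
apply: locallyC_imp (locally_and _ _ _ E (locally_and _ _ _ E' E'')) => z [h1 [h2 h3]] z0.
split; [|split]; [exact: h1 | exact: h2 | exact: h3].
Qed.

Lemma liouville_off_lattice f : (forall z, ~ Lam z -> hol f z) -> removable f 0 ->
  (forall z w, ~ Lam z -> Lam w -> f (z + w) = f z) -> exists c, forall z, ~ Lam z -> f z = c.
Proof.
move=> H1 H2 H3.
have [c Hc] := elliptic_liouville Lam f (in_lattice_plus tau) (punctured_notin_lattice tau Htau)
   (fun z Hz => H3 z 1 Hz (in_lattice_1 tau)) (fun z Hz => H3 z tau Hz (in_lattice_tau tau)) (removable_off_lattice f H1 H2).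
exists c => z Hz. apply: locally_punctured_cont; last exact: Hc. apply: hol_cont. exact: H1.
Qed.

(** The coefficients 4, 20 k0 and 6 cancel the poles at 0, so both combinations are constant.
    Treating the second order equation on its own avoids a division by wp'. *)
Lemma weierstrass_ode : exists a b : C, forall z, ~ Lam z ->
  wp' z ^ 2 = 4 * wp tau z ^ 3 - a * wp tau z - b /\ C_derive wp' z = 6 * wp tau z ^ 2 - a / 2.
Proof.
have [k0 [k [K E]]] := wp_laurent.
have hk := K. have hk' := hol_derive _ _ K. have hk'' := hol_derive _ _ hk'.
have hid := hol_id 0. have hc := fun c => hol_const c 0.
have [b Hb] : exists c, forall z, ~ Lam z -> wp' z ^ 2 - 4 * wp tau z ^ 3 + 20 * k0 * wp tau z = c.
  apply: liouville_off_lattice.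
  - move=> z Hz. have h1 := wp_hol tau Htau z Hz. have h2 := dwp_hol z Hz.
    hol_tac.
  - exists (fun z => - 28 * k z - 4 * z * C_derive k z + (2 * k0 * z + 4 * z ^ 3 * k z + z ^ 4 * C_derive k z) ^ 2
       - 12 * z ^ 2 * (k0 + z ^ 2 * k z) ^ 2 - 4 * (k0 * z ^ 2 + z ^ 4 * k z) ^ 3 + 20 * k0 * (k0 * z ^ 2 + z ^ 4 * k z)).
    split.
      hol_tac.
    apply: locallyC_imp E => z h z0. have [-> [-> _]] := h z0. by field.
  - move=> z w Hz Hw. by rewrite wp_period // dwp_period.
have [c Hc] : exists c, forall z, ~ Lam z -> C_derive wp' z - 6 * wp tau z ^ 2 + 10 * k0 = c.
  apply: liouville_off_lattice.
  - move=> z Hz. have h1 := wp_hol tau Htau z Hz. have h2 := hol_derive _ _ (dwp_hol z Hz).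
    hol_tac.
  - exists (fun z => 8 * z ^ 3 * C_derive k z + z ^ 4 * C_derive (C_derive k) z - 6 * (k0 * z ^ 2 + z ^ 4 * k z) ^ 2).
    split.
      hol_tac.
    apply: locallyC_imp E => z h z0. have [-> [_ ->]] := h z0. by field.
  - move=> z w Hz Hw. by rewrite wp_period // ddwp_period.
(* The regular part of the second combination has value 0 at 0. *)
have c0 : c = 0.
  have L : hol (fun z => 8 * z ^ 3 * C_derive k z + z ^ 4 * C_derive (C_derive k) z - 6 * (k0 * z ^ 2 + z ^ 4 * k z) ^ 2) 0.
    hol_tac.
  have := locally_punctured_cont _ 0 c (hol_cont _ _ L). move=> h.
  have <- : 8 * 0 ^ 3 * C_derive k 0 + 0 ^ 4 * C_derive (C_derive k) 0 - 6 * (k0 * 0 ^ 2 + 0 ^ 4 * k 0) ^ 2 = 0 by ring.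
  apply/esym. apply: h.
  apply: locallyC_imp (locally_and _ _ _ E near0_notin) => z [h1 h2] z0.
  rewrite -(Hc z (h2 z0)). have [-> [_ ->]] := h1 z0. by field.
exists (20 * k0), (- b) => z Hz. split.
- rewrite -(Hb z Hz). ring.
- have := Hc z Hz. rewrite c0 => h.
  transitivity ((C_derive wp' z - 6 * wp tau z ^ 2 + 10 * k0) + (6 * wp tau z ^ 2 - 10 * k0)); first by ring.
  rewrite h. field.
Qed.

End Elliptic.

(** * Half periods, the values of wp there, and the invariants *)

Section HalfPeriods.
Context (tau : C).
Hypothesis Htau : (0 < Im tau)%R.
Let Lam := in_lattice tau.
Let dwp := C_derive (wp tau).
Let e1 := e tau 1. Let e2 := e tau 2. Let e3 := e tau 3.

Definition half_period (k : nat) : C := omega tau k / 2.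
Let hp := half_period.

Lemma half_period_double k : hp k + hp k = omega tau k.
Proof. rewrite /hp /half_period. field. Qed.

Lemma omega_in k : Lam (omega tau k).
Proof.
case: k => [|[|[|k]]] /=; [exact: in_lattice_0 | exact: in_lattice_1 | exact: in_lattice_tau |].
apply: in_lattice_plus; [exact: in_lattice_1 | exact: in_lattice_tau].
Qed.

(** This ray is the path from a half period to the pole at 0 along which [half_product_exists]
    continues a germ. *)
Lemma half_period_ray k (s : R) : (k = 1 \/ k = 2 \/ k = 3)%nat -> (0 < s <= 1)%R -> ~ Lam (s * hp k).
Proof.
move=> Hk Hs [m [n E]].
have [a [b [Ea Hab]]] : exists a b : Z, hp k = (IZR a / 2)%R + (IZR b / 2)%R * tau /\
    ((a = 1 /\ (b = 0 \/ b = 1)) \/ (a = 0 /\ b = 1))%Z.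
  have h : RtoC (1 / 2) = 1 / 2 by rewrite RtoC_div //; lra.
  have h0 : RtoC (0 / 2) = 0 by rewrite RtoC_div ?/Cdiv; [ring | lra].
  case: Hk => [-> | [-> | ->]]; rewrite /hp /half_period /omega.
  - exists 1%Z, 0%Z. split; last by lia. rewrite h h0. field.
  - exists 0%Z, 1%Z. split; last by lia. rewrite h h0. field.
  - exists 1%Z, 1%Z. split; last by lia. rewrite h. field.
have hi := f_equal Im E. have hr := f_equal Re E. rewrite Im_latt in hi. rewrite Re_latt in hr.
rewrite Ea im_scal_l im_plus im_scal_l im_RtoC in hi. rewrite Ea re_scal_l re_plus re_scal_l re_RtoC in hr.
have hb : (s * (IZR b / 2) = IZR n)%R.
  apply: (Rmult_eq_reg_r (Im tau)); lra.
have ha : (s * (IZR a / 2) = IZR m)%R by rewrite -hb in hr; lra.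
have no : forall q : Z, (s * (1 / 2) = IZR q)%R -> False.
  move=> q Hq. have h1 : (0 < IZR q < 1)%R by lra. case: h1 => /lt_IZR h1 /lt_IZR h2. lia.
case: Hab => [[Ha _] | [_ Hb]].
- rewrite Ha in ha. exact: no ha.
- rewrite Hb in hb. exact: no hb.
Qed.

Lemma half_period_notin k : (k = 1 \/ k = 2 \/ k = 3)%nat -> ~ Lam (hp k).
Proof.
move=> Hk. have := half_period_ray k 1 Hk ltac:(lra). by have -> : 1 * hp k = hp k by ring.
Qed.

Lemma dwp_half_period k : (k = 1 \/ k = 2 \/ k = 3)%nat -> dwp (hp k) = 0.
Proof.
move=> Hk. have Hn := half_period_notin k Hk.
have h1 := dwp_odd tau Htau _ Hn.
have h2 : C_derive (wp tau) (- hp k) = dwp (hp k).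
  rewrite -(dwp_period tau Htau (- hp k) (omega tau k)); [|exact: (notin_opp tau)|exact: omega_in].
  congr dwp. rewrite -half_period_double. ring.
rewrite h2 in h1.
have -> : dwp (hp k) = / 2 * (dwp (hp k) + dwp (hp k)) by field.
rewrite {1}h1 /dwp. ring.
Qed.

Lemma wp_pole (c : C) : locally (RtoC 0) (fun z : C => z <> 0 -> wp tau z <> c).
Proof.
have h : hol (fun z => 1 + z ^ 2 * (wp_reg tau z - c)) 0.
  have h := wp_reg_hol tau Htau 0 (regular_0 tau Htau). hol_tac.
have v : 1 + 0 ^ 2 * (wp_reg tau 0 - c) <> 0 by (have -> : 1 + 0 ^ 2 * (wp_reg tau 0 - c) = 1 by ring); exact: C1_nz.
apply: locallyC_imp (flim_neq0 _ _ _ v (hol_cont _ _ h)) => z H z0 E. apply: H.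
have -> : wp_reg tau z = c - 1 / z ^ 2 by rewrite -E wp_split; ring. by field.
Qed.

Lemma cont_on_rcont (g : R -> C) : (forall t, rcont g t) -> continuous_on unit_itv g.
Proof.
move=> H t _. apply: filterlim_filter_le_1; first exact: filter_le_within.
exact: (proj1 (flim_filterlim _ _ _) (H t)).
Qed.

(** As 2 h is a period, wp (z + h) is even in z, so wp (z + h) - wp h is divisible by z^2 and
    cancels the double pole of the other factor. *)
Lemma removable_even_pole h f c0 : ~ Lam h -> Lam (h + h) -> c0 = wp tau h ->
  f = (fun z => (wp tau z - c0) * (wp tau (z + h) - c0)) -> removable f 0.
Proof.
move=> Hh H2 -> ->.
have hh : hol (fun z => wp tau (z + h)) 0.
  apply: hol_shift. have -> : 0 + h = h by ring. exact: wp_hol.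
have ev : locally (RtoC 0) (fun z : C => wp tau (- z + h) = wp tau (z + h)).
  have L : locally (0 + h) (fun z => ~ Lam z) by (have -> : 0 + h = h by ring); exact: notin_lattice_near.
  apply: locallyC_imp (locally_shift h 0 _ L) => z Hz.
  rewrite -(wp_even tau Htau (z + h) Hz). rewrite -(wp_period tau Htau (- (z + h)) (h + h)) //; last exact: (notin_opp tau).
  congr (wp tau). ring.
have [k [Hk [_ E]]] := even_expand _ hh ev.
exists (fun z => (1 + z ^ 2 * (wp_reg tau z - wp tau h)) * k z). split.
  have h' := wp_reg_hol tau Htau 0 (regular_0 tau Htau). hol_tac.
apply: locallyC_imp E => z -> z0. rewrite wp_split. have -> : 0 + h = h by ring. by field.
Qed.

(** The poles at 0 and at h are cancelled by double zeros, so the product is constant. If the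
    constant were 0, wp would be constant near h and, by continuation along the ray, near its
    pole. *)
Lemma half_product_exists h : ~ Lam h -> Lam (h + h) -> (forall s : R, (0 < s <= 1)%R -> ~ Lam (s * h)) ->
  exists H : C, H <> 0 /\ forall z, ~ Lam z -> ~ Lam (z + h) ->
    (wp tau z - wp tau h) * (wp tau (z + h) - wp tau h) = H.
Proof.
move=> Hh H2 Hray.
pose f z := (wp tau z - wp tau h) * (wp tau (z + h) - wp tau h).
pose S z := Lam z \/ Lam (z + h).
have fh : forall z, ~ S z -> f (z + h) = f z.
  move=> z Hz. have h1 : ~ Lam z by move=> q; apply: Hz; left. have h2 : ~ Lam (z + h) by move=> q; apply: Hz; right.
  rewrite /f. have -> : z + h + h = z + (h + h) by ring. rewrite (wp_period tau Htau z (h + h)) //. ring.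
have Sdis : forall a, locally a (fun z => z <> a -> ~ S z).
  move=> a. apply: locallyC_imp (locally_and _ _ _ (punctured_notin_lattice tau Htau a)
    (locally_shift h a _ (punctured_notin_lattice tau Htau (a + h)))) => z [h1 h2] ne [q|q]; first exact: h1 ne q.
  apply: h2 q => E. apply: ne. exact: Cplus_cancel_r E.
have fhol : forall z, ~ S z -> hol f z.
  move=> z Hz. have h1 : ~ Lam z by move=> q; apply: Hz; left. have h2 : ~ Lam (z + h) by move=> q; apply: Hz; right.
  have q1 := wp_hol tau Htau z h1. have q2 := hol_shift _ h z (wp_hol tau Htau _ h2). rewrite /f. hol_tac.
have rem0 : removable f 0 by exact: (removable_even_pole h f (wp tau h)).
have [c Hc] : exists c, forall a, locally a (fun z => z <> a -> f z = c).
  apply: (elliptic_liouville tau Htau S f) => //.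
  - move=> z w [q|q] Hw; [left | right]; first exact: in_lattice_plus.
    have -> : z + w + h = z + h + w by ring. exact: in_lattice_plus.
  - move=> z Hz. have h1 : ~ Lam z by move=> q; apply: Hz; left. have h2 : ~ Lam (z + h) by move=> q; apply: Hz; right.
    rewrite /f. have -> : z + 1 + h = z + h + 1 by ring.
    by rewrite (wp_period tau Htau z) ?(wp_period tau Htau (z + h)) //; exact: in_lattice_1.
  - move=> z Hz. have h1 : ~ Lam z by move=> q; apply: Hz; left. have h2 : ~ Lam (z + h) by move=> q; apply: Hz; right.
    rewrite /f. have -> : z + tau + h = z + h + tau by ring.
    by rewrite (wp_period tau Htau z) ?(wp_period tau Htau (z + h)) //; exact: in_lattice_tau.
  - move=> a. case: (classic (Lam a)) => h1.
      exists (- a). split; first exact: in_lattice_opp. by have -> : a + - a = 0 by ring.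
    case: (classic (Lam (a + h))) => h2; last first.
      exists 0. split; first exact: in_lattice_0. have -> : a + 0 = a by ring. apply: removable_hol. apply: fhol. by case.
    exists (- (a + h)). split; first exact: in_lattice_opp.
    apply: (removable_ext (fun z => f (z + h))).
      apply: locallyC_imp (Sdis (a + - (a + h))) => z q ne. apply: fh. exact: q.
    apply: removable_shift. by have -> : a + - (a + h) + h = 0 by ring.
have all : forall z, ~ S z -> f z = c.
  move=> z Hz. apply: locally_punctured_cont; last exact: Hc. apply: hol_cont. exact: fhol.
exists c. split; last by move=> z h1 h2; apply: all; case.
move=> c0.
(* Near h the second factor is wp close to its pole, hence nonzero, so the first factor vanishes. *)
have near_h : germ_eq h (wp tau) (fun _ => wp tau h).
  have e0 : h + - h = 0 by ring.
  have L : forall P : C -> Prop, locally (RtoC 0) P -> locally h (fun z => P (z + - h)).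
    move=> P HP. apply: locally_shift. by rewrite e0.
  apply: locallyC_imp (locally_and _ _ _ (L _ (wp_pole (wp tau h))) (locally_and _ _ _ (L _ (near0_notin tau Htau)) (notin_lattice_near tau Htau h Hh))) => z [h1 [h2 h3]].
  case: (classic (z = h)) => [-> // | ne].
  have zh : z + - h <> 0 by exact: Cminus_eq_contra.
  have n2 := h2 zh. have n1 := h1 zh.
  have E : z + h = (z + - h) + (h + h) by ring.
  have n3 : ~ Lam (z + h) by rewrite E; exact: notin_plus.
  have p : wp tau (z + h) - wp tau h <> 0 by rewrite E wp_period //; exact: Cminus_eq_contra.
  have := all z ltac:(by case). rewrite c0 /f => q.
  apply/Ceq_minus. apply: NNPP => r. exact: (Cmult_neq_0 _ _ r p q).
have h0 : h <> 0 by exact: (notin_lattice_neq0 tau h Hh).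
have hp0 : (0 < Cmod h)%R by apply/Cmod_gt_0.
have [d [d0 Hd]] := proj1 (locallyC _ _) (wp_pole (wp tau h)).
(* The point ep * h lies so close to 0 that wp differs from wp h there. *)
set ep := Rmin 1 (d / (2 * Cmod h)).
have ep0 : (0 < ep)%R by apply: Rmin_pos; [lra | apply: Rdiv_lt_0_compat; lra].
have ep1 : (ep <= 1)%R by exact: Rmin_l.
have epd : (ep * Cmod h < d)%R.
  have : (ep <= d / (2 * Cmod h))%R by exact: Rmin_r.
  have : (d / (2 * Cmod h) * Cmod h = d / 2)%R by field; lra. nra.
pose g t := seg h (ep * h) t.
have gE : forall t, g t = (1 - t * (1 - ep))%R * h.
  move=> t. rewrite /g /seg !RtoC_minus RtoC_mult RtoC_minus. ring.
have gn : forall t, (0 <= t <= 1)%R -> ~ Lam (g t).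
  move=> t Ht. rewrite gE. apply: Hray. nra.
have gc : continuous_on unit_itv g by apply: cont_on_rcont => t; exact: rder_cont (rder_seg _ _ t).
have A1 : analytic_continuation g (wp tau) (wp tau) by apply: ac_global => t Ht; apply: wp_hol => //; exact: gn.
have A2 : analytic_continuation g (fun _ => wp tau h) (fun _ => wp tau h) by apply: ac_global => t Ht; exact: hol_const.
have := ac_unique _ _ _ _ _ gc A1 A2. rewrite {1}/g seg0 => /(_ near_h). rewrite /g seg1 => G.
have eh0 : ep * h <> 0 by apply: Cmult_neq_0 => //; move=> /(f_equal Re) /=; lra.
apply: (Hd (ep * h)) => //; last exact: locally_singleton G.
have -> : ep * h - 0 = ep * h by ring. rewrite Cmod_mult Cmod_R Rabs_pos_eq; lra.
Qed.

Lemma half_period_sums : hp 1 + hp 2 = hp 3 /\ hp 1 + hp 3 = hp 2 + 1 /\ hp 2 + hp 3 = hp 1 + tau.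
Proof. rewrite /hp /half_period /=. split; [|split]; field. Qed.

Definition hconst (k : nat) : C := match k with
  | 1%nat => (e tau 1 - e tau 2) * (e tau 1 - e tau 3)
  | 2%nat => (e tau 2 - e tau 1) * (e tau 2 - e tau 3)
  | _ => (e tau 3 - e tau 1) * (e tau 3 - e tau 2) end.

(** The constant is evaluated at another half period, where z + hp k is the third one modulo the
    lattice. Its nonvanishing makes the e_k distinct. *)
Lemma half_product k z : (k = 1 \/ k = 2 \/ k = 3)%nat -> ~ Lam z -> ~ Lam (z + hp k) ->
  hconst k <> 0 /\ (wp tau z - e tau k) * (wp tau (z + hp k) - e tau k) = hconst k.
Proof.
move=> Hk Hz Hz'.
have [s12 [s13 s23]] := half_period_sums.
have n := half_period_notin.
have [H [H0 HH]] := half_product_exists (hp k) (n k Hk) (eq_ind_r Lam (omega_in k) (half_period_double k)) (fun s Hs => half_period_ray k s Hk Hs).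
suff : hconst k = H by move=> ->; split=> //; apply: HH.
have n1 := n 1%nat ltac:(lia). have n2 := n 2%nat ltac:(lia). have n3 := n 3%nat ltac:(lia).
have eE : forall j, wp tau (hp j) = e tau j by [].
case: Hk HH => [-> | [-> | ->]] HH.
- rewrite -(HH (hp 2)) //; have -> : hp 2 + hp 1 = hp 3 by rewrite -s12; ring.
    by rewrite !eE /=; ring. exact: n3.
- rewrite -(HH (hp 1)) // s12 //. rewrite !eE /=; ring.
- rewrite -(HH (hp 1)) // s13; last by apply: notin_plus => //; exact: in_lattice_1.
  rewrite (wp_period tau Htau) //; last exact: in_lattice_1. rewrite !eE /=; ring.
Qed.

Lemma e_distinct : e1 <> e2 /\ e1 <> e3 /\ e2 <> e3.
Proof.
have [s12 [s13 s23]] := half_period_sums.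
have n := half_period_notin.
have n1 := n 1%nat ltac:(lia). have n2 := n 2%nat ltac:(lia). have n3 := n 3%nat ltac:(lia).
have h1 := proj1 (half_product 1 (hp 2) ltac:(lia) n2 ltac:(by (have -> : hp 2 + hp 1 = hp 3 by rewrite -s12; ring))).
have h2 := proj1 (half_product 2 (hp 1) ltac:(lia) n1 ltac:(by rewrite s12)).
rewrite /= in h1 h2. split; [|split] => E.
- apply: h1. rewrite -/e1 E /e2. ring.
- apply: h1. rewrite -/e1 -/e3 E /e3. ring.
- apply: h2. rewrite -/e2 -/e3 E /e3. ring.
Qed.

Lemma vieta (a b : C) : (forall z, ~ Lam z -> dwp z ^ 2 = 4 * wp tau z ^ 3 - a * wp tau z - b) ->
  e3 = - e1 - e2 /\ a = - 4 * (e1 * e2 + e1 * e3 + e2 * e3) /\ b = 4 * (e1 * e2 * e3).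
Proof.
move=> H. have [d12 [d13 d23]] := e_distinct.
have root : forall k, (k = 1 \/ k = 2 \/ k = 3)%nat -> b = 4 * e tau k ^ 3 - a * e tau k.
  move=> k Hk. have := H (hp k) (half_period_notin k Hk). rewrite dwp_half_period //.
  have -> : wp tau (hp k) = e tau k by [].
  move=> h. transitivity (4 * e tau k ^ 3 - a * e tau k - (4 * e tau k ^ 3 - a * e tau k - b)); first by ring.
  rewrite -h. ring.
have r1 := root 1%nat ltac:(lia). have r2 := root 2%nat ltac:(lia). have r3 := root 3%nat ltac:(lia).
rewrite -/e1 in r1. rewrite -/e2 in r2. rewrite -/e3 in r3.
have quot : forall x y : C, x <> y -> b = 4 * x ^ 3 - a * x -> b = 4 * y ^ 3 - a * y -> a = 4 * (x ^ 2 + x * y + y ^ 2).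
  move=> x y ne hx hy. have n := Cminus_eq_contra _ _ ne.
  have : (x - y) * (4 * (x ^ 2 + x * y + y ^ 2) - a) = 0.
    transitivity ((4 * x ^ 3 - a * x) - (4 * y ^ 3 - a * y)); first by ring. rewrite -hx -hy; ring.
  move=> q. apply/esym/Ceq_minus. apply: NNPP => r. exact: (Cmult_neq_0 _ _ n r q).
have q12 := quot _ _ d12 r1 r2. have q13 := quot _ _ d13 r1 r3.
have s : e3 = - e1 - e2.
  have n := Cminus_eq_contra _ _ d23.
  have q : (e2 - e3) * (e1 + e2 + e3) = 0.
    transitivity (/ 4 * (4 * (e1 ^ 2 + e1 * e2 + e2 ^ 2) - 4 * (e1 ^ 2 + e1 * e3 + e3 ^ 2))); first by field.
    rewrite -q12 -q13; ring.
  have q' : e1 + e2 + e3 = 0 by apply: NNPP => r; exact: (Cmult_neq_0 _ _ n r q).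
  transitivity ((e1 + e2 + e3) - e1 - e2); first by ring. rewrite q'. ring.
split=> //. split.
- rewrite q12 s. ring.
- rewrite r1 q12 s. ring.
Qed.

(** [g2] and [g3] are unique choices. Existence is [weierstrass_ode]; evaluation at the first two
    half periods, where wp takes distinct values, gives uniqueness. *)
Lemma wp_invariants :
  e3 = - e1 - e2 /\ g2 tau = - 4 * (e1 * e2 + e1 * e3 + e2 * e3) /\ g3 tau = 4 * (e1 * e2 * e3) /\
  forall z, ~ Lam z -> dwp z ^ 2 = 4 * wp tau z ^ 3 - g2 tau * wp tau z - g3 tau /\
    C_derive dwp z = 6 * wp tau z ^ 2 - g2 tau / 2.
Proof.
have [a [b H]] := weierstrass_ode tau Htau.
have [s [va vb]] := vieta a b (fun z Hz => proj1 (H z Hz)).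
have [d12 [d13 d23]] := e_distinct.
have n := half_period_notin.
have inv : invariants tau a b.
  move=> z Hz. have [h1 h2] := H z Hz. split; first exact: h1. rewrite h1 va vb.
  rewrite -/e1 -/e2 -/e3 s. ring.
have uniq : forall a' b', invariants tau a' b' -> a' = a /\ b' = b.
  move=> a' b' H'.
  have q : forall k, (k = 1 \/ k = 2 \/ k = 3)%nat -> (a' - a) * e tau k = b - b'.
    move=> k Hk. have [p1 _] := H' (hp k) (n k Hk). have [p2 _] := inv (hp k) (n k Hk).
    have ee : wp tau (hp k) = e tau k by [].
    rewrite ee in p1 p2.
    transitivity ((4 * e tau k ^ 3 - a * e tau k - b) - (4 * e tau k ^ 3 - a' * e tau k - b') + (b - b')); first by ring.
    rewrite -p1 -p2. ring.
  have q1 := q 1%nat ltac:(lia). have q2 := q 2%nat ltac:(lia). rewrite -/e1 in q1. rewrite -/e2 in q2.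
  have ea : a' = a.
    apply/Ceq_minus. apply: NNPP => r. apply: (Cmult_neq_0 _ _ r (Cminus_eq_contra _ _ d12)).
    transitivity ((a' - a) * e1 - (a' - a) * e2); first by ring. rewrite q1 q2. ring.
  split=> //. apply/esym/Ceq_minus. rewrite -q1 ea. ring.
have Eg2 : g2 tau = a.
  apply: (@iota_unique C_AbsRing C_CompleteNormedModule).
  - move=> y [b' H']. exact: (proj1 (uniq _ _ H')).
  - by exists b.
have Eg3 : g3 tau = b.
  apply: (@iota_unique C_AbsRing C_CompleteNormedModule).
  - move=> y [a' H']. exact: (proj2 (uniq _ _ H')).
  - by exists a.
rewrite Eg2 Eg3. do 3 split => //.
Qed.

Lemma two_torsion_double z : two_torsion tau z <-> Lam (z + z).
Proof.
split.
- move=> [k [w [_ [Hw ->]]]]. have -> : omega tau k / 2 + w + (omega tau k / 2 + w) = omega tau k + (w + w) by field.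
  apply: in_lattice_plus; [exact: omega_in | exact: in_lattice_plus].
- move=> [m [n E]].
  have split2 : forall q : Z, exists q' r, q = (2 * q' + r)%Z /\ (r = 0 \/ r = 1)%Z.
    move=> q. exists (q / 2)%Z, (q mod 2)%Z. have := Z.mod_pos_bound q 2 ltac:(lia). have := Z.div_mod q 2 ltac:(lia). lia.
  have [m' [r [Em Hr]]] := split2 m. have [n' [s [En Hs]]] := split2 n.
  have Z2 : z = (IZR r + IZR s * tau) / 2 + latt tau m' n'.
    have -> : z = (z + z) / 2 by field. rewrite E Em En /latt !plus_IZR !mult_IZR !RtoC_plus !RtoC_mult. field.
  case: Hr Hs Z2 => -> [] -> Z2; [exists 0%nat | exists 2%nat | exists 1%nat | exists 3%nat]; exists (latt tau m' n');
    (split; [lia | split; [by exists m', n' | rewrite Z2 /omega; field]]).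
Qed.

Lemma not_double_notin z : ~ Lam (z + z) -> ~ Lam z.
Proof. move=> H Hz. apply: H. exact: in_lattice_plus. Qed.

Lemma not_double_shift z k : ~ Lam (z + z) -> ~ Lam (z + hp k).
Proof.
move=> H Hz. apply: H.
have -> : z + z = (z + hp k) + (z + hp k) - (hp k + hp k) by ring. rewrite half_period_double.
apply: in_lattice_minus; [exact: in_lattice_plus | exact: omega_in].
Qed.

Lemma dwp_product z : ~ Lam z -> dwp z ^ 2 = 4 * ((wp tau z - e1) * (wp tau z - e2) * (wp tau z - e3)).
Proof.
move=> Hz. have [s [v2 [v3 H]]] := wp_invariants. rewrite (proj1 (H z Hz)) v2 v3 s. ring.
Qed.

Lemma wp_neq_e z k : (k = 1 \/ k = 2 \/ k = 3)%nat -> ~ Lam (z + z) -> wp tau z - e tau k <> 0.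
Proof.
move=> Hk Hz E.
have [h1 h2] := half_product k z Hk (not_double_notin z Hz) (not_double_shift z k Hz).
apply: h1. rewrite -h2 E. ring.
Qed.

Lemma dwp_neq0 z : ~ Lam (z + z) -> dwp z <> 0.
Proof.
move=> Hz E. have := dwp_product z (not_double_notin z Hz). rewrite E => h.
have n1 := wp_neq_e z 1 ltac:(lia) Hz. have n2 := wp_neq_e z 2 ltac:(lia) Hz. have n3 := wp_neq_e z 3 ltac:(lia) Hz.
apply: (Cmult_neq_0 _ _ (Cmult_neq_0 _ _ n1 n2) n3). rewrite -/e1 -/e2 -/e3.
transitivity (/ 4 * (4 * ((wp tau z - e1) * (wp tau z - e2) * (wp tau z - e3)))); first by field.
rewrite -h. ring.
Qed.

Lemma not_double_near z : ~ Lam (z + z) -> locally z (fun u : C => ~ Lam (u + u)).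
Proof.
move=> H. have E : 2 * z + 0 = z + z by ring.
have L : locally (2 * z + 0) (fun u => ~ Lam u) by rewrite E; exact: notin_lattice_near.
apply: locallyC_imp (locally_affine _ _ _ _ L) => u. by have -> : 2 * u + 0 = u + u by ring.
Qed.

(** * Addition formulas *)

Section Addition.
Context (p : C).
Hypothesis Hp : ~ Lam (p + p).
Let Np : ~ Lam p := not_double_notin p Hp.

Definition addsing (z : C) : Prop := Lam z \/ Lam (z + p) \/ Lam (z - p).

Lemma addsing_discrete a : locally a (fun z => z <> a -> ~ addsing z).
Proof.
apply: locallyC_imp (locally_and _ _ _ (punctured_notin_lattice tau Htau a)
   (locally_and _ _ _ (locally_shift p a _ (punctured_notin_lattice tau Htau (a + p)))
     (locally_shift (- p) a _ (punctured_notin_lattice tau Htau (a + - p))))) => z [h1 [h2 h3]] ne [q|[q|q]].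
- exact: h1 ne q.
- apply: h2 q => E. apply: ne. exact: Cplus_cancel_r E.
- apply: h3 q => E. apply: ne. exact: Cplus_cancel_r E.
Qed.

Lemma wp_sub_expand : exists k, hol k p /\ k p = dwp p /\ locally p (fun z => wp tau z - wp tau p = (z - p) * k z).
Proof.
have h := wp_hol tau Htau p Np.
have [k [h1 [h2 h3]]] := hol_divide (fun z => wp tau z - wp tau p) p (hol_minus _ _ _ h (hol_const _ _)) ltac:(cbv beta; ring).
exists k. split=> //. split=> //. rewrite h2. apply: is_C_derive_unique.
apply: is_derive_eq (derive_minus _ _ _ _ _ (C_derive_is _ _ (hol_ex_derive _ _ h)) (derive_const _ _)) _. rewrite /dwp. ring.
Qed.

(** The product f is elliptic. At p and - p the simple pole meets the zero of wp z - wp p, and at 0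
    the first factor is even and vanishes, against a double pole. The constant is read off at z =
    p. *)
Lemma addition z : ~ addsing z ->
  (zeta tau (z + p) - zeta tau (z - p) - 2 * zeta tau p) * (wp tau z - wp tau p) = - dwp p.
Proof.
move=> Hz.
pose f z := (zeta tau (z + p) - zeta tau (z - p) - 2 * zeta tau p) * (wp tau z - wp tau p).
have parts : forall z, ~ addsing z -> ~ Lam z /\ ~ Lam (z + p) /\ ~ Lam (z - p).
  move=> u Hu. split; [|split] => q; apply: Hu; [left | right; left | right; right]; exact: q.
have fhol : forall z, ~ addsing z -> hol f z.
  move=> u /parts [h1 [h2 h3]]. have q1 := wp_hol tau Htau u h1.
  have q2 := hol_shift _ p u (zeta_hol tau Htau _ h2). have q3 := hol_shift _ (- p) u (zeta_hol tau Htau _ h3).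
  apply: (hol_mult (fun u => zeta tau (u + p) - zeta tau (u - p) - 2 * zeta tau p)); last by hol_tac.
  apply: hol_minus; last exact: hol_const. apply: hol_minus; [exact: q2 | exact: q3].
have fper : forall j, (j = 1 \/ j = 2)%nat -> forall z, ~ addsing z -> f (z + omega tau j) = f z.
  move=> j Hj u /parts [h1 [h2 h3]]. rewrite /f wp_period //; last exact: omega_in.
  have E1 := eta_eq tau Htau j _ Hj h2. have E2 := eta_eq tau Htau j _ Hj h3.
  congr (_ * _).
  have -> : u + omega tau j + p = u + p + omega tau j by ring.
  have -> : u + omega tau j - p = u - p + omega tau j by ring.
  have -> : zeta tau (u + p + omega tau j) = eta tau j + zeta tau (u + p) by rewrite -E1; ring.
  have -> : zeta tau (u - p + omega tau j) = eta tau j + zeta tau (u - p) by rewrite -E2; ring.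
  ring.
have zreg : hol (zeta_reg tau) 0 by apply: zeta_reg_hol => //; exact: regular_0.
have [k [Kh [Kp KE]]] := wp_sub_expand.
(* The expansion of f at p: the pole of zeta (z - p) times (z - p) k z leaves - k z, with k p = wp'
   p. *)
pose phi z := (zeta tau (z + p) - zeta_reg tau (z - p) - 2 * zeta tau p) * ((z - p) * k z) - k z.
have phih : hol phi p.
  have q2 := hol_shift _ p p (zeta_hol tau Htau _ Hp).
  have q3 : hol (fun u => zeta_reg tau (u - p)) p.
    apply: (hol_shift _ (- p)). by have -> : p + - p = 0 by ring.
  have := hol_id p. move=> q4.
  apply: hol_minus => //. apply: hol_mult; last by hol_tac.
  apply: hol_minus; last exact: hol_const. exact: hol_minus.
have phiE : locally p (fun z => z <> p -> f z = phi z).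
  apply: locallyC_imp KE => u h ne. have up := Cminus_eq_contra _ _ ne.
  rewrite /f /phi h (zeta_split tau (u - p)). by field.
have rem_p : removable f p by exists phi.
have [c Hc] : exists c, forall a, locally a (fun z => z <> a -> f z = c).
  apply: (elliptic_liouville tau Htau addsing f).
  - move=> u w Hu Hw. case: Hu => [q|[q|q]]; [left | right; left | right; right].
    + exact: in_lattice_plus.
    + have -> : u + w + p = u + p + w by ring. exact: in_lattice_plus.
    + have -> : u + w - p = u - p + w by ring. exact: in_lattice_plus.
  - exact: addsing_discrete.
  - exact: (fper 1%nat ltac:(lia)).
  - exact: (fper 2%nat ltac:(lia)).
  - move=> a. case: (classic (Lam a)) => h1.
      exists (- a). split; first exact: in_lattice_opp. have -> : a + - a = 0 by ring.
      (* At 0 this factor is even with value 0, because zeta is odd. *)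
      pose g z := zeta tau (z + p) - zeta tau (z - p) - 2 * zeta tau p.
      have gh : hol g 0.
        apply: hol_minus; last exact: hol_const. apply: hol_minus.
        - apply: hol_shift. have -> : 0 + p = p by ring. exact: zeta_hol.
        - apply: (hol_shift _ (- p)). have -> : 0 + - p = - p by ring. apply: zeta_hol => //. exact: (notin_opp tau).
      have gev : locally (RtoC 0) (fun z => g (- z) = g z).
        have L1 : locally (0 + p) (fun z => ~ Lam z) by (have -> : 0 + p = p by ring); exact: notin_lattice_near.
        have L2 : locally (0 + - p) (fun z => ~ Lam z) by (have -> : 0 + - p = - p by ring); apply: notin_lattice_near => //; exact: (notin_opp tau).
        apply: locallyC_imp (locally_and _ _ _ (locally_shift _ _ _ L1) (locally_shift _ _ _ L2)) => u [n1 n2].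
        rewrite /g. have -> : - u + p = - (u + - p) by ring. have -> : - u - p = - (u + p) by ring.
        rewrite !(zeta_odd tau Htau) //. rewrite /Cminus. ring.
      have [m [mh [_ mE]]] := even_expand g gh gev.
      have g0 : g 0 = 0.
        rewrite /g. have -> : 0 + p = p by ring. have -> : 0 - p = - p by ring. rewrite (zeta_odd tau Htau) //. ring.
      exists (fun z => m z * (1 + z ^ 2 * (wp_reg tau z - wp tau p))). split.
        have h' := wp_reg_hol tau Htau 0 (regular_0 tau Htau). hol_tac.
      apply: locallyC_imp mE => u h u0.
      have -> : f u = g u * (wp tau u - wp tau p) by []. rewrite h g0 wp_split. by field.
    case: (classic (Lam (a - p))) => h3.
      exists (- (a - p)). split; first exact: in_lattice_opp. by have -> : a + - (a - p) = p by ring.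
    case: (classic (Lam (a + p))) => h2; last first.
      exists 0. split; first exact: in_lattice_0. have -> : a + 0 = a by ring. apply: removable_hol. apply: fhol.
      by case=> [|[]].
    exists (- (a + p)). split; first exact: in_lattice_opp. have -> : a + - (a + p) = - p by ring.
    (* The expansion at - p, where zeta (z + p) has its pole. *)
    have hm := wp_hol tau Htau (- p) (notin_opp tau _ Np).
    have [k' [k'h [_ k'E]]] := hol_divide (fun z => wp tau z - wp tau p) (- p) (hol_minus _ _ _ hm (hol_const _ _))
       ltac:(cbv beta; rewrite wp_even //; ring).
    exists (fun z => (zeta_reg tau (z + p) - zeta tau (z - p) - 2 * zeta tau p) * ((z - - p) * k' z) + k' z). split.
      have q3 : hol (fun u => zeta_reg tau (u + p)) (- p).
        apply: hol_shift. by have -> : - p + p = 0 by ring.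
      have q2 : hol (fun u => zeta tau (u - p)) (- p).
        apply: (hol_shift _ (- p)). apply: zeta_hol => //. have -> : - p + - p = - (p + p) by ring. exact: (notin_opp tau).
      have q4 := hol_id (- p).
      apply: hol_plus => //. apply: hol_mult; last by hol_tac.
      apply: hol_minus; last exact: hol_const. exact: hol_minus.
    apply: locallyC_imp k'E => u h ne. have up : u + p <> 0 by move=> q; apply: ne; apply: (Cplus_cancel_r _ _ p); rewrite q; ring.
    rewrite /f h (zeta_split tau (u + p)). have -> : u - - p = u + p by ring. by field.
have cE : c = - dwp p.
  have -> : - dwp p = phi p by rewrite /phi Kp; ring.
  apply/esym. apply: (locally_punctured_cont phi p c (hol_cont _ _ phih)).
  apply: locallyC_imp (locally_and _ _ _ phiE (Hc p)) => u [h1 h2] ne. by rewrite -h1 // h2.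
rewrite -cE. apply: (locally_punctured_cont f z c (hol_cont _ _ (fhol z Hz))). exact: Hc.
Qed.

Lemma wp_sub_neq0 z : ~ addsing z -> wp tau z - wp tau p <> 0.
Proof.
move=> Hz E. have := addition z Hz. rewrite E => h. apply: (dwp_neq0 p Hp).
transitivity (- - dwp p); first by ring. rewrite -h. ring.
Qed.

(** The next order of the addition formula as z tends to p, with wp z - wp p = (z - p) (k p + (z -
    p) k2 z). *)
Lemma zeta_double : (zeta tau (p + p) - 2 * zeta tau p) * dwp p = C_derive dwp p / 2.
Proof.
have [k [Kh [Kp KE]]] := wp_sub_expand.
have [k2 [K2h [K2p K2E]]] := hol_divide (fun z => k z - k p) p (hol_minus _ _ _ Kh (hol_const _ _)) ltac:(cbv beta; ring).
have kd : C_derive dwp p = 2 * C_derive k p.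
  have D : locally p (fun z => dwp z = k z + (z - p) * C_derive k z).
    apply: locallyC_imp (locally_and _ _ _ (locally_locallyC _ _ KE) (hol_is_derive _ _ Kh)) => z [h1 h2].
    apply: is_C_derive_unique. apply: (derive_ext_near (fun z => wp tau p + (z - p) * k z)).
      apply: locallyC_imp h1 => u hu. rewrite -hu. ring.
    apply: is_derive_eq; first cderive. ring.
  apply: is_C_derive_unique. apply: (derive_ext_near (fun z => k z + (z - p) * C_derive k z)).
    by apply: locallyC_imp D => z ->.
  have h1 := C_derive_is _ _ (hol_ex_derive _ _ Kh).
  have h2 := C_derive_is _ _ (hol_ex_derive _ _ (hol_derive _ _ Kh)).
  apply: is_derive_eq; first cderive. ring.
have k2v : k2 p = C_derive k p.
  rewrite K2p. apply: is_C_derive_unique.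
  apply: is_derive_eq (derive_minus _ _ _ _ _ (C_derive_is _ _ (hol_ex_derive _ _ Kh)) (derive_const _ _)) _. ring.
have zreg : hol (zeta_reg tau) 0 by apply: zeta_reg_hol => //; exact: regular_0.
pose A z := (zeta tau (z + p) - zeta_reg tau (z - p) - 2 * zeta tau p) * k z - k2 z.
have Ah : hol A p.
  have q2 := hol_shift _ p p (zeta_hol tau Htau _ Hp).
  have q3 : hol (fun u => zeta_reg tau (u - p)) p.
    apply: (hol_shift _ (- p)). by have -> : p + - p = 0 by ring.
  apply: hol_minus => //. apply: hol_mult => //.
  apply: hol_minus; last exact: hol_const. exact: hol_minus.
have A0 : A p = 0.
  apply: (locally_punctured_cont A p 0 (hol_cont _ _ Ah)).
  apply: locallyC_imp (locally_and _ _ _ (locally_and _ _ _ KE K2E) (addsing_discrete p)) => z [[h1 h2] h3] ne.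
  have zp := Cminus_eq_contra _ _ ne.
  have := addition z (h3 ne). rewrite h1 (zeta_split tau (z - p)) -Kp => h.
  have -> : A z = / (z - p) * (((zeta tau (z + p) - (1 / (z - p) + zeta_reg tau (z - p)) - 2 * zeta tau p) * ((z - p) * k z)) + k p + ((k z - k p) - (z - p) * k2 z)).
    rewrite /A. by field.
  rewrite h h2. ring.
rewrite kd. transitivity (A p + C_derive k p); last by rewrite A0; field.
rewrite /A k2v Kp. have -> : p - p = 0 by ring. rewrite zeta_reg_0 //. ring.
Qed.

End Addition.

(** * Duplication formula for wp *)

Lemma dddwp z : ~ Lam z -> is_derive (C_derive dwp) z (12 * wp tau z * dwp z).
Proof.
move=> Hz. have [_ [_ [_ H]]] := wp_invariants.
apply: (derive_ext_near (fun z => 6 * wp tau z ^ 2 - g2 tau / 2)).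
  apply: locallyC_imp (notin_lattice_near tau Htau z Hz) => u Hu. by rewrite (proj2 (H u Hu)).
have d := dwp_is tau Htau z Hz.
apply: is_derive_eq; first (cderive; try exact: d).
  rewrite /=. move=> /(f_equal Re) /=. lra.
rewrite INR2 /dwp. field.
Qed.

(** Obtained by differentiating zeta (2 u) = 2 zeta u + wp'' u / (2 wp' u), which is
    [zeta_double]. *)
Lemma wp_double z : ~ Lam (z + z) -> 4 * dwp z ^ 2 * (wp tau (z + z) + 2 * wp tau z) = C_derive dwp z ^ 2.
Proof.
move=> Hz. have Nz := not_double_notin z Hz. have n0 := dwp_neq0 z Hz.
have E : locally z (fun u => zeta tau (2 * u + 0) = 2 * zeta tau u + C_derive dwp u / (2 * dwp u)).
  apply: locallyC_imp (not_double_near z Hz) => u Hu. have := zeta_double u Hu. have m0 := dwp_neq0 u Hu => h.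
  have -> : C_derive dwp u / (2 * dwp u) = (C_derive dwp u / 2) / dwp u by field. rewrite -h.
  have -> : 2 * u + 0 = u + u by ring. by field.
have E2 : 2 * z + 0 = z + z by ring.
have D1 := derive_affine (zeta tau) 2 0 z (- wp tau (z + z)). rewrite E2 in D1.
have {}D1 := D1 (zeta_derive tau Htau _ Hz).
have dz := zeta_derive tau Htau z Nz. have d2 := ddwp_is tau Htau z Nz. have d3 := dddwp z Nz.
have D2 : is_derive (fun u => 2 * zeta tau u + C_derive dwp u / (2 * dwp u)) z
   (2 * - wp tau z + (12 * wp tau z * dwp z * (2 * dwp z) - C_derive dwp z * (2 * C_derive dwp z)) / (2 * dwp z) ^ 2).
  apply: derive_plus; first exact: derive_scal. apply: derive_div => //; last exact: derive_scal.
  apply: Cmult_neq_0 => //. move=> /(f_equal Re) /=. lra.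
have := derive_unique _ _ _ _ (derive_ext_near _ _ _ _ E D1) D2.
move=> h. have -> : wp tau (z + z) = - / 2 * (- wp tau (z + z) * 2) by field. rewrite h. by field.
Qed.

(** * Square roots of [wp - e_k] *)

(** By the duplication formula wp z - e_k is the square of this function of u = z / 2. A period of z
    is a half period of u, which changes at most the sign. *)
Definition root_wp (k : nat) (z : C) : C := ((wp tau (z / 2) - e tau k) ^ 2 - hconst k) / dwp (z / 2).

Lemma half_not_double z : ~ Lam z -> ~ Lam (z / 2 + z / 2).
Proof. by have -> : z / 2 + z / 2 = z by field. Qed.

Lemma root_wp_sq k z : (k = 1 \/ k = 2 \/ k = 3)%nat -> ~ Lam z -> root_wp k z ^ 2 = wp tau z - e tau k.
Proof.
move=> Hk Hz. have Hu := half_not_double z Hz. set u := z / 2 in Hu *.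
have n0 := dwp_neq0 u Hu. have Nu := not_double_notin u Hu.
have [s [v2 [v3 H]]] := wp_invariants.
have D := wp_double u Hu. have P := dwp_product u Nu. have [_ Q] := H u Nu.
have zu : z = u + u by rewrite /u; field.
have W : wp tau z = - 2 * wp tau u + C_derive dwp u ^ 2 / (4 * dwp u ^ 2) by rewrite zu -D; field.
rewrite W Q v2 /root_wp -/u.
have -> : (((wp tau u - e tau k) ^ 2 - hconst k) / dwp u) ^ 2 = ((wp tau u - e tau k) ^ 2 - hconst k) ^ 2 / dwp u ^ 2 by field.
have n2 : dwp u ^ 2 <> 0 by exact: Cpow_nz.
have -> : - 2 * wp tau u + (6 * wp tau u ^ 2 - - 4 * (e1 * e2 + e1 * e3 + e2 * e3) / 2) ^ 2 / (4 * dwp u ^ 2) - e tau k =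
  ((6 * wp tau u ^ 2 - - 4 * (e1 * e2 + e1 * e3 + e2 * e3) / 2) ^ 2 / 4 - (2 * wp tau u + e tau k) * dwp u ^ 2) / dwp u ^ 2 by field.
congr (_ / _). rewrite P.
case: Hk => [-> | [-> | ->]]; rewrite /= -/e1 -/e2 -/e3 s; field.
Qed.

Lemma half_shift j u : (j = 1 \/ j = 2 \/ j = 3)%nat -> ~ Lam (u + u) ->
  wp tau (u + hp j) = e tau j + hconst j / (wp tau u - e tau j) /\
  dwp (u + hp j) = - hconst j * dwp u / (wp tau u - e tau j) ^ 2.
Proof.
move=> Hj Hu.
have val : forall v, ~ Lam (v + v) -> wp tau (v + hp j) = e tau j + hconst j / (wp tau v - e tau j).
  move=> v Hv. have n := wp_neq_e v j Hj Hv.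
  have [_ <-] := half_product j v Hj (not_double_notin v Hv) (not_double_shift v j Hv). by field.
split; first exact: val.
have n := wp_neq_e u j Hj Hu.
have D1 := derive_shift _ _ _ _ (dwp_is tau Htau _ (not_double_shift u j Hu)).
have D0 := dwp_is tau Htau u (not_double_notin u Hu).
have D2 : is_derive (fun v => e tau j + hconst j / (wp tau v - e tau j)) u (- hconst j * dwp u / (wp tau u - e tau j) ^ 2).
  apply: is_derive_eq; first (cderive; exact: n). rewrite /dwp. by field.
apply: (derive_unique _ _ _ _ _ D2). apply: derive_ext_near D1.
apply: locallyC_imp (not_double_near u Hu) => v. exact: val.
Qed.

(** These are the signs of the second family of formulas. They follow from the transformation of wp
    and wp' under u -> u + hp j. *)
Lemma root_wp_shift k j z : (k = 1 \/ k = 2 \/ k = 3)%nat -> (j = 1 \/ j = 2)%nat -> ~ Lam z ->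
  root_wp k (z + omega tau j) = (if Nat.eqb k j then RtoC 1 else RtoC (-1)) * root_wp k z.
Proof.
move=> Hk Hj Hz. have Hu := half_not_double z Hz.
have E : (z + omega tau j) / 2 = z / 2 + hp j by rewrite /hp /half_period; field.
have [w1 w2] := half_shift j (z / 2) ltac:(lia) Hu.
rewrite /root_wp E w1 w2. set u := z / 2 in Hu *.
have n0 := dwp_neq0 u Hu. have nj := wp_neq_e u j ltac:(lia) Hu.
have [d12 [d13 d23]] := e_distinct.
have n12 := Cminus_eq_contra _ _ d12. have n13 := Cminus_eq_contra _ _ d13. have n23 := Cminus_eq_contra _ _ d23.
have n21 := Cminus_eq_contra _ _ (not_eq_sym d12).
case: Hj nj => -> nj; case: Hk => [-> | [-> | ->]]; rewrite /= -/e1 -/e2 -/e3 in nj *; field; repeat split => //.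
Qed.

Lemma root_wp_hol k z : ~ Lam z -> hol (root_wp k) z.
Proof.
move=> Hz. have Hu := half_not_double z Hz.
have a : forall f, hol f (z / 2) -> hol (fun z => f (z / 2)) z.
  move=> f Hf. have E : / 2 * z + 0 = z / 2 by field.
  apply: (hol_ext (fun z => f (/ 2 * z + 0))); last by apply: hol_affine; rewrite E.
  apply: filter_forall => u. congr f. field.
have h1 := a _ (wp_hol tau Htau _ (not_double_notin _ Hu)).
have h2 := a _ (dwp_hol tau Htau _ (not_double_notin _ Hu)).
apply: (hol_div (fun z => (wp tau (z / 2) - e tau k) ^ 2 - hconst k) (fun z => dwp (z / 2))) => //; first exact: dwp_neq0.
apply: hol_minus; last exact: hol_const. apply: hol_pow. apply: hol_minus => //. exact: hol_const.
Qed.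

(* If [eta_2 = tau eta_1] then [zeta - eta_1 z] is elliptic, odd, and its square
   differs from [wp] by a constant; it vanishes at the half periods, so
   [e_1 = e_2]. *)
Lemma legendre_nonvanishing : eta tau 2 <> tau * eta tau 1.
Proof.
move=> E. pose G z := zeta tau z - eta tau 1 * z.
have per : forall j, (j = 1 \/ j = 2)%nat -> forall z, ~ Lam z -> G (z + omega tau j) = G z.
  move=> j Hj z Hz. have h := eta_eq tau Htau j z Hj Hz. rewrite /G.
  have -> : zeta tau (z + omega tau j) = zeta tau z + eta tau j by rewrite -h; ring.
  case: Hj => ->; rewrite /= ?E; ring.
have perL : forall z w, ~ Lam z -> Lam w -> G (z + w) = G z.
  apply: (period_all tau Lam G (in_lattice_plus tau)); [exact: (per 1%nat ltac:(lia)) | exact: (per 2%nat ltac:(lia))].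
have zr := zeta_reg_hol tau Htau 0 (regular_0 tau Htau).
have [m [mh [_ mE]]] := hol_divide (zeta_reg tau) 0 zr (zeta_reg_0 tau Htau).
have [c Hc] : exists c, forall z, ~ Lam z -> G z ^ 2 - wp tau z = c.
  apply: (liouville_off_lattice tau Htau).
  - move=> z Hz. have h1 := zeta_hol tau Htau z Hz. have h2 := wp_hol tau Htau z Hz. rewrite /G. hol_tac.
  - exists (fun z => 2 * (m z - eta tau 1) + z ^ 2 * (m z - eta tau 1) ^ 2 - wp_reg tau z). split.
      have h' := wp_reg_hol tau Htau 0 (regular_0 tau Htau). hol_tac.
    apply: locallyC_imp mE => z h z0. rewrite /G zeta_split h wp_split. have -> : z - 0 = z by ring. by field.
  - move=> z w Hz Hw. by rewrite perL // wp_period.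
have Gh : forall k, (k = 1 \/ k = 2 \/ k = 3)%nat -> e tau k = - c.
  move=> k Hk. have Hn := half_period_notin k Hk.
  have g0 : G (hp k) = 0.
    have h1 : G (- hp k) = - G (hp k) by rewrite /G (zeta_odd tau Htau) //; ring.
    have h2 : G (- hp k) = G (hp k).
      rewrite -(perL (- hp k) (omega tau k)); [|exact: (notin_opp tau)|exact: omega_in].
      congr G. rewrite -half_period_double. ring.
    have -> : G (hp k) = / 2 * (G (hp k) + G (hp k)) by field. rewrite -{1}h2 h1. ring.
  have := Hc (hp k) Hn. rewrite g0 => <-. have -> : wp tau (hp k) = e tau k by []. ring.
have [d12 _] := e_distinct. apply: d12. rewrite /e1 /e2 !Gh //; lia.
Qed.

End HalfPeriods.

(** * A periodic square root of [wp z - wp p] off the cuts *)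

Section CutRoot.
Context (tau p : C).
Hypothesis Htau : (0 < Im tau)%R.
Let Lam := in_lattice tau.

Lemma notcut_shift z (s : R) : ~ cut tau p z -> (0 <= s <= 1)%R -> ~ Lam (z + s * p) /\ ~ Lam (z - s * p).
Proof.
move=> H Hs. split=> q; apply: H.
- exists ((1 + s) / 2)%R, (z + s * p). split; first lra. split=> //. rewrite RtoC_div ?RtoC_plus; last lra. field.
- exists ((1 - s) / 2)%R, (z - s * p). split; first lra. split=> //. rewrite RtoC_div ?RtoC_minus; last lra. field.
Qed.

Lemma notcut_near z : ~ cut tau p z -> locally z (fun u => ~ cut tau p u).
Proof.
move=> H.
have [d [d0 Hd]] : exists d, (0 < d)%R /\ forall s, (0 <= s <= 1)%R -> forall u, (Cmod (u - z) < d)%R ->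
    ~ Lam (u - ((1 - s) * p + s * (- p))).
  apply: (uniform01 (fun d s => forall u, (Cmod (u - z) < d)%R -> ~ Lam (u - ((1 - s) * p + s * (- p))))).
    move=> d d' s Hd h u Hu. apply: h; lra.
  move=> t Ht. set c := (1 - t) * p + t * (- p).
  have n : ~ Lam (z - c) by move=> q; apply: H; exists t, (z - c); split=> //; split=> //; rewrite /c; ring.
  have [a [a0 Ha]] := proj1 (locallyC _ _) (notin_lattice_near tau Htau _ n).
  have P0 := Cmod_ge_0 p. set e := (a / (4 * (1 + Cmod p)))%R.
  have e0 : (0 < e)%R by apply: Rdiv_lt_0_compat; lra.
  have eE : (e * (1 + Cmod p) = a / 4)%R by rewrite /e; field; lra.
  exists e. split=> // s Hs As u Hu. apply: Ha.
  have -> : u - ((1 - s) * p + s * (- p)) - (z - c) = (u - z) + 2 * ((s - t)%R * p) by rewrite /c RtoC_minus; ring.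
  apply: Rle_lt_trans (Cmod_triangle _ _) _. rewrite !Cmod_mult !Cmod_R (Rabs_pos_eq 2); last lra.
  have := Rabs_pos (s - t). nra.
apply/locallyC. exists d. split=> // u Hu [s [w [Hs [Hw E]]]].
apply: (Hd s Hs u Hu). have -> : u - ((1 - s) * p + s * (- p)) = w by rewrite E; ring. exact: Hw.
Qed.

(** With the sigma function, the integral is log of sigma (z + p) sigma (z - p) / sigma (z)^2, which
    is wp z - wp p up to a constant factor; the factor 1 / 2 takes the root. A period adds the same
    eta_j to both zeta values, so the integrand is periodic off the cut. *)
Definition cut_root (z : C) : C :=
  cexp (/ 2 * I01 (fun s => p * (zeta tau (z + s * p) - zeta tau (z - s * p)))).

Lemma rcont_ray (z c : C) (t : R) : rcont (fun s => z + s * c) t.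
Proof. exact: rder_cont (rder_affine z c t). Qed.

(** The z-derivative of the integrand is also the derivative in s of zeta (z + s p) + zeta (z - s
    p), so it integrates to the boundary values. *)
Lemma cut_root_derive z : ~ cut tau p z ->
  is_derive cut_root z (/ 2 * (zeta tau (z + p) + zeta tau (z - p) - 2 * zeta tau z) * cut_root z).
Proof.
move=> Hz.
have sub : forall (u : C) (s : R), u - s * p = u + s * (- p) by move=> u s; ring.
have jc : forall (q : C) (t : R), flim (filter_prod (locally z) (locally t)) (fun x => fst x + snd x * q) (z + t * q).
  move=> q t. apply: flim_plus; first exact: flim_fst.
  exact: (flim_snd (fun s => s * q) t (flim_mult _ _ _ _ _ (flim_RtoC t) (flim_const _ q))).
have jcm : forall t : R, flim (filter_prod (locally z) (locally t)) (fun x => fst x - snd x * p) (z - t * p).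
  move=> t. apply: flim_minus; first exact: flim_fst.
  exact: (flim_snd (fun s => s * p) t (flim_mult _ _ _ _ _ (flim_RtoC t) (flim_const _ p))).
have rcm : forall (u : C) (t : R), flim (locally t) (fun s : R => u - s * p) (u - t * p).
  move=> u t. apply: flim_minus; first exact: flim_const. apply: flim_mult; [exact: flim_RtoC | exact: flim_const].
have nb : forall (q : C) (t : R), ~ Lam (z + t * q) -> filter_prod (locally z) (locally t) (fun x => ~ Lam (fst x + snd x * q)).
  move=> q t n. have [a [a0 Ha]] := proj1 (locallyC _ _) (notin_lattice_near tau Htau _ n).
  apply: filter_imp (jc q t a a0) => x Hx. exact: Ha.
have D : is_derive (fun z => I01 (fun s => p * (zeta tau (z + s * p) - zeta tau (z - s * p)))) z
   (I01 (fun s => p * (- wp tau (z + s * p) + wp tau (z - s * p)))).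
  apply: (derive_I01_filter _ (fun z s => p * (- wp tau (z + s * p) + wp tau (z - s * p)))).
  - move=> t Ht. have [n1 n2] := notcut_shift z t Hz Ht. rewrite sub in n2.
    apply: filter_imp (filter_and _ _ (nb p t n1) (nb (- p) t n2)) => -[u s]. cbn [fst snd] => -[m1 m2].
    rewrite -sub in m2.
    have d1 := derive_shift _ _ _ _ (zeta_derive tau Htau _ m1).
    have d2 := derive_shift _ u (- (s * p)) _ (zeta_derive tau Htau _ m2).
    apply: is_derive_eq (derive_scal p _ _ _ (derive_minus _ _ _ _ _ d1 d2)) _. ring.
  - move=> t Ht. have [n1 n2] := notcut_shift z t Hz Ht.
    apply: flim_mult; first exact: flim_const. apply: flim_plus.
    + apply: flim_opp. apply: (flim_comp _ (wp tau)); first exact: jc. exact: hol_cont (wp_hol tau Htau _ n1).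
    + exact: (flim_comp _ (wp tau) _ _ (jcm t) (hol_cont _ _ (wp_hol tau Htau _ n2))).
  - apply: filter_imp (notcut_near z Hz) => u Hu t Ht. have [n1 n2] := notcut_shift u t Hu Ht.
    apply: flim_mult; first exact: flim_const. apply: flim_minus.
    + apply: (flim_comp _ (zeta tau)); first exact: rcont_ray. exact: hol_cont (zeta_hol tau Htau _ n1).
    + exact: (flim_comp _ (zeta tau) _ _ (rcm u t) (hol_cont _ _ (zeta_hol tau Htau _ n2))).
have V : I01 (fun s => p * (- wp tau (z + s * p) + wp tau (z - s * p))) = zeta tau (z + p) + zeta tau (z - p) - 2 * zeta tau z.
  rewrite (I01_derive (fun s => zeta tau (z + s * p) + zeta tau (z + s * (- p)))).
  - have -> : z + 1%R * p = z + p by ring. have -> : z + 1%R * - p = z - p by ring.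
    have -> : z + 0%R * p = z by ring. have -> : z + 0%R * - p = z by ring. ring.
  - move=> t Ht. have [n1 n2] := notcut_shift z t Hz Ht. rewrite sub in n2.
    have r1 := rder_comp _ _ _ _ _ (zeta_derive tau Htau _ n1) (rder_affine z p t).
    have r2 := rder_comp _ _ _ _ _ (zeta_derive tau Htau _ n2) (rder_affine z (- p) t).
    have -> : p * (- wp tau (z + t * p) + wp tau (z - t * p)) = - wp tau (z + t * p) * p - - (- wp tau (z + t * - p) * - p).
      rewrite sub. ring.
    have r0 : rder (fun _ : R => RtoC 0) t 0 by have := rder_affine 0 0 t; congr rder; apply: functional_extensionality => s; ring.
    have r4 := rder_minus _ _ _ _ _ r1 (rder_minus _ _ _ _ _ r0 r2).
    have E1 : (fun s : R => zeta tau (z + s * p) + zeta tau (z + s * - p)) = (fun s : R => zeta tau (z + s * p) - (0 - zeta tau (z + s * - p))).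
      by apply: functional_extensionality => s; ring.
    rewrite E1. have -> : - wp tau (z + t * p) * p - - (- wp tau (z + t * - p) * - p) = - wp tau (z + t * p) * p - (0 - - wp tau (z + t * - p) * - p) by ring.
    exact: r4.
  - move=> t Ht. have [n1 n2] := notcut_shift z t Hz Ht.
    apply: flim_mult; first exact: flim_const. apply: flim_plus.
    + apply: flim_opp. apply: (flim_comp _ (wp tau)); first exact: rcont_ray. exact: hol_cont (wp_hol tau Htau _ n1).
    + exact: (flim_comp _ (wp tau) _ _ (rcm z t) (hol_cont _ _ (wp_hol tau Htau _ n2))).
rewrite V in D.
apply: is_derive_eq (derive_comp cexp _ _ _ _ (derive_cexp _) (derive_scal (/ 2) _ _ _ D)) _.
rewrite /cut_root. ring.
Qed.

Lemma cut_root_hol z : ~ cut tau p z -> hol cut_root z.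
Proof.
move=> Hz. apply: locallyC_imp (notcut_near z Hz) => u Hu. eexists. exact: cut_root_derive.
Qed.

Lemma cut_root_neq0 z : cut_root z <> 0.
Proof. exact: cexp_neq0. Qed.

Lemma cut_root_period j z : (j = 1 \/ j = 2)%nat -> ~ cut tau p z -> cut_root (z + omega tau j) = cut_root z.
Proof.
move=> Hj Hz. rewrite /cut_root. apply: (f_equal (fun x => cexp (/ 2 * x))). apply: I01_ext => s Hs.
have [n1 n2] := notcut_shift z s Hz Hs.
have E1 := eta_eq tau Htau j _ Hj n1. have E2 := eta_eq tau Htau j _ Hj n2.
have -> : z + omega tau j + s * p = z + s * p + omega tau j by ring.
have -> : z + omega tau j - s * p = z - s * p + omega tau j by ring.
have -> : zeta tau (z + s * p + omega tau j) = eta tau j + zeta tau (z + s * p) by rewrite -E1; ring.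
have -> : zeta tau (z - s * p + omega tau j) = eta tau j + zeta tau (z - s * p) by rewrite -E2; ring.
ring.
Qed.

(** * The potential as a rational function of [wp] *)

Hypothesis Hp : ~ Lam (p + p).
Let Np : ~ Lam p := not_double_notin tau p Hp.
Let dwp := C_derive (wp tau).
Let b := wp tau p.

Lemma notsing z : ~ sing tau p z <-> ~ Lam (z + z) /\ ~ Lam (z - p) /\ ~ Lam (z + p).
Proof.
split.
- move=> H. split; [|split] => q; apply: H.
  + left. by apply/two_torsion_double.
  + right. by left.
  + right. by right.
- move=> [h1 [h2 h3]] [/two_torsion_double q | [q | q]]; [exact: h1 | exact: h2 | exact: h3].
Qed.

Lemma notsing_addsing z : ~ sing tau p z -> ~ addsing tau p z.
Proof.
move=> /notsing [h1 [h2 h3]] [q|[q|q]]; [|exact: h3|exact: h2].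
exact: (not_double_notin tau z h1 q).
Qed.

Lemma notsing_near z : ~ sing tau p z -> locally z (fun u => ~ sing tau p u).
Proof.
move=> /notsing [h1 [h2 h3]].
apply: locallyC_imp (locally_and _ _ _ (not_double_near tau Htau z h1) (locally_and _ _ _
  (locally_shift (- p) z _ (notin_lattice_near tau Htau _ h2)) (locally_shift p z _ (notin_lattice_near tau Htau _ h3)))) => u [q1 [q2 q3]].
apply/notsing. by [].
Qed.

Lemma notsing_shift z w : ~ sing tau p z -> Lam w -> ~ sing tau p (z + w).
Proof.
move=> /notsing [h1 [h2 h3]] Hw. apply/notsing. split; [|split].
- have -> : z + w + (z + w) = z + z + (w + w) by ring. apply: notin_plus => //. exact: in_lattice_plus.
- have -> : z + w - p = z - p + w by ring. exact: notin_plus.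
- have -> : z + w + p = z + p + w by ring. exact: notin_plus.
Qed.

(** The addition formula with the roles of z and p exchanged. *)
Lemma zeta_sum z : ~ sing tau p z ->
  (zeta tau (z + p) + zeta tau (z - p) - 2 * zeta tau z) * (wp tau z - b) = dwp z.
Proof.
move=> /notsing [h1 [h2 h3]].
have na : ~ addsing tau z p.
  move=> [q|[q|q]]; first exact: Np.
  - apply: h3. by have -> : z + p = p + z by ring.
  - apply: h2. have -> : z - p = - (p - z) by ring. exact: in_lattice_opp.
have := addition tau Htau z h1 p na.
have -> : p + z = z + p by ring. have -> : p - z = - (z - p) by ring.
rewrite (zeta_odd tau Htau) // => h.
transitivity (- ((zeta tau (z + p) - - zeta tau (z - p) - 2 * zeta tau z) * (wp tau p - wp tau z))); first by rewrite /b; ring.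
rewrite h /dwp. ring.
Qed.

Lemma w_neq0 z : ~ sing tau p z -> wp tau z - b <> 0.
Proof. move=> Hz. apply: wp_sub_neq0 => //. exact: notsing_addsing. Qed.

(** Obtained by dividing [zeta_sum] by wp z - b and differentiating. *)
Lemma wp_sum z : ~ sing tau p z ->
  wp tau (z + p) + wp tau (z - p) = 2 * wp tau z - (C_derive dwp z * (wp tau z - b) - dwp z ^ 2) / (wp tau z - b) ^ 2.
Proof.
move=> Hz. have [h1 [h2 h3]] := proj1 (notsing z) Hz. have Nz := not_double_notin tau z h1.
have n := w_neq0 z Hz.
have d1 := derive_shift _ _ _ _ (zeta_derive tau Htau _ h3).
have d2 := derive_shift _ z (- p) _ (zeta_derive tau Htau _ h2).
have D1 := derive_minus _ _ _ _ _ (derive_plus _ _ _ _ _ d1 d2) (derive_scal 2 _ _ _ (zeta_derive tau Htau z Nz)).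
have dw := dwp_is tau Htau z Nz. have ddw := ddwp_is tau Htau z Nz.
have D2 : is_derive (fun u => dwp u / (wp tau u - b)) z ((C_derive dwp z * (wp tau z - b) - dwp z * (dwp z - 0)) / (wp tau z - b) ^ 2).
  apply: derive_div => //. apply: derive_minus => //. exact: derive_const.
have E : locally z (fun u => zeta tau (u + p) + zeta tau (u + - p) - 2 * zeta tau u = dwp u / (wp tau u - b)).
  apply: locallyC_imp (notsing_near z Hz) => u Hu. rewrite -(zeta_sum u Hu). have m := w_neq0 u Hu. rewrite /Cminus in m *. by field.
have := derive_unique _ _ _ _ (derive_ext_near _ _ _ _ E D1) D2 => h.
have -> : wp tau (z + p) + wp tau (z - p) = 2 * wp tau z - (- wp tau (z + p) + - wp tau (z - p) - 2 * - wp tau z) by ring.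
rewrite h. by field.
Qed.

(** By [cut_root_derive] and [zeta_sum] both sides have the same logarithmic derivative. The
    constant K is local, which suffices for an identity of germs at the base point. *)
Lemma cut_root_sq z : ~ sing tau p z -> ~ cut tau p z ->
  exists K : C, K <> 0 /\ locally z (fun u => cut_root u ^ 2 = K * (wp tau u - b)).
Proof.
move=> Hz Hc. have n := w_neq0 z Hz.
exists (cut_root z ^ 2 / (wp tau z - b)). split.
  apply: Cmult_neq_0; first by apply: Cpow_nz; exact: cut_root_neq0.
  move=> E. apply: C1_nz. have <- : (wp tau z - b) * / (wp tau z - b) = 1 by field. rewrite E. ring.
have L : locally z (fun u => is_derive (fun u => cut_root u ^ 2 / (wp tau u - b)) u (RtoC 0)).
  apply: locallyC_imp (locally_and _ _ _ (notsing_near z Hz) (notcut_near z Hc)) => u [Hu Hcu].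
  have [h1 [h2 h3]] := proj1 (notsing u) Hu. have Nu := not_double_notin tau u h1. have m := w_neq0 u Hu.
  have dE := cut_root_derive u Hcu. have dw := dwp_is tau Htau u Nu.
  apply: is_derive_eq; first (cderive; exact: m).
  have -> : C_derive (wp tau) u = dwp u by []. rewrite -(zeta_sum u Hu) INR2. field. exact: m.
apply: locallyC_imp (locally_and _ _ _ (derive_zero_near _ _ L) (notsing_near z Hz)) => u [h Hu].
have m := w_neq0 u Hu. rewrite -h. by field.
Qed.

Definition dmu2 := C_derive dwp p.

(** With the differential equation of wp this makes the expression for kappa a rational function of
    wp z alone. *)
Lemma potential_rational (A B : C) z : ~ sing tau p z ->
  potential tau p A B z = 2 * wp tau z + 3 / 4 * (2 * b + dmu2 / (wp tau z - b) + dwp p ^ 2 / (wp tau z - b) ^ 2)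
    + A * (2 * zeta tau p - dwp p / (wp tau z - b)) + B.
Proof.
move=> Hz. have [h1 _] := proj1 (notsing z) Hz. have Nz := not_double_notin tau z h1.
have n := w_neq0 z Hz. have [s [v2 [v3 H]]] := wp_invariants tau Htau.
have [f1 f2] := H z Nz. have [p1 p2] := H p Np.
rewrite /potential wp_sum //.
have -> : zeta tau (z + p) - zeta tau (z - p) = 2 * zeta tau p - dwp p / (wp tau z - b).
  have := addition tau Htau p Hp z (notsing_addsing z Hz) => h.
  have -> : dwp p = - (- dwp p) by ring. rewrite -[X in _ - (- X) / _]h -/b. by field.
have E3 : g3 tau = 4 * b ^ 3 - g2 tau * b - dwp p ^ 2 by rewrite /dwp p1 /b; ring.
congr (_ + _ * _ + _ + _).
rewrite f2 /dwp f1 -/dwp E3 /dmu2 p2 -/b. by field.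
Qed.

Lemma potential_hol (A B : C) z : ~ sing tau p z -> hol (potential tau p A B) z.
Proof.
move=> Hz. have [h1 [h2 h3]] := proj1 (notsing z) Hz. have Nz := not_double_notin tau z h1.
have q1 := wp_hol tau Htau z Nz.
have q2 := hol_shift _ p z (wp_hol tau Htau _ h3). have q3 := hol_shift _ (- p) z (wp_hol tau Htau _ h2).
have q4 := hol_shift _ p z (zeta_hol tau Htau _ h3). have q5 := hol_shift _ (- p) z (zeta_hol tau Htau _ h2).
apply: hol_plus; last exact: hol_const. apply: hol_plus.
- apply: hol_plus; first exact: (hol_mult _ _ _ (hol_const 2 _) q1). apply: hol_mult; first exact: hol_const. exact: hol_plus.
- apply: hol_mult; first exact: hol_const. exact: (hol_minus _ _ _ q4 q5).
Qed.

Lemma potential_period (A B : C) z w : ~ sing tau p z -> Lam w -> potential tau p A B (z + w) = potential tau p A B z.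
Proof.
move=> Hz Hw. have [h1 _] := proj1 (notsing z) Hz. have Nz := not_double_notin tau z h1.
rewrite (potential_rational A B z Hz) (potential_rational A B (z + w) (notsing_shift z w Hz Hw)). by rewrite wp_period.
Qed.

(** * The apparentness condition *)

(** For h = s y with s^2 = z - p the equation becomes (z - p) h'' - h' + (A - (z - p) m) h = 0. Its
    value and derivative at p give A h = h' and A h' = m h there, hence A^2 = m p as soon as some
    solution has h p <> 0. *)
Lemma apparent_relation (A B : C) : apparent (potential tau p A B) p ->
  A ^ 2 = 2 * wp tau p + 3 / 4 * wp tau (p + p) + A * zeta tau (p + p) + B.
Proof.
move=> [r [r0 Happ]].
(* The regular part of the potential at p: the potential is 3 / 4 (z - p)^-2 - A (z - p)^-1 + m. *)
pose m z := 2 * wp tau z + 3 / 4 * (wp tau (z + p) + wp_reg tau (z - p)) + A * (zeta tau (z + p) - zeta_reg tau (z - p)) + B.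
have reg0 := regular_0 tau Htau.
have pp : p + - p = 0 by ring.
have mh : hol m p.
  have q1 := wp_hol tau Htau p Np.
  have q2 := hol_shift _ p p (wp_hol tau Htau _ Hp). have q4 := hol_shift _ p p (zeta_hol tau Htau _ Hp).
  have q3 : hol (fun z => wp_reg tau (z + - p)) p by apply: hol_shift; rewrite pp; exact: wp_reg_hol.
  have q5 : hol (fun z => zeta_reg tau (z + - p)) p by apply: hol_shift; rewrite pp; exact: zeta_reg_hol.
  apply: hol_plus; last exact: hol_const. apply: hol_plus.
  - apply: hol_plus; first exact: (hol_mult _ _ _ (hol_const 2 _) q1). apply: hol_mult; first exact: hol_const. exact: hol_plus.
  - apply: hol_mult; first exact: hol_const. exact: (hol_minus _ _ _ q4 q5).
have mp : m p = 2 * wp tau p + 3 / 4 * wp tau (p + p) + A * zeta tau (p + p) + B.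
  rewrite /m. have -> : p - p = 0 by ring. rewrite wp_reg_0 // zeta_reg_0 //. ring.
rewrite -mp.
have punct : locally p (fun z => z <> p -> ~ sing tau p z).
  have L := punctured_notin_lattice tau Htau (p + - p).
  apply: locallyC_imp (locally_and _ _ _ (locally_shift (- p) p _ L) (locally_and _ _ _ (not_double_near tau Htau p Hp)
     (locally_shift p p _ (notin_lattice_near tau Htau _ Hp)))) => z [q1 [q2 q3]] ne.
  apply/notsing. split=> //. split=> //. apply: q1 => E. apply: ne. exact: Cplus_cancel_r E.
have [r1 [r10 mdisc]] := hol_disc_of _ _ mh.
have [r2 [r20 Hr2]] := proj1 (locallyC _ _) punct.
set r3 := Rmin r (Rmin r1 r2). have r30 : (0 < r3)%R by do 2 apply: Rmin_pos => //.
have l1 : (r3 <= r)%R by exact: Rmin_l.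
have l2 : (r3 <= r1)%R by apply: Rle_trans (Rmin_r _ _) (Rmin_l _ _).
have l3 : (r3 <= r2)%R by apply: Rle_trans (Rmin_r _ _) (Rmin_r _ _).
pose z0 := p + (r3 / 2)%R.
have z0p : z0 - p = (r3 / 2)%R by rewrite /z0; ring.
have z0n : Cmod (z0 - p) = (r3 / 2)%R by rewrite z0p Cmod_R Rabs_pos_eq; lra.
have z0ne : z0 <> p by move=> E; rewrite E Cmod_sub_self in z0n; lra.
have z0s : ~ sing tau p z0 by apply: Hr2 => //; lra.
have t0 : z0 - p <> 0 by exact: Cminus_eq_contra.
have [u1 [u2 [S1 [S2 W12]]]] := solution_pair _ z0 (potential_hol A B z0 z0s).
(* A branch of the square root of z - p near z0, as c0 times the exponential of a primitive of 1 /
   (2 (z - p)). *)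
have [s [sh [sder ssq]]] : exists s, hol s z0 /\ locally z0 (fun z : C => is_derive s z (s z / (2 * (z - p)))) /\
    locally z0 (fun z => s z ^ 2 = z - p).
  have [c0 Hc0] := C_sqrt_exists (z0 - p).
  have ne_near : forall z, (Cmod (z - z0) < r3 / 2)%R -> z - p <> 0.
    move=> z Hz E. have := Cmod_sub_tri z0 z p. rewrite E Cmod_0 z0n Cmod_sub_sym. lra.
  have two : RtoC 2 <> 0 by move=> /(f_equal Re) /=; lra.
  have hd : hol_disc (fun z => / (2 * (z - p))) z0 (r3 / 2).
    move=> z Hz. have n := ne_near z Hz. eexists. cderive. exact: Cmult_neq_0.
  pose L := SI (fun z => / (2 * (z - p))) z0.
  have zz : (Cmod (z0 - z0) < r3 / 2)%R by rewrite Cmod_sub_self; lra.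
  have sd : forall z, (Cmod (z - z0) < r3 / 2)%R -> is_derive (fun z => c0 * cexp (L z)) z (c0 * cexp (L z) / (2 * (z - p))).
    move=> z Hz. have n := ne_near z Hz.
    apply: is_derive_eq (derive_scal c0 _ _ _ (derive_comp cexp L _ _ _ (derive_cexp _) (primitive_disc _ _ _ z hd Hz))) _.
    by field.
  exists (fun z => c0 * cexp (L z)). split; [|split].
  - apply: locallyC_imp (locally_disc _ _ _ zz) => z Hz. eexists. exact: sd.
  - apply: locallyC_imp (locally_disc _ _ _ zz) => z Hz. exact: sd.
  - have cst : forall z, (Cmod (z - z0) < r3 / 2)%R -> is_derive (fun z => (c0 * cexp (L z)) ^ 2 / (z - p)) z (RtoC 0).
      move=> z Hz. have n := ne_near z Hz. have dd := sd z Hz.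
      have d2 := derive_pow _ _ _ 1 dd. have d3 := derive_minus _ _ _ _ _ (derive_id z) (derive_const p z).
      apply: is_derive_eq (derive_div (fun z => (c0 * cexp (L z)) ^ 2) (fun z => z - p) _ _ _ n d2 d3) _. rewrite INR2. by field.
    apply: locallyC_imp (locally_disc _ _ _ zz) => z Hz. have n := ne_near z Hz.
    have := derive_zero_disc _ _ _ cst z Hz. rewrite /L SI_self cexp_0.
    have -> : (c0 * 1) ^ 2 / (z0 - p) = 1 by (have -> : c0 * 1 = c0 by ring); rewrite Hc0; field.
    move=> h. transitivity ((c0 * cexp (SI (fun z => / (2 * (z - p))) z0 z)) ^ 2 / (z - p) * (z - p)); first by field.
    rewrite h. ring.
have shn : holomorphic_near s z0 by exact: sh.
have z0r : (0 < Cmod (z0 - p) < r)%R by rewrite z0n; lra.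
have [h1 [H1 E1]] := Happ z0 u1 s z0r S1 shn ssq.
have [h2 [H2 E2]] := Happ z0 u2 s z0r S2 shn ssq.
have Hd1 : hol_disc h1 p r3 by move=> z Hz; apply: H1; lra.
have Hd2 : hol_disc h2 p r3 by move=> z Hz; apply: H2; lra.
have z0d : (Cmod (z0 - p) < r3)%R by rewrite z0n; lra.
have pd : (Cmod (p - p) < r3)%R by rewrite Cmod_sub_self.
have L1 : locally z0 (fun z => z - p <> 0).
  exact: (flim_neq0 _ (fun z => z - p) _ t0 (flim_minus _ _ _ _ _ (flim_id z0) (flim_const _ p))).
have Qm : locally z0 (fun z => potential tau p A B z * (z - p) ^ 2 = 3 / 4 - A * (z - p) + (z - p) ^ 2 * m z).
  apply: locallyC_imp L1 => z n. rewrite /potential /m (wp_split tau (z - p)) (zeta_split tau (z - p)). by field.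
have deriv : forall u h, local_solution (potential tau p A B) z0 u -> germ_eq z0 (fun z => s z * u z) h ->
    locally z0 (fun z : C => [/\ is_derive u z (C_derive u z), is_derive (C_derive u) z (potential tau p A B z * u z),
       h z = s z * u z, C_derive h z = s z / (2 * (z - p)) * u z + s z * C_derive u z &
       C_derive (C_derive h) z = - s z / (4 * (z - p) ^ 2) * u z + s z / (z - p) * C_derive u z + s z * (potential tau p A B z * u z)]).
  move=> u h /local_solution_derive Su Eh.
  have two : RtoC 2 <> 0 by move=> /(f_equal Re) /=; lra.
  have D1 : locally z0 (fun z : C => C_derive h z = s z / (2 * (z - p)) * u z + s z * C_derive u z).
    apply: locallyC_imp (locally_and _ _ _ (germ_near _ _ _ Eh) (locally_and _ _ _ Su sder)) => z [q1 [[q2 q3] q4]].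
    apply: is_C_derive_unique. apply: derive_ext_near q1 _. exact: derive_mult.
  apply: locallyC_imp (locally_and _ _ _ L1 (locally_and _ _ _ Eh (locally_and _ _ _ (germ_near _ _ _ D1) (locally_and _ _ _ Su sder)))) => z [n [q0 [q1 [[q2 q3] q4]]]].
  split=> //; first exact: locally_singleton q1.
  apply: is_C_derive_unique. apply: derive_ext_near (germ_sym _ _ _ q1) _.
  have n2 : 2 * (z - p) <> 0 by exact: Cmult_neq_0.
  apply: is_derive_eq; first (cderive; exact: n2). by field.
have ode : forall u h, local_solution (potential tau p A B) z0 u -> germ_eq z0 (fun z => s z * u z) h -> hol_disc h p r3 ->
    (A * h p = C_derive h p) /\ (A * C_derive h p = m p * h p).
  move=> u h Su Eh Hh.
  have Hh' := hol_disc_derive _ _ _ Hh. have Hh'' := hol_disc_derive _ _ _ Hh'.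
  (* The equation holds near z0 and so, by the identity theorem, on the whole disc including p. *)
  pose N z := (z - p) * C_derive (C_derive h) z - C_derive h z + (A - (z - p) * m z) * h z.
  have Nd : hol_disc N p r3.
    move=> z Hz. have d1 := C_derive_is _ _ (Hh z Hz). have d2 := C_derive_is _ _ (Hh' z Hz). have d3 := C_derive_is _ _ (Hh'' z Hz).
    have d4 := C_derive_is _ _ (mdisc z ltac:(lra)). eexists. rewrite /N. cderive.
  have N0 : locally z0 (fun z => N z = 0).
    apply: locallyC_imp (locally_and _ _ _ L1 (locally_and _ _ _ Qm (deriv u h Su Eh))) => z [n [qm [_ _ e0 e1 e2]]].
    rewrite /N e0 e1 e2.
    have -> : m z = (potential tau p A B z * (z - p) ^ 2 - 3 / 4 + A * (z - p)) / (z - p) ^ 2 by rewrite qm; field.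
    by field.
  have NZ := identity_disc N p r3 z0 Nd z0d N0.
  have d1 := C_derive_is _ _ (Hh p pd). have d2 := C_derive_is _ _ (Hh' p pd). have d3 := C_derive_is _ _ (Hh'' p pd).
  have d4 := C_derive_is _ _ (mdisc p ltac:(lra)).
  split.
  - have := NZ p pd. rewrite /N => q. transitivity (((p - p) * C_derive (C_derive h) p - C_derive h p + (A - (p - p) * m p) * h p) + C_derive h p); first by ring.
    rewrite q. ring.
  - have Dz : is_derive N p (RtoC 0).
      apply: (derive_ext_near (fun _ => RtoC 0)); last exact: derive_const.
      apply: locallyC_imp (locally_disc _ _ _ pd) => z Hz. by rewrite NZ.
    have Dn : is_derive N p (A * C_derive h p - m p * h p).
      apply: is_derive_eq; first (rewrite /N; cderive). ring.
    have := derive_unique _ _ _ _ Dn Dz => q. by apply/Ceq_minus.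
have [o1 o1'] := ode u1 h1 S1 E1 Hd1. have [o2 o2'] := ode u2 h2 S2 E2 Hd2.
suff : h1 p <> 0 \/ h2 p <> 0.
  move=> [n|n]; apply/Ceq_minus; apply: NNPP => q; apply: (Cmult_neq_0 _ _ q n).
  - transitivity (A * (A * h1 p) - m p * h1 p); first by ring. rewrite o1 o1'. ring.
  - transitivity (A * (A * h2 p) - m p * h2 p); first by ring. rewrite o2 o2'. ring.
apply: NNPP => nn.
have h1p : h1 p = 0 by apply: NNPP => q; apply: nn; left.
have h2p : h2 p = 0 by apply: NNPP => q; apply: nn; right.
(* The Wronskian of h1 and h2 is s^2 times that of u1 and u2, that is z - p. If both functions
   vanished at p, the derivative of V at p would be - 1 although V is zero. *)
pose V z := h1 z * C_derive h2 z - C_derive h1 z * h2 z - (z - p).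
have Hd1' := hol_disc_derive _ _ _ Hd1. have Hd2' := hol_disc_derive _ _ _ Hd2.
have dv1 := fun z Hz => C_derive_is _ _ (Hd1 z Hz). have dv2 := fun z Hz => C_derive_is _ _ (Hd2 z Hz).
have dv1' := fun z Hz => C_derive_is _ _ (Hd1' z Hz). have dv2' := fun z Hz => C_derive_is _ _ (Hd2' z Hz).
have Vd : forall z, (Cmod (z - p) < r3)%R -> is_derive V z (h1 z * C_derive (C_derive h2) z - C_derive (C_derive h1) z * h2 z - 1).
  move=> z Hz. have a1 := dv1 z Hz. have a2 := dv2 z Hz. have a3 := dv1' z Hz. have a4 := dv2' z Hz.
  apply: is_derive_eq; first (rewrite /V; cderive). ring.
have V0 : locally z0 (fun z => V z = 0).
  apply: locallyC_imp (locally_and _ _ _ L1 (locally_and _ _ _ ssq (locally_and _ _ _ (wronskian_const _ _ _ _ S1 S2)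
     (locally_and _ _ _ (deriv u1 h1 S1 E1) (deriv u2 h2 S2 E2))))) => z [n [qs [qw [[_ _ e0 e1 _] [_ _ f0 f1 _]]]]].
  rewrite W12 in qw. rewrite /V e0 e1 f0 f1.
  transitivity (s z ^ 2 * wronskian u1 u2 z - (z - p)); first by rewrite /wronskian; field.
  rewrite qw qs. ring.
have VZ := identity_disc V p r3 z0 (fun z Hz => ex_intro _ _ (Vd z Hz)) z0d V0.
have Dz : is_derive V p (RtoC 0).
  apply: (derive_ext_near (fun _ => RtoC 0)); last exact: derive_const.
  apply: locallyC_imp (locally_disc _ _ _ pd) => z Hz. by rewrite VZ.
have := derive_unique _ _ _ _ (Vd p pd) Dz. rewrite h1p h2p => q.
apply: C1_nz. transitivity (- (0 * C_derive (C_derive h2) p - C_derive (C_derive h1) p * 0 - 1)); first by ring.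
rewrite q. ring.
Qed.

End CutRoot.

(** * Proportional germs *)

(** The quotient is constant near some point close to a where g is nonzero; the identity theorem
    carries the relation back to a, where g may vanish. *)
Lemma germ_proportional (f g : C -> C) (a : C) : hol f a -> hol g a ->
  locally a (fun z => C_derive f z * g z - f z * C_derive g z = 0) ->
  ~ germ_eq a g (fun _ => RtoC 0) -> exists k : C, germ_eq a f (fun z => k * g z).
Proof.
move=> /hol_disc_of [r1 [r10 Hf]] /hol_disc_of [r2 [r20 Hg]] /locallyC [r3 [r30 H]] ng.
set r := Rmin r1 (Rmin r2 r3). have r0 : (0 < r)%R by do 2 apply: Rmin_pos => //.
have l1 : (r <= r1)%R by exact: Rmin_l.
have l2 : (r <= r2)%R by apply: Rle_trans (Rmin_r _ _) (Rmin_l _ _).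
have l3 : (r <= r3)%R by apply: Rle_trans (Rmin_r _ _) (Rmin_r _ _).
have [z1 [Hz1 gz1]] : exists z1, (Cmod (z1 - a) < r)%R /\ g z1 <> 0.
  apply: NNPP => h. apply: ng. apply/locallyC. exists r. split=> // w Hw. apply: NNPP => q. apply: h. by exists w.
have Df : forall z : C, (Cmod (z - a) < r)%R -> is_derive f z (C_derive f z) by move=> z Hz; apply: C_derive_is; apply: Hf; lra.
have Dg : forall z : C, (Cmod (z - a) < r)%R -> is_derive g z (C_derive g z) by move=> z Hz; apply: C_derive_is; apply: Hg; lra.
have gn : locally z1 (fun z => g z <> 0) by exact: flim_neq0 gz1 (is_derive_cont _ _ _ (Dg z1 Hz1)).
have L : locally z1 (fun z : C => is_derive (fun z => f z / g z) z (RtoC 0)).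
  apply: locallyC_imp (locally_and _ _ _ gn (locally_disc _ _ _ Hz1)) => z [n Hz].
  apply: is_derive_eq (derive_div f g z _ _ n (Df z Hz) (Dg z Hz)) _. rewrite (H z ltac:(lra)). by field.
exists (f z1 / g z1).
have E : locally z1 (fun z => f z - f z1 / g z1 * g z = 0).
  apply: locallyC_imp (locally_and _ _ _ gn (derive_zero_near _ _ L)) => z [n <-]. by field.
have hd : hol_disc (fun z => f z - f z1 / g z1 * g z) a r.
  move=> z Hz. eexists. exact: (derive_minus _ _ _ _ _ (Df z Hz) (derive_scal (f z1 / g z1) _ _ _ (Dg z Hz))).
have aa : (Cmod (a - a) < r)%R by rewrite Cmod_sub_self.
apply: locallyC_imp (locally_disc _ _ _ aa) => z Hz. apply/Ceq_minus. exact: (identity_disc _ _ _ _ hd Hz1 E z Hz).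
Qed.

(** With s^2 = c, f^2 - c g^2 factors as (f - s g) (f + s g), and one factor vanishes as a germ. *)
Lemma germ_sqrt (f g : C -> C) (a c : C) : hol f a -> hol g a ->
  locally a (fun z => f z ^ 2 = c * g z ^ 2) -> exists k : C, germ_eq a f (fun z => k * g z).
Proof.
move=> Hf Hg H. have [s Hs] := C_sqrt_exists c.
have h1 : hol (fun z => f z - s * g z) a by apply: hol_minus => //; apply: hol_mult => //; exact: hol_const.
have h2 : hol (fun z => f z + s * g z) a by apply: hol_plus => //; apply: hol_mult => //; exact: hol_const.
have E : locally a (fun z => (f z - s * g z) * (f z + s * g z) = 0).
  apply: locallyC_imp H => z h. transitivity (f z ^ 2 - s ^ 2 * g z ^ 2); first by ring. rewrite h Hs. ring.
case: (hol_mult_zero _ _ _ h1 h2 E) => L.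
- exists s. apply: locallyC_imp L => z h. by apply/Ceq_minus.
- exists (- s). apply: locallyC_imp L => z h. apply/Ceq_minus. rewrite -h. ring.
Qed.

Lemma solution_collinear (Q : C -> C) a y v : hol Q a -> local_solution Q a y -> local_solution Q a v ->
  wronskian y v a = 0 -> ~ germ_eq a y (fun _ => RtoC 0) -> exists c : C, germ_eq a v (fun z => c * y z).
Proof.
move=> hQ Sy Sv W ny. rewrite /wronskian in W.
have red : forall c, v a = c * y a -> C_derive v a = c * C_derive y a -> exists c : C, germ_eq a v (fun z => c * y z).
  move=> c E1 E2. exists c. have S := local_solution_lin Q a v y 1 (- c) Sv Sy.
  have /local_solution_derive /locally_singleton [dv _] := Sv. have /local_solution_derive /locally_singleton [dy _] := Sy.
  have D := is_C_derive_unique _ _ _ (derive_plus _ _ _ _ _ (derive_scal 1 _ _ _ dv) (derive_scal (- c) _ _ _ dy)).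
  have Z := solution_zero Q a _ hQ S.
  apply: locallyC_imp (Z _ _) => [z h| |].
  - apply/Ceq_minus. rewrite -h. ring.
  - rewrite E1. ring.
  - rewrite D E2. ring.
case: (Ceq_dec (y a) 0) => [y0|n].
- have n : C_derive y a <> 0 by move=> q; apply: ny; exact: (solution_zero Q).
  have v0 : v a = 0.
    apply: NNPP => q. apply: (Cmult_neq_0 _ _ n q). rewrite y0 in W. transitivity (- (0 * C_derive v a - C_derive y a * v a)); first by ring.
    rewrite W. ring.
  apply: (red (C_derive v a / C_derive y a)); first by rewrite v0 y0; ring. by field.
- apply: (red (v a / y a)); first by field.
  have E : y a * C_derive v a = C_derive y a * v a by apply/Ceq_minus.
  transitivity (y a * C_derive v a / y a); first by field. rewrite E. by field.
Qed.

Lemma wronskian_lin_indep (Q : C -> C) a y1 y2 : local_solution Q a y1 -> local_solution Q a y2 ->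
  wronskian y1 y2 a <> 0 -> lin_indep a y1 y2.
Proof.
move=> S1 S2 W c1 c2 E.
have /local_solution_derive /locally_singleton [d1 _] := S1. have /local_solution_derive /locally_singleton [d2 _] := S2.
have D := derive_plus _ _ _ _ _ (derive_scal c1 _ _ _ d1) (derive_scal c2 _ _ _ d2).
have e0 := locally_singleton _ _ E. cbv beta in e0.
have e1 := derive_unique _ _ _ _ (derive_ext_near _ _ _ _ E D) (derive_const (RtoC 0) a).
rewrite /wronskian in W.
split; apply: NNPP => q; apply: (Cmult_neq_0 _ _ q W).
- transitivity ((c1 * y1 a + c2 * y2 a) * C_derive y2 a - (c1 * C_derive y1 a + c2 * C_derive y2 a) * y2 a); first by ring.
  rewrite e0 e1. ring.
- transitivity ((c1 * C_derive y1 a + c2 * C_derive y2 a) * y1 a - (c1 * y1 a + c2 * y2 a) * C_derive y1 a); first by ring.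
  rewrite e0 e1. ring.
Qed.

Lemma wronskian_basis (Q : C -> C) a y1 y2 : local_solution Q a y1 -> local_solution Q a y2 ->
  wronskian y1 y2 a <> 0 -> solution_basis Q a y1 y2.
Proof.
move=> S1 S2 W. split; [|split; [|split]] => //; first exact: (wronskian_lin_indep Q).
move=> y Sy. do 2 eexists. exact: (solution_span Q a y1 y2 y S1 S2 W Sy).
Qed.

Lemma wronskian_scal y1 y2 (c : C) a : ex_derive y1 a -> wronskian (fun z => c * y1 z) y2 a = c * wronskian y1 y2 a.
Proof.
move=> /C_derive_is d. rewrite /wronskian (is_C_derive_unique _ _ _ (derive_scal c _ _ _ d)). ring.
Qed.

(** * The operator [Phi y' - Phi' y / 2] on solutions *)

Section ProductOperator.
Context (Q Phi : C -> C) (a kappa : C).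
Hypothesis HQ : hol Q a.
Hypothesis HPhi : hol Phi a.
Hypothesis Hnz : ~ germ_eq a Phi (fun _ => RtoC 0).
Hypothesis Hkappa : locally a (fun z =>
  C_derive Phi z ^ 2 - 2 * Phi z * C_derive (C_derive Phi) z + 4 * Q z * Phi z ^ 2 = kappa).

(** This is T. For Phi = u v it acts on u and v by - W / 2 and W / 2, where W is the Wronskian of u
    and v. *)
Definition prodop (y : C -> C) (z : C) : C := Phi z * C_derive y z - C_derive Phi z * y z / 2.

(** The third order equation satisfied by products of solutions. The derivative of the kappa
    relation is 2 Phi times it, and Phi is cancelled as a nonzero germ. *)
Lemma product_equation : locally a (fun z =>
  C_derive (C_derive (C_derive Phi)) z = 4 * Q z * C_derive Phi z + 2 * C_derive Q z * Phi z).
Proof.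
have h1 := hol_derive _ _ HPhi. have h2 := hol_derive _ _ h1. have h3 := hol_derive _ _ h2. have hq := hol_derive _ _ HQ.
have E : locally a (fun z => Phi z * (4 * Q z * C_derive Phi z + 2 * C_derive Q z * Phi z - C_derive (C_derive (C_derive Phi)) z) = 0).
  have K := locally_locallyC _ _ Hkappa.
  apply: locallyC_imp (locally_and _ _ _ K (locally_and _ _ _ (hol_is_derive _ _ HPhi)
    (locally_and _ _ _ (hol_is_derive _ _ h1) (locally_and _ _ _ (hol_is_derive _ _ h2) (hol_is_derive _ _ HQ))))) => z [k [d0 [d1 [d2 dq]]]].
  have D : is_derive (fun z => C_derive Phi z ^ 2 - 2 * Phi z * C_derive (C_derive Phi) z + 4 * Q z * Phi z ^ 2) z
    (2 * (Phi z * (4 * Q z * C_derive Phi z + 2 * C_derive Q z * Phi z - C_derive (C_derive (C_derive Phi)) z))).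
    apply: is_derive_eq; first cderive. rewrite INR2. ring.
  have := derive_unique _ _ _ _ (derive_ext_near _ _ _ _ k D) (derive_const kappa z) => h.
  transitivity (2 * (Phi z * (4 * Q z * C_derive Phi z + 2 * C_derive Q z * Phi z - C_derive (C_derive (C_derive Phi)) z)) / 2).
    field.
  rewrite h. field.
have hr : hol (fun z => 4 * Q z * C_derive Phi z + 2 * C_derive Q z * Phi z - C_derive (C_derive (C_derive Phi)) z) a.
  apply: hol_minus => //. apply: hol_plus; apply: hol_mult => //; apply: hol_mult => //; exact: hol_const.
case: (hol_mult_zero _ _ _ HPhi hr E) => // L.
apply: locallyC_imp L => z h. symmetry. by apply/Ceq_minus.
Qed.

Lemma prodop_solution y : local_solution Q a y ->
  local_solution Q a (prodop y) /\
  locally a (fun z => C_derive (prodop y) z = C_derive Phi z * C_derive y z / 2 + (Phi z * Q z - C_derive (C_derive Phi) z / 2) * y z).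
Proof.
move=> /local_solution_derive Sy.
have h1 := hol_derive _ _ HPhi. have h2 := hol_derive _ _ h1.
have L := locally_and _ _ _ Sy (locally_and _ _ _ (hol_is_derive _ _ HPhi)
    (locally_and _ _ _ (hol_is_derive _ _ h1) (locally_and _ _ _ (hol_is_derive _ _ h2) (locally_and _ _ _ (hol_is_derive _ _ HQ) product_equation)))).
pose dT (z : C) : C := C_derive Phi z * C_derive y z / 2 + (Phi z * Q z - C_derive (C_derive Phi) z / 2) * y z.
have D : locally a (fun z : C => is_derive (prodop y) z (dT z) /\ is_derive dT z (Q z * prodop y z)).
  have n2 : RtoC 2 <> 0 by move=> /(f_equal Re) /=; lra.
  apply: locallyC_imp L => z [[y1 y2] [d0 [d1 [d2 [dq pe]]]]]. split.
  - rewrite /prodop. apply: is_derive_eq; first (cderive; exact: n2). rewrite /dT. field.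
  - rewrite /dT. apply: is_derive_eq; first (cderive; exact: n2). rewrite pe /prodop. field.
split; first by exists dT.
apply: locallyC_imp D => z [h _]. exact: is_C_derive_unique h.
Qed.

Lemma prodop_sq y : local_solution Q a y -> germ_eq a (prodop (prodop y)) (fun z => kappa / 4 * y z).
Proof.
move=> Sy. have [_ D] := prodop_solution y Sy.
apply: locallyC_imp (locally_and _ _ _ D Hkappa) => z [d k].
rewrite {1}/prodop d /prodop -k. field.
Qed.

Lemma prodop_ext y v : hol y a -> germ_eq a y v -> germ_eq a (prodop y) (prodop v).
Proof.
move=> Hy E. apply: locallyC_imp (locally_and _ _ _ E (germ_derive _ _ _ Hy E)) => z [e1 e2]. by rewrite /prodop e1 e2.
Qed.

Lemma prodop_lin y v (c1 c2 : C) : hol y a -> hol v a ->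
  germ_eq a (prodop (fun z => c1 * y z + c2 * v z)) (fun z => c1 * prodop y z + c2 * prodop v z).
Proof.
move=> Hy Hv. apply: locallyC_imp (locally_and _ _ _ (hol_is_derive _ _ Hy) (hol_is_derive _ _ Hv)) => z [d1 d2].
rewrite /prodop (is_C_derive_unique _ _ _ (derive_plus _ _ _ _ _ (derive_scal c1 _ _ _ d1) (derive_scal c2 _ _ _ d2))). field.
Qed.

Lemma prodop_wronskian y v z : y z * prodop v z - v z * prodop y z = Phi z * wronskian y v z.
Proof. rewrite /prodop /wronskian. field. Qed.

(** Equal eigenvalues make Phi times the Wronskian zero, by [prodop_wronskian]; so each eigenspace
    of T has dimension at most one. *)
Lemma prodop_scalar y v (mu : C) : local_solution Q a y -> local_solution Q a v ->
  germ_eq a (prodop y) (fun z => mu * y z) -> germ_eq a (prodop v) (fun z => mu * v z) -> wronskian y v a = 0.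
Proof.
move=> Sy Sv E1 E2. apply: NNPP => n. apply: Hnz.
apply: locallyC_imp (locally_and _ _ _ E1 (locally_and _ _ _ E2 (wronskian_const Q a y v Sy Sv))) => z [e1 [e2 w]].
have := prodop_wronskian y v z. rewrite e1 e2 w => h.
transitivity (Phi z * wronskian y v a / wronskian y v a); first by field.
rewrite -h. by field.
Qed.

Lemma prodop_not_scalar (mu : C) : exists u, local_solution Q a u /\
  ~ germ_eq a (fun z => prodop u z - mu * u z) (fun _ => RtoC 0).
Proof.
have [u1 [u2 [S1 [S2 W]]]] := solution_pair Q a HQ.
apply: NNPP => h.
have all : forall u, local_solution Q a u -> germ_eq a (prodop u) (fun z => mu * u z).
  move=> u Su. apply: NNPP => n. apply: h. exists u. split=> // q. apply: n. apply: locallyC_imp q => z q. by apply/Ceq_minus.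
apply: C1_nz. rewrite -W. exact: prodop_scalar S1 S2 (all _ S1) (all _ S2).
Qed.

(** On solutions (T - mu) (T + mu) = 0, so (T + mu) u is an eigenvector; it can be made nonzero
    because T is not the scalar - mu. *)
Lemma prodop_eigenvector (mu : C) : mu ^ 2 = kappa / 4 -> exists y, local_solution Q a y /\
  germ_eq a (prodop y) (fun z => mu * y z) /\ ~ germ_eq a y (fun _ => RtoC 0).
Proof.
move=> Hmu. have [u [Su nu]] := prodop_not_scalar (- mu).
have [ST _] := prodop_solution u Su.
exists (fun z => 1 * prodop u z + mu * u z). split; [|split].
- exact: local_solution_lin.
- apply: locallyC_imp (locally_and _ _ _ (prodop_lin _ _ 1 mu (local_solution_hol _ _ _ ST) (local_solution_hol _ _ _ Su)) (prodop_sq u Su)) => z [-> ->].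
  rewrite -Hmu. ring.
- move=> q. apply: nu. apply: locallyC_imp q => z <-. ring.
Qed.

Lemma prodop_pullback g y v : continuous_on unit_itv g -> g 0%R = a ->
  (forall t, (0 <= t <= 1)%R -> hol Phi (g t)) ->
  locally a (fun z => Phi (z + (g 1%R - a)) = Phi z) ->
  local_solution Q a y -> pullback g y v -> pullback g (prodop y) (prodop v).
Proof.
move=> Hg ga HP per Sy Hv.
have p1 : pullback g Phi Phi.
  apply: pullback_ext (pullback_global g Phi HP); first exact: germ_refl. by rewrite ga.
have p2 := pullback_derive g _ _ Hg p1. have p3 := pullback_derive g _ _ Hg Hv.
have := pullback_minus g _ _ _ _ (pullback_mult g _ _ _ _ p1 p3) (pullback_scal g _ _ (/ 2) (pullback_mult g _ _ _ _ p2 Hv)).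
apply: pullback_ext; apply: filter_forall => z; rewrite /prodop; field.
Qed.

End ProductOperator.

(** * Continuation of the eigenvectors of the product operator *)

Section Continuation.
Context (tau p A B q0 kappa : C) (Phi : C -> C).
Hypothesis Htau : (0 < Im tau)%R.
Hypothesis Hp : ~ in_lattice tau (p + p).
Let Q := potential tau p A B.
Hypothesis Hq0 : ~ sing tau p q0.
Hypothesis HPhi : forall z, ~ sing tau p z -> hol Phi z.
Hypothesis Hper : forall z w, ~ sing tau p z -> in_lattice tau w -> Phi (z + w) = Phi z.
Hypothesis Hkappa : forall z, ~ sing tau p z ->
  C_derive Phi z ^ 2 - 2 * Phi z * C_derive (C_derive Phi) z + 4 * Q z * Phi z ^ 2 = kappa.
Hypothesis Hnz : ~ germ_eq q0 Phi (fun _ => RtoC 0).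

Let HQ0 : hol Q q0 := potential_hol tau p Htau A B q0 Hq0.
Let HP0 : hol Phi q0 := HPhi q0 Hq0.
Let T := prodop Phi.

Let Hk0 : locally q0 (fun z =>
  C_derive Phi z ^ 2 - 2 * Phi z * C_derive (C_derive Phi) z + 4 * Q z * Phi z ^ 2 = kappa).
Proof. apply: locallyC_imp (notsing_near tau p Htau q0 Hq0) => z. exact: Hkappa. Qed.

Lemma path_pullback_exists g w y : in_lattice tau w -> path (fun z => ~ sing tau p z) g q0 (q0 + w) ->
  local_solution Q q0 y -> exists v, pullback g y v /\ local_solution Q q0 v.
Proof.
move=> Hw [Hg [g0 [g1 Hs]]] Sy.
have := pullback_exists g y Q Hg. rewrite g0 g1. apply=> //.
- move=> t Ht. apply: (potential_hol tau p Htau). exact: Hs.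
- have -> : q0 + w - q0 = w by ring.
  apply: locallyC_imp (notsing_near tau p Htau q0 Hq0) => z Hz. exact: (potential_period tau p Htau Hp).
Qed.

Lemma path_prodop_pullback g w y v : in_lattice tau w -> path (fun z => ~ sing tau p z) g q0 (q0 + w) ->
  local_solution Q q0 y -> pullback g y v -> pullback g (T y) (T v).
Proof.
move=> Hw [Hg [g0 [g1 Hs]]] Sy. apply: (prodop_pullback Q Phi q0) => //.
- move=> t Ht. apply: HPhi. exact: Hs.
- rewrite g1. have -> : q0 + w - q0 = w by ring.
  apply: locallyC_imp (notsing_near tau p Htau q0 Hq0) => z Hz. exact: Hper.
Qed.

(** Continuation commutes with T, so it preserves the eigenvalue, and the eigenspace is
    one-dimensional. *)
Lemma eigenvector_common (mu : C) y : local_solution Q q0 y -> germ_eq q0 (T y) (fun z => mu * y z) ->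
  ~ germ_eq q0 y (fun _ => RtoC 0) -> common_eigenfunction tau p A B q0 y.
Proof.
move=> Sy E ny. split=> // g w Hw Hg.
have [v [Hv Sv]] := path_pullback_exists g w y Hw Hg Sy.
have HT := path_prodop_pullback g w y v Hw Hg Sy Hv.
have [Hc [g0 _]] := Hg.
have Ev : germ_eq q0 (T v) (fun z => mu * v z).
  have := pullback_unique g _ _ _ _ Hc HT (pullback_scal g _ _ mu Hv). rewrite g0. by apply.
have W := prodop_scalar Q Phi q0 Hnz y v mu Sy Sv E Ev.
have [c Hcv] := solution_collinear Q q0 y v HQ0 Sy Sv W ny.
exists c. apply: pullback_ext Hv; rewrite g0 //. exact: germ_refl.
Qed.

Lemma kappa_neq0_completely_reducible : kappa <> 0 -> completely_reducible tau p A B q0.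
Proof.
move=> nk. have [mu Hmu] := C_sqrt_exists (kappa / 4).
have nmu : mu <> 0.
  move=> q. apply: nk. have -> : kappa = kappa / 4 * 4 by field. rewrite -Hmu q. ring.
have Hmu' : (- mu) ^ 2 = kappa / 4 by rewrite -Hmu; ring.
have [y1 [S1 [E1 n1]]] := prodop_eigenvector Q Phi q0 kappa HQ0 HP0 Hnz Hk0 mu Hmu.
have [y2 [S2 [E2 n2]]] := prodop_eigenvector Q Phi q0 kappa HQ0 HP0 Hnz Hk0 (- mu) Hmu'.
exists y1, y2. split; first exact: (eigenvector_common mu). split; first exact: (eigenvector_common (- mu)).
apply: (wronskian_lin_indep Q) => // W.
have [c Hc] := solution_collinear Q q0 y1 y2 HQ0 S1 S2 W n1.
have E3 := prodop_ext Phi q0 y2 _ (local_solution_hol _ _ _ S2) Hc.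
have E4 : germ_eq q0 (T (fun z => c * y1 z)) (fun z => c * T y1 z).
  have := prodop_lin Phi q0 y1 y1 c 0 (local_solution_hol _ _ _ S1) (local_solution_hol _ _ _ S1) => h.
  have e : (fun z => c * y1 z + 0 * y1 z) = (fun z => c * y1 z) by apply: functional_extensionality => z; ring.
  rewrite e in h. apply: locallyC_imp h => z h. rewrite /T h. ring.
apply: n2.
apply: locallyC_imp (locally_and _ _ _ E1 (locally_and _ _ _ E2 (locally_and _ _ _ E3 (locally_and _ _ _ E4 Hc)))) => z [e1 [e2 [e3 [e4 ec]]]].
have h : 2 * mu * y2 z = 0.
  transitivity (mu * y2 z - (- mu * y2 z)); first by ring. rewrite -e2 e3. rewrite /T in e4 e1. rewrite e4 e1 ec. ring.
apply: NNPP => q. apply: (Cmult_neq_0 (2 * mu) (y2 z)) => //. apply: Cmult_neq_0 => //. move=> /(f_equal Re) /=; lra.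
Qed.

Hypothesis Hkappa0 : kappa = 0.

Let T2_zero y : local_solution Q q0 y -> germ_eq q0 (T (T y)) (fun _ => RtoC 0).
Proof.
move=> Sy. apply: locallyC_imp (prodop_sq Q Phi q0 kappa HQ0 HP0 Hnz Hk0 y Sy) => z h.
rewrite /T h Hkappa0. field.
Qed.

(** A Jordan chain T u, u for a solution u outside the kernel of T. It supplies the basis in which
    monodromy data are shown to exist. *)
Lemma nilpotent_basis : exists y1 y2, local_solution Q q0 y1 /\ local_solution Q q0 y2 /\ wronskian y1 y2 q0 <> 0 /\
  germ_eq q0 (T y1) (fun _ => RtoC 0) /\ germ_eq q0 (T y2) (fun z => 1 * y1 z).
Proof.
have [u [Su nu]] := prodop_not_scalar Q Phi q0 HQ0 Hnz 0.
have [ST _] := prodop_solution Q Phi q0 kappa HQ0 HP0 Hnz Hk0 u Su.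
have nT : ~ germ_eq q0 (T u) (fun _ => RtoC 0).
  move=> q. apply: nu. apply: locallyC_imp q => z q. rewrite /T in q. rewrite q. ring.
exists (T u), u. split; [|split; [|split; [|split]]] => //; last first.
- apply: filter_forall => z. ring.
- exact: T2_zero.
move=> W. have [c Hc] := solution_collinear Q q0 (T u) u HQ0 ST Su W nT.
have E3 := prodop_ext Phi q0 u _ (local_solution_hol _ _ _ Su) Hc.
have HTu := local_solution_hol _ _ _ ST.
have E4 := prodop_lin Phi q0 (T u) (T u) c 0 HTu HTu.
have e : (fun z => c * T u z + 0 * T u z) = (fun z => c * T u z) by apply: functional_extensionality => z; ring.
rewrite e in E4. apply: nT.
apply: locallyC_imp (locally_and _ _ _ E3 (locally_and _ _ _ E4 (T2_zero u Su))) => z [e3 [e4 e5]].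
rewrite /T in e3 e4 e5 |- *. rewrite e3 e4 e5. ring.
Qed.

Lemma solution_coeff_zero y1 y2 (c1 c2 : C) : local_solution Q q0 y1 -> local_solution Q q0 y2 -> wronskian y1 y2 q0 <> 0 ->
  germ_eq q0 (fun z => c1 * y1 z + c2 * y2 z) (fun _ => RtoC 0) -> c1 = 0 /\ c2 = 0.
Proof. move=> S1 S2 W. exact: (wronskian_lin_indep Q q0 y1 y2 S1 S2 W). Qed.

(* A nontrivial unipotent matrix and the commuting nilpotent [T] have the same kernel. *)
Lemma unipotent_kernel g w y1 y2 (eps : C) : in_lattice tau w -> path (fun z => ~ sing tau p z) g q0 (q0 + w) ->
  local_solution Q q0 y1 -> local_solution Q q0 y2 -> wronskian y1 y2 q0 <> 0 -> eps <> 0 ->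
  pullback g y1 (fun z => eps * y1 z) -> pullback g y2 (fun z => eps * y1 z + eps * y2 z) ->
  germ_eq q0 (T y1) (fun _ => RtoC 0) /\ exists c : C, c <> 0 /\ germ_eq q0 (T y2) (fun z => c * y1 z).
Proof.
move=> Hw Hg S1 S2 W ne M1 M2. have [Hc [g0 _]] := Hg.
have [ST1 _] := prodop_solution Q Phi q0 kappa HQ0 HP0 Hnz Hk0 y1 S1.
have [ST2 _] := prodop_solution Q Phi q0 kappa HQ0 HP0 Hnz Hk0 y2 S2.
have E1 := solution_span Q q0 y1 y2 _ S1 S2 W ST1. have E2 := solution_span Q q0 y1 y2 _ S1 S2 W ST2.
set a := (X in germ_eq _ _ (fun z => X * _ + _)) in E1. set b := (X in germ_eq _ _ (fun z => _ + X * _)) in E1.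
set c := (X in germ_eq _ _ (fun z => X * _ + _)) in E2. set d := (X in germ_eq _ _ (fun z => _ + X * _)) in E2.
have lin : forall u v (x y : C), local_solution Q q0 u -> local_solution Q q0 v -> germ_eq q0 (T (fun z => x * u z + y * v z)) (fun z => x * T u z + y * T v z).
  move=> u v x y Su Sv. exact: prodop_lin (local_solution_hol _ _ _ Su) (local_solution_hol _ _ _ Sv).
(* Applying T to the continuation of y1, and continuing T y1, gives b * eps = 0 in coordinates. *)
have b0 : b = 0.
  have P1 := path_prodop_pullback g w y1 _ Hw Hg S1 M1.
  have e : (fun z => eps * y1 z) = (fun z => eps * y1 z + 0 * y1 z) by apply: functional_extensionality => z; ring.
  rewrite e in P1.
  have P2 := pullback_plus g _ _ _ _ (pullback_scal g _ _ a M1) (pullback_scal g _ _ b M2).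
  have := pullback_unique g _ _ _ _ Hc P1 P2. rewrite g0 => /(_ E1) U.
  have Z : germ_eq q0 (fun z => (b * eps) * y1 z + 0 * y2 z) (fun _ => RtoC 0).
    apply: locallyC_imp (locally_and _ _ _ U (locally_and _ _ _ E1 (lin y1 y1 eps 0 S1 S1))) => z [u [e1 l]].
    rewrite l /T e1 in u.
    transitivity (a * (eps * y1 z) + b * (eps * y1 z + eps * y2 z) - (eps * (a * y1 z + b * y2 z) + 0 * (a * y1 z + b * y2 z))); first by ring.
    rewrite -u. ring.
  have [q _] := solution_coeff_zero _ _ _ _ S1 S2 W Z. apply: NNPP => nb. exact: (Cmult_neq_0 _ _ nb ne).
rewrite b0 in E1.
(* T^2 = 0 in coordinates; it yields a^2 = 0 and then d^2 = 0. *)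
have sq : forall u v (x y : C), local_solution Q q0 u -> local_solution Q q0 v ->
   germ_eq q0 (T v) (fun z => x * u z + y * v z) -> germ_eq q0 (fun z => x * T u z + y * T v z) (fun _ => RtoC 0).
  move=> u v x y Su Sv E. have [STv _] := prodop_solution Q Phi q0 kappa HQ0 HP0 Hnz Hk0 v Sv.
  have X := prodop_ext Phi q0 _ _ (local_solution_hol _ _ _ STv) E.
  apply: locallyC_imp (locally_and _ _ _ X (locally_and _ _ _ (lin u v x y Su Sv) (T2_zero v Sv))) => z [x1 [x2 x3]].
  rewrite -x2. rewrite /T in x3 |- *. by rewrite -x1 x3.
have a0 : a = 0.
  have E1' : germ_eq q0 (T y1) (fun z => 0 * y2 z + a * y1 z) by apply: locallyC_imp E1 => z h; rewrite /T h; ring.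
  have Z := sq y2 y1 0 a S2 S1 E1'.
  have Z2 : germ_eq q0 (fun z => (a * a) * y1 z + 0 * y2 z) (fun _ => RtoC 0).
    apply: locallyC_imp (locally_and _ _ _ Z E1) => z [h1 h2]. transitivity (0 * T y2 z + a * T y1 z); last exact: h1. rewrite /T h2. ring.
  have [q _] := solution_coeff_zero _ _ _ _ S1 S2 W Z2. apply: NNPP => na. exact: (Cmult_neq_0 _ _ na na).
rewrite a0 in E1.
have T1 : germ_eq q0 (T y1) (fun _ => RtoC 0) by apply: locallyC_imp E1 => z h; rewrite /T h; ring.
have d0 : d = 0.
  have Z := sq y1 y2 c d S1 S2 E2.
  have Z2 : germ_eq q0 (fun z => (d * c) * y1 z + (d * d) * y2 z) (fun _ => RtoC 0).
    apply: locallyC_imp (locally_and _ _ _ Z (locally_and _ _ _ T1 E2)) => z [h1 [h2 h3]]. transitivity (c * T y1 z + d * T y2 z); last exact: h1. rewrite h2 /T h3. ring.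
  have [_ q] := solution_coeff_zero _ _ _ _ S1 S2 W Z2. apply: NNPP => na. exact: (Cmult_neq_0 _ _ na na).
rewrite d0 in E2.
split=> //. exists c. split; last by apply: locallyC_imp E2 => z h; rewrite /T h; ring.
(* Otherwise T would vanish on both solutions, and [prodop_scalar] would make their Wronskian
   zero. *)
move=> c0. apply: W. apply: (prodop_scalar Q Phi q0 Hnz y1 y2 0) => //.
- apply: locallyC_imp T1 => z h. rewrite /T in h. rewrite h. ring.
- apply: locallyC_imp E2 => z ->. rewrite c0. ring.
Qed.

(** * Explicit continuation in the nilpotent case *)

Section Jordan.
Context (y1 y2 : C -> C) (beta0 : C).
Hypothesis S1 : local_solution Q q0 y1.
Hypothesis S2 : local_solution Q q0 y2.
Hypothesis HW : wronskian y1 y2 q0 <> 0.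
Hypothesis T1 : germ_eq q0 (T y1) (fun _ => RtoC 0).
Hypothesis T2 : germ_eq q0 (T y2) (fun z => beta0 * y1 z).
Hypothesis Hb0 : beta0 <> 0.

(** Y is a square root of Phi up to K, and X / P is a primitive of w / P = 1 / Phi, with the
    quotient rule cleared of denominators in [HXP]. Zeros of Phi on a path then do no harm. *)
Context (Y P X w : C -> C) (K : C).
Hypothesis HY : hol Y q0.
Hypothesis HPh : hol P q0.
Hypothesis HX : hol X q0.
Hypothesis HYsq : locally q0 (fun z => Phi z = K * Y z ^ 2).
Hypothesis HPw : locally q0 (fun z => P z = Phi z * w z).
Hypothesis HPn : ~ germ_eq q0 P (fun _ => RtoC 0).
Hypothesis HXP : locally q0 (fun z => C_derive X z * P z - X z * C_derive P z = P z * w z).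

Let W := wronskian y1 y2 q0.

(** [prodop_wronskian] with T y1 = 0 and T y2 = beta0 y1. *)
Let first_sq : locally q0 (fun z => beta0 * y1 z ^ 2 = Phi z * W).
Proof.
apply: locallyC_imp (locally_and _ _ _ T1 (locally_and _ _ _ T2 (wronskian_const Q q0 y1 y2 S1 S2))) => z [t1 [t2 wc]].
rewrite /W -wc -prodop_wronskian. rewrite /T in t1 t2. rewrite t1 t2. ring.
Qed.

Lemma first_solution_form : exists k : C, germ_eq q0 y1 (fun z => k * Y z).
Proof.
apply: (germ_sqrt y1 Y q0 (W * K / beta0)) => //; first exact: (local_solution_hol Q).
apply: locallyC_imp (locally_and _ _ _ first_sq HYsq) => z [h1 h2].
transitivity (beta0 * y1 z ^ 2 / beta0); first by field. rewrite h1 h2. by field.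
Qed.

(** In quotient form (y2 / y1)' = W / y1^2 = beta0 / Phi = beta0 (X / P)'; the statement is the
    integrated relation multiplied by P y1. *)
Lemma second_solution_form : exists k : C, germ_eq q0 (fun z => P z * y2 z) (fun z => k * (P z * y1 z) + beta0 * (X z * y1 z)).
Proof.
have H1 := local_solution_hol _ _ _ S1. have H2 := local_solution_hol _ _ _ S2.
have hM : hol (fun z => P z * y2 z - beta0 * (X z * y1 z)) q0.
  exact: (hol_minus _ _ _ (hol_mult _ _ _ HPh H2) (hol_mult _ _ _ (hol_const _ _) (hol_mult _ _ _ HX H1))).
have hN : hol (fun z => P z * y1 z) q0 by exact: hol_mult.
have [k Hk] : exists k : C, germ_eq q0 (fun z => P z * y2 z - beta0 * (X z * y1 z)) (fun z => k * (P z * y1 z)).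
  apply: germ_proportional => //.
  - have L := locally_and _ _ _ (hol_is_derive _ _ H1) (locally_and _ _ _ (hol_is_derive _ _ H2) (locally_and _ _ _ (hol_is_derive _ _ HPh) (hol_is_derive _ _ HX))).
    have L2 := locally_and _ _ _ first_sq (locally_and _ _ _ HPw (locally_and _ _ _ HXP (wronskian_const Q q0 y1 y2 S1 S2))).
    apply: locallyC_imp (locally_and _ _ _ L L2) => z [[d1 [d2 [dP dX]]] [fs [pw [xp wc]]]].
    have D1 : is_derive (fun z => P z * y2 z - beta0 * (X z * y1 z)) z (C_derive P z * y2 z + P z * C_derive y2 z - beta0 * (C_derive X z * y1 z + X z * C_derive y1 z)).
      apply: is_derive_eq; first cderive. ring.
    have D2 := derive_mult _ _ _ _ _ dP d1.
    rewrite (is_C_derive_unique _ _ _ D1) (is_C_derive_unique _ _ _ D2).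
    transitivity (P z ^ 2 * wronskian y1 y2 z - (beta0 * y1 z ^ 2) * (C_derive X z * P z - X z * C_derive P z)); first by rewrite /wronskian; ring.
    rewrite wc -/W xp fs pw. ring.
  - move=> q. case: (hol_mult_zero _ _ _ HPh H1 q) => // z0. apply: HW.
    have := locally_singleton _ _ z0. have := locally_singleton _ _ (germ_derive _ _ _ H1 z0).
    rewrite /wronskian (is_C_derive_unique _ _ _ (derive_const (RtoC 0) q0)) => -> ->. ring.
exists k. apply: locallyC_imp Hk => z h.
transitivity (P z * y2 z - beta0 * (X z * y1 z) + beta0 * (X z * y1 z)); first by ring. by rewrite h.
Qed.

(** y1 and P y2 are expressed through Y, P and X, which are holomorphic along the whole path, so
    their continuation is a translation by om. The factor P is cancelled at the end. *)
Lemma jordan_pullback g om (eps c : C) : in_lattice tau om -> path (fun z => ~ sing tau p z) g q0 (q0 + om) ->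
  (forall t, (0 <= t <= 1)%R -> hol Y (g t)) -> (forall t, (0 <= t <= 1)%R -> hol P (g t)) ->
  (forall t, (0 <= t <= 1)%R -> hol X (g t)) ->
  locally q0 (fun z => Y (z + om) = eps * Y z) -> locally q0 (fun z => P (z + om) = P z) ->
  locally q0 (fun z => X (z + om) = X z + c * P z) ->
  pullback g y1 (fun z => eps * y1 z) /\
  pullback g y2 (fun z => (eps * (beta0 * c)) * y1 z + eps * y2 z).
Proof.
move=> Hom Hg gY gP gX sY sP sX. have [Hc [g0 [g1 _]]] := Hg.
have om' : g 1%R - g 0%R = om by rewrite g0 g1; ring.
have glob : forall f, (forall t, (0 <= t <= 1)%R -> hol f (g t)) -> pullback g f (fun z => f (z + om)).
  move=> f Hf. rewrite -om'. exact: pullback_global.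
have M1 : pullback g y1 (fun z => eps * y1 z).
  have [k Hk] := first_solution_form.
  apply: pullback_ext (pullback_scal g _ _ k (glob Y gY)); rewrite g0; first exact: germ_sym.
  apply: locallyC_imp (locally_and _ _ _ Hk sY) => z [h1 h2]. rewrite h1 h2. ring.
split=> //.
have [v [Hv Sv]] := path_pullback_exists g om y2 Hom Hg S2.
have [k Hk] := second_solution_form.
have M2 := pullback_plus g _ _ _ _ (pullback_scal g _ _ k (pullback_mult g _ _ _ _ (glob P gP) M1))
  (pullback_scal g _ _ beta0 (pullback_mult g _ _ _ _ (glob X gX) M1)).
have M3 := pullback_mult g _ _ _ _ (glob P gP) Hv.
have := pullback_unique g _ _ _ _ Hc M3 M2. rewrite g0 => /(_ Hk) U.
have H1 := local_solution_hol _ _ _ S1. have H2 := local_solution_hol _ _ _ S2. have H3 := local_solution_hol _ _ _ Sv.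
have hd : hol (fun z => v z - ((eps * (beta0 * c)) * y1 z + eps * y2 z)) q0.
  exact: (hol_minus _ _ _ H3 (hol_plus _ _ _ (hol_mult _ _ _ (hol_const _ _) H1) (hol_mult _ _ _ (hol_const _ _) H2))).
have Z : locally q0 (fun z => P z * (v z - ((eps * (beta0 * c)) * y1 z + eps * y2 z)) = 0).
  apply: locallyC_imp (locally_and _ _ _ U (locally_and _ _ _ Hk (locally_and _ _ _ sP sX))) => z [u [h [p1 x1]]].
  rewrite p1 x1 in u.
  transitivity (P z * v z - (eps * (beta0 * c)) * (P z * y1 z) - eps * (P z * y2 z)); first by ring.
  rewrite u h. ring.
apply: pullback_ext Hv; rewrite g0; first exact: germ_refl.
case: (hol_mult_zero _ _ _ HPh hd Z) => // L.
apply: locallyC_imp L => z h. by apply/Ceq_minus.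
Qed.

End Jordan.

End Continuation.

(** * The elliptic product of two solutions *)

Section EllipticProduct.
Context (tau p A B : C).
Hypothesis Htau : (0 < Im tau)%R.
Hypothesis Hp : ~ in_lattice tau (p + p).
Hypothesis Happ : apparent (potential tau p A B) p.
Let Lam := in_lattice tau.
Let dwp := C_derive (wp tau).
Let b := wp tau p.
Let y := dwp p.
Let f1 := 12 * b ^ 2 - g2 tau.
Let Np : ~ Lam p := not_double_notin tau p Hp.
Let ny : y <> 0 := dwp_neq0 tau Htau p Hp.

(** With w = wp z - b, these two constants are chosen so that the potential reads 2 w + 3 b - c + 2
    d / w + 3 / 4 y^2 / w^2. *)
Definition prod_d : C := (3 / 8 * f1 - A * y) / 2.
Definition prod_c : C := - (B + b / 2 + 2 * A * zeta tau p).
Let c := prod_c.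
Let d := prod_d.

Definition elliptic_product (z : C) : C := wp tau z - b + c + d / (wp tau z - b).
Let Phi := elliptic_product.

(** The coefficient of w^0 in the expression for kappa; the coefficients of the negative powers are
    multiples of [prod_relation]. *)
Definition prod_kappa : C := 4 * y ^ 2 - 48 * b * d + 20 * c * d - c * f1 + 12 * b * c ^ 2 - 4 * c ^ 3.

Let ddwp_p : C_derive dwp p = f1 / 2.
Proof.
have [_ [_ [_ H]]] := wp_invariants tau Htau. have [_ h] := H p Np. rewrite /dwp h /f1 /b. field.
Qed.

(** The apparentness condition in terms of c and d, after zeta (2 p) and wp (2 p) are eliminated by
    the duplication formulas. *)
Lemma prod_relation : c * y ^ 2 = d * (f1 - 4 * d).
Proof.
have R := apparent_relation tau p Htau Hp A B Happ.
have Z := zeta_double tau Htau p Hp. have D := wp_double tau Htau p Hp.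
rewrite -/dwp ddwp_p -/y in Z D. rewrite -/b in D R.
have Z' : zeta tau (p + p) = 2 * zeta tau p + f1 / 2 / 2 / y.
  transitivity (2 * zeta tau p + (zeta tau (p + p) - 2 * zeta tau p) * y / y); first by field. by rewrite Z.
have D' : wp tau (p + p) = (f1 / 2) ^ 2 / (4 * y ^ 2) - 2 * b.
  transitivity (4 * y ^ 2 * (wp tau (p + p) + 2 * b) / (4 * y ^ 2) - 2 * b); last by rewrite D.
  field. exact: ny.
rewrite Z' D' in R.
have E : B = A ^ 2 - (2 * b + 3 / 4 * ((f1 / 2) ^ 2 / (4 * y ^ 2) - 2 * b) + A * (2 * zeta tau p + f1 / 2 / 2 / y)) by rewrite R; ring.
rewrite /c /d /prod_c /prod_d E. field. exact: ny.
Qed.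

Let curve z : ~ Lam z -> dwp z ^ 2 = 4 * (wp tau z - b) ^ 3 + 12 * b * (wp tau z - b) ^ 2 + f1 * (wp tau z - b) + y ^ 2
  /\ C_derive dwp z = 6 * (wp tau z - b) ^ 2 + 12 * b * (wp tau z - b) + f1 / 2.
Proof.
move=> Hz. have [_ [_ [_ H]]] := wp_invariants tau Htau. have [h1 h2] := H z Hz. have [h3 _] := H p Np.
rewrite -/dwp -/y -/b in h1 h2 h3. split.
- rewrite h1 h3 /f1. ring.
- rewrite h2 /f1. field.
Qed.

Let notin z : ~ sing tau p z -> ~ Lam z.
Proof. move=> /notsing [h _]. exact: not_double_notin. Qed.

Let wn z : ~ sing tau p z -> wp tau z - b <> 0.
Proof. exact: w_neq0. Qed.

Lemma elliptic_product_hol z : ~ sing tau p z -> hol Phi z.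
Proof.
move=> Hz. have h := wp_hol tau Htau z (notin z Hz).
have h2 : hol (fun z => wp tau z - b) z by exact: hol_minus h (hol_const _ _).
exact: (hol_plus _ _ _ (hol_plus _ _ _ h2 (hol_const c _)) (hol_div (fun _ => d) (fun z => wp tau z - b) z (wn z Hz) (hol_const _ _) h2)).
Qed.

Lemma elliptic_product_period z w : ~ sing tau p z -> Lam w -> Phi (z + w) = Phi z.
Proof. move=> Hz Hw. rewrite /Phi /elliptic_product (wp_period tau Htau z w) //. exact: notin. Qed.

Let dPhi z : ~ sing tau p z -> is_derive Phi z (dwp z * (1 - d / (wp tau z - b) ^ 2)).
Proof.
move=> Hz. have n := wn z Hz. have dw := dwp_is tau Htau z (notin z Hz).
rewrite /Phi /elliptic_product. apply: is_derive_eq; first (cderive; exact: n). rewrite -/dwp. by field.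
Qed.

Lemma elliptic_product_kappa z : ~ sing tau p z ->
  C_derive Phi z ^ 2 - 2 * Phi z * C_derive (C_derive Phi) z + 4 * potential tau p A B z * Phi z ^ 2 = prod_kappa.
Proof.
move=> Hz. have n := wn z Hz. have Nz := notin z Hz.
have e1 := is_C_derive_unique _ _ _ (dPhi z Hz).
have L : locally z (fun u => dwp u * (1 - d / (wp tau u - b) ^ 2) = C_derive Phi u).
  apply: locallyC_imp (notsing_near tau p Htau z Hz) => u Hu. by rewrite (is_C_derive_unique _ _ _ (dPhi u Hu)).
have n2 : (wp tau z - b) ^ 2 <> 0 by exact: Cpow_nz.
have dw := dwp_is tau Htau z Nz. have ddw := ddwp_is tau Htau z Nz. rewrite -/dwp in dw ddw.
have D2 : is_derive (fun u => dwp u * (1 - d / (wp tau u - b) ^ 2)) z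
   (C_derive dwp z * (1 - d / (wp tau z - b) ^ 2) + 2 * d * dwp z ^ 2 / (wp tau z - b) ^ 3).
  apply: is_derive_eq; first (cderive; exact: n2). rewrite INR2. field. exact: n.
have e2 := is_C_derive_unique _ _ _ (derive_ext_near _ _ _ _ L D2).
have [c1 c2] := curve z Nz.
rewrite e1 e2 (potential_rational tau p Htau Hp A B z Hz) -/b -/dwp -/y /dmu2 -/dwp ddwp_p.
have R := prod_relation.
have EA : A = (3 / 8 * f1 - 2 * d) / y by rewrite /d /prod_d; field; exact: ny.
have EB : B = - c - b / 2 - 2 * A * zeta tau p by rewrite /c /prod_c; ring.
rewrite EB c2.
(* The bracket is zero by [prod_relation], so only the constant remains. *)
transitivity (prod_kappa + (c * y ^ 2 - d * (f1 - 4 * d)) * (2 * d / (wp tau z - b) ^ 3 + 3 * c / (wp tau z - b) ^ 2 + 6 / (wp tau z - b))); last by rewrite R; ring.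
have -> : (dwp z * (1 - d / (wp tau z - b) ^ 2)) ^ 2 = dwp z ^ 2 * (1 - d / (wp tau z - b) ^ 2) ^ 2 by ring.
rewrite c1 /Phi /elliptic_product /prod_kappa.
have EA' : A * y = 3 / 8 * f1 - 2 * d by rewrite EA; field; exact: ny.
set w := wp tau z - b in n *.
have -> : wp tau z = w + b by rewrite /w; ring.
have -> : 2 * (w + b) + 3 / 4 * (2 * b + f1 / 2 / w + y ^ 2 / w ^ 2) + A * (2 * zeta tau p - y / w) + (- c - b / 2 - 2 * A * zeta tau p)
  = 2 * w + 3 * b - c + 2 * d / w + 3 / 4 * (y ^ 2 / w ^ 2).
  transitivity (2 * w + 3 * b - c + (3 / 8 * f1 - A * y) / w + 3 / 4 * (y ^ 2 / w ^ 2)); first by field.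
  rewrite EA'. by field.
by field.
Qed.

(** If Phi were the zero germ, its derivative would give w^2 = d, and a second differentiation w wp'
    = 0, which fails off the singular points. *)
Lemma elliptic_product_nonzero z : ~ sing tau p z -> ~ germ_eq z Phi (fun _ => RtoC 0).
Proof.
move=> Hz E. have /notsing [Hz2 _] := Hz.
have dn : forall u, ~ Lam (u + u) -> dwp u <> 0 by move=> u; exact: dwp_neq0.
have L1 : locally z (fun u => (wp tau u - b) ^ 2 - d = 0).
  apply: locallyC_imp (locally_and _ _ _ (notsing_near tau p Htau z Hz) (germ_near _ _ _ E)) => u [Hu Eu].
  have n := wn u Hu. have /notsing [Hu2 _] := Hu.
  have := derive_unique _ _ _ _ (derive_ext_near _ _ _ _ Eu (dPhi u Hu)) (derive_const (RtoC 0) u) => h.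
  apply: NNPP => q. apply: (Cmult_neq_0 _ _ (dn u Hu2) q).
  transitivity (dwp u * (1 - d / (wp tau u - b) ^ 2) * (wp tau u - b) ^ 2); first by field. rewrite h. ring.
have dw := dwp_is tau Htau z (notin z Hz). rewrite -/dwp in dw.
have D : is_derive (fun u => (wp tau u - b) ^ 2 - d) z (2 * (wp tau z - b) * dwp z).
  apply: is_derive_eq; first cderive. rewrite INR2. ring.
have := derive_unique _ _ _ _ (derive_ext_near _ _ _ _ L1 D) (derive_const (RtoC 0) z).
apply: Cmult_neq_0; last exact: dn. apply: Cmult_neq_0; last exact: wn. move=> /(f_equal Re) /=; lra.
Qed.

Let x_curve x : 4 * x ^ 3 - g2 tau * x - g3 tau = 4 * (x - b) ^ 3 + 12 * b * (x - b) ^ 2 + f1 * (x - b) + y ^ 2.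
Proof.
have [_ [_ [_ H]]] := wp_invariants tau Htau. have [h3 _] := H p Np. rewrite -/dwp -/y -/b in h3.
rewrite h3 /f1. ring.
Qed.

Let cubic_e x : 4 * x ^ 3 - g2 tau * x - g3 tau = 4 * ((x - e tau 1) * (x - e tau 2) * (x - e tau 3)).
Proof.
have [s [v2 [v3 _]]] := wp_invariants tau Htau. rewrite v2 v3 s. ring.
Qed.

Lemma cubic_simple_roots x : 4 * x ^ 3 - g2 tau * x - g3 tau = 0 ->
  (exists k, (k = 1 \/ k = 2 \/ k = 3)%nat /\ x = e tau k) /\ 12 * x ^ 2 - g2 tau <> 0.
Proof.
move=> H. have [s [v2 [v3 _]]] := wp_invariants tau Htau. have [d12 [d13 d23]] := e_distinct tau Htau.
have four : RtoC 4 <> 0 by move=> /(f_equal Re) /=; lra.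
have nz : forall u v : C, u <> v -> u - v <> 0 by move=> u v; exact: Cminus_eq_contra.
have Hk : x = e tau 1 \/ x = e tau 2 \/ x = e tau 3.
  apply: NNPP => q. rewrite cubic_e in H.
  apply: (Cmult_neq_0 _ _ four _ H). apply: Cmult_neq_0; [apply: Cmult_neq_0|]; apply: nz => E; apply: q; [left|right;left|right;right]; exact: E.
split.
  case: Hk => [|[|]] E; [exists 1%nat | exists 2%nat | exists 3%nat]; (split; [lia | exact: E]).
rewrite v2. case: Hk => [|[|]] ->.
- have -> : 12 * e tau 1 ^ 2 - - 4 * (e tau 1 * e tau 2 + e tau 1 * e tau 3 + e tau 2 * e tau 3) = 4 * ((e tau 1 - e tau 2) * (e tau 1 - e tau 3)).
    rewrite s. ring.
  exact: (Cmult_neq_0 _ _ four (Cmult_neq_0 _ _ (nz _ _ d12) (nz _ _ d13))).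
- have -> : 12 * e tau 2 ^ 2 - - 4 * (e tau 1 * e tau 2 + e tau 1 * e tau 3 + e tau 2 * e tau 3) = 4 * ((e tau 2 - e tau 1) * (e tau 2 - e tau 3)).
    rewrite s. ring.
  exact: (Cmult_neq_0 _ _ four (Cmult_neq_0 _ _ (nz _ _ (not_eq_sym d12)) (nz _ _ d23))).
- have -> : 12 * e tau 3 ^ 2 - - 4 * (e tau 1 * e tau 2 + e tau 1 * e tau 3 + e tau 2 * e tau 3) = 4 * ((e tau 3 - e tau 1) * (e tau 3 - e tau 2)).
    rewrite s. ring.
  exact: (Cmult_neq_0 _ _ four (Cmult_neq_0 _ _ (nz _ _ (not_eq_sym d13)) (nz _ _ (not_eq_sym d23)))).
Qed.

Hypothesis Hkappa0 : prod_kappa = 0.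

(** If d = 0, the relation gives c = 0, and then kappa is 4 y^2, which is nonzero. So the zeros of
    Phi are not at x = b. *)
Lemma prod_d_neq0 : d <> 0.
Proof.
move=> d0. have R := prod_relation. rewrite d0 in R.
have y2 : y ^ 2 <> 0 by exact: Cpow_nz.
have c0 : c = 0 by apply: NNPP => q; apply: (Cmult_neq_0 _ _ q y2); rewrite R; ring.
have K := Hkappa0. rewrite /prod_kappa c0 d0 in K.
apply: (Cmult_neq_0 (RtoC 4) (y ^ 2)) => //; first by move=> /(f_equal Re) /=; lra.
rewrite -K. ring.
Qed.

(* With [kappa = 0], at a simple zero of [Phi] the relation for [kappa] reads [wp'^2 = 0]. *)
Lemma prod_roots : exists x1 x2 : C, (forall x, (x - b) ^ 2 + c * (x - b) + d = (x - x1) * (x - x2)) /\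
  ((x1 = x2 /\ 12 * x1 ^ 2 - g2 tau <> 0 /\ 4 * x1 ^ 3 - g2 tau * x1 - g3 tau = (12 * x1 ^ 2 - g2 tau) * (x1 - b) / 2) \/
   (x1 <> x2 /\ 4 * x1 ^ 3 - g2 tau * x1 - g3 tau = 0 /\ 4 * x2 ^ 3 - g2 tau * x2 - g3 tau = 0)).
Proof.
have [s Hs] := C_sqrt_exists (c ^ 2 - 4 * d).
set r1 := (- c + s) / 2. set r2 := (- c - s) / 2.
have Ec : c = - (r1 + r2) by rewrite /r1 /r2; field.
have Ed : d = r1 * r2.
  have -> : r1 * r2 = (c ^ 2 - s ^ 2) / 4 by rewrite /r1 /r2; field. rewrite Hs. field.
have nd := prod_d_neq0.
have n1 : r1 <> 0 by move=> q; apply: nd; rewrite Ed q; ring.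
have n2 : r2 <> 0 by move=> q; apply: nd; rewrite Ed q; ring.
have R := prod_relation. have K := Hkappa0.
exists (b + r1), (b + r2). split; first by move=> x; rewrite Ec Ed; ring.
case: (Ceq_dec r1 r2) => [E|ne].
- left. rewrite -E in Ec Ed *.
  (* For a double root c = - 2 r1 and d = r1^2, so [prod_relation] can be solved for y^2. *)
  have Y2 : y ^ 2 = - r1 * (f1 - 4 * r1 ^ 2) / 2.
    have nc : c <> 0 by rewrite Ec => q; apply: n1; transitivity (- (- (r1 + r1)) / 2); [field | rewrite q; field].
    apply/Ceq_minus. apply: NNPP => q. apply: (Cmult_neq_0 _ _ nc q).
    transitivity (c * y ^ 2 - c * (- r1 * (f1 - 4 * r1 ^ 2) / 2)); first by ring. rewrite R Ec Ed. field.
  have F : 4 * (b + r1) ^ 3 - g2 tau * (b + r1) - g3 tau = (12 * (b + r1) ^ 2 - g2 tau) * (b + r1 - b) / 2.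
    rewrite x_curve Y2. have -> : g2 tau = 12 * b ^ 2 - f1 by rewrite /f1; ring. field.
  split=> //. split=> // q.
  have F0 : 4 * (b + r1) ^ 3 - g2 tau * (b + r1) - g3 tau = 0 by rewrite F q; field.
  by have [_ h] := cubic_simple_roots _ F0.
- right.
  have main : forall r r' : C, r <> 0 -> r <> r' -> c = - (r + r') -> d = r * r' -> 4 * (b + r) ^ 3 - g2 tau * (b + r) - g3 tau = 0.
    move=> r r' nr nr' Ec' Ed'.
    (* The kappa relation times w^4 at w = r, where Phi = 0 and Phi' = wp' (r - r') / r; the last
       summand is a multiple of [prod_relation]. *)
    have I : (4 * (b + r) ^ 3 - g2 tau * (b + r) - g3 tau) * (r ^ 2 * (r - r') ^ 2) =
      prod_kappa * r ^ 4 + r * (c * y ^ 2 - d * (f1 - 4 * d)) * (2 * d + 3 * c * r + 6 * r ^ 2).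
      rewrite x_curve /prod_kappa Ec' Ed'. ring.
    rewrite K R in I. apply: NNPP => q. apply: (Cmult_neq_0 _ _ q _ (eq_trans I _)); last by ring.
    have nd2 : r - r' <> 0 by exact: (Cminus_eq_contra r r' nr').
    apply: Cmult_neq_0; exact: Cpow_nz.
  split; first by move=> q; apply: ne; transitivity (b + r1 - b); [ring | rewrite q; ring].
  split; [exact: (main r1 r2) | apply: (main r2 r1) => //; [by move=> q; apply: ne | rewrite Ec; ring | rewrite Ed; ring]].
Qed.

End EllipticProduct.

(** * Monodromy along the fundamental cycles *)

Section Monodromy.
Context (tau p A B q0 : C) (ell : nat -> R -> C).
Hypothesis Htau : (0 < Im tau)%R.
Hypothesis Hp : ~ in_lattice tau (p + p).
Hypothesis Happ : apparent (potential tau p A B) p.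
Hypothesis Hq0 : ~ sing tau p q0.
Hypothesis Hell : forall j, (j = 1 \/ j = 2)%nat ->
  path (fun z => ~ sing tau p z /\ ~ cut tau p z) (ell j) q0 (q0 + omega tau j).
Hypothesis Hkappa0 : prod_kappa tau p A B = 0.
Let Q := potential tau p A B.
Let Phi := elliptic_product tau p A B.
Let dwp := C_derive (wp tau).
Let b := wp tau p.
Let c := prod_c tau p A B.
Let d := prod_d tau p A.

(** Stated for every Jordan pair of T, so that it applies both to the basis constructed for the
    existence of monodromy data and to an arbitrary given one. The bracket is the increment of beta
    z - alpha zeta z along the cycle. *)
Definition jordan_form (eps : nat -> C) (alpha beta : C) : Prop :=
  forall (y1 y2 : C -> C) (beta0 : C), local_solution Q q0 y1 -> local_solution Q q0 y2 ->
    wronskian y1 y2 q0 <> 0 -> germ_eq q0 (prodop Phi y1) (fun _ => RtoC 0) ->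
    germ_eq q0 (prodop Phi y2) (fun z => beta0 * y1 z) -> beta0 <> 0 ->
    forall j, (j = 1 \/ j = 2)%nat ->
      pullback (ell j) y1 (fun z => eps j * y1 z) /\
      pullback (ell j) y2 (fun z => (eps j * (beta0 * (beta * omega tau j - alpha * eta tau j))) * y1 z + eps j * y2 z).

Let notin z : ~ sing tau p z -> ~ in_lattice tau z.
Proof. move=> /notsing [h _]. exact: not_double_notin. Qed.

Let Hc0 : ~ cut tau p q0.
Proof.
have [_ [g0 [_ H]]] := Hell 1%nat ltac:(lia). rewrite -g0.
have u0 : unit_itv 0 by rewrite /unit_itv; lra. exact: (proj2 (H 0%R u0)).
Qed.

(** Here x stands for wp z, [Pp] is the numerator of Phi, and X = Pp (beta z - alpha zeta z) + wp'
    Rp. The polynomial identity is X' P - X P' = P w, with wp'^2 and wp'' replaced by polynomials in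
    x. *)
Lemma jordan_form_of (eps : nat -> C) (alpha beta K : C) (Y Pp Px Rp Rx : C -> C) :
  (forall z, ~ sing tau p z -> ~ cut tau p z -> hol Y z) ->
  (forall j z, (j = 1 \/ j = 2)%nat -> ~ sing tau p z -> ~ cut tau p z -> Y (z + omega tau j) = eps j * Y z) ->
  locally q0 (fun z => Phi z = K * Y z ^ 2) ->
  (forall x : C, is_derive Pp x (Px x)) -> (forall x : C, is_derive Rp x (Rx x)) ->
  (forall x, Pp x = (x - b) ^ 2 + c * (x - b) + d) ->
  (forall x, Pp x ^ 2 * (beta + alpha * x)
     + Pp x * ((6 * x ^ 2 - g2 tau / 2) * Rp x + (4 * x ^ 3 - g2 tau * x - g3 tau) * Rx x)
     - (4 * x ^ 3 - g2 tau * x - g3 tau) * Rp x * Px x = Pp x * (x - b)) ->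
  jordan_form eps alpha beta.
Proof.
move=> HY Ysh HK dP dR PE ID y1 y2 beta0 S1 S2 W T1 T2 nb j Hj.
have wn := w_neq0 tau p Htau Hp. have nPhi := elliptic_product_nonzero tau p A B Htau Hp q0 Hq0.
pose P z := Pp (wp tau z). pose X z := Pp (wp tau z) * (beta * z - alpha * zeta tau z) + dwp z * Rp (wp tau z).
have DP : forall z, ~ sing tau p z -> is_derive P z (Px (wp tau z) * dwp z).
  move=> z Hz. exact: derive_comp (dP _) (dwp_is tau Htau z (notin z Hz)).
have DX : forall z, ~ sing tau p z -> is_derive X z (Px (wp tau z) * dwp z * (beta * z - alpha * zeta tau z)
    + Pp (wp tau z) * (beta + alpha * wp tau z) + (C_derive dwp z * Rp (wp tau z) + dwp z * (Rx (wp tau z) * dwp z))).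
  move=> z Hz. have dz := zeta_derive tau Htau z (notin z Hz). have ddw := ddwp_is tau Htau z (notin z Hz).
  have dRw := derive_comp _ _ _ _ _ (dR (wp tau z)) (dwp_is tau Htau z (notin z Hz)).
  have d2 := derive_minus _ _ _ _ _ (derive_scal beta _ _ _ (derive_id z)) (derive_scal alpha _ _ _ dz).
  apply: is_derive_eq (derive_plus _ _ _ _ _ (derive_mult _ _ _ _ _ (DP z Hz) d2) (derive_mult _ _ _ _ _ ddw dRw)) _.
  rewrite /P /dwp. ring.
have nsg : forall z, ~ sing tau p z -> locally z (fun z => ~ sing tau p z) by move=> z; exact: notsing_near.
have HPh : forall z, ~ sing tau p z -> hol P z.
  move=> z Hz. apply: locallyC_imp (nsg z Hz) => u Hu. eexists. exact: DP.
have HXh : forall z, ~ sing tau p z -> hol X z.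
  move=> z Hz. apply: locallyC_imp (nsg z Hz) => u Hu. eexists. exact: DX.
have PPhi : locally q0 (fun z => P z = Phi z * (wp tau z - b)).
  apply: locallyC_imp (nsg q0 Hq0) => z Hz. have n := wn z Hz.
  rewrite /P PE /Phi /elliptic_product -/b -/c -/d. field. exact: n.
have Hom : in_lattice tau (omega tau j) := omega_in tau j.
have [Hcj [g0 [g1 Hs]]] := Hell j Hj.
apply: (jordan_pullback tau p A B q0 Phi Htau Hp Hq0 y1 y2 beta0 S1 S2 W T1 T2 nb Y P X (fun z => wp tau z - b) K) => //.
- exact: HY.
- exact: HPh.
- exact: HXh.
- move=> q. have hw : hol (fun z => wp tau z - b) q0 by exact: hol_minus (wp_hol tau Htau q0 (notin q0 Hq0)) (hol_const _ _).
  have hz : locally q0 (fun z => Phi z * (wp tau z - b) = 0).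
    apply: locallyC_imp (locally_and _ _ _ q PPhi) => z [q1 q2]. by rewrite -q2.
  case: (hol_mult_zero _ _ _ (elliptic_product_hol tau p A B Htau Hp q0 Hq0) hw hz) => L; first exact: nPhi.
  exact: (wn q0 Hq0 (locally_singleton _ _ L)).
- apply: locallyC_imp (nsg q0 Hq0) => z Hz. have Nz := notin z Hz.
  rewrite (is_C_derive_unique _ _ _ (DX z Hz)) (is_C_derive_unique _ _ _ (DP z Hz)).
  have [_ [_ [_ H]]] := wp_invariants tau Htau. have [h1 h2] := H z Nz. rewrite -/dwp in h1 h2.
  have I := ID (wp tau z). rewrite -h1 -h2 in I. rewrite /P /X -I. ring.
- exact: Hom.
- split=> //. split=> //. split=> // t Ht. exact: (proj1 (Hs t Ht)).
- move=> t Ht. have [h1 h2] := Hs t Ht. exact: HY.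
- move=> t Ht. have [h1 h2] := Hs t Ht. exact: HPh.
- move=> t Ht. have [h1 h2] := Hs t Ht. exact: HXh.
- apply: locallyC_imp (locally_and _ _ _ (nsg q0 Hq0) (notcut_near tau p Htau q0 Hc0)) => z [h1 h2]. exact: Ysh.
- apply: locallyC_imp (nsg q0 Hq0) => z Hz. by rewrite /P (wp_period tau Htau z _ (notin z Hz) Hom).
- apply: locallyC_imp (nsg q0 Hq0) => z Hz.
  rewrite /X /P (wp_period tau Htau z _ (notin z Hz) Hom) /dwp (dwp_period tau Htau z _ (notin z Hz) Hom).
  rewrite -(eta_eq tau Htau j z Hj (notin z Hz)). ring.
Qed.

(** The primitive of 1 / Phi is beta z - alpha zeta z - (2 / F) wp' / (x - x0). The relation between
    the cubic at x0 and F gives the last term the right poles at x = x0, and alpha = 4 / F removes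
    its pole at 0. Both x - x0 and the cut root are periodic, so the signs are 1. *)
Lemma double_root_case x0 : (forall x, (x - b) ^ 2 + c * (x - b) + d = (x - x0) * (x - x0)) ->
  12 * x0 ^ 2 - g2 tau <> 0 ->
  4 * x0 ^ 3 - g2 tau * x0 - g3 tau = (12 * x0 ^ 2 - g2 tau) * (x0 - b) / 2 ->
  jordan_form (fun _ => 1) (4 / (12 * x0 ^ 2 - g2 tau)) (- (4 / (12 * x0 ^ 2 - g2 tau) * x0)).
Proof.
move=> PE nF Ef. set F := 12 * x0 ^ 2 - g2 tau in nF Ef *.
have [K [nK HK]] := cut_root_sq tau p Htau Hp q0 Hq0 Hc0.
have En := cut_root_neq0 tau p. have wn := w_neq0 tau p Htau Hp.
apply: (jordan_form_of _ _ _ K (fun z => (wp tau z - x0) / cut_root tau p z) (fun x => (x - x0) * (x - x0)) (fun x => 2 * (x - x0))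
  (fun x => - 2 / F * (x - x0)) (fun _ => - 2 / F)).
- move=> z h1 h2. apply: (hol_div (fun z => wp tau z - x0) _ _ (En z)); last exact: cut_root_hol.
  exact: hol_minus (wp_hol tau Htau z (notin z h1)) (hol_const _ _).
- move=> j z Hj h1 h2. rewrite (cut_root_period tau p Htau j z Hj h2) (wp_period tau Htau z _ (notin z h1) (omega_in tau j)). ring.
- apply: locallyC_imp (locally_and _ _ _ HK (notsing_near tau p Htau q0 Hq0)) => z [k Hz]. have n := wn z Hz.
  transitivity (K * (wp tau z - x0) ^ 2 / cut_root tau p z ^ 2); last by field; exact: En.
  rewrite k /Phi /elliptic_product -/b -/c -/d.
  transitivity (((wp tau z - b) ^ 2 + c * (wp tau z - b) + d) / (wp tau z - b)); first by field; exact: n.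
  rewrite PE. field. by split; [exact: n|].
- move=> x. apply: is_derive_eq; first cderive. ring.
- move=> x. apply: is_derive_eq; first (cderive; exact: nF). field. exact: nF.
- move=> x. by rewrite PE.
- move=> x.
  have E3 : g3 tau = 4 * x0 ^ 3 - g2 tau * x0 - F * (x0 - b) / 2 by rewrite -Ef; ring.
  have E2 : g2 tau = 12 * x0 ^ 2 - F by rewrite /F; ring.
  rewrite E3 E2. field. exact: nF.
Qed.

(** Here Phi = wp'^2 / (4 (wp - e_k) (wp - b)), so its root carries the sign of [root_wp]. The
    normalisation makes the denominator of the second formula 1 at (alpha, beta), and its numerator
    b. *)
Lemma distinct_root_case k (ei ej : C) : (k = 1 \/ k = 2 \/ k = 3)%nat ->
  e tau k = - ei - ej -> g2 tau = - 4 * (ei * ej + ei * e tau k + ej * e tau k) -> g3 tau = 4 * (ei * ej * e tau k) ->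
  ei <> ej -> ei <> e tau k -> ej <> e tau k ->
  (forall x, (x - b) ^ 2 + c * (x - b) + d = (x - ei) * (x - ej)) ->
  exists alpha beta : C, jordan_form (fun j => if Nat.eqb k j then RtoC 1 else RtoC (-1)) alpha beta /\
    3 * e tau k * beta + (g2 tau / 2 - 3 * e tau k ^ 2) * alpha = 1 /\
    (g2 tau / 2 - 3 * e tau k ^ 2) * beta + g2 tau / 4 * e tau k * alpha = b.
Proof.
move=> Hk Ek E2 E3 nij nik njk PE.
set ek := e tau k in Ek E2 E3 nik njk *.
have n1 : ei - ej <> 0 := Cminus_eq_contra _ _ nij.
have n2 : 2 * ei + ej <> 0.
  have h := Cminus_eq_contra _ _ nik. by have <- : ei - ek = 2 * ei + ej by rewrite Ek; ring.
have n3 : 2 * ej + ei <> 0.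
  have h := Cminus_eq_contra _ _ njk. by have <- : ej - ek = 2 * ej + ei by rewrite Ek; ring.
(* The partial fractions of 1 / Phi in 1 / (x - ei) and 1 / (x - ej). By [half_product], (ei - ej)
   (ei - ek) / (x - ei) is a translate of wp minus ei, with primitive - zeta z - ei z - wp' / (2 (x
   - ei)); here ei - ek = 2 ei + ej. *)
pose ai := (ei - b) / (ei - ej) / ((ei - ej) * (2 * ei + ej)).
pose aj := (b - ej) / (ei - ej) / (- (ei - ej) * (2 * ej + ei)).
exists (ai + aj), (- (ai * ei + aj * ej)).
split; last first.
  rewrite /ai /aj E2 Ek. split; field; by split; [exact: n1|split].
have [K [nK HK]] := cut_root_sq tau p Htau Hp q0 Hq0 Hc0.
have En := cut_root_neq0 tau p. have wn := w_neq0 tau p Htau Hp.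
have rs := root_wp_sq tau Htau k.
have rn : forall z, ~ sing tau p z -> root_wp tau k z <> 0.
  move=> z Hz q. have /notsing [h _] := Hz.
  apply: (wp_neq_e tau Htau z k Hk h). rewrite -(rs z Hk (notin z Hz)) q. ring.
have two : RtoC 2 <> 0 by move=> /(f_equal Re) /=; lra.
apply: (jordan_form_of _ _ _ K (fun z => dwp z / (2 * root_wp tau k z * cut_root tau p z)) (fun x => (x - ei) * (x - ej)) (fun x => (x - ei) + (x - ej))
  (fun x => - ai / 2 * (x - ej) - aj / 2 * (x - ei)) (fun _ => - ai / 2 - aj / 2)).
- move=> z h1 h2. apply: (hol_div dwp (fun z => 2 * root_wp tau k z * cut_root tau p z)).
  + apply: Cmult_neq_0; [apply: Cmult_neq_0 => //; exact: rn | exact: En].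
  + exact: dwp_hol (notin z h1).
  + exact: (hol_mult _ _ _ (hol_mult _ _ _ (hol_const _ _) (root_wp_hol tau Htau k z (notin z h1))) (cut_root_hol tau p Htau z h2)).
- move=> j z Hj h1 h2. rewrite (cut_root_period tau p Htau j z Hj h2) /dwp (dwp_period tau Htau z _ (notin z h1) (omega_in tau j)).
  rewrite (root_wp_shift tau Htau k j z Hk Hj (notin z h1)). have r := rn z h1. have e0 := En z.
  have m1 : RtoC (-1) <> 0 by move=> /(f_equal Re) /=; lra.
  case: (Nat.eqb k j); field; by split.
- apply: locallyC_imp (locally_and _ _ _ HK (notsing_near tau p Htau q0 Hq0)) => z [k0 Hz]. have n := wn z Hz. have r := rn z Hz.
  transitivity (K * dwp z ^ 2 / (4 * root_wp tau k z ^ 2 * cut_root tau p z ^ 2)); last by field; split; [exact: En|].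
  have nk : wp tau z - ek <> 0 by have /notsing [h _] := Hz; exact: (wp_neq_e tau Htau z k Hk h).
  rewrite k0 (rs z Hk (notin z Hz)) /Phi /elliptic_product -/b -/c -/d -/ek.
  have [_ [_ [_ H]]] := wp_invariants tau Htau. have [h1 _] := H z (notin z Hz). rewrite -/dwp E2 E3 in h1.
  transitivity (((wp tau z - b) ^ 2 + c * (wp tau z - b) + d) / (wp tau z - b)); first by field; exact: n.
  rewrite PE h1.
  have -> : 4 * wp tau z ^ 3 - - 4 * (ei * ej + ei * ek + ej * ek) * wp tau z - 4 * (ei * ej * ek) = 4 * ((wp tau z - ei) * (wp tau z - ej)) * (wp tau z - ek).
    rewrite Ek. ring.
  field. by split; [exact: n|split].
- move=> x. apply: is_derive_eq; first cderive. ring.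
- move=> x. apply: is_derive_eq; first (cderive; exact: two). field.
- move=> x. by rewrite PE.
- move=> x. rewrite E3 E2 Ek /ai /aj. field. by split; [exact: n1|split].
Qed.

End Monodromy.

(** * The values of [wp p] *)

(* The homogeneous forms of the right-hand sides in [m = C - tau], [n = C eta_1 - eta_2]. *)
Definition num1 tau (m n : C) : C := 2 * g3 tau * m ^ 3 - 4 * n ^ 3 - g2 tau * n * m ^ 2.
Definition den1 tau (m n : C) : C := m * (12 * n ^ 2 - g2 tau * m ^ 2).
Definition num2 tau k (m n : C) : C := (g2 tau / 2 - 3 * e tau k ^ 2) * n + g2 tau / 4 * e tau k * m.
Definition den2 tau k (m n : C) : C := 3 * e tau k * n + (g2 tau / 2 - 3 * e tau k ^ 2) * m.

(** The claim at (alpha, beta) in place of (C - tau, C eta_1 - eta_2), multiplied out. *)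
Definition monodromy_value tau (eps1 eps2 alpha beta v : C) : Prop :=
  (den1 tau alpha beta <> 0 /\ num1 tau alpha beta = v * den1 tau alpha beta /\ eps1 = 1 /\ eps2 = 1) \/
  exists k, (k = 1 \/ k = 2 \/ k = 3)%nat /\ den2 tau k alpha beta <> 0 /\ num2 tau k alpha beta = v * den2 tau k alpha beta /\
    (eps1, eps2) = match k with 1%nat => (RtoC 1, RtoC (-1)) | 2%nat => (RtoC (-1), RtoC 1) | _ => (RtoC (-1), RtoC (-1)) end.

Lemma monodromy_value_neq0 tau eps1 eps2 alpha beta v : monodromy_value tau eps1 eps2 alpha beta v -> alpha = 0 -> beta = 0 -> False.
Proof.
move=> [[n _]|[k [_ [n _]]]] a0 b0; apply: n; rewrite a0 b0 /den1 /den2; ring.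
Qed.

Lemma monodromy_value_sign tau eps1 eps2 alpha beta v : monodromy_value tau eps1 eps2 alpha beta v ->
  (eps1 = 1 \/ eps1 = RtoC (-1)) /\ (eps2 = 1 \/ eps2 = RtoC (-1)).
Proof.
move=> [[_ [_ [-> ->]]]|[k [Hk [_ [_ E]]]]]; first by split; left.
case: Hk E => [->|[->|->]] [-> ->]; split; by [left|right].
Qed.

Lemma monodromy_cases tau p A B q0 ell : (0 < Im tau)%R -> ~ in_lattice tau (p + p) ->
  apparent (potential tau p A B) p -> ~ sing tau p q0 ->
  (forall j, (j = 1 \/ j = 2)%nat ->
     path (fun z => ~ sing tau p z /\ ~ cut tau p z) (ell j) q0 (q0 + omega tau j)) ->
  prod_kappa tau p A B = 0 ->
  exists (eps : nat -> C) (alpha beta : C), jordan_form tau p A B q0 ell eps alpha beta /\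
    monodromy_value tau (eps 1%nat) (eps 2%nat) alpha beta (wp tau p).
Proof.
move=> Htau Hp Happ Hq0 Hell K0.
have [x1 [x2 [PE [[E [nF Ef]]|[ne [f1 f2]]]]]] := prod_roots tau p A B Htau Hp Happ K0.
- rewrite -E in PE.
  have J := double_root_case tau p A B q0 ell Htau Hp Hq0 Hell x1 PE nF Ef.
  do 3 eexists. split; first exact: J.
  left. split; [|split; [|split; reflexivity]].
  + rewrite /den1. set F := 12 * x1 ^ 2 - g2 tau in nF *.
    have -> : 4 / F * (12 * (- (4 / F * x1)) ^ 2 - g2 tau * (4 / F) ^ 2) = 64 / F ^ 2 by rewrite /F; field; exact: nF.
    move=> q. have : RtoC 64 = 0 by transitivity (64 / F ^ 2 * F ^ 2); [field; exact: nF | rewrite q; ring].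
    move=> /(f_equal Re) /=; lra.
  + rewrite /den1 /num1. set F := 12 * x1 ^ 2 - g2 tau in nF Ef *.
    have E3 : g3 tau = 4 * x1 ^ 3 - g2 tau * x1 - F * (x1 - wp tau p) / 2 by rewrite -Ef; ring.
    have E2 : g2 tau = 12 * x1 ^ 2 - F by rewrite /F; ring.
    rewrite E3 E2. field. exact: nF.
- have [[i [Hi Ei]] _] := cubic_simple_roots tau Htau x1 f1. have [[j [Hj Ej]] _] := cubic_simple_roots tau Htau x2 f2.
  have [s [v2 [v3 _]]] := wp_invariants tau Htau. have [d12 [d13 d23]] := e_distinct tau Htau.
  (* The index k is the one missing from the two roots, and it alone enters the formula and the
     signs. *)
  have fin : forall k ei ej, (k = 1 \/ k = 2 \/ k = 3)%nat ->
    e tau k = - ei - ej -> g2 tau = - 4 * (ei * ej + ei * e tau k + ej * e tau k) -> g3 tau = 4 * (ei * ej * e tau k) ->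
    ei <> ej -> ei <> e tau k -> ej <> e tau k -> (forall x, (x - ei) * (x - ej) = (x - x1) * (x - x2)) ->
    exists (eps : nat -> C) (alpha beta : C), jordan_form tau p A B q0 ell eps alpha beta /\
      monodromy_value tau (eps 1%nat) (eps 2%nat) alpha beta (wp tau p).
    move=> k ei ej Hk h1 h2 h3 h4 h5 h6 h7.
    have PE' : forall x, (x - wp tau p) ^ 2 + prod_c tau p A B * (x - wp tau p) + prod_d tau p A = (x - ei) * (x - ej) by move=> x; rewrite h7 PE.
    have [al [be [J [D1 N1]]]] := distinct_root_case tau p A B q0 ell Htau Hp Hq0 Hell k ei ej Hk h1 h2 h3 h4 h5 h6 PE'.
    do 3 eexists. split; first exact: J.
    right. exists k. split; first exact: Hk. rewrite /den2 /num2 D1 N1. split; first exact: C1_nz. split; first by ring.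
    case: Hk => [->|[->|->]]; reflexivity.
  have F3 := fin 3%nat (e tau 1) (e tau 2) ltac:(lia) s v2 v3 d12 d13 d23.
  have F2 := fin 2%nat (e tau 1) (e tau 3) ltac:(lia) ltac:(rewrite s; ring) ltac:(rewrite v2; ring) ltac:(rewrite v3; ring) d13 d12 (not_eq_sym d23).
  have F1 := fin 1%nat (e tau 2) (e tau 3) ltac:(lia) ltac:(rewrite s; ring) ltac:(rewrite v2; ring) ltac:(rewrite v3; ring) d23 (not_eq_sym d12) (not_eq_sym d13).
  have same : forall r, x1 = r -> x2 = r -> False by move=> r q1 q2; apply: ne; rewrite q1 q2.
  have Ei' : x1 = e tau 1 \/ x1 = e tau 2 \/ x1 = e tau 3 by case: Hi Ei => [->|[->|->]] q; [left|right;left|right;right]; exact: q.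
  have Ej' : x2 = e tau 1 \/ x2 = e tau 2 \/ x2 = e tau 3 by case: Hj Ej => [->|[->|->]] q; [left|right;left|right;right]; exact: q.
  case: Ei' => [q1|[q1|q1]]; case: Ej' => [q2|[q2|q2]].
  + case: (same _ q1 q2).
  + apply: F3 => x. rewrite q1 q2. ring.
  + apply: F2 => x. rewrite q1 q2. ring.
  + apply: F3 => x. rewrite q1 q2. ring.
  + case: (same _ q1 q2).
  + apply: F1 => x. rewrite q1 q2. ring.
  + apply: F2 => x. rewrite q1 q2. ring.
  + apply: F1 => x. rewrite q1 q2. ring.
  + case: (same _ q1 q2).
Qed.

(** * From the point (alpha : beta) to the rational functions of C *)

Definition direction tau (c : Chat) (alpha beta : C) : Prop :=
  match c with
  | Fin c => exists l : C, l <> 0 /\ c - tau = l * alpha /\ c * eta tau 1 - eta tau 2 = l * beta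
  | Infty => alpha <> 0 /\ beta = alpha * eta tau 1
  end.

(** For forms of the same degree the quotient depends only on the ratio of the arguments. As c tends
    to infinity that ratio is eta_1 + dl / m, which tends to eta_1, where the quotient is
    continuous. *)
Lemma rational_value_homogeneous tau (N D : C -> C -> C) (k : nat) c (alpha beta v : C) :
  (forall l m n, N (l * m) (l * n) = l ^ k * N m n) -> (forall l m n, D (l * m) (l * n) = l ^ k * D m n) ->
  (forall a, hol (N 1) a) -> (forall a, hol (D 1) a) ->
  direction tau c alpha beta -> D alpha beta <> 0 -> N alpha beta = v * D alpha beta ->
  rational_value (fun c => N (c - tau) (c * eta tau 1 - eta tau 2)) (fun c => D (c - tau) (c * eta tau 1 - eta tau 2)) c v.
Proof.
move=> hN hD cN cD. case: c => [c|] /=.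
- move=> [l [nl [-> ->]]] nD E. rewrite hN hD E.
  have nk : l ^ k <> 0 by exact: Cpow_nz.
  split; first exact: Cmult_neq_0. by field.
- move=> [na Eb] nD E eps eps0. set s0 := eta tau 1.
  have sc : forall F : C -> C -> C, (forall l m n, F (l * m) (l * n) = l ^ k * F m n) -> F alpha beta = alpha ^ k * F 1 s0.
    move=> F hF. rewrite -hF -Eb. congr F. ring.
  have nk : alpha ^ k <> 0 by exact: Cpow_nz.
  have nD1 : D 1 s0 <> 0 by move=> q; apply: nD; rewrite (sc D hD) q; ring.
  have E1 : N 1 s0 / D 1 s0 = v.
    rewrite (sc N hN) (sc D hD) in E. transitivity (alpha ^ k * N 1 s0 / (alpha ^ k * D 1 s0)); first by field. rewrite E. by field.
  have L := flim_div _ (N 1) (D 1) _ _ nD1 (hol_cont _ _ (cN s0)) (hol_cont _ _ (cD s0)).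
  rewrite E1 in L.
  have [r [r0 Hr]] := proj1 (locallyC _ _) (locally_and _ _ _ (L _ eps eps0) (flim_neq0 _ _ _ nD1 (hol_cont _ _ (cD s0)))).
  set dl := eta tau 1 * tau - eta tau 2.
  have M0 := Cmod_ge_0 dl. have t0 := Cmod_ge_0 tau.
  (* This forces |c - tau| > |dl| / r + 1, so that m is nonzero and |dl / m| < r. *)
  exists (Cmod tau + (Cmod dl / r + 1))%R => c Hc.
  have dr : (0 <= Cmod dl / r)%R by apply: Rmult_le_pos => //; left; exact: Rinv_0_lt_compat.
  have big : (Cmod dl / r + 1 < Cmod (c - tau))%R by have := Cmod_sub_ge c tau; lra.
  have nm : c - tau <> 0 by move=> q; rewrite q Cmod_0 in big; lra.
  set m := c - tau in big nm *.
  have En : c * eta tau 1 - eta tau 2 = m * (s0 + dl / m) by transitivity (m * s0 + dl); [rewrite /m /s0 /dl; ring | field; exact: nm].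
  have Em : m = m * 1 by ring.
  have EN : N m (c * eta tau 1 - eta tau 2) = m ^ k * N 1 (s0 + dl / m) by rewrite En {1}Em hN.
  have ED : D m (c * eta tau 1 - eta tau 2) = m ^ k * D 1 (s0 + dl / m) by rewrite En {1}Em hD.
  rewrite EN ED.
  have close : (Cmod (s0 + dl / m - s0) < r)%R.
    have -> : s0 + dl / m - s0 = dl / m by ring.
    rewrite Cmod_div //. apply: (Rmult_lt_reg_r (Cmod m)); first lra.
    have -> : (Cmod dl / Cmod m * Cmod m = Cmod dl)%R by field; lra.
    have -> : Cmod dl = (r * (Cmod dl / r))%R by field; lra.
    apply: Rmult_lt_compat_l; lra.
  have [h1 h2] := Hr _ close.
  have nmk : m ^ k <> 0 by exact: Cpow_nz.
  have -> : m ^ k * N 1 (s0 + dl / m) / (m ^ k * D 1 (s0 + dl / m)) = N 1 (s0 + dl / m) / D 1 (s0 + dl / m) by field.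
  exact: h1.
Qed.

Lemma poly_hol (F : C -> C) (a : C) : (forall z : C, ex_derive F z) -> hol F a.
Proof. move=> H. exact: filter_forall. Qed.

Lemma monodromy_value_rational tau eps1 eps2 alpha beta v c : monodromy_value tau eps1 eps2 alpha beta v ->
  direction tau c alpha beta ->
  (rational_value
     (fun c => 2 * g3 tau * (c - tau) ^ 3 - 4 * (c * eta tau 1 - eta tau 2) ^ 3
               - g2 tau * (c * eta tau 1 - eta tau 2) * (c - tau) ^ 2)
     (fun c => (c - tau) * (12 * (c * eta tau 1 - eta tau 2) ^ 2 - g2 tau * (c - tau) ^ 2)) c v
   /\ (eps1, eps2) = (RtoC 1, RtoC 1))
  \/
  (exists k : nat, (k = 1 \/ k = 2 \/ k = 3)%nat /\
     rational_value
       (fun c => (g2 tau / 2 - 3 * e tau k ^ 2) * (c * eta tau 1 - eta tau 2) + g2 tau / 4 * e tau k * (c - tau))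
       (fun c => 3 * e tau k * (c * eta tau 1 - eta tau 2) + (g2 tau / 2 - 3 * e tau k ^ 2) * (c - tau)) c v
     /\ (eps1, eps2) = match k with
                       | 1%nat => (RtoC 1, RtoC (-1))
                       | 2%nat => (RtoC (-1), RtoC 1)
                       | _ => (RtoC (-1), RtoC (-1))
                       end).
Proof.
move=> [[nD [E [-> ->]]]|[k [Hk [nD [E Ee]]]]] Hc.
- left. split=> //.
  apply: (rational_value_homogeneous tau (num1 tau) (den1 tau) 3 c alpha beta v) => //.
  + move=> l m n. rewrite /num1 /=. ring.
  + move=> l m n. rewrite /den1 /=. ring.
  + move=> a. apply: poly_hol => z. eexists. rewrite /num1. cderive.
  + move=> a. apply: poly_hol => z. eexists. rewrite /den1. cderive.
- right. exists k. split=> //. split=> //.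
  have two : RtoC 2 <> 0 by move=> /(f_equal Re) /=; lra.
  have four : RtoC 4 <> 0 by move=> /(f_equal Re) /=; lra.
  apply: (rational_value_homogeneous tau (num2 tau k) (den2 tau k) 1 c alpha beta v) => //.
  + move=> l m n. rewrite /num2 /=. ring.
  + move=> l m n. rewrite /den2 /=. ring.
  + move=> a. apply: poly_hol => z. eexists. rewrite /num2. cderive; [exact: two | exact: four].
  + move=> a. apply: poly_hol => z. eexists. rewrite /den2. cderive; exact: two.
Qed.

(** The two period equations are linear in alpha and beta, with determinant beta0^2 (tau eta_1 -
    eta_2) up to sign; solving them gives the factor l. *)
Lemma direction_of_periods tau (alpha beta beta0 c : C) : eta tau 2 <> tau * eta tau 1 -> beta0 <> 0 ->
  beta0 * (beta * 1 - alpha * eta tau 1) = 1 -> beta0 * (beta * tau - alpha * eta tau 2) = c ->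
  direction tau (Fin c) alpha beta.
Proof.
move=> HL nb h1 h2. exists (beta0 * (tau * eta tau 1 - eta tau 2)). split; [|split].
- apply: Cmult_neq_0 => //. apply: Cminus_eq_contra. exact: not_eq_sym.
- transitivity (c - tau * 1); first by ring. rewrite -h1 -h2. ring.
- transitivity (c * eta tau 1 - eta tau 2 * 1); first by ring. rewrite -h1 -h2. ring.
Qed.

Lemma direction_infty_of_periods tau (alpha beta beta0 : C) : beta0 <> 0 ->
  beta0 * (beta * 1 - alpha * eta tau 1) = 0 -> beta0 * (beta * tau - alpha * eta tau 2) = 1 ->
  direction tau Infty alpha beta.
Proof.
move=> nb h1 h2.
have E : beta = alpha * eta tau 1.
  apply/Ceq_minus. apply: NNPP => q. apply: (Cmult_neq_0 _ _ nb q). rewrite -h1. ring.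
split=> // a0. apply: C1_nz. rewrite -h2 E a0. ring.
Qed.

Theorem theorem1p1
  (tau p A B q0 : C) (gp gm l1 l2 : R -> C)
  (Htau : (0 < Im tau)%R)
  (Hp : ~ two_torsion tau p)
  (Happ_p : apparent (potential tau p A B) p)
  (Happ_m : apparent (potential tau p A B) (- p))
  (Hq0 : ~ sing tau p q0)
  (Hcycles : fundamental_cycles tau p q0 gp gm l1 l2)
  (Hncr : ~ completely_reducible tau p A B q0) :
  (exists (eps1 eps2 : C) (c : Chat),
     monodromy_data tau p A B q0 l1 l2 eps1 eps2 c)
  /\
  forall (eps1 eps2 : C) (c : Chat),
    monodromy_data tau p A B q0 l1 l2 eps1 eps2 c ->
    (rational_value
       (fun c => 2 * g3 tau * (c - tau) ^ 3
                 - 4 * (c * eta tau 1 - eta tau 2) ^ 3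
                 - g2 tau * (c * eta tau 1 - eta tau 2) * (c - tau) ^ 2)
       (fun c => (c - tau) * (12 * (c * eta tau 1 - eta tau 2) ^ 2
                              - g2 tau * (c - tau) ^ 2))
       c (wp tau p)
     /\ (eps1, eps2) = (RtoC 1, RtoC 1))
    \/
    (exists k : nat,
       (k = 1 \/ k = 2 \/ k = 3)%nat /\
       rational_value
         (fun c => (g2 tau / 2 - 3 * e tau k ^ 2) * (c * eta tau 1 - eta tau 2)
                   + g2 tau / 4 * e tau k * (c - tau))
         (fun c => 3 * e tau k * (c * eta tau 1 - eta tau 2)
                   + (g2 tau / 2 - 3 * e tau k ^ 2) * (c - tau))
         c (wp tau p)
       /\ (eps1, eps2) = match k with
                         | 1%nat => (RtoC 1, RtoC (-1))
                         | 2%nat => (RtoC (-1), RtoC 1)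
                         | _ => (RtoC (-1), RtoC (-1))
                         end).
Proof.
have Hpp : ~ in_lattice tau (p + p) by move=> /(two_torsion_double tau).
have [_ [_ [P1 [P2 _]]]] := Hcycles.
pose ell j := match j with 1%nat => l1 | _ => l2 end.
have Hell : forall j, (j = 1 \/ j = 2)%nat ->
     path (fun z => ~ sing tau p z /\ ~ cut tau p z) (ell j) q0 (q0 + omega tau j) by move=> j [->|->].
have Hpath : forall j, (j = 1 \/ j = 2)%nat -> path (fun z => ~ sing tau p z) (ell j) q0 (q0 + omega tau j).
  move=> j Hj. have [h1 [h2 [h3 h4]]] := Hell j Hj. split=> //. split=> //. split=> // t Ht. exact: (proj1 (h4 t Ht)).
have Hphi := elliptic_product_hol tau p A B Htau Hpp. have Hper := elliptic_product_period tau p A B Htau.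
have Hkap := elliptic_product_kappa tau p A B Htau Hpp Happ_p.
have Hnz := elliptic_product_nonzero tau p A B Htau Hpp q0 Hq0.
have K0 : prod_kappa tau p A B = 0.
  apply: NNPP => nk. apply: Hncr.
  exact: (kappa_neq0_completely_reducible tau p A B q0 _ _ Htau Hpp Hq0 Hphi Hper Hkap Hnz nk).
have [eps [alpha [beta [J V]]]] := monodromy_cases tau p A B q0 ell Htau Hpp Happ_p Hq0 Hell K0.
have HL := legendre_nonvanishing tau Htau.
have [sg1 sg2] := monodromy_value_sign _ _ _ _ _ _ V.
have sgn0 : forall x : C, x = 1 \/ x = RtoC (-1) -> x <> 0 by move=> x [->|->] /(f_equal Re) /=; lra.
split.
- have [y1 [y2 [S1 [S2 [W [T1 T2]]]]]] := nilpotent_basis tau p A B q0 _ _ Htau Hq0 Hphi Hkap Hnz K0.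
  have JJ := J y1 y2 1 S1 S2 W T1 T2 C1_nz.
  have [M11 M12] := JJ 1%nat ltac:(lia). have [M21 M22] := JJ 2%nat ltac:(lia).
  (* Multiplying y1 by s divides both entries below the diagonal by s; this normalises one of them
     to 1. *)
  have basis : forall s : C, s <> 0 -> solution_basis (potential tau p A B) q0 (fun z => s * y1 z) y2.
    move=> s ns. apply: wronskian_basis => //.
    + have := local_solution_lin _ _ _ _ s 0 S1 S1. apply: local_solution_ext. apply: filter_forall => z. ring.
    + rewrite wronskian_scal; last exact: (hol_ex_derive _ _ (local_solution_hol _ _ _ S1)). exact: Cmult_neq_0.
  set t1 := beta * omega tau 1 - alpha * eta tau 1 in M12. set t2 := beta * omega tau 2 - alpha * eta tau 2 in M22.
  have mat : forall (j : nat) (s e' c' : C), pullback (ell j) y1 (fun z => e' * y1 z) -> pullback (ell j) y2 (fun z => e' * (1 * (s * c')) * y1 z + e' * y2 z) ->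
    monodromy_matrix (ell j) (fun z => s * y1 z) y2 (e' * 1) (e' * 0) (e' * c') (e' * 1).
    move=> j s e' c' m1 m2. split.
    + apply: pullback_ext (pullback_scal _ _ _ s m1); apply: filter_forall => z; ring.
    + apply: pullback_ext m2; apply: filter_forall => z; ring.
  case: (Ceq_dec t1 0) => [z1|n1].
  (* If both periods vanished, eta_2 <> tau eta_1 would force alpha = beta = 0, against the nonzero
     denominator in V. *)
  + have n2 : t2 <> 0.
      move=> z2. rewrite /t1 /= in z1. rewrite /t2 /= in z2.
      have Eb : beta = alpha * eta tau 1 by apply/Ceq_minus; rewrite -z1; ring.
      have a0 : alpha = 0.
        apply: NNPP => na. apply: (Cmult_neq_0 alpha (eta tau 2 - tau * eta tau 1) na); first exact: Cminus_eq_contra.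
        transitivity (- (beta * tau - alpha * eta tau 2)); first by rewrite Eb; ring. rewrite z2. ring.
      apply: (monodromy_value_neq0 _ _ _ _ _ _ V a0). rewrite Eb a0. ring.
    exists (eps 1%nat), (eps 2%nat), Infty. split; first exact: sg1. split; first exact: sg2.
    exists (fun z => t2 * y1 z), y2. split; first exact: basis. split.
    * apply: (mat 1%nat) => //. rewrite z1 in M12. by have -> : t2 * 0 = 0 by ring.
    * apply: (mat 2%nat) => //. by have -> : t2 * 1 = t2 by ring.
  + exists (eps 1%nat), (eps 2%nat), (Fin (t2 / t1)). split; first exact: sg1. split; first exact: sg2.
    exists (fun z => t1 * y1 z), y2. split; first exact: basis. split.
    * apply: (mat 1%nat) => //. by have -> : t1 * 1 = t1 by ring.
    * apply: (mat 2%nat) => //. by have -> : t1 * (t2 / t1) = t2 by field.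
- move=> eps1 eps2 c [se1 [se2 [y1 [y2 [[S1 [S2 [LI _]]] Hm]]]]].
  have W := wronskian_neq0 _ _ _ _ (potential_hol tau p Htau A B q0 Hq0) S1 S2 LI.
  (* The entries below the diagonal without their signs, for finite and infinite C alike. *)
  pose m1 := match c with Fin _ => RtoC 1 | Infty => RtoC 0 end.
  pose m2 := match c with Fin c => c | Infty => RtoC 1 end.
  have [MM1 MM2] : monodromy_matrix l1 y1 y2 (eps1 * 1) (eps1 * 0) (eps1 * m1) (eps1 * 1) /\
     monodromy_matrix l2 y1 y2 (eps2 * 1) (eps2 * 0) (eps2 * m2) (eps2 * 1) by rewrite /m1 /m2; destruct c; exact Hm.
  have unip : forall (j : nat) (e' : C), (j = 1 \/ j = 2)%nat -> e' = 1 \/ e' = RtoC (-1) ->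
      monodromy_matrix (ell j) y1 y2 (e' * 1) (e' * 0) (e' * 1) (e' * 1) ->
      germ_eq q0 (prodop (elliptic_product tau p A B) y1) (fun _ => RtoC 0) /\
      exists c : C, c <> 0 /\ germ_eq q0 (prodop (elliptic_product tau p A B) y2) (fun z => c * y1 z).
    move=> j e' Hj se [a1 a2].
    apply: (unipotent_kernel tau p A B q0 _ _ Htau Hq0 Hphi Hper Hkap Hnz K0 (ell j) (omega tau j) y1 y2 e').
    + exact: omega_in.
    + exact: Hpath.
    + exact: S1.
    + exact: S2.
    + exact: W.
    + exact: sgn0.
    + apply: pullback_ext a1; apply: filter_forall => z //. ring.
    + apply: pullback_ext a2; apply: filter_forall => z //. ring.
  (* A cycle with nontrivial unipotent part is needed here: the first one for finite C, the second
     for C = infinity. *)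
  have [T1 [beta0 [nb T2]]] : germ_eq q0 (prodop (elliptic_product tau p A B) y1) (fun _ => RtoC 0) /\
      exists c : C, c <> 0 /\ germ_eq q0 (prodop (elliptic_product tau p A B) y2) (fun z => c * y1 z).
    clear m1 m2 MM1 MM2. destruct c as [c0|]; case: Hm => h1 h2; [exact: (unip 1%nat eps1 ltac:(lia) se1 h1) | exact: (unip 2%nat eps2 ltac:(lia) se2 h2)].
  have JJ := J y1 y2 beta0 S1 S2 W T1 T2 nb.
  (* The explicit matrix and the given one describe the same continuation in the same basis, so
     independence allows comparing their entries. *)
  have cmp : forall (j : nat) (e' m' : C), (j = 1 \/ j = 2)%nat -> e' = 1 \/ e' = RtoC (-1) ->
      monodromy_matrix (ell j) y1 y2 (e' * 1) (e' * 0) (e' * m') (e' * 1) ->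
      eps j = e' /\ beta0 * (beta * omega tau j - alpha * eta tau j) = m'.
    move=> j e' m' Hj se [a1 a2]. have [b1 b2] := JJ j Hj. have [Hc [g0 _]] := Hpath j Hj.
    have ne' := sgn0 e' se.
    have u1 := pullback_unique _ _ _ _ _ Hc b1 a1. rewrite g0 in u1.
    have u2 := pullback_unique _ _ _ _ _ Hc b2 a2. rewrite g0 in u2.
    set t := beta0 * _ in b2 u2 *.
    have [z1 _] := LI (eps j - e') 0 ltac:(apply: locallyC_imp (u1 (germ_refl _ _)) => z h; transitivity (eps j * y1 z - (e' * 1 * y1 z + e' * 0 * y2 z)); [ring | rewrite h; ring]).
    have Ee : eps j = e' by apply/Ceq_minus.
    split=> //.
    have [z2 _] := LI (eps j * t - e' * m') (eps j - e') ltac:(apply: locallyC_imp (u2 (germ_refl _ _)) => z h; transitivity (eps j * t * y1 z + eps j * y2 z - (e' * m' * y1 z + e' * 1 * y2 z)); [ring | rewrite h; ring]).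
    apply/Ceq_minus. apply: NNPP => q. apply: (Cmult_neq_0 _ _ ne' q). rewrite -z2 Ee. ring.
  have [E1 D1] := cmp 1%nat eps1 m1 ltac:(lia) se1 MM1. have [E2 D2] := cmp 2%nat eps2 m2 ltac:(lia) se2 MM2.
  rewrite E1 E2 in V. apply: (monodromy_value_rational tau eps1 eps2 alpha beta) => //.
  rewrite /m1 in D1. rewrite /m2 in D2. clear m1 m2 MM1 MM2 cmp Hm. destruct c as [c0|].
  + exact: (direction_of_periods tau alpha beta beta0 c0 HL nb D1 D2).
  + exact: (direction_infty_of_periods tau alpha beta beta0 nb D1 D2).
Qed.
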